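(* Let $1<p<n$, $s\in(0,1)$, $0<\gamma<1$, $r\in(p-1,p^*-1)$ with $p^*=\frac{np}{n-p}$, and let $\Omega\subset\mathbb{R}^n$ be a bounded domain with $C^1$ boundary. Then there exists $\Lambda>0$ such that for all $\lambda\in(0,\Lambda)$ the problem $$-\Delta_p u+(-\Delta)_p^s u=\frac{\lambda}{u^{\gamma}}+u^r \ \text{ in }\Omega,\qquad u>0\ \text{ in }\Omega,\qquad u=0\ \text{ in }\mathbb{R}^n\setminus\Omega,$$ admits at least two distinct weak solutions (in the sense defined in the context).
   Context: $W_0^{1,p}(\Omega)$ is the closure of $C_c^\infty(\Omega)$ in $W^{1,p}(\Omega)$; its elements are extended by zero to $\mathbb{R}^n$. $\Delta_p u=\operatorname{div}(|\nabla u|^{p-2}\nabla u)$ and $(-\Delta)_p^s$ is the fractional $p$-Laplacian, $(-\Delta)_p^su(x)=c_{n,s}\,\mathrm{P.V.}\int_{\mathbb{R}^n}\frac{|u(x)-u(y)|^{p-2}(u(x)-u(y))}{|x-y|^{n+sp}}dy$ (the normalization constant is dropped in weak formulations). Weak solution: a function $u\in W_0^{1,p}(\Omega)$ with $u>0$ in $\Omega$, such that for every $\omega\subset\subset\Omega$ there is a constant $c(\omega)>0$ with $u\ge c(\omega)$ in $\omega$, and such that for all $\phi\in C_c^\infty(\Omega)$, $$\int_\Omega|\nabla u|^{p-2}\nabla u\cdot\nabla\phi\,dx+\int_{\mathbb{R}^n}\int_{\mathbb{R}^n}\frac{|u(x)-u(y)|^{p-2}(u(x)-u(y))(\phi(x)-\phi(y))}{|x-y|^{n+sp}}\,dx\,dy=\lambda\int_\Omega\frac{\phi}{u^\gamma}\,dx+\int_\Omega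 u^r\phi\,dx.$$ *)

(* Defs.v *)
From HB Require Import structures.
From mathcomp Require Import all_boot all_order all_algebra.
From mathcomp Require Import all_classical all_reals all_analysis.

Set Implicit Arguments.
Unset Strict Implicit.
Unset Printing Implicit Defensive.

Import Order.TTheory GRing.Theory Num.Theory.
Import numFieldNormedType.Exports.

Local Open Scope classical_set_scope.
Local Open Scope ring_scope.

Section measurable_rV.
Context {R : realType} (n : nat).

Let coord (i : 'I_n) (x : 'rV[R]_n) : R := x ord0 i.

Let rV_set0 : g_sigma_preimage coord set0.
Proof. exact: sigma_algebra0. Qed.

Let rV_setC A : g_sigma_preimage coord A -> g_sigma_preimage coord (~` A).
Proof. exact: sigma_algebraC. Qed.

Let rV_bigcup (F : (set 'rV[R]_n)^nat) :
  (forall i, g_sigma_preimage coord (F i)) ->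
  g_sigma_preimage coord (\bigcup_i (F i)).
Proof. exact: sigma_algebra_bigcup. Qed.

(* The sigma-algebra generated by the coordinates, i.e. the Borel sets of R^n. *)
HB.instance Definition _ := @isMeasurable.Build default_measure_display
  'rV[R]_n (g_sigma_preimage coord) rV_set0 rV_setC rV_bigcup.

End measurable_rV.

Section measurable_rV_lemmas.
Context {R : realType}.

Lemma measurable_coord n (i : 'I_n) :
  measurable_fun [set: 'rV[R]_n] (fun x : 'rV[R]_n => x ord0 i).
Proof.
move=> _ Y mY; rewrite setTI; apply: sub_sigma_algebra => /=.
rewrite -bigcup_seq/=; exists i => /=; first by rewrite mem_index_enum.
by exists Y => //; rewrite setTI.
Qed.

Lemma measurable_fun_rV d (T : measurableType d) n (f : T -> 'rV[R]_n) :
  (forall i, measurable_fun [set: T] (fun t => f t ord0 i)) ->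
  measurable_fun [set: T] f.
Proof.
move=> mf _ A mA; rewrite setTI.
have : (preimage_set_system setT f
   (g_sigma_preimage (fun (i : 'I_n) (x : 'rV[R]_n) => x ord0 i : R))) (f @^-1` A).
  by exists A => //; rewrite setTI.
rewrite -g_sigma_preimage_comp; apply: smallest_sub.
  exact: sigma_algebra_measurable.
rewrite -bigcup_seq; apply: bigcup_sub => i _ B [C mC <-].
exact: mf.
Qed.

Definition rV_cons n (xy : measurableTypeR R * 'rV[R]_n) : 'rV[R]_n.+1 :=
  row_mx (const_mx xy.1 : 'rV_1) xy.2.

Lemma measurable_rV_cons n : measurable_fun setT (@rV_cons n).
Proof.
apply: measurable_fun_rV => i; case: (@split_ordP 1 n i) => j ->.
  rewrite (_ : (fun _ => _) = fst); first exact: measurable_fst.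
  by apply/funext => -[x y]; rewrite /rV_cons (@row_mxEl _ 1 1 n) mxE.
rewrite (_ : (fun _ => _) = (fun z : 'rV[R]_n => z ord0 j) \o snd).
  by apply: measurableT_comp => //; exact: measurable_coord.
by apply/funext => -[x y]; rewrite /rV_cons (@row_mxEr _ 1 1 n).
Qed.

Definition rV_uncons n (z : 'rV[R]_n.+1) : measurableTypeR R * 'rV[R]_n :=
  (z ord0 ord0, rsubmx (z : 'rV_(1 + n))).

Lemma rV_consK n : cancel (@rV_cons n) (@rV_uncons n).
Proof.
move=> [x y]; rewrite /rV_uncons /rV_cons row_mxKr; congr pair.
rewrite (_ : ord0 = lshift n (ord0 : 'I_1)); last exact/val_inj.
by rewrite (@row_mxEl _ 1 1 n) mxE.
Qed.

Lemma measurable_rV_uncons n : measurable_fun setT (@rV_uncons n).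
Proof.
apply/measurable_fun_pair; first exact: measurable_coord.
apply: measurable_fun_rV => i.
rewrite (_ : (fun _ => _) = (fun z : 'rV[R]_n.+1 => z ord0 (rshift 1 i))).
  exact: measurable_coord.
by apply/funext => z; rewrite mxE.
Qed.

End measurable_rV_lemmas.

Section lebesgue_cons.
Context {R : realType} (n : nat).
Variable mu : {sigma_finite_measure set 'rV[R]_n -> \bar R}.

Definition lebesgue_cons : set 'rV[R]_n.+1 -> \bar R :=
  pushforward (@lebesgue_measure R \x mu)%E (@rV_cons R n).

Let mcons : {measure set 'rV[R]_n.+1 -> \bar R}.
Proof.
refine (pushforward (@lebesgue_measure R \x mu)%E (@rV_cons R n) :
  {measure set 'rV[R]_n.+1 -> \bar R}).
exact: measurable_rV_cons.
Defined.

HB.instance Definition _ := isMeasure.Build _ _ _ lebesgue_cons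
  (measure0 mcons) (measure_ge0 mcons) (@measure_semi_sigma_additive _ _ _ mcons).

Let product_sigma_finite : sigma_finite setT (@lebesgue_measure R \x mu)%E.
Proof.
have /sigma_finiteP[F [TF ndF Foo]] := sigma_finiteT (@lebesgue_measure R).
have /sigma_finiteP[G [TG ndG Goo]] := sigma_finiteT mu.
exists (fun k => F k `*` G k).
  rewrite -setXTT TF TG predeqE => -[x y]; split.
    move=> [/= [k _ Fkx] [l _ Gly]]; exists (maxn k l) => //; split.
    - by move: x Fkx; exact/subsetPset/ndF/leq_maxl.
    - by move: y Gly; exact/subsetPset/ndG/leq_maxr.
  by move=> [k _ []/= ? ?]; split; exists k.
move=> k; have [? ?] := Foo k; have [? ?] := Goo k.
split; first exact: measurableX.
by rewrite product_measure1E// lte_mul_pinfty// ge0_fin_numE.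
Qed.

Let lebesgue_cons_sigma_finite : sigma_finite setT lebesgue_cons.
Proof.
have [F FT Foo] := product_sigma_finite.
exists (fun k => @rV_uncons R n @^-1` F k).
  by rewrite -preimage_bigcup -FT preimage_setT.
move=> k; have [mF Fk] := Foo k; split.
  by rewrite -[X in measurable X]setTI; exact: measurable_rV_uncons.
rewrite /lebesgue_cons /pushforward -comp_preimage.
by rewrite (_ : _ \o _ = id)//; apply/funext => z /=; rewrite rV_consK.
Qed.

HB.instance Definition _ := Measure_isSigmaFinite.Build _ _ _
  lebesgue_cons lebesgue_cons_sigma_finite.

End lebesgue_cons.

Fixpoint lebesgue_rV (R : realType) (n : nat) :
    {sigma_finite_measure set 'rV[R]_n -> \bar R} :=
  match n with
  | 0 => \d_ (0 : 'rV[R]_0)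
  | n'.+1 => lebesgue_cons (lebesgue_rV R n')
  end.

Section euclidean.
Context {R : realType} (n : nat).

Definition dotp (x y : 'rV[R]_n) : R := \sum_(i < n) x ord0 i * y ord0 i.

(* The norm [`|x|] of the library on ['rV[R]_n] is the sup norm; it induces the
   same topology, but the Euclidean norm is the one of the equation. *)
Definition enorm (x : 'rV[R]_n) : R := Num.sqrt (dotp x x).

End euclidean.

Section smooth_functions.
Context {R : realType}.

Definition pderiv n (i : 'I_n) (f : 'rV[R]_n -> R) : 'rV[R]_n -> R :=
  'D_(delta_mx ord0 i) f.

Definition grad n (f : 'rV[R]_n -> R) (x : 'rV[R]_n) : 'rV[R]_n :=
  \row_i pderiv i f x.

Fixpoint Ck (k n : nat) (f : 'rV[R]_n -> R) : Prop :=
  continuous f /\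
  if k is k'.+1 then
    forall i : 'I_n,
      (forall x, derivable f x (delta_mx ord0 i)) /\ Ck k' (pderiv i f)
  else True.

Definition Cc_infty n (Omega : set 'rV[R]_n) (phi : 'rV[R]_n -> R) :=
  [/\ forall k, Ck k phi,
      compact (closure [set x | phi x != 0]) &
      closure [set x | phi x != 0] `<=` Omega].

(* Near each boundary point, after an orthogonal change of coordinates
   [y = x *m Q], [Omega] is the region [y_i > g(y_1,...,^y_i,...,y_n)] above
   the graph of a C^1 function [g] of the other coordinates. *)
Definition C1_boundary n (Omega : set 'rV[R]_n) :=
  forall x0, (closure Omega `\` Omega°) x0 ->
  exists (Q : 'M[R]_n) (i : 'I_n) (g : 'rV[R]_n.-1 -> R),
    [/\ Q *m Q^T = 1%:M, Ck 1 g &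
        \forall x \near x0,
          Omega x <-> g (col' i (x *m Q)) < (x *m Q) ord0 i].

End smooth_functions.

Section sobolev.
Context {R : realType} (n : nat).
Implicit Types (Omega : set 'rV[R]_n) (u phi : 'rV[R]_n -> R).
Implicit Types (G : 'rV[R]_n -> 'rV[R]_n).

Local Notation mu := (lebesgue_rV R n).

Definition locally_integrable_on Omega u :=
  forall K, compact K -> K `<=` Omega -> mu.-integrable K (EFin \o u).

Definition weak_gradient Omega u G :=
  [/\ locally_integrable_on Omega u,
      forall i, locally_integrable_on Omega (fun x => G x ord0 i) &
      forall phi, Cc_infty Omega phi -> forall i : 'I_n,
        \int[mu]_(x in Omega) (u x * pderiv i phi x) =
        - \int[mu]_(x in Omega) (G x ord0 i * phi x)].

(* The weak gradient is unique up to a null set; [wgrad] picks one. *)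
Definition wgrad Omega u : 'rV[R]_n -> 'rV[R]_n :=
  get [set G | weak_gradient Omega u G].

Definition in_Lp Omega (p : R) u := (u \_ Omega) \in Lfun mu p%:E.

Definition W1p Omega p u :=
  [/\ in_Lp Omega p u,
      exists G, weak_gradient Omega u G &
      forall i, in_Lp Omega p (fun x => wgrad Omega u x ord0 i)].

Definition W1p_norm Omega (p : R) u : \bar R :=
  ('N[mu]_p%:E [EFin \o (u \_ Omega)] +
   'N[mu]_p%:E [EFin \o ((fun x => enorm (wgrad Omega u x)) \_ Omega)])%E.

(* An element is given by its extension by zero to R^n. *)
Definition W01p Omega (p : R) u :=
  [/\ W1p Omega p u,
      forall x, ~ Omega x -> u x = 0 &
      forall e : R, 0 < e ->
        exists2 phi, Cc_infty Omega phi & (W1p_norm Omega p (u \- phi)%R < e%:E)%E].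

End sobolev.

Section weak_solution.
Context {R : realType} (n : nat).
Variables (p s gamma r lambda : R) (Omega : set 'rV[R]_n).

Local Notation mu := (lebesgue_rV R n).

(* [0 `^ a = 0] for [a != 0], so [`|t| `^ (p - 2) * t] is [0] at [t = 0] also
   for [p < 2], and so is the integrand [nonlocal_term] on the (null) diagonal. *)
Definition local_term (u phi : 'rV[R]_n -> R) (x : 'rV[R]_n) : R :=
  enorm (wgrad Omega u x) `^ (p - 2) * dotp (wgrad Omega u x) (grad phi x).

Definition nonlocal_term (u phi : 'rV[R]_n -> R) (z : 'rV[R]_n * 'rV[R]_n) : R :=
  `|u z.1 - u z.2| `^ (p - 2) * (u z.1 - u z.2) * (phi z.1 - phi z.2) /
  enorm (z.1 - z.2) `^ (n%:R + s * p).

Definition singular_term (u phi : 'rV[R]_n -> R) (x : 'rV[R]_n) : R :=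
  phi x / u x `^ gamma.

Definition power_term (u phi : 'rV[R]_n -> R) (x : 'rV[R]_n) : R :=
  u x `^ r * phi x.

(* The integrability clauses make explicit that the integrals of the equation
   are genuine: [Rintegral] is a junk value on a non-integrable function. *)
Definition weak_equation (u phi : 'rV[R]_n -> R) :=
  [/\ mu.-integrable Omega (EFin \o local_term u phi),
      (mu \x mu)%E.-integrable setT (EFin \o nonlocal_term u phi),
      mu.-integrable Omega (EFin \o singular_term u phi),
      mu.-integrable Omega (EFin \o power_term u phi) &
      \int[mu]_(x in Omega) local_term u phi x +
      \int[(mu \x mu)%E]_z nonlocal_term u phi z =
      lambda * \int[mu]_(x in Omega) singular_term u phi x +
      \int[mu]_(x in Omega) power_term u phi x].

(* Sobolev functions are defined up to null sets, hence the pointwise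
   inequalities hold almost everywhere. *)
Definition weak_solution (u : 'rV[R]_n -> R) :=
  [/\ W01p Omega p u,
      {ae mu, forall x, Omega x -> 0 < u x},
      forall omega : set 'rV[R]_n,
        compact (closure omega) -> closure omega `<=` Omega ->
        exists2 c : R, 0 < c & {ae mu, forall x, omega x -> c <= u x} &
      forall phi, Cc_infty Omega phi -> weak_equation u phi].

End weak_solution.

(* Main.v *)
(* Weak solutions are critical points of
     J(u) = (|grad u|_p^p + [u]_{s,p}^p) / p - lambda / a |u|_a^a - |u|_q^q / q,
   with a = 1 - gamma and q = r + 1, over nonnegative functions of W_0^{1,p}. For
   small lambda there is a radius on which J is bounded below by a positive constant,
   by the Sobolev inequality. The first solution minimises J inside this radius, where
   J takes negative values because a < 1. The second one minimises the positive
   functional u |-> max_t J(t u); along each ray the maximum is attained once. Since J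
   is negative at the first and positive at the second, they differ. Minimisers exist
   because sublevels of the energy are precompact in L^q (dyadic averages instead of
   the Rellich theorem) and the strict convexity of the energy makes near minimisers
   close in energy.

   The singular term is not differentiable, so a minimiser v first satisfies only an
   inequality in nonnegative directions: it is a supersolution of the operator
   -Delta_p + (-Delta)_p^s and it cannot vanish on a set of positive measure. De Giorgi
   iteration applied to the truncations (k eta - l - v)^+ turns this into a positive
   lower bound on each compact subset; then directions of both signs are admissible and
   the equation follows by dominated convergence. *)
Require Import Defs.
From HB Require Import structures.
From mathcomp Require Import all_boot all_order all_algebra.
From mathcomp Require Import all_classical all_reals all_analysis.
From mathcomp Require Import measurable_realfun.
From mathcomp Require Import ring lra zify.

Set Implicit Arguments.
Unset Strict Implicit.
Unset Printing Implicit Defensive.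

Import Order.TTheory GRing.Theory Num.Theory.
Import numFieldNormedType.Exports.

Local Open Scope classical_set_scope.
Local Open Scope ring_scope.

(** * Elementary inequalities *)

(** Two encodings shape the development. The gradient travels with the function: an element of the
    Sobolev space is a pair approximated by pairs made of a test function and its gradient, so that
    limits, truncations and tests are carried out on pairs, and the chosen weak gradient [wgrad] is
    identified with the second component only at the end. The nonlocal form is rewritten as a local
    one for an R^1-valued field on R^n x R^n, so that one theory of vector-valued p-energies serves
    both operators. The obstacle is that J has no derivative where u vanishes, so minimality is
    exploited only through one-sided convexity inequalities between u and u + e phi. For the second
    solution the perturbed function is first moved to the top of its own ray, by a factor [t k]; the
    uniqueness of the top forces [t k --> 1], and the factors disappear in the limit e -> 0. *)

Section powR_inequalities.
Context {R : realType}.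
Implicit Types (x y a b t p q : R).

(* From the strict inequality [1 + z < e^z], applied to [ln (w / m)] and
   [ln (1 / m)] with [m] the weighted mean of [w] and [1]. *)
Lemma powR_lt_affine a w : 0 < a < 1 -> 0 <= w -> w != 1 ->
  w `^ a < a * w + (1 - a).
Proof.
move=> /andP[a0 a1] w0 w1; have [->|wn0] := eqVneq w 0.
  by rewrite powR0 ?gt_eqF// mulr0 add0r subr_gt0.
have wp : 0 < w by rewrite lt_neqAle eq_sym wn0.
set m := a * w + (1 - a).
have m0 : 0 < m by rewrite /m addr_gt0 ?mulr_gt0 ?subr_gt0.
have lnlt z : 0 < z -> z != 1 -> ln z < z - 1.
  move=> z0 z1; have : ln z != 0.
    by apply: contra z1 => /eqP h; rewrite -(lnK z0) h expR0 eqxx.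
  by move=> /expR_gt1Dx; rewrite lnK// => h; lra.
have lnle z : 0 < z -> ln z <= z - 1.
  by move=> z0; have := expR_ge1Dx (ln z); rewrite lnK// => h; lra.
have wm : w / m != 1 \/ m^-1 != 1.
  have [e|me] := eqVneq m 1; last by right; rewrite invr_eq1.
  by left; rewrite e divr1.
have l1 : ln (w / m) = ln w - ln m by rewrite ln_div.
have l2 : ln m^-1 = - ln m by rewrite lnV.
have key : a * ln w < ln m.
  suff : a * ln (w / m) + (1 - a) * ln m^-1 < a * (w/m - 1) + (1 - a) * (m^-1 - 1).
    rewrite l1 l2.
    have -> : a * (w/m - 1) + (1 - a) * (m^-1 - 1) = m * m^-1 - 1.
      by rewrite /m; ring.
    by rewrite divff ?gt_eqF// => h; lra.
  have m1p : 0 < m^-1 by rewrite invr_gt0.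
  have wmp : 0 < w / m by rewrite divr_gt0.
  have a1' : 0 < 1 - a by lra.
  case: wm => h.
    by apply: ltr_leD; [rewrite ltr_pM2l// lnlt|rewrite ler_pM2l// lnle].
  by apply: ler_ltD; [rewrite ler_pM2l// lnle|rewrite ltr_pM2l// lnlt].
by rewrite /powR (negbTE wn0) -[ltRHS](lnK m0) ltr_expR.
Qed.

(** The preceding inequality for the exponent 1/p at the point w^p, multiplied by p. *)
Lemma powR_gt_affine p w : 1 < p -> 0 <= w -> w != 1 ->
  p * (w - 1) + 1 < w `^ p.
Proof.
move=> p1 w0 w1; have p0 : 0 < p by lra.
have pn0 : p != 0 by rewrite gt_eqF.
have := @powR_lt_affine p^-1 (w `^ p).
rewrite -powRrM (mulfV pn0) powRr1// => /(_ _ (powR_ge0 _ _)) H.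
have : w < p^-1 * w `^ p + (1 - p^-1).
  apply: H; first by rewrite invr_gt0 p0/= invf_lt1.
  apply: contra w1 => /eqP h.
  have : (w `^ p) `^ p^-1 = 1 by rewrite h powR1.
  by rewrite -powRrM (mulfV pn0) powRr1// => ->.
rewrite -(ltr_pM2l p0) mulrDr mulrA (mulfV pn0) mul1r mulrBr (mulfV pn0).
by move=> h; lra.
Qed.

Lemma powR_eq0_pos x p : 0 < p -> (x `^ p == 0) = (x == 0).
Proof. by move=> p0; rewrite powR_eq0 (gt_eqF p0) andbT. Qed.

Lemma powRB1 x p : 0 <= x -> p != 0 -> x `^ (p - 1) * x = x `^ p.
Proof.
move=> x0 p0; have [->|xn0] := eqVneq x 0; first by rewrite mulr0 powR0.
by rewrite -[X in _ * X]powRr1// -powRD ?xn0 ?implybT// subrK.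
Qed.

Lemma powR_divK x y a : 0 < x -> 0 <= y -> (y / x) `^ a * x `^ a = y `^ a.
Proof.
move=> x0 y0; rewrite -powRM ?divfK ?gt_eqF//; last exact: ltW.
by rewrite divr_ge0// ltW.
Qed.

(** Tangent line of t^p at 1, evaluated at y/x and multiplied by x^p. The strict form is kept for
    the equality case of the convexity of [|.|^p]. *)
Lemma young_lt x y p : 1 < p -> 0 <= x -> 0 <= y -> x != y ->
  p * (x `^ (p - 1) * y) < (p - 1) * x `^ p + y `^ p.
Proof.
move=> p1 x0 y0 xy; have p0 : 0 < p by lra.
have pn0 : p != 0 by rewrite gt_eqF.
have [x00|xn0] := eqVneq x 0.
  rewrite x00 !powR0 ?mul0r ?mulr0 ?add0r ?powR_gt0//; last by lra.
  by rewrite lt_neqAle y0 -x00 xy.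
have xp : 0 < x by rewrite lt_neqAle eq_sym xn0.
have := @powR_gt_affine p (y / x) p1 (divr_ge0 y0 x0).
have -> : y / x != 1.
  by apply: contra xy => /eqP h; apply/eqP; rewrite -[y](divfK xn0) h mul1r.
move=> /(_ isT); have xpp : 0 < x `^ p by exact: powR_gt0.
rewrite -(ltr_pM2r xpp) powR_divK// => h.
rewrite -subr_gt0; move: h; rewrite -subr_gt0; congr (0 < _).
rewrite -(powRB1 x0 pn0); field.
by rewrite xn0.
Qed.

Lemma young_le x y p : 1 < p -> 0 <= x -> 0 <= y ->
  p * (x `^ (p - 1) * y) <= (p - 1) * x `^ p + y `^ p.
Proof.
move=> p1 x0 y0; have [<-|xy] := eqVneq x y; last exact/ltW/young_lt.
rewrite powRB1 ?gt_eqF//; last by lra.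
by rewrite mulrBl mul1r subrK.
Qed.

Lemma powR_concave_tangent x y a : 0 < a < 1 -> 0 < x -> 0 <= y ->
  y `^ a <= x `^ a + a * x `^ (a - 1) * (y - x).
Proof.
move=> a01 x0 y0; have /andP[a0 a1] := a01.
have xn0 : x != 0 by rewrite gt_eqF.
have : (y / x) `^ a <= a * (y / x) + (1 - a).
  have [->|h] := eqVneq (y / x) 1; first by rewrite powR1 mulr1; lra.
  by apply/ltW/powR_lt_affine => //; rewrite divr_ge0// ltW.
have xa : 0 < x `^ a by exact: powR_gt0.
rewrite -(ler_pM2r xa) powR_divK// => /le_trans; apply; rewrite -(powRB1 (ltW x0) (lt0r_neq0 a0)).
by rewrite le_eqVlt; apply/orP; left; apply/eqP; field.
Qed.

(** Convexity of z^q at the points a/(1-t) and b/t. The weight t is free: small t makes the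
    coefficient of a^q as close to 1 as desired, at the expense of that of b^q. *)
Lemma powR_convex2 a b q t : 1 <= q -> 0 < t < 1 -> 0 <= a -> 0 <= b ->
  (a + b) `^ q <= (1 - t) `^ (1 - q) * a `^ q + t `^ (1 - q) * b `^ q.
Proof.
move=> q1 /andP[t0 t1] a0 b0; have q0 : q != 0 by apply/eqP; lra.
have t1' : 0 < 1 - t by lra.
set x := a / (1 - t); set y := b / t.
have x0 : 0 <= x by rewrite divr_ge0// ltW.
have y0 : 0 <= y by rewrite divr_ge0// ltW.
have ax : a = (1 - t) * x by rewrite /x mulrC divfK// gt_eqF.
have by_ : b = t * y by rewrite /y mulrC divfK// gt_eqF.
have e s z : 0 < s -> 0 <= z -> s `^ (1 - q) * (s * z) `^ q = s * z `^ q.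
  move=> s0 z0; rewrite powRM// 1?ltW// mulrA -powRD; last first.
    by rewrite (gt_eqF s0) implybT.
  by rewrite subrK powRr1// ltW.
rewrite [in leRHS]ax [in leRHS]by_ !e// ax by_.
have T01 : t \in `[0, 1]%R by rewrite in_itv/= !ltW.
have := @convex_powR R q q1 (Itv01 (ltW t0) (ltW t1)) y x.
rewrite !inE/= !in_itv/= !andbT => /(_ y0 x0).
move=> h; rewrite addrC [leRHS]addrC; exact: h.
Qed.

(* [x^a <= d] unless [x^q >= d^(q/a)], in which case [x^a = x^q / x^(q-a)]. *)
Lemma powR_interp a q d : 0 < a < q -> 0 < d ->
  exists2 C, 0 <= C & forall x, 0 <= x -> x `^ a <= d + C * x `^ q.
Proof.
move=> /andP[a0 aq] d0; set e := d `^ a^-1.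
have e0 : 0 < e by exact: powR_gt0.
have qa : 0 < q - a by rewrite subr_gt0.
exists ((e `^ (q - a))^-1) => [|x x0]; first by rewrite invr_ge0 powR_ge0.
have ea : e `^ a = d by rewrite /e -powRrM mulVf ?gt_eqF// powRr1// ltW.
have eqa : 0 < e `^ (q - a) by exact: powR_gt0.
have [xe|ex] := leP x e.
  rewrite -ea (le_trans (ge0_ler_powR (ltW a0) _ _ xe)) ?nnegrE ?(ltW e0)//.
  by rewrite lerDl mulr_ge0// ?invr_ge0 powR_ge0.
have xp : 0 < x by exact: lt_trans ex.
rewrite -[leLHS]add0r lerD ?(ltW d0)// mulrC ler_pdivlMr//.
have -> : x `^ q = x `^ a * x `^ (q - a).
  by rewrite -powRD ?(gt_eqF xp) ?implybT// addrC subrK.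
rewrite ler_pM2l ?powR_gt0// ge0_ler_powR ?nnegrE ?(ltW qa) ?(ltW e0) ?(ltW xp)//.
exact: ltW.
Qed.

(** As a - 1 < 0, each z in {x, y} satisfies z (x+y)^(a-1) <= z^a; the two inequalities are
    added. *)
Lemma powR_subadd x y a : 0 < a < 1 -> 0 <= x -> 0 <= y ->
  (x + y) `^ a <= x `^ a + y `^ a.
Proof.
move=> /andP[a0 a1] x0 y0; have [xy|] := ltP 0 (x + y); last first.
  move=> xy; have -> : x + y = 0 by apply/eqP; rewrite eq_le xy addr_ge0.
  by rewrite powR0 ?gt_eqF// addr_ge0// powR_ge0.
have s z : 0 <= z -> z <= x + y -> z * (x + y) `^ (a - 1) <= z `^ a.
  move=> z0 zs; have [->|zn0] := eqVneq z 0; first by rewrite mul0r powR_ge0.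
  have zp : 0 < z by rewrite lt_neqAle eq_sym zn0.
  rewrite -(@powRB1 z a)// ?gt_eqF// mulrC ler_pM2r// -opprB !powRN.
  rewrite lef_pV2 ?posrE ?powR_gt0// ge0_ler_powR ?nnegrE//.
    by rewrite subr_ge0 ltW.
  exact: ltW.
apply: le_trans (lerD (s x x0 _) (s y y0 _)); rewrite ?lerDl ?lerDr//.
by rewrite -mulrDl mulrC powRB1 ?gt_eqF ?(ltW xy).
Qed.

Lemma powR_dist x y a : 0 < a < 1 -> 0 <= x -> 0 <= y ->
  `|x `^ a - y `^ a| <= `|x - y| `^ a.
Proof.
move=> a01; wlog : x y / y <= x.
  move=> H x0 y0; have [h|h] := leP y x; first exact: H.
  by rewrite distrC [in leRHS]distrC H// ltW.
move=> yx x0 y0; have /andP[a0 a1] := a01.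
rewrite ger0_norm ?subr_ge0 ?ge0_ler_powR ?nnegrE// ?(ltW a0)//.
rewrite ger0_norm ?subr_ge0// lerBlDr.
have := @powR_subadd (x - y) y a a01; rewrite subr_ge0 subrK.
exact.
Qed.

Lemma powR_add_le x y q : 1 <= q -> 0 <= x -> 0 <= y ->
  (x + y) `^ q <= 2 `^ q * (x `^ q + y `^ q).
Proof.
move=> q1 x0 y0; have q0 : 0 <= q by lra.
wlog xy : x y x0 y0 / x <= y.
  move=> H; have [h|h] := leP x y; first exact: H.
  by rewrite addrC [in leRHS]addrC H// ltW.
apply: (@le_trans _ _ ((2 * y) `^ q)).
  by rewrite ge0_ler_powR ?nnegrE ?addr_ge0 ?mulr_ge0//; lra.
by rewrite powRM// ler_wpM2l ?powR_ge0// lerDr powR_ge0.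
Qed.

Lemma powR_sum_le (I : Type) (s : seq I) (f : I -> R) p : 1 <= p ->
  (\sum_(i <- s) `|f i|) `^ p <=
  (size s)%:R `^ (p - 1) * \sum_(i <- s) `|f i| `^ p.
Proof.
move=> p1; have p0 : p != 0 by rewrite gt_eqF//; lra.
elim: s => [|i s IH]; first by rewrite !big_nil powR0// mulr0.
rewrite !big_cons; case: s IH => [|j s] IH.
  by rewrite !big_nil !addr0 /= powR1 mul1r.
set N := size (j :: s) in IH *.
set S := \sum_(k <- j :: s) `|f k| in IH *.
set T := \sum_(k <- j :: s) `|f k| `^ p in IH *.
have S0 : 0 <= S by apply: sumr_ge0.
have T0 : 0 <= T by apply: sumr_ge0 => k _; exact: powR_ge0.
have N0 : (0 : R) < N%:R by rewrite ltr0n.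
have N1 : (0 : R) < N.+1%:R by rewrite ltr0n.
have NN : (N.+1%:R : R) = N%:R + 1 by rewrite -natr1.
(* With weight 1/(N+1) on the head, the coefficients of the head and of the tail both become
   (N+1)^(p-1). *)
have t01 : 0 < (N.+1%:R : R)^-1 < 1.
  by rewrite invr_gt0 N1/= invf_lt1// NN ltrDr.
have := powR_convex2 p1 t01 S0 (normr_ge0 (f i)).
rewrite addrC => /le_trans; apply; rewrite addrC mulrDr lerD//.
  by rewrite ler_wpM2r ?powR_ge0// -powR_inv1 ?(ltW N1)// -powRrM mulN1r opprB.
have -> : 1 - (N.+1%:R : R)^-1 = N%:R / N.+1%:R.
  rewrite -[X in X - _](divff (lt0r_neq0 N1)) -[X in _ - X]mul1r -mulrBl.
  by rewrite NN addrK.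
apply: le_trans (ler_wpM2l (powR_ge0 _ _) IH) _.
rewrite mulrA ler_wpM2r// powRM ?invr_ge0 ?(ltW N0) ?(ltW N1)//.
rewrite mulrAC -powRD; last by rewrite (gt_eqF N0) implybT.
have -> : 1 - p + (p - 1) = 0 by ring.
rewrite powRr0 mul1r.
by rewrite -powR_inv1 ?(ltW N1)// -powRrM mulN1r opprB.
Qed.

Lemma normr_powR_continuous p : 0 < p -> continuous (fun t : R => `|t| `^ p).
Proof.
move=> p0 x; have [->|x0] := eqVneq x 0; last first.
  apply: (@continuous_comp _ _ _ (fun t : R => `|t|) (fun t => t `^ p)).
    exact: norm_continuous.
  apply/differentiable_continuous/derivable1_diffP.
  by apply: derivable_powR; rewrite in_itv/= normr_gt0 x0.
(* The power may fail to be differentiable at 0; there |y| < e^(1/p) gives |y|^p < e. *)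
rewrite /continuous_at normr0 powR0 ?gt_eqF//; apply/cvgrPdist_lt => e e0.
have := @norm_continuous _ R 0; rewrite /continuous_at normr0.
move=> /cvgrPdist_lt /(_ (e `^ p^-1)); rewrite powR_gt0// => /(_ isT).
apply: filterS => y; rewrite !sub0r !normrN normr_id (ger0_norm (powR_ge0 _ _)) => h.
rewrite -[ltRHS](@powRr1 _ e) ?(ltW e0)// -(mulVf (lt0r_neq0 p0)) powRrM.
by rewrite gt0_ltr_powR// nnegrE ?powR_ge0.
Qed.

End powR_inequalities.

(** * Euclidean norm: Cauchy-Schwarz and strict convexity of its powers *)

Section euclid.
Context {R : realType} (n : nat).
Implicit Types (x y z : 'rV[R]_n) (a p : R).

Lemma dotpC x y : dotp x y = dotp y x.
Proof. by apply: eq_bigr => i _; rewrite mulrC. Qed.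

Lemma dotpDl x y z : dotp (x + y) z = dotp x z + dotp y z.
Proof. by rewrite -big_split/=; apply: eq_bigr => i _; rewrite mxE mulrDl. Qed.

Lemma dotpDr x y z : dotp x (y + z) = dotp x y + dotp x z.
Proof. by rewrite dotpC dotpDl !(dotpC _ x). Qed.

Lemma dotpZl a x y : dotp (a *: x) y = a * dotp x y.
Proof. by rewrite /dotp mulr_sumr; apply: eq_bigr => i _; rewrite mxE mulrA. Qed.

Lemma dotpZr a x y : dotp x (a *: y) = a * dotp x y.
Proof. by rewrite dotpC dotpZl dotpC. Qed.

Lemma dotpNr x y : dotp x (- y) = - dotp x y.
Proof. by rewrite -scaleN1r dotpZr mulN1r. Qed.

Lemma dotp0l y : dotp 0 y = 0.
Proof. by rewrite -(scale0r 0) dotpZl mul0r. Qed.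

Lemma dotpp_ge0 x : 0 <= dotp x x.
Proof. by apply: sumr_ge0 => i _; rewrite -expr2 sqr_ge0. Qed.

Lemma dotpp_eq0 x : (dotp x x == 0) = (x == 0).
Proof.
apply/eqP/eqP => [|->]; last by rewrite dotp0l.
move=> /eqP; rewrite psumr_eq0 => [/allP h|i _]; last by rewrite -expr2 sqr_ge0.
apply/rowP => i; rewrite mxE; apply/eqP.
by have := h i (mem_index_enum _); rewrite -expr2 sqrf_eq0.
Qed.

Lemma enorm_ge0 x : 0 <= enorm x.
Proof. exact: sqrtr_ge0. Qed.

Lemma enorm_sqr x : enorm x ^+ 2 = dotp x x.
Proof. by rewrite sqr_sqrtr// dotpp_ge0. Qed.

Lemma enorm_eq0 x : (enorm x == 0) = (x == 0).
Proof. by rewrite -dotpp_eq0 -enorm_sqr sqrf_eq0. Qed.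

Lemma enorm0 : enorm (0 : 'rV[R]_n) = 0.
Proof. by apply/eqP; rewrite enorm_eq0. Qed.

Lemma enorm_gt0 x : (0 < enorm x) = (x != 0).
Proof. by rewrite lt_neqAle enorm_ge0 andbT eq_sym enorm_eq0. Qed.

Lemma enormZ a x : enorm (a *: x) = `|a| * enorm x.
Proof. by rewrite /enorm dotpZl dotpZr mulrA -expr2 sqrtrM ?sqr_ge0// sqrtr_sqr. Qed.

Lemma enormN x : enorm (- x) = enorm x.
Proof. by rewrite -scaleN1r enormZ normrN1 mul1r. Qed.

Lemma enormBC x y : enorm (x - y) = enorm (y - x).
Proof. by rewrite -enormN opprB. Qed.

Lemma dotp_le x y : dotp x y <= enorm x * enorm y.
Proof.
have [->|x0] := eqVneq x 0; first by rewrite dotp0l enorm0 mul0r.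
have [->|y0] := eqVneq y 0; first by rewrite dotpC dotp0l enorm0 mulr0.
have ex : 0 < enorm x by rewrite enorm_gt0.
have ey : 0 < enorm y by rewrite enorm_gt0.
have := dotpp_ge0 (enorm y *: x - enorm x *: y).
rewrite dotpDr !dotpDl !dotpNr !(dotpC (- _)) !dotpNr !dotpZl !dotpZr.
rewrite -!enorm_sqr => h; rewrite -subr_ge0.
have e2 : 0 < 2 * (enorm x * enorm y) by rewrite mulr_gt0// mulr_gt0.
rewrite -(pmulr_rge0 _ e2); apply: le_trans h _.
by rewrite le_eqVlt; apply/orP; left; apply/eqP; ring.
Qed.

Lemma dotp_norm_le x y : `|dotp x y| <= enorm x * enorm y.
Proof.
by rewrite ler_norml dotp_le andbT lerNl -dotpNr -(enormN y) dotp_le.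
Qed.

Lemma enormD x y : enorm (x + y) <= enorm x + enorm y.
Proof.
have h : 0 <= enorm x + enorm y by rewrite addr_ge0 ?enorm_ge0.
rewrite -(ler_pXn2r (n := 2))// ?nnegrE ?enorm_ge0//.
rewrite enorm_sqr dotpDr !dotpDl -!enorm_sqr (dotpC y x).
by have := dotp_le x y; lra.
Qed.

Lemma coord_le_enorm x i : `|x ord0 i| <= enorm x.
Proof.
rewrite -(ler_pXn2r (n := 2))// ?nnegrE ?enorm_ge0// enorm_sqr real_normK ?num_real//.
rewrite /dotp (bigD1 i)//= -expr2 lerDl.
by apply: sumr_ge0 => j _; rewrite -expr2 sqr_ge0.
Qed.

Lemma enorm_le_sum x : enorm x <= \sum_i `|x ord0 i|.
Proof.
have s0 : 0 <= \sum_i `|x ord0 i| by apply: sumr_ge0.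
rewrite -(ler_pXn2r (n := 2))// ?nnegrE ?enorm_ge0// enorm_sqr expr2.
rewrite [leRHS]mulr_suml; apply: ler_sum => i _.
rewrite -expr2 -real_normK ?num_real// expr2 ler_wpM2l//.
by rewrite (bigD1 i)//= lerDl sumr_ge0.
Qed.

(** Cauchy-Schwarz reduces the inequality to Young's inequality for the two norms. Equality forces
    equal norms by [young_lt], and then x = y since the norm of x - y vanishes. *)
Lemma powR_enorm_grad_le p x y : 1 < p ->
  enorm x `^ p + p * (enorm x `^ (p - 2) * dotp x (y - x)) <= enorm y `^ p
  ?= iff (x == y).
Proof.
move=> p1; have p0 : p != 0 by rewrite gt_eqF//; lra.
have [->|xy] := eqVneq x y.
  by apply/leifP; rewrite subrr dotpC dotp0l !mulr0 addr0.
apply/leifP; have [x0|x0] := eqVneq x 0.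
  rewrite x0 enorm0 dotp0l !mulr0 powR0// addr0 powR_gt0// enorm_gt0.
  by rewrite eq_sym -x0.
have ex : 0 < enorm x by rewrite enorm_gt0.
have e2 : enorm x `^ (p - 2) * enorm x ^+ 2 = enorm x `^ p.
  rewrite -powR_mulrn ?enorm_ge0// -powRD ?subrK//.
  by rewrite (gt_eqF ex) implybT.
have e1 : enorm x `^ (p - 2) * enorm x = enorm x `^ (p - 1).
  rewrite -[X in _ * X]powRr1 ?enorm_ge0// -powRD; last by rewrite (gt_eqF ex) implybT.
  by congr powR; lra.
rewrite dotpDr dotpNr -enorm_sqr mulrBr e2.
have ea : 0 < enorm x `^ (p - 2) by rewrite powR_gt0.
have [exy|exy] := eqVneq (enorm x) (enorm y); last first.
  have := young_lt p1 (enorm_ge0 x) (enorm_ge0 y) exy.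
  rewrite -e1 -mulrA => h.
  have : p * (enorm x `^ (p - 2) * dotp x y) <=
         p * (enorm x `^ (p - 2) * (enorm x * enorm y)).
    by rewrite !ler_pM2l ?dotp_le//; lra.
  move: h; rewrite mulrBr mulrBl mul1r; set a := p * _; set b := p * _.
  by move: a b => a b; lra.
have dxy : dotp x y < enorm x * enorm y.
  have : 0 < dotp (x - y) (x - y).
    by rewrite lt_neqAle dotpp_ge0 andbT eq_sym dotpp_eq0 subr_eq0.
  rewrite dotpDr !dotpDl !dotpNr !(dotpC (- _)) !dotpNr -!enorm_sqr -exy.
  by move: (enorm x) (dotp x y) => a b; lra.
have : p * (enorm x `^ (p - 2) * dotp x y) <
         p * (enorm x `^ (p - 2) * (enorm x * enorm y)).
  by rewrite !ltr_pM2l//; lra.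
by rewrite -exy -expr2 e2; lra.
Qed.

(** The defect of midpoint convexity of [|.|^p]. It gives a single substitute for uniform convexity,
    with the same argument for p < 2 and p >= 2. *)
Definition midgap p x y : R :=
  2^-1 * (enorm x `^ p + enorm y `^ p) - enorm (2^-1 *: (x + y)) `^ p.

(** The tangent inequalities at the midpoint m, evaluated at x and at y, are added; the linear terms
    cancel because x - m = -(y - m). *)
Lemma midgap_ge0 p x y : 1 < p -> 0 <= midgap p x y ?= iff (x == y).
Proof.
move=> p1; set m := 2^-1 *: (x + y).
have e2 : x - m = - (y - m).
  apply/eqP; rewrite opprB subr_eq addrAC eq_sym subr_eq /m -scalerDl.
  by rewrite -[2^-1]mul1r -splitr scale1r addrC.
have := leifD (powR_enorm_grad_le m x p1) (powR_enorm_grad_le m y p1).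
rewrite e2 dotpNr; set D := enorm m `^ (p - 2) * dotp m (y - m).
rewrite mulrN -/D mulrN addrACA addNr addr0 => -[h1 h2].
have mg : midgap p x y =
    2^-1 * (enorm x `^ p + enorm y `^ p - (enorm m `^ p + enorm m `^ p)).
  by rewrite /midgap -/m; move: (_ `^ _) (_ `^ _) (_ `^ _) => a b c; field.
split; first by rewrite mg mulr_ge0// ?invr_ge0// subr_ge0.
have -> : (x == y) = (m == x) && (m == y).
  apply/eqP/andP => [e|[/eqP h /eqP h']]; last by rewrite -h -h'.
  by split; apply/eqP; rewrite /m e scalerDr -scalerDl -[2^-1]mul1r -splitr scale1r.
rewrite -h2 mg; apply/eqP/eqP => [/esym/eqP|->]; last by rewrite subrr mulr0.
by rewrite mulf_eq0 invr_eq0 pnatr_eq0/= subr_eq0 => /eqP.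
Qed.

Lemma enorm_continuous : continuous (@enorm R n).
Proof.
move=> x; rewrite /enorm.
apply: (@continuous_comp _ _ _ (fun x => dotp x x) (@Num.sqrt R)); last first.
  exact: sqrt_continuous.
rewrite /dotp; elim: (index_enum _) => [|i s IH].
  rewrite (_ : (fun x => _) = cst 0); first exact: cst_continuous.
  by apply/funext => y; rewrite big_nil.
rewrite (_ : (fun x => _) = (fun x => x ord0 i * x ord0 i) \+
    fun x => \sum_(i <- s) x ord0 i * x ord0 i); last first.
  by apply/funext => y; rewrite big_cons.
apply: continuousD => //.
by apply: continuousM; exact: coord_continuous.
Qed.

Lemma enorm_powR_continuous p : 0 < p ->
  continuous (fun x : 'rV[R]_n => enorm x `^ p).
Proof.
move=> p0 x; rewrite (_ : (fun x => _) = (fun t => `|t| `^ p) \o @enorm R n).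
  by apply: continuous_comp; [exact: enorm_continuous|exact: normr_powR_continuous].
by apply/funext => y /=; rewrite ger0_norm// enorm_ge0.
Qed.

End euclid.

Section midgap_control.
Context {R : realType} (n : nat) (p : R) (p1 : 1 < p).
Implicit Types (x y : 'rV[R]_n).

Let p0 : 0 < p. Proof. exact: lt_trans p1. Qed.

Lemma enorm_powRZ (a : R) x : enorm (a *: x) `^ p = `|a| `^ p * enorm x `^ p.
Proof. by rewrite enormZ powRM// enorm_ge0. Qed.

Lemma midgapZ (a : R) x y : midgap p (a *: x) (a *: y) = `|a| `^ p * midgap p x y.
Proof.
rewrite /midgap -scalerDr scalerA mulrC -scalerA !enorm_powRZ.
by move: (_ `^ p) (_ `^ p) (_ `^ p) (_ `^ p) => b c d e; ring.
Qed.

Lemma enormB_powR_le x y :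
  enorm (x - y) `^ p <= 2 `^ p * (enorm x `^ p + enorm y `^ p).
Proof.
apply: le_trans (powR_add_le (ltW p1) (enorm_ge0 x) (enorm_ge0 y)).
rewrite ge0_ler_powR ?nnegrE ?enorm_ge0 ?addr_ge0 ?enorm_ge0 ?(ltW p0)//.
by rewrite (le_trans (enormD _ _))// enormN.
Qed.

Lemma enormD_powR_le x y :
  enorm (x + y) `^ p <= 2 `^ p * (enorm x `^ p + enorm y `^ p).
Proof. by have := enormB_powR_le x (- y); rewrite opprK enormN. Qed.

(* By homogeneity and compactness of the unit sphere of [R^n * R^n], on which
   the midpoint gap is bounded below away from the diagonal. *)
Lemma midgap_control d : 0 < d -> exists2 C, 0 <= C & forall x y,
  enorm (x - y) `^ p <= d * (enorm x `^ p + enorm y `^ p) + C * midgap p x y.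
Proof.
move=> d0.
pose K := [set z : 'rV[R]_n * 'rV[R]_n |
  enorm z.1 `^ p + enorm z.2 `^ p = 1 /\ d <= enorm (z.1 - z.2) `^ p].
have cE := enorm_powR_continuous p0 (n := n).
have c1 : continuous (fun z : 'rV[R]_n * 'rV[R]_n => enorm z.1 `^ p).
  by move=> z; apply: (@continuous_comp _ _ _ fst (fun x => enorm x `^ p));
    [exact: cvg_fst|exact: cE].
have c2 : continuous (fun z : 'rV[R]_n * 'rV[R]_n => enorm z.2 `^ p).
  by move=> z; apply: (@continuous_comp _ _ _ snd (fun x => enorm x `^ p));
    [exact: cvg_snd|exact: cE].
have c3 : continuous (fun z : 'rV[R]_n * 'rV[R]_n => enorm (z.1 - z.2) `^ p).
  move=> z; apply: (@continuous_comp _ _ _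
      (fun z : 'rV[R]_n * 'rV[R]_n => z.1 - z.2) (fun x => enorm x `^ p)); last exact: cE.
  by apply: cvgB; [exact: cvg_fst|exact: cvg_snd].
have c4 : continuous (fun z : 'rV[R]_n * 'rV[R]_n => midgap p z.1 z.2).
  move=> z; apply: cvgB.
    by apply: cvgM; [exact: cvg_cst|apply: cvgD; [exact: c1|exact: c2]].
  apply: (@continuous_comp _ _ _ (fun z : 'rV[R]_n * 'rV[R]_n => 2^-1 *: (z.1 + z.2))
    (fun x => enorm x `^ p)); last exact: cE.
  by apply: cvgZr; apply: cvgD; [exact: cvg_fst|exact: cvg_snd].
pose B := [set x : 'rV[R]_n | forall i, `[(-1)%R, 1%R]%classic (x ord0 i)].
have Bc : compact B by apply: (@rV_compact R n (fun=> `[(-1)%R, 1%R]%classic)) => i; exact: segment_compact.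
have Kbox : K `<=` B `*` B.
  have aux x : enorm x `^ p <= 1 -> B x.
    move=> h i; rewrite /= in_itv/= -ler_norml (le_trans (coord_le_enorm _ _))//.
    have -> : enorm x = (enorm x `^ p) `^ p^-1.
      by rewrite -powRrM mulfV ?gt_eqF// powRr1// enorm_ge0.
    have -> : 1 = 1 `^ p^-1 :> R by rewrite powR1.
    by rewrite ge0_ler_powR ?nnegrE ?powR_ge0// invr_ge0 ltW.
  move=> [a b] [/= ab _]; split => /=; apply: aux; rewrite -ab.
    by rewrite lerDl powR_ge0.
  by rewrite lerDr powR_ge0.
have Kc : compact K.
  apply: (@subclosed_compact _ _ (B `*` B)) => //; last exact: compact_setX.
  apply: closedI.
    apply: (@preimage_closed _ _ (fun z : 'rV[R]_n * 'rV[R]_n =>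
        enorm z.1 `^ p + enorm z.2 `^ p) [set 1]) => //.
    by move=> z _; apply: cvgD; [exact: c1|exact: c2].
  apply: (@preimage_closed _ _ (fun z : 'rV[R]_n * 'rV[R]_n => enorm (z.1 - z.2) `^ p)
    [set x | d <= x]) => //.
have scale x y : let t := enorm x `^ p + enorm y `^ p in 0 < t ->
    let l := t `^ (- p^-1) in `|l| `^ p = t^-1.
  move=> /= t0; rewrite ger0_norm ?powR_ge0// -powRrM mulNr mulVf ?gt_eqF//.
  by rewrite powR_inv1 // ltW.
have [m m0 mK] : exists2 m, 0 < m & forall a b, K (a, b) -> m <= midgap p a b.
  have [->|/set0P K0] := eqVneq K set0; first by exists 1.
  have [|[a b]] := compact_EVT_min K0 Kc (f := fun z => midgap p z.1 z.2).
    by apply: continuous_subspaceT.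
  move=> /set_mem[/= ab1 ab2] abm; exists (midgap p a b).
    have [g0 g1] := midgap_ge0 a b p1.
    rewrite lt_neqAle g0 andbT g1; apply: contraTN ab2 => /eqP ->.
    by rewrite subrr enorm0 powR0 ?gt_eqF// -ltNge.
  by move=> a' b' /mem_set /abm.
(* With t = |x|^p + |y|^p, rescaling to the sphere gives m t <= [midgap p x y] whenever |x-y|^p > d
   t, while |x-y|^p <= 2^p t always. *)
exists (2 `^ p / m); first by rewrite divr_ge0 ?powR_ge0// ltW.
move=> x y; have [g0 _] := midgap_ge0 x y p1.
have xp := powR_ge0 (enorm x) p; have yp := powR_ge0 (enorm y) p.
set t := enorm x `^ p + enorm y `^ p.
have Cg : 0 <= 2 `^ p / m * midgap p x y.
  by rewrite mulr_ge0// divr_ge0 ?powR_ge0// ltW.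
have [h|h] := leP (enorm (x - y) `^ p) (d * t); first by rewrite (le_trans h)// lerDl.
have t0 : 0 < t.
  rewrite lt_neqAle addr_ge0// andbT; apply: contraTN h => /eqP t0.
  rewrite -t0 mulr0 -leNgt (le_trans (enormB_powR_le x y))//.
  by rewrite -/t -t0 mulr0.
have := scale x y t0; rewrite -/t; set l := t `^ _ => lE.
have := mK (l *: x) (l *: y).
rewrite midgapZ lE mulrC ler_pdivlMr// => H.
have {}H : m * t <= midgap p x y.
  apply: H; split => /=; rewrite -?scalerBr !enorm_powRZ lE.
    by rewrite -mulrDr mulVf// gt_eqF.
  by rewrite mulrC ler_pdivlMr// ltW.
apply: (@le_trans _ _ (2 `^ p / m * midgap p x y)); last first.
  by rewrite lerDr mulr_ge0 ?(ltW d0) ?(ltW t0).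
apply: le_trans (enormB_powR_le x y) _; rewrite -/t -mulrA ler_wpM2l ?powR_ge0//.
by rewrite mulrC ler_pdivlMr// mulrC.
Qed.

End midgap_control.

(** * Real-valued integrals and p-energies *)

Section real_integral.
Context d (T : measurableType d) (R : realType).
Variable mu : {measure set T -> \bar R}.
Implicit Types f g h : T -> R.

Definition L1 f : Prop := mu.-integrable setT (EFin \o f).

Lemma L1_measurable f : L1 f -> measurable_fun setT f.
Proof. by move=> /measurable_int/measurable_EFinP. Qed.

Lemma L1_ge0P f : measurable_fun setT f -> (forall x, 0 <= f x) ->
  (\int[mu]_x (f x)%:E < +oo)%E -> L1 f.
Proof.
move=> mf f0 h; apply/integrableP; split; first exact/measurable_EFinP.
by under eq_integral do rewrite /= ger0_norm//.
Qed.

Lemma L1_lty f : L1 f -> (\int[mu]_x (f x)%:E < +oo)%E.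
Proof. by move=> h; exact: integrable_lty. Qed.

Lemma L1_integralE f : L1 f -> (\int[mu]_x (f x)%:E)%E = (\int[mu]_x f x)%:E.
Proof. by move=> h; rewrite /Rintegral fineK//; exact: integrable_fin_num. Qed.

Lemma L1_le f g : measurable_fun setT f -> L1 g -> (forall x, `|f x| <= g x) -> L1 f.
Proof.
move=> mf ig fg; apply: (@le_integrable _ _ _ mu _ measurableT _ (EFin \o g)) => //.
  exact/measurable_EFinP.
by move=> x _ /=; rewrite lee_fin (le_trans (fg x))// ler_norm.
Qed.

Lemma L1D f g : L1 f -> L1 g -> L1 (fun x => f x + g x).
Proof. by move=> hf hg; exact: (integrableD measurableT hf hg). Qed.

Lemma L1B f g : L1 f -> L1 g -> L1 (fun x => f x - g x).
Proof. by move=> hf hg; exact: (integrableB measurableT hf hg). Qed.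

Lemma L1Z a f : L1 f -> L1 (fun x => a * f x).
Proof. by move=> hf; exact: (integrableZl measurableT a hf). Qed.

Lemma L1_0 : L1 (fun=> 0).
Proof. exact: integrable0. Qed.

Lemma L1_norm f : L1 f -> L1 (fun x => `|f x|).
Proof.
move=> hf; apply: (@L1_le _ (fun x => `|f x|)).
- by apply: measurableT_comp => //; exact: L1_measurable.
- exact: (integrable_norm hf).
- by move=> x; rewrite normr_id.
Qed.

Lemma rintD f g : L1 f -> L1 g -> \int[mu]_x (f x + g x) = \int[mu]_x f x + \int[mu]_x g x.
Proof. by move=> hf hg; rewrite RintegralD. Qed.

Lemma rintB f g : L1 f -> L1 g -> \int[mu]_x (f x - g x) = \int[mu]_x f x - \int[mu]_x g x.
Proof. by move=> hf hg; rewrite RintegralB. Qed.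

Lemma rintZ a f : L1 f -> \int[mu]_x (a * f x) = a * \int[mu]_x f x.
Proof. by move=> hf; rewrite RintegralZl. Qed.

Lemma rint_ge0 f : (forall x, 0 <= f x) -> 0 <= \int[mu]_x f x.
Proof. by move=> h; apply: Rintegral_ge0. Qed.

Lemma rint_le f g : L1 f -> L1 g -> (forall x, f x <= g x) ->
  \int[mu]_x f x <= \int[mu]_x g x.
Proof. by move=> hf hg h; apply: le_Rintegral. Qed.

Lemma rint_norm f : L1 f -> `|\int[mu]_x f x| <= \int[mu]_x `|f x|.
Proof.
move=> hf; rewrite ler_norml; apply/andP; split.
  rewrite lerNl -mulN1r -rintZ//; apply: rint_le; [exact: L1Z|exact: L1_norm|].
  by move=> x; rewrite mulN1r -normrN ler_norm.
by apply: rint_le => //; [exact: L1_norm|move=> x; exact: ler_norm].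
Qed.

Lemma L1_lty_rint f M : measurable_fun setT f -> (forall x, 0 <= f x) ->
  (\int[mu]_x (f x)%:E <= M%:E)%E -> L1 f /\ \int[mu]_x f x <= M.
Proof.
move=> mf f0 h; have i : L1 f by apply: L1_ge0P => //; rewrite (le_lt_trans h) ?ltry.
by split => //; rewrite -lee_fin -L1_integralE.
Qed.

Lemma L1_ae f g : measurable_fun setT g -> ae_eq mu setT f g -> L1 f -> L1 g.
Proof.
move=> mg fg hf; have mf := L1_measurable hf.
apply/integrableP; split; first exact/measurable_EFinP.
rewrite (@ae_eq_integral _ _ _ mu setT (fun x => `|(f x)%:E|)%E)//.
- by move/integrableP : hf => [].
- by do 2 apply: measurableT_comp => //.
- by do 2 apply: measurableT_comp => //.
- by apply: filterS fg => x /= h _; rewrite h.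
Qed.

Lemma rint_ae f g : measurable_fun setT f -> measurable_fun setT g ->
  ae_eq mu setT f g -> \int[mu]_x f x = \int[mu]_x g x.
Proof.
move=> mf mg fg; rewrite /Rintegral; congr fine; apply: ae_eq_integral => //.
- exact/measurable_EFinP.
- exact/measurable_EFinP.
- by apply: filterS fg => x /= h _; rewrite h.
Qed.

Lemma rint_dct (f : nat -> T -> R) g h :
  (forall k, measurable_fun setT (f k)) -> measurable_fun setT g -> L1 h ->
  {ae mu, forall x, forall k, `|f k x| <= h x} ->
  {ae mu, forall x, f k x @[k --> \oo] --> g x} ->
  L1 g /\ \int[mu]_x f k x @[k --> \oo] --> \int[mu]_x g x.
Proof.
move=> mf mg hh fh fg.
have [] := @dominated_convergence _ _ _ mu setT measurableT (fun k => EFin \o f k)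
  (EFin \o g) (EFin \o h).
- by move=> k; exact/measurable_EFinP.
- exact/measurable_EFinP.
- apply: filterS fg => x fg _; apply/fine_cvgP; split; first by near=> k.
  exact: fg.
- exact: hh.
- by apply: filterS fh => x fh k _ /=; rewrite lee_fin.
move=> ig _ c; split => //; rewrite /Rintegral.
apply: fine_cvg; rewrite fineK//; exact: integrable_fin_num.
Unshelve. all: by end_near.
Qed.

(** Fatou in the form used for energies: upper bounds [M k] that converge stand in for the lower
    limit of the integrals. *)
Lemma rint_fatou (f : nat -> T -> R) g (M : nat -> R) l :
  (forall k, L1 (f k)) -> (forall k x, 0 <= f k x) -> (forall k, \int[mu]_x f k x <= M k) ->
  M k @[k --> \oo] --> l -> measurable_fun setT g -> (forall x, 0 <= g x) ->
  {ae mu, forall x, f k x @[k --> \oo] --> g x} ->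
  L1 g /\ \int[mu]_x g x <= l.
Proof.
move=> hf f0 fM Ml mg g0 fg; apply: L1_lty_rint => //.
have -> : (\int[mu]_x (g x)%:E = \int[mu]_x (limn_einf (fun k => (f k x)%:E)))%E.
  apply: ae_eq_integral => //.
  - exact/measurable_EFinP.
  - rewrite (_ : (fun x => _) = (fun x => - limn_esup (fun k => - (f k x)%:E))%E); last first.
      apply/funext => x; rewrite -limn_einfN; congr limn_einf.
      by apply/funext => k; rewrite /= ?opprK ?oppeK.
    apply: measurableT_comp => //; apply: measurable_fun_limn_esup => k.
    by apply: measurableT_comp => //; exact/measurable_EFinP/L1_measurable.
  - apply: filterS fg => x fg _; apply/esym.
    have c : (f k x)%:E @[k --> \oo] --> (g x)%:E.
      by apply/fine_cvgP; split; [near=> k|exact: fg].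
    by rewrite (cvg_limn_einf_sup c).1.
apply: le_trans (@fatou _ _ _ mu setT measurableT (fun k => EFin \o f k) _ _) _.
- by move=> k; exact/measurable_EFinP/L1_measurable.
- by move=> k x _; rewrite lee_fin.
have c : (M k)%:E @[k --> \oo] --> l%:E.
  by apply/fine_cvgP; split; [near=> k|exact: Ml].
rewrite -(cvg_lim _ c)// limn_einf_lim; apply: lee_lim.
- exact: is_cvg_einfs.
- by apply/cvg_ex; exists l%:E.
near=> k; apply: (@le_trans _ _ (\int[mu]_x (f k x)%:E)%E).
  by apply: ereal_inf_lbound; exists k => //=.
by rewrite L1_integralE// lee_fin.
Unshelve. all: by end_near.
Qed.

(** The sum of the series has a finite integral, hence is finite almost everywhere, and the terms of
    a convergent series tend to 0. *)
Lemma ae_cvg0_of_summable (g : nat -> T -> R) :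
  (forall k, measurable_fun setT (g k)) -> (forall k x, 0 <= g k x) ->
  (forall k, \int[mu]_x (g k x)%:E <= (2^-1 ^+ k)%:E)%E ->
  {ae mu, forall x, g k x @[k --> \oo] --> (0 : R)}.
Proof.
move=> mg g0 hg.
have mS : measurable_fun setT (fun x => \sum_(0 <= k <oo) (g k x)%:E)%E.
  apply: (@ge0_emeasurable_sum _ _ _ setT (fun k x => (g k x)%:E)) => [k x _ _|k _].
    by rewrite lee_fin.
  exact/measurable_EFinP.
have ig : (\int[mu]_x (\sum_(0 <= k <oo) (g k x)%:E) < +oo)%E.
  rewrite integral_nneseries; [|exact: measurableT|by move=> k; exact/measurable_EFinP|
    by move=> k x _; rewrite lee_fin].
  apply: (@le_lt_trans _ _ (\sum_(0 <= k <oo) (2^-1 ^+ k)%:E)%E); last first.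
    have c : (\sum_(0 <= k < N) (2^-1 ^+ k : R)%:E)%E @[N --> \oo] --> (2 : R)%:E.
      rewrite (_ : (fun N => _) = EFin \o series (geometric 1 (2^-1 : R))); last first.
        apply/funext => N; rewrite /= sumEFin /series/=; congr EFin.
        by apply: eq_bigr => k _; rewrite /geometric/= mul1r.
      apply/fine_cvgP; split; first by near=> k.
      have := @cvg_geometric_series R 1 2^-1; rewrite ger0_norm// invf_lt1// ltr1n.
      by move=> /(_ isT); rewrite div1r; have -> : (1 - 2^-1)^-1 = 2 :> R by field.
    by rewrite (cvg_lim _ c)// ltry.
  by apply: lee_nneseries => // k _ _; apply: integral_ge0 => x _; rewrite lee_fin.
have : mu.-integrable setT (fun x => \sum_(0 <= k <oo) (g k x)%:E)%E.
  apply/integrableP; split => //.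
  rewrite (eq_integral (fun x => \sum_(0 <= k <oo) (g k x)%:E)%E)// => x _.
  by rewrite gee0_abs// nneseries_ge0// => k _ _; rewrite lee_fin.
move=> /integrable_ae -/(_ measurableT); apply: filterS => x /(_ I) fx.
apply: cvg_series_cvg_0.
apply: nondecreasing_is_cvgn.
  by apply/nondecreasing_seqP => k; rewrite /series/= big_nat_recr//= lerDl.
exists (fine (\sum_(0 <= k <oo) (g k x)%:E)%E) => _ [N _ <-].
rewrite -lee_fin fineK// /series/= -sumEFin.
by apply: nneseries_lim_ge => k _ _; rewrite lee_fin.
Unshelve. all: by end_near.
Qed.

End real_integral.

Lemma cvgn_of_fast (R : realType) (u : nat -> R) N :
  (forall k, (N <= k)%N -> `|u k.+1 - u k| <= 2^-1 ^+ k) -> cvgn u.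
Proof.
move=> h.
(* [e k] is the sum of all the remaining steps, so [v - e] increases and [v + e] decreases. *)
pose v k := u (k + N)%N; pose e k : R := 2 * 2^-1 ^+ (k + N)%N.
have eS k : e k.+1 = e k - 2^-1 ^+ (k + N)%N.
  by rewrite /e addSn exprS; move: (_ ^+ _) => a; field.
have vS k : `|v k.+1 - v k| <= 2^-1 ^+ (k + N)%N.
  by rewrite /v addSn h// leq_addl.
have e0 : e k @[k --> \oo] --> (0 : R).
  rewrite -[0 in X in _ --> X](mulr0 2); apply: cvgM; first exact: cvg_cst.
  rewrite (cvg_shiftn N (fun k => 2^-1 ^+ k : R)).
  by apply: cvg_expr; rewrite ger0_norm// invf_lt1// ltr1n.
have nd : nondecreasing_seq (fun k => v k - e k).
  apply/nondecreasing_seqP => k; rewrite eS -subr_ge0.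
  by have := vS k; rewrite ler_norml => /andP[]; move: (v k.+1) (v k) (e k) (_ ^+ _) => a b c d' *; lra.
have ni : nonincreasing_seq (fun k => v k + e k).
  apply/nonincreasing_seqP => k; rewrite eS -subr_ge0.
  by have := vS k; rewrite ler_norml => /andP[]; move: (v k.+1) (v k) (e k) (_ ^+ _) => a b c d' *; lra.
have /cvg_ex[l vl] : cvgn (fun k => v k - e k).
  apply: nondecreasing_is_cvgn => //; exists (v 0%N + e 0%N) => _ [k _ <-].
  apply: le_trans (ni _ _ (leq0n k)).
  rewrite lerD2l -subr_ge0 opprK addr_ge0// /e mulr_ge0// exprn_ge0// invr_ge0//.
apply/cvg_ex; exists (l + 0); rewrite -(cvg_shiftn N).
rewrite (_ : (fun k => u (k + N)%N) = (fun k => v k - e k) \+ e); first exact: cvgD.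
by apply/funext => k /=; rewrite subrK.
Qed.

Lemma cvg_sum_seq (R : realType) (V : normedModType R) (I : Type) (s : seq I)
    (u : I -> nat -> V) (l : I -> V) : (forall i, u i k @[k --> \oo] --> l i) ->
  \sum_(i <- s) u i k @[k --> \oo] --> \sum_(i <- s) l i.
Proof.
move=> h; elim: s => [|i s IH].
  by under eq_fun do rewrite big_nil; rewrite big_nil; exact: cvg_cst.
by under eq_fun do rewrite big_cons; rewrite big_cons; exact: cvgD.
Qed.

Lemma cvg_rV (R : realType) n (u : nat -> 'rV[R]_n) (l : 'rV[R]_n) :
  (forall i, u k ord0 i @[k --> \oo] --> l ord0 i) -> u k @[k --> \oo] --> l.
Proof.
move=> h; rewrite [X in _ --> X]row_sum_delta.
rewrite (_ : (fun k => _) = fun k => \sum_j u k ord0 j *: delta_mx 0 j).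
  by apply: cvg_sum_seq => i; apply: cvgZr_tmp; exact: h.
by apply/funext => k; exact: row_sum_delta.
Qed.

(** * Vector-valued fields, their p-energies and the duality pairing *)

Section vector_Lp.
Context d (T : measurableType d) (R : realType) (n : nat).
Variable mu : {measure set T -> \bar R}.
Implicit Types (F G H : T -> 'rV[R]_n) (p : R).

Definition vmeas F := forall i, measurable_fun setT (fun x => F x ord0 i).

Definition inLp p F := vmeas F /\ L1 mu (fun x => enorm (F x) `^ p).

Definition energy p F := \int[mu]_x (enorm (F x) `^ p).

(** Up to the factor p, the derivative of the energy at F in the direction H: the weak form of the
    p-Laplacian when F is a gradient, of its fractional version when F is [nlfield]. *)
Definition pairing p F H := \int[mu]_x (enorm (F x) `^ (p - 2) * dotp (F x) (H x)).

Lemma measurable_dotp F G : vmeas F -> vmeas G ->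
  measurable_fun setT (fun x => dotp (F x) (G x)).
Proof.
move=> mF mG; rewrite /dotp; apply: measurable_sum => i.
by apply: measurable_funM.
Qed.

Lemma measurable_enorm F : vmeas F -> measurable_fun setT (fun x => enorm (F x)).
Proof.
move=> mF; rewrite /enorm; apply: (measurableT_comp (f := @Num.sqrt R)).
  by apply: continuous_measurable_fun; exact: sqrt_continuous.
exact: measurable_dotp.
Qed.

Lemma measurable_enorm_powR p F : vmeas F ->
  measurable_fun setT (fun x => enorm (F x) `^ p).
Proof.
move=> mF; apply: (measurableT_comp (f := fun t : R => t `^ p)) => //.
exact: measurable_enorm.
Qed.

Lemma vmeasD F G : vmeas F -> vmeas G -> vmeas (fun x => F x + G x).
Proof.
move=> mF mG i; rewrite (_ : (fun x => _) = (fun x => F x ord0 i + G x ord0 i)).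
  exact: measurable_funD.
by apply/funext => x; rewrite mxE.
Qed.

Lemma vmeasZ a F : vmeas F -> vmeas (fun x => a *: F x).
Proof.
move=> mF i; rewrite (_ : (fun x => _) = (fun x => a * F x ord0 i)).
  by apply: measurable_funM.
by apply/funext => x; rewrite mxE.
Qed.

Lemma vmeasB F G : vmeas F -> vmeas G -> vmeas (fun x => F x - G x).
Proof.
move=> mF mG; rewrite (_ : (fun x => _) = (fun x => F x + (-1) *: G x)).
  by apply: vmeasD => //; exact: vmeasZ.
by apply/funext => x; rewrite scaleN1r.
Qed.

Lemma energy_ge0 p F : 0 <= energy p F.
Proof. by apply: rint_ge0 => x; exact: powR_ge0. Qed.

Variables (p : R) (p1 : 1 < p).

Let p0 : 0 < p. Proof. exact: lt_trans p1. Qed.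

Lemma inLpD F G : inLp p F -> inLp p G -> inLp p (fun x => F x + G x).
Proof.
move=> [mF iF] [mG iG]; split; first exact: vmeasD.
apply: (@L1_le _ _ _ _ _ (fun x => 2 `^ p * (enorm (F x) `^ p + enorm (G x) `^ p))).
- exact/measurable_enorm_powR/vmeasD.
- by apply: L1Z; exact: L1D.
- by move=> x; rewrite ger0_norm ?powR_ge0// enormD_powR_le.
Qed.

Lemma inLpZ a F : inLp p F -> inLp p (fun x => a *: F x).
Proof.
move=> [mF iF]; split; first exact: vmeasZ.
under eq_fun do rewrite enorm_powRZ.
exact: L1Z.
Qed.

Lemma inLpB F G : inLp p F -> inLp p G -> inLp p (fun x => F x - G x).
Proof.
move=> hF hG; rewrite (_ : (fun x => _) = (fun x => F x + (-1) *: G x)).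
  by apply: inLpD => //; exact: inLpZ.
by apply/funext => x; rewrite scaleN1r.
Qed.

Lemma energyD_le F G : inLp p F -> inLp p G ->
  energy p (fun x => F x + G x) <= 2 `^ p * (energy p F + energy p G).
Proof.
move=> hF hG; rewrite /energy -(rintD hF.2 hG.2).
rewrite -rintZ; last by apply: L1D; [exact: hF.2|exact: hG.2].
apply: rint_le; first exact: (inLpD hF hG).2.
  by apply/L1Z/L1D; [exact: hF.2|exact: hG.2].
by move=> x; exact: enormD_powR_le.
Qed.

Lemma energyZ a F : inLp p F -> energy p (fun x => a *: F x) = `|a| `^ p * energy p F.
Proof.
move=> hF; rewrite /energy -rintZ; last exact: hF.2.
by apply: eq_Rintegral => x _; rewrite enorm_powRZ.
Qed.

Lemma energyBC F G : energy p (fun x => F x - G x) = energy p (fun x => G x - F x).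
Proof. by apply: eq_Rintegral => x _; rewrite enormBC. Qed.

Lemma norm_pairing_le (a b : 'rV[R]_n) :
  `|enorm a `^ (p - 2) * dotp a b| <= enorm a `^ (p - 1) * enorm b.
Proof.
have -> : enorm a `^ (p - 1) = enorm a `^ (p - 2) * enorm a.
  have -> : p - 2 = p - 1 - 1 by ring.
  by rewrite powRB1 ?enorm_ge0// subr_eq0 gt_eqF.
rewrite normrM (ger0_norm (powR_ge0 _ _)) -mulrA ler_wpM2l ?powR_ge0//.
exact: dotp_norm_le.
Qed.

Lemma norm_pairing_le_powR (a b : 'rV[R]_n) :
  `|enorm a `^ (p - 2) * dotp a b| <= enorm a `^ p + enorm b `^ p.
Proof.
apply: le_trans (norm_pairing_le a b) _.
have := young_le p1 (enorm_ge0 a) (enorm_ge0 b).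
have := powR_ge0 (enorm a) p; have := powR_ge0 (enorm b) p.
set z := _ * enorm b; move: (_ `^ p) (_ `^ p) z => x y z y0 x0 h.
rewrite -(ler_pM2l p0); apply: le_trans h _.
rewrite mulrDr; apply: lerD; first by rewrite ler_wpM2r// lerBlDr lerDl.
by rewrite ler_peMl// ltW.
Qed.

Lemma measurable_pairing F H : vmeas F -> vmeas H ->
  measurable_fun setT (fun x => enorm (F x) `^ (p - 2) * dotp (F x) (H x)).
Proof.
move=> mF mH; apply: measurable_funM; first exact: measurable_enorm_powR.
exact: measurable_dotp.
Qed.

Lemma L1_pairing F H : inLp p F -> inLp p H ->
  L1 mu (fun x => enorm (F x) `^ (p - 2) * dotp (F x) (H x)).
Proof.
move=> hF hH; apply: L1_le (L1D hF.2 hH.2) _; last first.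
  by move=> x; exact: norm_pairing_le_powR.
by apply: measurable_pairing; [exact: hF.1|exact: hH.1].
Qed.

Lemma pairingZr a F H : inLp p F -> inLp p H ->
  pairing p F (fun x => a *: H x) = a * pairing p F H.
Proof.
move=> hF hH; rewrite /pairing -rintZ; last exact: L1_pairing.
by apply: eq_Rintegral => x _; rewrite dotpZr mulrCA.
Qed.

(** Convexity of the energy, with no differentiation. Applied later at the perturbed point with step
    [-e], it becomes an upper bound for an increment of energy. *)
Lemma energy_gradient e F H : inLp p F -> inLp p H ->
  energy p F + p * e * pairing p F H <= energy p (fun x => F x + e *: H x).
Proof.
move=> hF hH; rewrite -mulrA -pairingZr// /energy /pairing.
have i := L1_pairing hF (inLpZ e hH).
rewrite -rintZ// -rintD; [|exact: hF.2|exact: L1Z].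
apply: rint_le; first by apply: L1D; [exact: hF.2|exact: L1Z].
  exact: (inLpD hF (inLpZ e hH)).2.
move=> x; have [+ _] := powR_enorm_grad_le (F x) (F x + e *: H x) p1.
by rewrite addrAC subrr add0r.
Qed.

Lemma pairing_pointwise_cvg (e : nat -> R) (a b : 'rV[R]_n) : e k @[k --> \oo] --> (0 : R) ->
  enorm (a + e k *: b) `^ (p - 2) * dotp (a + e k *: b) b @[k --> \oo] -->
  enorm a `^ (p - 2) * dotp a b.
Proof.
move=> e0.
have c : a + e k *: b @[k --> \oo] --> a.
  rewrite -[X in _ --> X]addr0 -(scale0r b); apply: cvgD; first exact: cvg_cst.
  by apply: cvgZr_tmp.
have ce : enorm (a + e k *: b) @[k --> \oo] --> enorm a.
  by apply: (@cvg_comp _ _ _ _ (@enorm R n) _ _ _ c); exact: enorm_continuous.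
have [a0|a0] := eqVneq a 0; last first.
  apply: cvgM.
    apply: (@cvg_comp _ _ _ _ (fun t : R => t `^ (p - 2)) _ _ _ ce).
    have ct : {for enorm a, continuous (fun t : R => t `^ (p - 2))}.
      apply/differentiable_continuous/derivable1_diffP.
      by apply: derivable_powR; rewrite in_itv/= andbT enorm_gt0.
    exact: ct.
  under eq_fun do rewrite dotpDl dotpZl.
  suff : dotp a b + e k * dotp b b @[k --> \oo] --> dotp a b + 0 by rewrite addr0.
  apply: cvgD; first exact: cvg_cst.
  by rewrite -(mul0r (dotp b b)); apply: cvgM => //; exact: cvg_cst.
(* For p < 2 the factor |.|^(p-2) is singular at 0; the product is nevertheless at most |.|^(p-1)
   |b|, which tends to 0. *)
rewrite a0 dotp0l mulr0; apply/norm_cvg0P.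
apply: (@squeeze_cvgr _ _ _ _ (fun=> 0) (fun k => enorm (a + e k *: b) `^ (p - 1) * enorm b)).
- by near=> k; rewrite normr_ge0/= -a0 norm_pairing_le.
- exact: cvg_cst.
- rewrite -(mul0r (enorm b)); apply: cvgM; last exact: cvg_cst.
  have p10 : 0 < p - 1 by rewrite subr_gt0.
  have -> : 0 = enorm a `^ (p - 1) by rewrite a0 enorm0 powR0// gt_eqF.
  by apply: (@cvg_comp _ _ _ _ (fun x : 'rV[R]_n => enorm x `^ (p - 1)) _ _ _ c);
    exact: enorm_powR_continuous.
Unshelve. all: by end_near.
Qed.

Lemma pairing_cvg (e : nat -> R) F H : inLp p F -> inLp p H ->
  e k @[k --> \oo] --> (0 : R) -> (forall k, `|e k| <= 1) ->
  pairing p (fun x => F x + e k *: H x) H @[k --> \oo] --> pairing p F H.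
Proof.
move=> hF hH e0 e1.
pose D x := 2 `^ p * (enorm (F x) `^ p + enorm (H x) `^ p) + enorm (H x) `^ p.
apply: (@rint_dct _ _ _ mu _ _ D _ _ _ _ _).2.
- move=> k; apply: measurable_pairing; last exact: hH.1.
  by apply: vmeasD; [exact: hF.1|apply: vmeasZ; exact: hH.1].
- by apply: measurable_pairing; [exact: hF.1|exact: hH.1].
- apply: L1D; last exact: hH.2.
  by apply/L1Z/L1D; [exact: hF.2|exact: hH.2].
- apply: aeW => x k; apply: le_trans (norm_pairing_le_powR _ _) _.
  rewrite lerD2r; apply: le_trans (enormD_powR_le p1 _ _) _.
  rewrite ler_wpM2l ?powR_ge0// lerD2l enorm_powRZ ler_piMl ?powR_ge0//.
  have -> : 1 = 1 `^ p :> R by rewrite powR1.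
  by rewrite ge0_ler_powR// ?nnegrE// ltW.
- by apply: aeW => x; exact: pairing_pointwise_cvg.
Qed.

Lemma energy_fatou (F : nat -> T -> 'rV[R]_n) G (M : nat -> R) l :
  (forall k, inLp p (F k)) -> (forall k, energy p (F k) <= M k) ->
  M k @[k --> \oo] --> l -> vmeas G ->
  {ae mu, forall x, F k x @[k --> \oo] --> G x} ->
  inLp p G /\ energy p G <= l.
Proof.
move=> hF FM Ml mG FG.
have [|||||||i le] := @rint_fatou _ _ _ mu (fun k x => enorm (F k x) `^ p)
  (fun x => enorm (G x) `^ p) M l.
- by move=> k; exact: (hF k).2.
- by move=> k x; exact: powR_ge0.
- exact: FM.
- exact: Ml.
- exact: measurable_enorm_powR.
- by move=> x; exact: powR_ge0.
- apply: filterS FG => x c.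
  by apply: (@cvg_comp _ _ _ _ (fun x : 'rV[R]_n => enorm x `^ p) _ _ _ c);
    exact: enorm_powR_continuous.
by split.
Qed.

(** Fatou in the second index [l] of the differences F k - F l. *)
Lemma energy_cauchy_limit (F : nat -> T -> 'rV[R]_n) G e N :
  (forall k, inLp p (F k)) -> vmeas G ->
  {ae mu, forall x, F k x @[k --> \oo] --> G x} ->
  (forall k l, (N <= k)%N -> (N <= l)%N -> energy p (fun x => F k x - F l x) <= e) ->
  forall k, (N <= k)%N ->
    inLp p (fun x => F k x - G x) /\ energy p (fun x => F k x - G x) <= e.
Proof.
move=> hF mG FG Fe k Nk.
apply: (@energy_fatou (fun l x => F k x - F (l + N)%N x) _ (fun=> e)).
- by move=> l; exact: inLpB.
- by move=> l; apply: Fe => //; exact: leq_addl.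
- exact: cvg_cst.
- by apply: vmeasB => //; exact: (hF k).1.
- apply: filterS FG => x c; apply: cvgB; first exact: cvg_cst.
  by rewrite (cvg_shiftn N (fun l => F l x)).
Qed.

(** [midgap_control] integrated: two fields with nearly equal energies, whose midpoint has no much
    smaller energy, are close in L^p. *)
Lemma energy_midgap c : 0 < c -> exists2 C, 0 <= C & forall F G, inLp p F -> inLp p G ->
  energy p (fun x => F x - G x) <= c * (energy p F + energy p G) +
   C * (2^-1 * (energy p F + energy p G) - energy p (fun x => 2^-1 *: (F x + G x))).
Proof.
move=> c0; have [C C0 h] := @midgap_control R n p p1 c c0; exists C => // F G hF hG.
have iD := L1D hF.2 hG.2.
have iM := (inLpZ 2^-1 (inLpD hF hG)).2.
rewrite /energy -rintD; [|exact: hF.2|exact: hG.2].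
rewrite -(rintZ 2^-1 iD) -(rintB (L1Z 2^-1 iD) iM).
have iG := L1B (L1Z 2^-1 iD) iM.
rewrite -!rintZ// -rintD; [|exact: L1Z|exact: L1Z].
apply: rint_le => [||x]; first exact: (inLpB hF hG).2.
  by apply: L1D; exact: L1Z.
exact: h.
Qed.

Lemma energy_midpoint_le F G : inLp p F -> inLp p G ->
  energy p (fun x => 2^-1 *: (F x + G x)) <= 2^-1 * (energy p F + energy p G).
Proof.
move=> hF hG; have iD := L1D hF.2 hG.2.
rewrite /energy -rintD; [|exact: hF.2|exact: hG.2].
rewrite -rintZ//; apply: rint_le; [exact: (inLpZ 2^-1 (inLpD hF hG)).2|exact: L1Z|].
by move=> x; have [+ _] := midgap_ge0 (F x) (G x) p1; rewrite /midgap subr_ge0.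
Qed.

(* [2^(kp) |F_(k+1) - F_k|^p] has a summable integral, so it tends to 0 almost
   everywhere, and there [F_k] is eventually a fast Cauchy sequence. *)
Lemma Lp_fast_cauchy (F : nat -> T -> 'rV[R]_n) : (forall k, inLp p (F k)) ->
  (forall k, energy p (fun x => F k.+1 x - F k x) <= 2^-1 ^+ k * (2^-1 ^+ k) `^ p) ->
  exists2 G, vmeas G & {ae mu, forall x, F k x @[k --> \oo] --> G x}.
Proof.
move=> hF h.
(* The upper limits exist at every point and are measurable; they are the limits wherever these
   exist. *)
pose G x : 'rV[R]_n := \row_i fine (limn_esup (fun k => (F k x ord0 i)%:E)).
exists G => [i|].
  rewrite (_ : (fun x => _) = fine \o (fun x => limn_esup (fun k => (F k x ord0 i)%:E))).
    apply: measurableT_comp => //.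
    by apply: measurable_fun_limn_esup => k; apply/measurable_EFinP; exact: (hF k).1.
  by apply/funext => x; rewrite mxE.
pose g k x := (2 ^+ k) `^ p * enorm (F k.+1 x - F k x) `^ p.
have hg k : L1 mu (fun x => enorm (F k.+1 x - F k x) `^ p) by exact: (inLpB (hF _) (hF _)).2.
have : {ae mu, forall x, g k x @[k --> \oo] --> (0 : R)}.
  apply: ae_cvg0_of_summable => [k|k x|k].
  - exact/L1_measurable/L1Z/hg.
  - by rewrite mulr_ge0 ?powR_ge0.
  - rewrite L1_integralE; last exact/L1Z/hg.
    rewrite lee_fin rintZ// -(@ler_pM2l _ ((2^-1 ^+ k) `^ p)); last first.
      by rewrite powR_gt0// exprn_gt0// invr_gt0.
    rewrite mulrA -powRM ?exprn_ge0 ?invr_ge0// -exprMn mulVf// expr1n powR1 mul1r.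
    by rewrite mulrC; exact: h.
apply: filterS => x gx.
have [N hN] : exists N, forall k, (N <= k)%N -> enorm (F k.+1 x - F k x) <= 2^-1 ^+ k.
  move/cvgrPdist_lt : gx => /(_ 1 ltr01)[N _ hN]; exists N => k Nk.
  have := hN k Nk; rewrite sub0r normrN ger0_norm; last by rewrite mulr_ge0 ?powR_ge0.
  rewrite /g -powRM ?enorm_ge0 ?exprn_ge0// => h1.
  rewrite exprVn -[leRHS]div1r ler_pdivlMr ?exprn_gt0// mulrC leNgt.
  apply/negP => h2; move: h1; rewrite ltNge => /negP; apply.
  apply: (@le_trans _ _ (1 `^ p)); first by rewrite powR1.
  by rewrite ge0_ler_powR ?nnegrE ?(ltW p0) ?(ltW h2)// mulr_ge0 ?enorm_ge0 ?exprn_ge0.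
have c i : F k x ord0 i @[k --> \oo] --> G x ord0 i.
  have /cvg_ex[l hl] : cvgn (fun k => F k x ord0 i).
    apply: (@cvgn_of_fast _ _ N) => k Nk; apply: le_trans (hN k Nk).
    by apply: le_trans (coord_le_enorm _ i); rewrite !mxE.
  rewrite mxE; have cE : (F k x ord0 i)%:E @[k --> \oo] --> l%:E.
    by apply/fine_cvgP; split; [near=> k|exact: hl].
  by rewrite (cvg_limn_einf_sup cE).2.
exact: cvg_rV.
Unshelve. all: by end_near.
Qed.

End vector_Lp.

(** * Borel sets and Lebesgue measure of R^n *)

Section borel_rV.
Context {R : realType} (n : nat).
Local Notation mu := (lebesgue_rV R n).
Implicit Types (x z : 'rV[R]_n).

Definition box (I : 'I_n -> set R) : set 'rV[R]_n := [set x | forall i, I i (x ord0 i)].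

Lemma measurable_box (I : 'I_n -> set R) :
  (forall i, measurable (I i)) -> measurable (box I).
Proof.
move=> mI; rewrite (_ : box I = \bigcap_(i in [set: 'I_n]) ((fun x : 'rV[R]_n => x ord0 i) @^-1` I i)).
  apply: fin_bigcap_measurable => // i _.
  by rewrite -[X in measurable X]setTI; exact: measurable_coord.
by apply/seteqP; split => x /= h i; [move=> _|]; exact: h.
Qed.

(** The integer label of the half-open dyadic cube of side 2^-j that contains x. *)
Definition cell (j : nat) x : 'rV[int]_n := \row_i Num.floor (x ord0 i * 2 ^+ j).

Lemma cellP j x (c : 'rV[int]_n) : cell j x = c <->
  forall i, (c ord0 i)%:~R / 2 ^+ j <= x ord0 i < ((c ord0 i) + 1)%:~R / 2 ^+ j.
Proof.
have j0 : (0 : R) < 2 ^+ j by rewrite exprn_gt0.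
split=> [<- i|h].
  by rewrite mxE ler_pdivrMr// ltr_pdivlMr// floor_itv.
apply/rowP => i; rewrite mxE; apply: floor_def.
by have := h i; rewrite ler_pdivrMr// ltr_pdivlMr.
Qed.

Lemma cell_box j (c : 'rV[int]_n) : [set x | cell j x = c] =
  box (fun i => `[(c ord0 i)%:~R / 2 ^+ j, ((c ord0 i) + 1)%:~R / 2 ^+ j[%classic).
Proof.
apply/seteqP; split => x /=.
  by move/cellP => h i; rewrite /= in_itv/=; exact: h.
by move=> h; apply/cellP => i; have := h i; rewrite /= in_itv.
Qed.

Lemma measurable_cell j c : measurable [set x | cell j x = c].
Proof. by rewrite cell_box; apply: measurable_box => i; exact: measurable_itv. Qed.

Lemma cell_dist j x y i : cell j x = cell j y -> `|x ord0 i - y ord0 i| <= 2^-1 ^+ j.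
Proof.
have j0 : (0 : R) < 2 ^+ j by rewrite exprn_gt0.
move=> /cellP/(_ i) h1; have /cellP/(_ i) := erefl (cell j y).
move: h1; set a := _ / _; set b := _ / _.
have -> : b = a + 2^-1 ^+ j by rewrite /a /b intrD mulrDl div1r exprVn.
by move=> /andP[h1 h2] /andP[h3 h4]; rewrite ler_norml; apply/andP; split; lra.
Qed.

(** The sigma-algebra is generated by the coordinates, so open sets have to be reached by countable
    operations: an open set is the union of the dyadic cells that it contains. *)
Lemma open_measurable_rV (U : set 'rV[R]_n) : open U -> measurable U.
Proof.
move=> oU.
pose F (jc : nat * 'rV[int]_n) : set 'rV[R]_n :=
  if `[< [set x | cell jc.1 x = jc.2] `<=` U >] then [set x | cell jc.1 x = jc.2] else set0.
rewrite (_ : U = \bigcup_jc F jc).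
  apply: countable_bigcupT_measurable; first exact: countableP.
  by move=> jc; rewrite /F; case: ifP => _; [exact: measurable_cell|exact: measurable0].
apply/seteqP; split => [x Ux|x [jc _]]; last first.
  by rewrite /F; case: asboolP => // h; exact: h.
have /nbhs_ballP[e /= e0 xe] : nbhs x U by exact: open_nbhs_nbhs.
have [j je] : exists j, 2^-1 ^+ j < e.
  have := @cvg_expr R 2^-1; rewrite ger0_norm// invf_lt1// ltr1n => /(_ isT).
  move=> /cvgrPdist_lt /(_ e e0)[j _ /(_ j (leqnn j))] /=.
  by rewrite sub0r normrN ger0_norm ?exprn_ge0// => ?; exists j.
exists (j, cell j x) => //; rewrite /F; case: asboolP => // -[] y /= yx; apply: xe.
split => // a b; rewrite (ord1 a); apply: le_lt_trans je.
exact: cell_dist.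
Qed.

Lemma closed_measurable_rV (U : set 'rV[R]_n) : closed U -> measurable U.
Proof. by move=> cU; rewrite -[U]setCK; apply: measurableC; apply: open_measurable_rV; exact: closed_openC. Qed.

Lemma continuous_measurable_rV (f : 'rV[R]_n -> R) : continuous f -> measurable_fun setT f.
Proof.
move=> cf; apply: (measurability _ (RGenOInfty.measurableE R)).
move=> _ [_ [a ->] <-]; rewrite setTI; apply: open_measurable_rV.
by move/continuousP : cf; apply; exact: rray_open.
Qed.

Lemma measurable_fun_addr z : measurable_fun setT (fun x => x + z).
Proof.
apply: measurable_fun_rV => i.
rewrite (_ : (fun x => _) = (fun x => x ord0 i + z ord0 i)); last first.
  by apply/funext => x; rewrite mxE.
by apply: measurable_funD => //; exact: measurable_coord.
Qed.

Lemma measurable_fun_add2 :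
  measurable_fun setT (fun xz : 'rV[R]_n * 'rV[R]_n => xz.1 + xz.2).
Proof.
apply: measurable_fun_rV => i.
under eq_fun do rewrite mxE.
apply: measurable_funD.
  by apply: (measurableT_comp (measurable_coord i)); exact: measurable_fst.
by apply: (measurableT_comp (measurable_coord i)); exact: measurable_snd.
Qed.

End borel_rV.

Section lebesgue_rV_properties.
Context {R : realType}.
Local Open Scope ereal_scope.

Lemma lebesgue_rVS n (A : set 'rV[R]_n.+1) :
  lebesgue_rV R n.+1 A = (@lebesgue_measure R \x lebesgue_rV R n) (@rV_cons R n @^-1` A).
Proof. by []. Qed.

Lemma lebesgue_box n (I : 'I_n -> set R) : (forall i, measurable (I i)) ->
  lebesgue_rV R n (box I) = \prod_(i < n) lebesgue_measure (I i).
Proof.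
elim: n I => [|n IH] I mI.
  by rewrite big_ord0 /= diracE mem_set// => -[].
rewrite lebesgue_rVS (_ : _ @^-1` _ = I ord0 `*` box (fun i => I (lift ord0 i))).
  rewrite product_measure1E; [|exact: mI|by apply: measurable_box => i; exact: mI].
  by rewrite big_ord_recl IH// => i; exact: mI.
apply/seteqP; split => [[a y]|[a y] [/= h1 h2]] /=.
  move=> h; split => /=.
    have := h ord0; rewrite (_ : ord0 = lshift n (ord0 : 'I_1)); last exact/val_inj.
    by rewrite /rV_cons (@row_mxEl _ 1 1 n) mxE.
  move=> i; have := h (rshift 1 i); rewrite /rV_cons (@row_mxEr _ 1 1 n).
  by rewrite (_ : rshift 1 i = lift ord0 i)//; exact/val_inj.
move=> i; case: (@split_ordP 1 n i) => k ->; rewrite /rV_cons.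
  rewrite (@row_mxEl _ 1 1 n) mxE (_ : lshift n k = ord0)//.
  by apply/val_inj; rewrite /= ord1.
rewrite (@row_mxEr _ 1 1 n) (_ : rshift 1 k = lift ord0 k); last exact/val_inj.
exact: h2.
Qed.

Let phi (c : R) (x : measurableTypeR R) : measurableTypeR R := (x + c)%R.

Let mphi c : measurable_fun setT (phi c).
Proof. by apply: measurable_funD. Qed.

Lemma lebesgue_measure_translate (c : R) (A : set R) : measurable A ->
  pushforward (@lebesgue_measure R) (phi c) A = lebesgue_measure A.
Proof.
move=> mA; apply/esym/lebesgue_measure_unique => //.
move=> _ [[a b]] _ <-.
change (lebesgue_measure `](a, b).1, (a, b).2] =
  lebesgue_measure (phi c @^-1` `](a, b).1, (a, b).2])).
rewrite (_ : phi c @^-1` _ = `](a - c)%R, (b - c)%R]%classic); last first.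
  by apply/seteqP; split => x /=; rewrite !in_itv/= ltrBlDr lerBrDr.
rewrite !lebesgue_measure_itv/= !lte_fin ltrD2r.
by case: ifP => // _; rewrite -!EFinB opprB addrA subrK.
Qed.

Lemma integral_translate1 (c : R) (f : R -> \bar R) :
  measurable_fun [set: R] f -> (forall x, 0 <= f x) ->
  \int[@lebesgue_measure R]_x f (x + c)%R = \int[@lebesgue_measure R]_x f x.
Proof.
move=> mf f0.
have := @ge0_integral_pushforward _ _ _ _ R (phi c) (mphi c)
  (@lebesgue_measure R) setT f measurableT mf (fun y _ => f0 y).
rewrite preimage_setT => <-.
by apply: eq_measure_integral => //= A mA _; rewrite lebesgue_measure_translate.
Qed.

Lemma integral_rV_cons n (f : 'rV[R]_n.+1 -> \bar R) :
  measurable_fun setT f -> (forall x, 0 <= f x) ->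
  \int[lebesgue_rV R n.+1]_x f x =
  \int[@lebesgue_measure R]_a \int[lebesgue_rV R n]_y f (rV_cons (a, y)).
Proof.
move=> mf f0.
have mc := @measurable_rV_cons R n.
rewrite -(@fubini_tonelli1 _ _ _ _ R (@lebesgue_measure R) (lebesgue_rV R n)
  (f \o @rV_cons R n)) /=; [|exact: measurableT_comp|by move=> x; exact: f0].
have := @ge0_integral_pushforward _ _ _ _ R (@rV_cons R n) mc
  (@lebesgue_measure R \x lebesgue_rV R n) setT f measurableT mf (fun y _ => f0 y).
by rewrite preimage_setT => <-; apply: eq_measure_integral.
Qed.

(** Induction on the dimension: Tonelli separates the first coordinate, and the one-dimensional
    measure is invariant by its uniqueness on half-open intervals. *)
Lemma integral_translate n (z : 'rV[R]_n) (f : 'rV[R]_n -> \bar R) :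
  measurable_fun setT f -> (forall x, 0 <= f x) ->
  \int[lebesgue_rV R n]_x f (x + z)%R = \int[lebesgue_rV R n]_x f x.
Proof.
elim: n z f => [|n IH] z f mf f0.
  by apply: eq_integral => x _; rewrite (thinmx0 z) addr0.
rewrite !integral_rV_cons//; last first.
  exact: (measurableT_comp mf (measurable_fun_addr z)).
have e a y : (rV_cons (a, y) + z = rV_cons (a + z ord0 ord0, y + rsubmx (z : 'rV_(1 + n))))%R.
  apply/rowP => i; rewrite [LHS]mxE; case: (@split_ordP 1 n i) => k ->; rewrite /rV_cons.
    rewrite !(@row_mxEl _ 1 1 n) !mxE/=; congr (_ + z _ _)%R; apply/val_inj.
    by rewrite /= ord1.
  by rewrite !(@row_mxEr _ 1 1 n) !mxE/=.
pose g a := \int[lebesgue_rV R n]_y f (rV_cons (a, y)).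
have mg : measurable_fun [set: R] g.
  have := @measurable_fun_fubini_tonelli_F _ _ _ _ R (lebesgue_rV R n) (f \o @rV_cons R n).
  apply => //; first by apply: measurableT_comp => //; exact: measurable_rV_cons.
  by move=> x; exact: f0.
rewrite -[RHS](@integral_translate1 (z ord0 ord0) g) => //; last first.
  by move=> a; apply: integral_ge0 => y _; exact: f0.
apply: eq_integral => a _; under eq_integral do rewrite e.
apply: (IH _ (fun y => f (rV_cons (a + z ord0 ord0, y)%R))) => [|y]; last exact: f0.
apply: measurableT_comp => //; apply: measurableT_comp; first exact: measurable_rV_cons.
exact: measurable_pair1.
Qed.

End lebesgue_rV_properties.

(** * Smooth functions with compact support *)

Section is_derive_pointwise.
Context {R : realType} (V : normedModType R).
Implicit Types (f g : V -> R) (x v : V) (a b c : R).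

Lemma is_deriveD_fun f g x v a b : is_derive x v f a -> is_derive x v g b ->
  is_derive x v (fun t => f t + g t) (a + b).
Proof. by move=> h1 h2; exact: (is_deriveD h1 h2). Qed.

Lemma is_deriveB_fun f g x v a b : is_derive x v f a -> is_derive x v g b ->
  is_derive x v (fun t => f t - g t) (a - b).
Proof. by move=> h1 h2; exact: (is_deriveB h1 h2). Qed.

Lemma is_deriveM_fun f g x v a b : is_derive x v f a -> is_derive x v g b ->
  is_derive x v (fun t => f t * g t) (f x * b + g x * a).
Proof. by move=> h1 h2; exact: (is_deriveM h1 h2). Qed.

Lemma is_deriveZ_fun f x v a c : is_derive x v f a ->
  is_derive x v (fun t => c * f t) (c * a).
Proof. by move=> h1; exact: (@is_deriveZ _ _ _ f c x v a h1). Qed.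

Lemma is_deriveN_fun f x v a : is_derive x v f a -> is_derive x v (fun t => - f t) (- a).
Proof. by move=> h1; exact: (is_deriveN h1). Qed.

Lemma is_derive_cst_fun x v c : is_derive x v (fun=> c) 0.
Proof. exact: is_derive_cst. Qed.

End is_derive_pointwise.

Section Ck_algebra.
Context {R : realType} (n : nat).
Implicit Types (f g : 'rV[R]_n -> R) (h : R -> R).

Local Notation e_ i := (delta_mx ord0 i : 'rV[R]_n).

(** Both difference quotients are the same function of h. The mean value theorem and the chain rule
    in one variable thus apply to directional derivatives. *)
Lemma derive_line f (x v : 'rV[R]_n) t (df : R) :
  is_derive (t *: v + x) v f df <-> is_derive t (1 : R) (fun t => f (t *: v + x)) df.
Proof.
have E : (fun h : R => h^-1 *: ((f \o shift (t *: v + x)) (h *: v) - f (t *: v + x))) =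
  (fun h : R => h^-1 *: (((fun t => f (t *: v + x)) \o shift t) (h *: (1 : R)) - f (t *: v + x))).
  by apply/funext => h /=; rewrite /shift/= scaler1 scalerDl addrA.
split=> -[d1 d2]; split.
- by move: d1; rewrite /derivable E.
- by rewrite -d2 /derive E.
- by move: d1; rewrite /derivable -E.
- by rewrite -d2 /derive -E.
Qed.

Lemma is_derive_comp_dir h f (x v : 'rV[R]_n) (a b : R) :
  is_derive x v f a -> is_derive (f x) (1 : R) h b -> is_derive x v (h \o f) (b * a).
Proof.
move=> fa hb; have := @derive_line (h \o f) x v 0 (b * a).
rewrite scale0r add0r => ->.
apply: (@is_derive1_comp _ h (fun t => f (t *: v + x)) 0 b a); first by rewrite scale0r add0r.
by apply/derive_line; rewrite scale0r add0r.
Qed.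

Lemma Ck_continuous k f : Ck k f -> continuous f.
Proof. by case: k => [|k] []. Qed.

Lemma Ck_W k f : Ck k.+1 f -> Ck k f.
Proof.
elim: k f => [|k IH] f [cf h]; first by split.
by split => // i; have [d c] := h i; split => //; exact: IH.
Qed.

Lemma Ck_pderiv k f i : Ck k.+1 f -> Ck k (pderiv i f).
Proof. by move=> [_ /(_ i)[]]. Qed.

Lemma Ck_derivable k f i x : Ck k.+1 f -> derivable f x (e_ i).
Proof. by move=> [_ /(_ i)[+ _]]; exact. Qed.

Lemma Ck_is_derive k f i x : Ck k.+1 f -> is_derive x (e_ i) f (pderiv i f x).
Proof. by move=> /Ck_derivable h; exact: derivableP. Qed.

Lemma Ck_intro k f (df : 'I_n -> 'rV[R]_n -> R) : continuous f ->
  (forall i x, is_derive x (e_ i) f (df i x)) -> (forall i, Ck k (df i)) -> Ck k.+1 f.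
Proof.
move=> cf fd hd; split => // i; split; first by move=> x; case: (fd i x).
suff -> : pderiv i f = df i by exact: hd.
by apply/funext => x; rewrite /pderiv; case: (fd i x).
Qed.

Lemma pderivE i f (df : 'rV[R]_n -> R) :
  (forall x, is_derive x (e_ i) f (df x)) -> pderiv i f = df.
Proof. by move=> h; apply/funext => x; rewrite /pderiv; case: (h x). Qed.

Lemma Ck_cst k (a : R) : Ck k (cst a : 'rV[R]_n -> R).
Proof.
elim: k a => [|k IH] a; first by split => //; exact: cst_continuous.
by apply: (@Ck_intro _ _ (fun _ => cst 0)) => //; exact: cst_continuous.
Qed.

Lemma CkD k f g : Ck k f -> Ck k g -> Ck k (fun x => f x + g x).
Proof.
elim: k f g => [|k IH] f g hf hg;
  have cf := Ck_continuous hf; have cg := Ck_continuous hg;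
  have cfg : continuous (fun x => f x + g x) by move=> x; apply: continuousD; [exact: cf|exact: cg].
  by split.
apply: (@Ck_intro _ _ (fun i x => pderiv i f x + pderiv i g x)) => //.
- by move=> i x; apply: is_deriveD_fun; apply: Ck_is_derive; eassumption.
- by move=> i; apply: IH; exact: Ck_pderiv.
Qed.

Lemma CkM k f g : Ck k f -> Ck k g -> Ck k (fun x => f x * g x).
Proof.
elim: k f g => [|k IH] f g hf hg;
  have cf := Ck_continuous hf; have cg := Ck_continuous hg;
  have cfg : continuous (fun x => f x * g x) by move=> x; apply: continuousM; [exact: cf|exact: cg].
  by split.
apply: (@Ck_intro _ _ (fun i x => f x * pderiv i g x + g x * pderiv i f x)) => //.
- by move=> i x; apply: is_deriveM_fun; apply: Ck_is_derive; eassumption.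
- by move=> i; apply: CkD; apply: IH; [exact: Ck_W|exact: Ck_pderiv|exact: Ck_W|exact: Ck_pderiv].
Qed.

Lemma CkZ k (a : R) f : Ck k f -> Ck k (fun x => a * f x).
Proof. by move=> h; apply: CkM => //; exact: Ck_cst. Qed.

Lemma CkB k f g : Ck k f -> Ck k g -> Ck k (fun x => f x - g x).
Proof.
move=> hf hg; rewrite (_ : (fun x => _) = (fun x => f x + (-1) * g x)).
  by apply: CkD => //; exact: CkZ.
by apply/funext => x; rewrite mulN1r.
Qed.

Lemma Ck_sum k (I : Type) (s : seq I) (f : I -> 'rV[R]_n -> R) : (forall i, Ck k (f i)) ->
  Ck k (fun x => \sum_(i <- s) f i x).
Proof.
move=> h; elim: s => [|i s IH].
  by under eq_fun do rewrite big_nil; exact: Ck_cst.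
by under eq_fun do rewrite big_cons; exact: CkD.
Qed.

Lemma Ck_prod k (I : Type) (s : seq I) (f : I -> 'rV[R]_n -> R) : (forall i, Ck k (f i)) ->
  Ck k (fun x => \prod_(i <- s) f i x).
Proof.
move=> h; elim: s => [|i s IH].
  by under eq_fun do rewrite big_nil; exact: Ck_cst.
by under eq_fun do rewrite big_cons; exact: CkM.
Qed.

Lemma Ck_coord k i : Ck k (fun x : 'rV[R]_n => x ord0 i).
Proof.
have c : continuous (fun x : 'rV[R]_n => x ord0 i) by exact: coord_continuous.
case: k => [|k]; first by split.
apply: (@Ck_intro _ _ (fun j => cst (i == j)%:R)) => // [j x|j]; last exact: Ck_cst.
have := @derive_line (fun x => x ord0 i) x (e_ j) 0 ((i == j)%:R).
rewrite scale0r add0r => ->.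
rewrite (_ : (fun t => _) = (fun t => (i == j)%:R *: t + x ord0 i)); last first.
  by apply/funext => t; rewrite !mxE eqxx /= mulrC eq_sym.
apply: is_derive_eq; rewrite addr0; exact: mulr1.
Qed.

(** All the derivatives are exhibited at once as a sequence, so that smoothness reduces to one
    derivative formula valid at every order. *)
Definition smooth1 h := exists2 F : nat -> R -> R,
  F 0%N = h & forall k x, is_derive x (1 : R) (F k) (F k.+1 x).

Lemma smooth1_derive h : smooth1 h ->
  exists2 h', smooth1 h' & forall x, is_derive x (1 : R) h (h' x).
Proof.
move=> [F <- hF]; exists (F 1%N) => //; exists (fun k => F k.+1) => // k x.
Qed.

Lemma smooth1_continuous h : smooth1 h -> continuous h.
Proof.
move=> /smooth1_derive[h' _ hh] x.
by apply/differentiable_continuous/derivable1_diffP; case: (hh x).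
Qed.

Lemma Ck_comp k h f : smooth1 h -> Ck k f -> Ck k (h \o f).
Proof.
elim: k h f => [|k IH] h f hh hf.
  split => // x; apply: continuous_comp; first exact: (Ck_continuous hf).
  exact: smooth1_continuous.
have [h' sh' dh] := smooth1_derive hh.
apply: (@Ck_intro _ _ (fun i x => h' (f x) * pderiv i f x)).
- move=> x; apply: continuous_comp; first exact: (Ck_continuous hf).
  exact: smooth1_continuous.
- by move=> i x; exact: (is_derive_comp_dir (Ck_is_derive i x hf) (dh (f x))).
- move=> i; apply: CkM; last exact: Ck_pderiv.
  by apply: IH => //; exact: Ck_W.
Qed.

End Ck_algebra.

(** * Smooth functions of one variable: cut-offs and approximations of steps and positive parts *)

Section smooth_bump.
Context {R : realType}.

(** The family of the P(1/x) exp(-1/x) for x > 0 is closed under differentiation, with P replaced by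
    X^2 (P - P'). The smoothness of exp(-1/x) is the case P = 1. *)
Definition psiP (P : {poly R}) (x : R) : R :=
  if 0 < x then P.[x^-1] * expR (- x^-1) else 0.

Lemma horner_le_expr (P : {poly R}) : exists2 C, 0 <= C &
  forall y, 1 <= y -> `|P.[y]| <= C * y ^+ size P.
Proof.
exists (\sum_(i < size P) `|P`_i|); first exact: sumr_ge0.
move=> y y1; rewrite horner_coef mulr_suml (le_trans (ler_norm_sum _ _ _))//.
apply: ler_sum => i _; rewrite normrM ler_wpM2l// ger0_norm ?exprn_ge0//; last lra.
by rewrite ler_weXn2l// ltnW.
Qed.

(* [e^y >= y^(m+2) / (m+2)!] with [m = size P] and [y = 1/x]. *)
Lemma psiP_le_sqr (P : {poly R}) : exists2 C, 0 <= C &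
  forall x, x <= 1 -> `|psiP P x| <= C * x ^+ 2.
Proof.
have [C C0 hC] := horner_le_expr P; set m := size P in hC.
exists (C * (m.+2)`!%:R); first by rewrite mulr_ge0.
move=> x x1; rewrite /psiP; case: ifPn => x0; last first.
  by rewrite normr0; apply: mulr_ge0; [exact: mulr_ge0|exact: sqr_ge0].
set y := x^-1; have y1 : 1 <= y by rewrite invf_ge1.
have y0 : 0 < y by exact: lt_le_trans y1.
rewrite normrM (ger0_norm (expR_ge0 _)) expRN.
rewrite ler_pdivrMr ?expR_gt0//; apply: le_trans (hC y y1) _.
rewrite -!mulrA ler_wpM2l//.
have -> : y ^+ m = x * (x * y ^+ m.+2) by rewrite !exprS /y; field; rewrite gt_eqF.
have f0 : (0 : R) < (m.+2)`!%:R by rewrite ltr0n fact_gt0.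
rewrite [leRHS]mulrCA ler_pM2l// [leRHS]mulrCA ler_pM2l// -ler_pdivrMl// mulrC.
by apply: le_trans (expR_ge1Dxn m.+1 (ltW y0)); rewrite lerDr.
Qed.

Lemma psiP_derive (P : {poly R}) (x : R) :
  is_derive x (1 : R) (psiP P) (psiP ('X^2 * (P - P^`())) x).
Proof.
have [x0|x0|->] := ltgtP x 0.
- rewrite {2}/psiP ltNge (ltW x0)/=.
  apply: (@near_eq_is_derive _ _ _ (cst 0)).
    apply/nbhs_ballP; exists (- x) => /=; first by rewrite oppr_gt0.
    move=> z; rewrite /ball/= ltr_norml => /andP[h _].
    by rewrite /psiP ltNge; have -> : z <= 0 by lra.
- rewrite {2}/psiP x0.
  pose q (z : R) : R := P.[z^-1] * expR (- z^-1).
  apply: (@near_eq_is_derive _ _ _ q).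
    apply/nbhs_ballP; exists x => //= z; rewrite /ball/= ltr_norml => /andP[_ h].
    by rewrite /psiP; have -> : 0 < z by lra.
  have xn0 : x != 0 by rewrite gt_eqF.
  have dinv : is_derive x (1 : R) (fun z : R => z^-1) (- x ^- 2).
    have := @is_deriveV _ (fun z => z) x 1 1 xn0 (is_derive_id _ _).
    by rewrite scaler1.
  have dP : is_derive x (1 : R) (fun z => P.[z^-1]) (P^`().[x^-1] * (- x ^- 2)).
    apply: (@is_derive1_comp _ (fun y => P.[y]) (fun z => z^-1)) => //; exact: is_derive_poly.
  have dE : is_derive x (1 : R) (fun z => expR (- z^-1)) (expR (- x^-1) * (x ^- 2)).
    apply: (@is_derive1_comp _ expR (fun z => - z^-1)).
    by rewrite -[x ^- 2]opprK; apply: is_deriveN.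
  have := is_deriveM_fun dP dE.
  move=> h; apply: (is_derive_eq h).
  rewrite !hornerE /GRing.scale/= exprVn -[x ^- 2]exprVn.
  move: (P.[x^-1]) (P^`().[x^-1]) (expR _) (x^-1 ^+ 2) => a b c d.
  by ring.
(* At the origin the quadratic bound makes the difference quotient O(|h|), on both sides. *)
- rewrite {2}/psiP ltxx.
  have [C C0 hC] := psiP_le_sqr P.
  have L : (fun h : R => h^-1 *: ((psiP P \o shift 0) (h *: (1 : R)) - psiP P 0)) @ 0^' --> (0 : R).
    apply/cvgr0Pnorm_lt => e e0.
    have nz : \forall h \near (0 : R)^', h != 0 by rewrite /dnbhs near_withinE; exact: nearW.
    near=> h; rewrite /= scaler1 addr0 {2}/psiP ltxx subr0 normrZ normfV.
    have h0 : h != 0 by near: h; exact: nz.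
    have nh : 0 < `|h| by rewrite normr_gt0.
    rewrite mulrC ltr_pdivrMr//; apply: le_lt_trans (hC _ _) _.
      rewrite (le_trans (ler_norm _))//; near: h; exact: dnbhs0_le.
    rewrite -[h ^+ 2]ger0_norm ?sqr_ge0// normrX expr2 mulrA ltr_pM2r//.
    rewrite (@le_lt_trans _ _ ((C + 1) * `|h|)) ?ler_wpM2r ?lerDl//.
    rewrite mulrC -ltr_pdivlMr; last by rewrite ltr_wpDl.
    by near: h; apply: dnbhs0_lt; rewrite divr_gt0// ltr_wpDl.
  by split; [apply/cvg_ex; exists 0|exact: cvg_lim].
Unshelve. all: by end_near.
Qed.

Lemma psiP_smooth (P : {poly R}) : smooth1 (psiP P).
Proof.
exists (fun k => psiP (iter k (fun Q => 'X^2 * (Q - Q^`())) P)) => // k x.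
exact: psiP_derive.
Qed.

Definition psi : R -> R := psiP 1.

Lemma psi_smooth : smooth1 psi.
Proof. exact: psiP_smooth. Qed.

Lemma psiE x : psi x = if 0 < x then expR (- x^-1) else 0.
Proof. by rewrite /psi /psiP hornerE mul1r. Qed.

Lemma psi_ge0 x : 0 <= psi x.
Proof. by rewrite psiE; case: ifP => // _; exact: expR_ge0. Qed.

Lemma psi_gt0 x : (0 < psi x) = (0 < x).
Proof. by rewrite psiE; case: ifPn; rewrite ?expR_gt0 ?ltxx. Qed.

Lemma psi_le x y : x <= y -> psi x <= psi y.
Proof.
move=> xy; rewrite !psiE; case: ifPn => x0; last by case: ifP => // _; exact: expR_ge0.
have y0 : 0 < y by exact: lt_le_trans xy.
by rewrite y0 ler_expR lerN2 lef_pV2.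
Qed.

(** On t >= 0 it tends to the indicator of t > 0 as k grows. Composed with a smooth function that is
    positive exactly on an open set, it yields smooth approximations of the indicator of that
    set. *)
Definition satur (k : nat) (t : R) : R := 1 - expR (- (k%:R * t)).

Lemma satur_smooth k : smooth1 (satur k).
Proof.
exists (fun j t => if j is 0%N then satur k t else - (- k%:R) ^+ j * expR (- (k%:R * t))) => //.
move=> j x.
have d : is_derive x (1 : R) (fun t => expR (- (k%:R * t))) (expR (- (k%:R * x)) * (- k%:R)).
  apply: (@is_derive1_comp _ expR (fun t => - (k%:R * t))).
  apply: (is_derive_eq (is_deriveN_fun (is_deriveZ_fun k%:R (is_derive_id x 1)))).
  by rewrite mulr1.
case: j => [|j].
  apply: (is_derive_eq (is_deriveB_fun (is_derive_cst_fun x 1 1) d)).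
  by rewrite sub0r expr1 -mulNr mulrC mulrN mulNr.
apply: (is_derive_eq (is_deriveZ_fun (- (- k%:R) ^+ j.+1) d)).
by rewrite [in RHS]exprSr; move: (_ ^+ j.+1) (expR _) => P E; ring.
Qed.

(** The logistic function; its derivative is the polynomial s - s^2 in s, which keeps all higher
    derivatives polynomial in s. *)
Definition sigm (t : R) : R := (1 + expR (- t))^-1.

Lemma sigm_bound t : 0 < sigm t < 1.
Proof.
have e := expR_gt0 (- t); rewrite /sigm invr_gt0 addr_gt0//=.
by rewrite invf_lt1 ?ltrDl ?addr_gt0.
Qed.

Lemma sigm_derive t : is_derive t (1 : R) sigm (sigm t - sigm t ^+ 2).
Proof.
have e := expR_gt0 (- t).
have d0 : 1 + expR (- t) != 0 by rewrite gt_eqF// addr_gt0.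
have dE : is_derive t (1 : R) (fun t => expR (- t)) (expR (- t) * (-1)).
  by apply: (@is_derive1_comp _ expR (fun t => - t)).
have dD : is_derive t (1 : R) (fun t => 1 + expR (- t)) (- expR (- t)).
  apply: (is_derive_eq (is_deriveD_fun (is_derive_cst_fun t 1 1) dE)).
  by rewrite add0r mulrN1.
have := @is_deriveV _ (fun t => 1 + expR (- t)) t _ 1 d0 dD.
move=> h; apply: (is_derive_eq h); rewrite /sigm /GRing.scale/=.
by move: (expR _) d0 => a a0; field.
Qed.

(** A smooth version of (t - l)^+ at scale d with derivative [sigm ((t - l) / d)]. The subtracted
    constant makes it vanish at 0, so that composition with it preserves compact supports. *)
Definition softplus (l d t : R) : R := d * (ln (1 + expR ((t - l) / d)) - ln (1 + expR (- l / d))).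

Lemma softplus_derive l d x : 0 < d ->
  is_derive x (1 : R) (softplus l d) (sigm ((x - l) / d)).
Proof.
move=> d0; have dn0 : d != 0 by rewrite gt_eqF.
have dl : is_derive x (1 : R) (fun t => (t - l) / d) d^-1.
  rewrite (_ : (fun t => _) = (fun t => d^-1 * (t - l))); last first.
    by apply/funext => t; rewrite mulrC.
  apply: (is_derive_eq (is_deriveZ_fun d^-1
    (is_deriveB_fun (is_derive_id x 1) (is_derive_cst_fun x 1 l)))).
  by rewrite subr0 mulr1.
have e := expR_gt0 ((x - l) / d).
have dE : is_derive x (1 : R) (fun t => expR ((t - l) / d)) (expR ((x - l) / d) * d^-1).
  by apply: (@is_derive1_comp _ expR (fun t => (t - l) / d)).
have dD : is_derive x (1 : R) (fun t => 1 + expR ((t - l) / d)) (expR ((x - l) / d) * d^-1).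
  apply: (is_derive_eq (is_deriveD_fun (is_derive_cst_fun x 1 1) dE)).
  by rewrite add0r.
have p0 : 0 < 1 + expR ((x - l) / d) by rewrite addr_gt0.
have dL : is_derive x (1 : R) (fun t => ln (1 + expR ((t - l) / d)))
    ((1 + expR ((x - l) / d))^-1 * (expR ((x - l) / d) * d^-1)).
  apply: (@is_derive1_comp _ (@ln R) (fun t => 1 + expR ((t - l) / d))).
  exact: is_derive1_ln.
have dM : is_derive x (1 : R) (fun t => ln (1 + expR ((t - l) / d)) - ln (1 + expR (- l / d)))
    ((1 + expR ((x - l) / d))^-1 * (expR ((x - l) / d) * d^-1)).
  apply: (is_derive_eq (is_deriveB_fun dL (is_derive_cst_fun x 1 _))).
  by rewrite subr0.
apply: (is_derive_eq (is_deriveZ_fun d dM)).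
rewrite /sigm expRN /GRing.scale/=.
move: (expR _) (lt0r_neq0 e) (lt0r_neq0 p0) => a a0 pn0.
have q0 : a + 1 != 0 by rewrite addrC.
by field; rewrite ?dn0 ?a0 ?pn0 ?q0.
Qed.

Lemma softplus_smooth l d : 0 < d -> smooth1 (softplus l d).
Proof.
(* The derivative of order j + 1 is Q_j evaluated at the logistic function; the recursion is s' = s
   - s^2 together with the inner factor 1/d. *)
move=> d0; pose Q j : {poly R} := iter j (fun Q => d^-1 *: (Q^`() * ('X - 'X^2))) 'X.
exists (fun j t => if j is j'.+1 then (Q j').[sigm ((t - l) / d)] else softplus l d t) => //.
case=> [|j] x; first by rewrite /= hornerX; exact: softplus_derive.
have dl : is_derive x (1 : R) (fun t => (t - l) / d) d^-1.
  rewrite (_ : (fun t => _) = (fun t => d^-1 * (t - l))); last first.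
    by apply/funext => t; rewrite mulrC.
  apply: (is_derive_eq (is_deriveZ_fun d^-1
    (is_deriveB_fun (is_derive_id x 1) (is_derive_cst_fun x 1 l)))).
  by rewrite subr0 mulr1.
rewrite [X in is_derive _ _ _ X](_ : _ =
   (Q j)^`().[sigm ((x - l) / d)] * ((sigm ((x - l) / d) - sigm ((x - l) / d) ^+ 2) * d^-1)).
  apply: (@is_derive1_comp _ (fun y => (Q j).[y]) (fun t => sigm ((t - l) / d))).
    exact: is_derive_poly.
  apply: (@is_derive1_comp _ sigm (fun t => (t - l) / d)).
  exact: sigm_derive.
by rewrite /= hornerZ hornerM hornerD hornerN hornerX hornerXn; ring.
Qed.

End smooth_bump.

(** * Operations on test functions and their integrability *)

Section compact_support.
Context {R : realType} (n : nat).
Implicit Types (f g phi : 'rV[R]_n -> R) (Omega S : set 'rV[R]_n).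
Local Notation mu := (lebesgue_rV R n).
Local Notation e_ i := (delta_mx ord0 i : 'rV[R]_n).

Lemma Cc_intro Omega S f : (forall k, Ck k f) -> compact S -> S `<=` Omega ->
  (forall x, f x != 0 -> S x) -> Cc_infty Omega f.
Proof.
move=> cf cS SO fS.
have clS : closed S by apply: compact_closed => //; exact: norm_hausdorff.
have sub : closure [set x | f x != 0] `<=` S.
  by move=> x /(closure_subset fS); rewrite -(proj1 (closure_id S) clS).
split => //; last exact: subset_trans SO.
by apply: (@subclosed_compact _ _ S) => //; exact: closed_closure.
Qed.

Lemma Cc_supp Omega f x : f x != 0 -> closure [set x | f x != 0] x.
Proof. by move=> h; exact: subset_closure. Qed.

Lemma Cc_outside Omega f x : Cc_infty Omega f -> ~ Omega x -> f x = 0.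
Proof.
move=> [_ _ fO] xO; apply/eqP; apply: contraPT xO => h.
by move=> /(_ (fO _ (Cc_supp Omega h))).
Qed.

Lemma Cc_add Omega f g : Cc_infty Omega f -> Cc_infty Omega g ->
  Cc_infty Omega (fun x => f x + g x).
Proof.
move=> [cf kf fO] [cg kg gO].
apply: (@Cc_intro _ (closure [set x | f x != 0] `|` closure [set x | g x != 0])).
- by move=> k; exact: CkD.
- exact: compactU.
- by move=> x [/fO|/gO].
- move=> x; have [->|fx _] := eqVneq (f x) 0; last by left; exact: subset_closure.
  by rewrite add0r => gx; right; exact: subset_closure.
Qed.

Lemma Cc_mulr Omega f g : Cc_infty Omega f -> (forall k, Ck k g) ->
  Cc_infty Omega (fun x => f x * g x).
Proof.
move=> [cf kf fO] cg; apply: (@Cc_intro _ (closure [set x | f x != 0])) => //.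
  by move=> k; exact: CkM.
by move=> x; rewrite mulf_eq0 negb_or => /andP[h _]; exact: subset_closure.
Qed.

Lemma Cc_scale Omega (a : R) f : Cc_infty Omega f -> Cc_infty Omega (fun x => a * f x).
Proof.
move=> hf; under eq_fun do rewrite mulrC.
by apply: Cc_mulr => // k; exact: Ck_cst.
Qed.

Lemma Cc_sub Omega f g : Cc_infty Omega f -> Cc_infty Omega g ->
  Cc_infty Omega (fun x => f x - g x).
Proof.
move=> hf hg; rewrite (_ : (fun x => _) = (fun x => f x + (-1) * g x)).
  by apply: Cc_add => //; exact: Cc_scale.
by apply/funext => x; rewrite mulN1r.
Qed.

Lemma Cc_comp Omega (h : R -> R) f : smooth1 h -> h 0 = 0 -> Cc_infty Omega f ->
  Cc_infty Omega (h \o f).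
Proof.
move=> sh h0 [cf kf fO]; apply: (@Cc_intro _ (closure [set x | f x != 0])) => //.
  by move=> k; exact: Ck_comp.
move=> x hx; apply: subset_closure => /=; apply: contra hx => /eqP fx.
by rewrite /= fx h0.
Qed.

Lemma pderiv_outside_supp i f x : ~ closure [set x | f x != 0] x -> pderiv i f x = 0.
Proof.
move=> nx; have : nbhs x (~` closure [set x | f x != 0]).
  by apply: open_nbhs_nbhs; split => //; apply: closed_openC; exact: closed_closure.
move=> nb; rewrite /pderiv (@near_eq_derive _ _ _ f (cst 0)) ?derive_cst//.
apply: filterS nb => y /= ny; apply/eqP; apply: contraPT ny => h.
by apply; exact: (@subset_closure _ [set x | f x != 0] y h).
Qed.

Lemma Cc_pderiv Omega i f : Cc_infty Omega f -> Cc_infty Omega (pderiv i f).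
Proof.
move=> [cf kf fO]; apply: (@Cc_intro _ (closure [set x | f x != 0])) => //.
  by move=> k; exact: Ck_pderiv (cf k.+1).
by move=> x h; apply: contrapT => /(@pderiv_outside_supp i) h'; rewrite h' eqxx in h.
Qed.

Lemma Cc_cont Omega f : Cc_infty Omega f -> continuous f.
Proof. by move=> [/(_ 0%N)/Ck_continuous]. Qed.

Lemma Cc_meas Omega f : Cc_infty Omega f -> measurable_fun setT f.
Proof. by move=> /Cc_cont; exact: continuous_measurable_rV. Qed.

Lemma Cc_is_derive Omega i f x : Cc_infty Omega f -> is_derive x (e_ i) f (pderiv i f x).
Proof. by move=> [/(_ 1%N) h _ _]; exact: Ck_is_derive h. Qed.

Lemma gradE f x i : grad f x ord0 i = pderiv i f x.
Proof. by rewrite mxE. Qed.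

Lemma vmeas_grad Omega f : Cc_infty Omega f -> vmeas (grad f).
Proof.
move=> hf i; under eq_fun do rewrite gradE.
by apply: Cc_meas; exact: Cc_pderiv hf.
Qed.

Lemma gradD Omega f g : Cc_infty Omega f -> Cc_infty Omega g ->
  grad (fun x => f x + g x) = (fun x => grad f x + grad g x).
Proof.
move=> hf hg; apply/funext => x; apply/rowP => i; rewrite !mxE.
by rewrite /pderiv; case: (is_deriveD_fun (Cc_is_derive i x hf) (Cc_is_derive i x hg)).
Qed.

Lemma gradZ Omega (a : R) f : Cc_infty Omega f ->
  grad (fun x => a * f x) = (fun x => a *: grad f x).
Proof.
move=> hf; apply/funext => x; apply/rowP => i; rewrite !mxE.
by rewrite /pderiv; case: (is_deriveZ_fun a (Cc_is_derive i x hf)).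
Qed.

Lemma gradB Omega f g : Cc_infty Omega f -> Cc_infty Omega g ->
  grad (fun x => f x - g x) = (fun x => grad f x - grad g x).
Proof.
move=> hf hg; apply/funext => x; apply/rowP => i; rewrite !mxE.
by rewrite /pderiv; case: (is_deriveB_fun (Cc_is_derive i x hf) (Cc_is_derive i x hg)).
Qed.

Lemma grad_comp Omega (h h' : R -> R) f : (forall x, is_derive x (1 : R) h (h' x)) ->
  Cc_infty Omega f -> grad (h \o f) = (fun x => h' (f x) *: grad f x).
Proof.
move=> hh hf; apply/funext => x; apply/rowP => i; rewrite !mxE.
by rewrite /pderiv; case: (is_derive_comp_dir (Cc_is_derive i x hf) (hh (f x))).
Qed.

Lemma coord_le_norm (x : 'rV[R]_n) i : `|x ord0 i| <= `|x|.
Proof.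
rewrite [leRHS]/Num.Def.normr/= mx_normrE.
exact: (le_bigmax _ (fun ij : 'I_1 * 'I_n => `|x ij.1 ij.2|) (ord0, i)).
Qed.

Lemma bounded_set_box (S : set 'rV[R]_n) : bounded_set S ->
  exists2 L, 0 < L & forall x i, S x -> `|x ord0 i| <= L.
Proof.
move=> [M [Mr hM]]; exists (`|M| + 1); first by rewrite ltr_wpDl.
move=> x i Sx; have M1 : M < `|M| + 1 by rewrite (le_lt_trans (ler_norm _))// ltrDl.
have := hM _ M1 x Sx; apply: le_trans; exact: coord_le_norm.
Qed.

Lemma compact_box (S : set 'rV[R]_n) : compact S ->
  exists2 L, 0 < L & forall x i, S x -> `|x ord0 i| <= L.
Proof. by move=> /compact_bounded/bounded_set_box. Qed.

Definition cube (L : R) : set 'rV[R]_n := box (fun=> `[- L, L]%classic).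

Lemma cubeP L x : cube L x <-> forall i, `|x ord0 i| <= L.
Proof.
by split=> h i; have := h i; rewrite /= ?in_itv/= ler_norml.
Qed.

Lemma measurable_cube L : measurable (cube L).
Proof. by apply: measurable_box => i; exact: measurable_itv. Qed.

Lemma prode_cst m (a : R) : (\prod_(i < m) a%:E)%E = (a ^+ m)%:E.
Proof.
by elim: m => [|m IH]; rewrite ?big_ord0 ?expr0// big_ord_recr/= IH -EFinM -exprSr.
Qed.

Lemma lebesgue_cube L : 0 <= L -> mu (cube L) = ((2 * L) ^+ n)%:E.
Proof.
move=> L0; rewrite /cube lebesgue_box//=.
rewrite (eq_bigr (fun=> (2 * L)%:E)) => [|i _].
  exact: prode_cst.
rewrite lebesgue_measure_itv/= lte_fin; case: ltP => h.
  by rewrite -EFinB opprK mulr_natl mulr2n.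
have -> : L = 0 by lra.
by rewrite mulr0.
Qed.

Lemma L1_bounded_cube f L M : measurable_fun setT f -> (forall x, `|f x| <= M) ->
  (forall x, f x != 0 -> cube L x) -> L1 mu f.
Proof.
move=> mf fM fL; have M0 : 0 <= M by apply: le_trans (fM 0).
have mA := measurable_cube `|L|.
have hA : L1 mu (fun x => \1_(cube `|L|) x).
  apply: L1_ge0P; [exact: measurable_indic|by []|].
  apply: (@le_lt_trans _ _ (mu (cube `|L|))); first by rewrite integral_indic// setIT.
  by rewrite lebesgue_cube// ltry.
apply: (@L1_le _ _ _ _ _ (fun x => M * \1_(cube `|L|) x)) => //; first exact: L1Z.
move=> x; have [->|fx] := eqVneq (f x) 0; first by rewrite normr0 mulr_ge0.
rewrite indicE mem_set ?mulr1//; apply/cubeP => i.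
by have /cubeP/(_ i)/le_trans := fL x fx; apply; exact: ler_norm.
Qed.

Lemma Cc_bounded Omega f : Cc_infty Omega f -> exists2 M, 0 <= M & forall x, `|f x| <= M.
Proof.
move=> hf; have cf := Cc_cont hf; case: hf => _ kf _.
set S := closure _ in kf; have [S0|/set0P S0] := eqVneq S set0.
  exists 0 => // x; have [->|h] := eqVneq (f x) 0; first by rewrite normr0.
  by have : S x by [exact: subset_closure]; rewrite S0.
have [|c cS hc] := @compact_EVT_max _ _ (fun x => `|f x|) S S0 kf.
  apply: continuous_subspaceT => x; apply: continuous_comp; first exact: cf.
  exact: norm_continuous.
exists `|f c| => // x; have [->|h] := eqVneq (f x) 0; first by rewrite normr0.
by apply: hc; rewrite inE; exact: subset_closure.
Qed.

Lemma Cc_cube Omega f : Cc_infty Omega f ->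
  exists2 L, 0 < L & forall x, closure [set x | f x != 0] x -> cube L x.
Proof.
move=> [_ kf _]; have [L L0 hL] := compact_box kf; exists L => // x fx.
by apply/cubeP => i; exact: hL.
Qed.

Lemma Cc_L1 Omega f : Cc_infty Omega f -> L1 mu f.
Proof.
move=> hf; have [M M0 hM] := Cc_bounded hf; have [L L0 hL] := Cc_cube hf.
by apply: (@L1_bounded_cube f L M) => // [|x fx]; [exact: Cc_meas hf|exact/hL/subset_closure].
Qed.

Lemma Cc_L1_powR Omega f p : 0 < p -> Cc_infty Omega f -> L1 mu (fun x => `|f x| `^ p).
Proof.
move=> p0 hf; have [M M0 hM] := Cc_bounded hf; have [L L0 hL] := Cc_cube hf.
apply: (@L1_bounded_cube _ L (M `^ p)).
- apply: (measurableT_comp (f := fun t : R => t `^ p)) => //.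
  by apply: measurableT_comp => //; exact: Cc_meas hf.
- by move=> x; rewrite ger0_norm ?powR_ge0// ge0_ler_powR ?nnegrE// ltW.
- move=> x; rewrite powR_eq0_pos// normr_eq0 => h; exact/hL/subset_closure.
Qed.

Lemma grad_inLp Omega f p : 1 < p -> Cc_infty Omega f -> inLp mu p (grad f).
Proof.
move=> p1 hf; have p0 : 0 < p by exact: lt_trans p1.
have [L L0 hL] := Cc_cube hf.
have mg := vmeas_grad hf; split => //.
have hb i := Cc_bounded (Cc_pderiv i hf).
pose M i := sval (cid2 (hb i)).
have hM i x : `|pderiv i f x| <= M i by rewrite /M; case: cid2.
apply: (@L1_bounded_cube _ L ((\sum_i M i) `^ p)).
- exact: measurable_enorm_powR.
- move=> x; rewrite ger0_norm ?powR_ge0// ge0_ler_powR ?nnegrE ?enorm_ge0 ?(ltW p0)//.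
    by apply: sumr_ge0 => i _; rewrite /M; case: cid2.
  apply: le_trans (enorm_le_sum _) _; apply: ler_sum => i _; by rewrite gradE.
- move=> x; rewrite powR_eq0_pos// enorm_eq0 => h; apply: hL; apply: contrapT => nx.
  by move/eqP : h; apply; apply/rowP => i; rewrite gradE mxE pderiv_outside_supp.
Qed.

End compact_support.

(** * Translations and cell averages *)

Section translation_estimates.
Context {R : realType} (n : nat).
Local Notation mu := (lebesgue_rV R n).
Local Notation e_ i := (delta_mx ord0 i : 'rV[R]_n).
Implicit Types (f u : 'rV[R]_n -> R) (z : 'rV[R]_n) (Omega : set 'rV[R]_n).

Lemma measurable_translate f z : measurable_fun setT f ->
  measurable_fun setT (fun x : 'rV[R]_n => f (x + z)).
Proof. by move=> mf; apply: (measurableT_comp mf); exact: measurable_fun_addr. Qed.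

Lemma rint_translate_ge0 f z : L1 mu f -> (forall x, 0 <= f x) ->
  L1 mu (fun x => f (x + z)) /\ \int[mu]_x f (x + z) = \int[mu]_x f x.
Proof.
move=> hf f0; have mf := L1_measurable hf.
have e : (\int[mu]_x (f (x + z))%:E = \int[mu]_x (f x)%:E)%E.
  apply: (@integral_translate R n z (fun x => (f x)%:E)) => [|x].
    exact/measurable_EFinP.
  by rewrite lee_fin.
split; last by rewrite /Rintegral e.
apply: L1_ge0P => //; first exact: measurable_translate.
by rewrite e; exact: L1_lty.
Qed.

Lemma rint_translate f z : L1 mu f ->
  L1 mu (fun x => f (x + z)) /\ \int[mu]_x f (x + z) = \int[mu]_x f x.
Proof.
move=> hf; have hn := L1_norm hf; have hs := L1D hf hn.
have [i1 e1] := @rint_translate_ge0 _ z hn (fun x => normr_ge0 _).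
have [i2 e2] : L1 mu (fun x => f (x + z) + `|f (x + z)|) /\
    \int[mu]_x (f (x + z) + `|f (x + z)|) = \int[mu]_x (f x + `|f x|).
  apply: (@rint_translate_ge0 _ z hs) => x.
  by rewrite -lerBlDl sub0r lerNl lerNnormlW.
have E : (fun x => f (x + z)) = (fun x => (f (x + z) + `|f (x + z)|) - `|f (x + z)|).
  by apply/funext => x; rewrite addrK.
have i3 := L1B i2 i1; rewrite E; split => //.
by rewrite rintB// e1 e2 rintD// addrK.
Qed.

Lemma Cc_increment_le Omega f i M x h : Cc_infty Omega f -> (forall y, `|pderiv i f y| <= M) ->
  `|f (x + h *: e_ i) - f x| <= `|h| * M.
Proof.
move=> hf hM.
have d t : is_derive t (1 : R) (fun t => f (t *: e_ i + x)) (pderiv i f (t *: e_ i + x)).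
  by apply/derive_line; exact: Cc_is_derive hf.
have c (S : set R) : {within S, continuous (fun t => f (t *: e_ i + x))}.
  apply: continuous_subspaceT => t; apply/differentiable_continuous/derivable1_diffP.
  by case: (d t).
have E : f (x + h *: e_ i) - f x = f (h *: e_ i + x) - f (0 *: e_ i + x).
  by rewrite scale0r add0r addrC [x + _]addrC addrC.
rewrite E; have [h0|h0] := leP 0 h.
  have [t _ ->] := @MVT_segment R (fun t => f (t *: e_ i + x)) _ 0 h h0 (fun t _ => d t) (c _).
  by rewrite subr0 normrM mulrC ler_wpM2l.
have [t _ et] := @MVT_segment R (fun t => f (t *: e_ i + x)) _ h 0 (ltW h0) (fun t _ => d t) (c _).
by rewrite distrC et sub0r normrM normrN mulrC ler_wpM2l.
Qed.

Lemma Cc_quotient_cvg Omega f i x h : Cc_infty Omega f ->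
  k.+1%:R * (f (x + (h / k.+1%:R) *: e_ i) - f x) @[k --> \oo] --> h * pderiv i f x.
Proof.
move=> hf; have [->|h0] := eqVneq h 0.
  under eq_fun do rewrite mul0r scale0r addr0 subrr mulr0.
  by rewrite mul0r; exact: cvg_cst.
have [dv de] := Cc_is_derive i x hf.
have c : (fun t : R => t^-1 *: ((f \o shift x) (t *: e_ i) - f x)) @ 0^' --> pderiv i f x.
  by rewrite -de; exact: dv.
have tk : h / k.+1%:R @[k --> \oo] --> (0 : R)^'.
  have t0 : h / k.+1%:R @[k --> \oo] --> (0 : R).
    rewrite -[X in _ --> X](mulr0 h); apply: cvgM; first exact: cvg_cst.
    exact: cvg_harmonic.
  move=> P hP; have := t0 _ hP.
  change ((\forall k \near \oo, (h / k.+1%:R != 0 -> P (h / k.+1%:R))) ->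
    \forall k \near \oo, P (h / k.+1%:R)).
  by apply: filterS => k; apply; rewrite mulf_neq0// invr_neq0.
have := @cvg_comp _ _ _ (fun k : nat => h / k.+1%:R) _ _ _ _ tk c.
move=> c2; rewrite (_ : (fun k : nat => _) = (fun k : nat => h * ((h / k.+1%:R)^-1 *:
    ((f \o shift x) ((h / k.+1%:R) *: e_ i) - f x)))).
  by apply: cvgM; [exact: cvg_cst|exact: c2].
apply/funext => k; rewrite /shift/= [_ + x]addrC /GRing.scale/= invf_div mulrA.
by congr (_ * _); rewrite mulrCA divff// mulr1.
Qed.

Lemma L1_increment Omega f p z : 0 < p -> Cc_infty Omega f ->
  L1 mu (fun x => `|f (x + z) - f x| `^ p).
Proof.
move=> p0 hf; have [M M0 hM] := Cc_bounded hf; have [L L0 hL] := Cc_cube hf.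
have mf := Cc_meas hf.
apply: (@L1_bounded_cube _ _ _ (L + `|z|) ((M + M) `^ p)).
- apply: (measurableT_comp (f := fun t : R => t `^ p)) => //.
  apply: measurableT_comp => //; apply: measurable_funB => //.
  exact: measurable_translate.
- move=> x; rewrite ger0_norm ?powR_ge0// ge0_ler_powR ?nnegrE ?addr_ge0 ?(ltW p0)//.
  by rewrite (le_trans (ler_normB _ _))// lerD.
- move=> x; rewrite powR_eq0_pos// normr_eq0 => h; apply/cubeP => i.
  have [fx|fx] := eqVneq (f x) 0; last first.
    have /cubeP/(_ i)/le_trans := hL _ (Cc_supp Omega fx); apply.
    by rewrite lerDl.
  have fxz : f (x + z) != 0 by move: h; rewrite fx subr0.
  have /cubeP/(_ i) := hL _ (Cc_supp Omega fxz); rewrite mxE => h2.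
  have := ler_normB (x ord0 i + z ord0 i) (z ord0 i); rewrite addrK => /le_trans; apply.
  by rewrite lerD// coord_le_norm.
Qed.

Definition incr p f z : R := \int[mu]_x (`|f (x + z) - f x| `^ p).

Lemma incr_ge0 p f z : 0 <= incr p f z.
Proof. by apply: rint_ge0 => x; exact: powR_ge0. Qed.

(* Cut the segment into [N] equal pieces: the increments along the pieces have
   the same integral by translation invariance, and [N] times the first one
   tends to the directional derivative. *)
Lemma incr_dir_le Omega f p i h : 1 <= p -> Cc_infty Omega f ->
  incr p f (h *: e_ i) <= `|h| `^ p * \int[mu]_x (`|pderiv i f x| `^ p).
Proof.
move=> p1 hf; have p0 : 0 < p by exact: lt_le_trans p1.
have hp := Cc_pderiv i hf; have [M M0 hM] := Cc_bounded hp.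
have [L L0 hL] := Cc_cube hf.
pose q k (x : 'rV[R]_n) := `|k.+1%:R * (f (x + (h / k.+1%:R) *: e_ i) - f x)| `^ p.
have [_ cv] : L1 mu (fun x => `|h * pderiv i f x| `^ p) /\
   \int[mu]_x q k x @[k --> \oo] --> \int[mu]_x (`|h * pderiv i f x| `^ p).
  (* The quotients are bounded by |h| M by the mean value theorem, and all vanish outside the cube
     of the support enlarged by |h|. *)
  apply: (@rint_dct _ _ _ mu q _ (fun x => (`|h| * M) `^ p * \1_(cube (L + `|h|)) x)).
  - move=> k; apply: (measurableT_comp (f := fun t : R => t `^ p)) => //.
    apply: measurableT_comp => //; apply: measurable_funM => //.
    apply: measurable_funB; last exact: Cc_meas hf.
    by apply: measurable_translate; exact: Cc_meas hf.
  - apply: (measurableT_comp (f := fun t : R => t `^ p)) => //.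
    by apply: measurableT_comp => //; apply: measurable_funM => //; exact: Cc_meas hp.
  - apply: L1Z; apply: (@L1_bounded_cube _ _ _ (L + `|h|) 1) => //.
    + by apply: measurable_indic; exact: measurable_cube.
    + by move=> x; rewrite indicE; case: (_ \in _); rewrite ?normr1 ?normr0.
    + by move=> x; rewrite indicE; case: (boolP (x \in _)) => [/set_mem//|_]; rewrite eqxx.
  - apply: aeW => x k; rewrite ger0_norm ?powR_ge0//.
    have k0 : (0 : R) < k.+1%:R by rewrite ltr0n.
    have [xc|xc] := pselect (cube (L + `|h|) x).
      rewrite indicE mem_set// mulr1 /q ge0_ler_powR ?nnegrE ?mulr_ge0 ?(ltW p0)//.
      rewrite normrM (ger0_norm (ltW k0)).
      have := @Cc_increment_le _ _ _ _ x (h / k.+1%:R) hf hM.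
      rewrite -(ler_pM2l k0) => /le_trans; apply.
      by rewrite normrM normfV (ger0_norm (ltW k0)) mulrA mulrCA divff ?mulr1// gt_eqF.
    have out (y : 'rV[R]_n) : (forall j, `|y ord0 j - x ord0 j| <= `|h|) -> f y = 0.
      move=> yx; apply/eqP; apply: contraPT xc => fy; apply.
      have /cubeP hy := hL _ (Cc_supp Omega fy).
      apply/cubeP => j; have := ler_normB (y ord0 j) (y ord0 j - x ord0 j).
      by rewrite opprB addrCA subrr addr0 => /le_trans; apply; apply: lerD.
    rewrite /q (out x); last by move=> j; rewrite subrr normr0.
    rewrite out ?subrr ?mulr0 ?normr0 ?powR0 ?gt_eqF// ?mulr_ge0 ?powR_ge0//.
    move=> j; rewrite !mxE addrAC subrr add0r eqxx/= !normrM normfV (ger0_norm (ltW k0)).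
    case: (j == i); rewrite ?mulr0n ?normr0 ?mulr0// mulr1n normr1 mulr1.
    by rewrite ler_pdivrMr// ler_peMr// ler1n.
  - apply: aeW => x.
    have c := @Cc_quotient_cvg _ _ i x h hf.
    apply: (@cvg_comp _ _ _ _ (fun t : R => `|t| `^ p) _ _ _ c).
    exact: normr_powR_continuous.
rewrite -rintZ; last by exact: Cc_L1_powR hp.
under eq_Rintegral do rewrite -powRM// -normrM.
rewrite -(cvg_lim (@Rhausdorff R) cv); apply: limr_ge.
  by apply/cvg_ex; eexists; exact: cv.
apply: nearW => k.
pose z j : 'rV[R]_n := (j%:R * (h / k.+1%:R)) *: e_ i.
have k0 : (0 : R) < k.+1%:R by rewrite ltr0n.
have L1j j : L1 mu (fun x => `|f (x + z j.+1) - f (x + z j)| `^ p) /\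
    \int[mu]_x (`|f (x + z j.+1) - f (x + z j)| `^ p) = incr p f (z 1%N).
  have h1 := @L1_increment _ _ p (z 1%N) p0 hf.
  have [] := rint_translate (z j) h1.
  suff E (x : 'rV[R]_n) : x + z j + z 1%N = x + z j.+1.
    have -> : (fun x => `|f (x + z j + z 1%N) - f (x + z j)| `^ p) =
        (fun x => `|f (x + z j.+1) - f (x + z j)| `^ p) by apply/funext => x; rewrite E.
    by [].
  by rewrite -addrA /z -scalerDl -mulrDl -natrD addn1.
have zN : z k.+1 = h *: e_ i by rewrite /z mulrCA divff ?mulr1// gt_eqF.
have z0 : z 0%N = 0 by rewrite /z mul0r scale0r.
have z1 : z 1%N = (h / k.+1%:R) *: e_ i by rewrite /z mul1r.
have tel x : f (x + h *: e_ i) - f x = \sum_(0 <= j < k.+1) (f (x + z j.+1) - f (x + z j)).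
  by rewrite telescope_sumr// zN z0 addr0.
have L1s : L1 mu (fun x => \sum_(j <- iota 0 k.+1) `|f (x + z j.+1) - f (x + z j)| `^ p) /\
   \int[mu]_x (\sum_(j <- iota 0 k.+1) `|f (x + z j.+1) - f (x + z j)| `^ p) =
   (size (iota 0 k.+1))%:R * incr p f (z 1%N).
  elim: (iota _ _) => [|j s [IH1 IH2]].
    split; first by under eq_fun do rewrite big_nil; exact: L1_0.
    under eq_Rintegral do rewrite big_nil.
    by rewrite mul0r /Rintegral integral0.
  split; first by under eq_fun do rewrite big_cons; exact: (L1D (L1j j).1 IH1).
  under eq_Rintegral do rewrite big_cons.
  by rewrite (rintD (L1j j).1 IH1) IH2 (L1j j).2 /= -natr1 mulrDl mul1r addrC.
have -> : \int[mu]_x q k x = k.+1%:R `^ p * incr p f (z 1%N).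
  rewrite /incr -rintZ; last exact: L1_increment hf.
  apply: eq_Rintegral => x _; rewrite /q normrM (ger0_norm (ltW k0)) powRM ?(ltW k0)//.
  by rewrite z1.
have pn : p != 0 by rewrite gt_eqF.
(* The factor (k+1)^p splits into (k+1)^(p-1), the cost of [powR_sum_le], and k+1, the number of
   increments with the same integral. *)
rewrite -(powRB1 (ltW k0) pn) -mulrA.
have := L1s.2; rewrite size_iota => <-.
rewrite -rintZ; last exact: L1s.1.
apply: rint_le; first exact: L1_increment hf.
  by apply: L1Z; exact: L1s.1.
move=> x; rewrite tel /index_iota subn0.
have := @powR_sum_le R nat (iota 0 k.+1) (fun j => f (x + z j.+1) - f (x + z j)) p p1.
rewrite size_iota; apply: le_trans.
by rewrite ge0_ler_powR ?nnegrE ?(ltW p0) ?sumr_ge0// ler_norm_sum.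
Qed.

(** A path along the coordinate axes, so that an increment of a function is controlled by its
    partial derivatives alone. *)
Lemma axis_path (z : 'rV[R]_n) : exists w : nat -> 'rV[R]_n,
  [/\ w 0%N = 0, w n = z & forall k : 'I_n, w k.+1 = w k + z ord0 k *: e_ k].
Proof.
exists (fun k => \row_j (if (j < k)%N then z ord0 j else 0)); split.
- by apply/rowP => j; rewrite !mxE.
- by apply/rowP => j; rewrite !mxE ltn_ord.
- move=> k; apply/rowP => j; rewrite !mxE eqxx/= ltnS leq_eqVlt.
  have [->|jk] := eqVneq j k; first by rewrite eqxx ltnn/= add0r mulr1.
  have -> : (nat_of_ord j == k) = false by apply/negbTE.
  by rewrite /= mulr0 addr0.
Qed.

(** The n legs of [axis_path] are summed: n^(p-1) comes from [powR_sum_le] and the last factor n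
    from the number of legs. *)
Lemma incr_le Omega f p rho z : 1 < p -> Cc_infty Omega f ->
  0 <= rho -> (forall i, `|z ord0 i| <= rho) ->
  incr p f z <= (n%:R * rho) `^ p * energy mu p (grad f).
Proof.
move=> p1 hf rho0 hz; have p0 : 0 < p by exact: lt_trans p1.
have hg := (grad_inLp p1 hf).2.
have [w [w0 wn wS]] := axis_path z.
have tel x : f (x + z) - f x = \sum_(k < n) (f (x + w k.+1) - f (x + w k)).
  by rewrite -(big_mkord xpredT (fun k => f (x + w k.+1) - f (x + w k))) telescope_sumr// wn w0 addr0.
have term (k : 'I_n) : L1 mu (fun x => `|f (x + w k.+1) - f (x + w k)| `^ p) /\
   \int[mu]_x (`|f (x + w k.+1) - f (x + w k)| `^ p) <= rho `^ p * energy mu p (grad f).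
  have h1 := @L1_increment _ _ p (z ord0 k *: e_ k) p0 hf.
  have [i1 e1] := rint_translate (w k) h1.
  have E x : x + w k + z ord0 k *: e_ k = x + w k.+1 by rewrite wS addrA.
  split; first by move: i1; under eq_fun do rewrite E.
  move: e1; under eq_Rintegral do rewrite E.
  move=> ->; apply: le_trans (incr_dir_le _ _ (ltW p1) hf) _.
  apply: ler_pM; rewrite ?powR_ge0//.
  - by apply: rint_ge0 => x; exact: powR_ge0.
  - by rewrite ge0_ler_powR ?nnegrE ?(ltW p0).
  - apply: rint_le => //; first by apply: Cc_L1_powR => //; exact: Cc_pderiv hf.
    move=> x; rewrite ge0_ler_powR ?nnegrE ?enorm_ge0 ?(ltW p0)//.
    by rewrite -gradE coord_le_enorm.
have [L1s les] : L1 mu (fun x => \sum_(k < n) `|f (x + w k.+1) - f (x + w k)| `^ p) /\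
   \int[mu]_x (\sum_(k < n) `|f (x + w k.+1) - f (x + w k)| `^ p) <=
   (size (index_enum 'I_n))%:R * (rho `^ p * energy mu p (grad f)).
  elim: (index_enum _) => [|j s [IH1 IH2]].
    split; first by under eq_fun do rewrite big_nil; exact: L1_0.
    under eq_Rintegral do rewrite big_nil.
    by rewrite mul0r /Rintegral integral0.
  split; first by under eq_fun do rewrite big_cons; exact: (L1D (term j).1 IH1).
  under eq_Rintegral do rewrite big_cons.
  by rewrite (rintD (term j).1 IH1) /= -natr1 mulrDl mul1r addrC lerD// (term j).2.
have sn : size (index_enum 'I_n) = n by rewrite -[RHS]card_ord cardE enumT.
rewrite sn in les.
have n0 : (0 : R) <= n%:R by [].
have pn : p != 0 by rewrite gt_eqF.
rewrite powRM// -(powRB1 n0 pn) -!mulrA.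
apply: le_trans (ler_wpM2l (powR_ge0 _ _) les).
rewrite -rintZ//; apply: rint_le; [exact: L1_increment hf|exact: L1Z|].
move=> x; rewrite tel.
have := @powR_sum_le R _ (index_enum 'I_n) (fun k => f (x + w k.+1) - f (x + w k)) p (ltW p1).
rewrite sn; apply: le_trans.
by rewrite ge0_ler_powR ?nnegrE ?(ltW p0) ?sumr_ge0// ler_norm_sum.
Qed.

End translation_estimates.

Section integration_by_parts.
Context {R : realType} (n : nat).
Local Notation mu := (lebesgue_rV R n).
Local Notation e_ i := (delta_mx ord0 i : 'rV[R]_n).
Implicit Types (f g : 'rV[R]_n -> R) (Omega : set 'rV[R]_n).

(** Every difference quotient has integral 0 by translation invariance, and the quotients converge
    under domination. *)
Lemma rint_pderiv Omega f i : Cc_infty Omega f -> \int[mu]_x pderiv i f x = 0.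
Proof.
move=> hf; have hp := Cc_pderiv i hf; have [M M0 hM] := Cc_bounded hp.
have [L L0 hL] := Cc_cube hf.
pose q k (x : 'rV[R]_n) := k.+1%:R * (f (x + (1 / k.+1%:R) *: e_ i) - f x).
have hfL1 := Cc_L1 hf.
have [_ cv] : L1 mu (fun x => 1 * pderiv i f x) /\
   \int[mu]_x q k x @[k --> \oo] --> \int[mu]_x (1 * pderiv i f x).
  apply: (@rint_dct _ _ _ mu q _ (fun x => M * \1_(cube (L + 1)) x)).
  - move=> k; apply: measurable_funM => //.
    apply: measurable_funB; last exact: Cc_meas hf.
    by apply: measurable_translate; exact: Cc_meas hf.
  - by apply: measurable_funM => //; exact: Cc_meas hp.
  - apply: L1Z; apply: (@L1_bounded_cube _ _ _ (L + 1) 1) => //.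
    + by apply: measurable_indic; exact: measurable_cube.
    + by move=> x; rewrite indicE; case: (_ \in _); rewrite ?normr1 ?normr0.
    + by move=> x; rewrite indicE; case: (boolP (x \in _)) => [/set_mem//|_]; rewrite eqxx.
  - apply: aeW => x k.
    have k0 : (0 : R) < k.+1%:R by rewrite ltr0n.
    have [xc|xc] := pselect (cube (L + 1) x).
      rewrite indicE mem_set// mulr1 /q normrM (ger0_norm (ltW k0)).
      have := @Cc_increment_le _ _ _ _ _ _ x (1 / k.+1%:R) hf hM.
      rewrite -(ler_pM2l k0) => /le_trans; apply.
      by rewrite div1r normfV (ger0_norm (ltW k0)) mulrA divff ?mul1r// gt_eqF.
    have out (y : 'rV[R]_n) : (forall j, `|y ord0 j - x ord0 j| <= 1) -> f y = 0.
      move=> yx; apply/eqP; apply: contraPT xc => fy; apply.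
      have /cubeP hy := hL _ (Cc_supp Omega fy).
      apply/cubeP => j; have := ler_normB (y ord0 j) (y ord0 j - x ord0 j).
      by rewrite opprB addrCA subrr addr0 => /le_trans; apply; apply: lerD.
    rewrite /q (out x); last by move=> j; rewrite subrr normr0.
    rewrite out ?subrr ?mulr0 ?normr0 ?mulr_ge0//.
    move=> j; rewrite !mxE addrAC subrr add0r eqxx/= !normrM normfV (ger0_norm (ltW k0)).
    rewrite normr1 mul1r.
    case: (j == i); rewrite ?mulr0n ?normr0 ?mulr0// mulr1n normr1 mulr1.
    by rewrite invf_le1// ler1n.
  - by apply: aeW => x; exact: Cc_quotient_cvg hf.
have q0 : (fun k => \int[mu]_x q k x) = cst 0.
  apply/funext => k; have [i1 e1] := rint_translate ((1 / k.+1%:R) *: e_ i) hfL1.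
  by rewrite /q rintZ ?rintB ?e1 ?subrr ?mulr0//; exact: L1B.
rewrite q0 in cv; rewrite -[RHS](cvg_lim (@Rhausdorff R) (@cvg_cst _ (0 : R) _ \oo _)).
rewrite (cvg_lim (@Rhausdorff R) cv); apply: eq_Rintegral => x _.
by rewrite mul1r.
Qed.

Lemma integration_by_parts_rV Omega f g i : Cc_infty Omega f -> Cc_infty Omega g ->
  \int[mu]_x (f x * pderiv i g x) = - \int[mu]_x (pderiv i f x * g x).
Proof.
move=> hf hg; have [cf _ _] := hf; have [cg _ _] := hg.
have := @rint_pderiv Omega (fun x => f x * g x) i (Cc_mulr hf cg).
have -> : pderiv i (fun x => f x * g x) = (fun x => f x * pderiv i g x + g x * pderiv i f x).
  by apply: pderivE => x; apply: is_deriveM_fun; [exact: Cc_is_derive hf|exact: Cc_is_derive hg].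
have i1 : L1 mu (fun x => f x * pderiv i g x).
  by apply: (@Cc_L1 _ _ Omega); apply: Cc_mulr => // k; exact: Ck_pderiv (cg k.+1).
have i2 : L1 mu (fun x => g x * pderiv i f x).
  by apply: (@Cc_L1 _ _ Omega); apply: Cc_mulr => // k; exact: Ck_pderiv (cf k.+1).
rewrite rintD// => /eqP; rewrite addr_eq0 => /eqP ->; congr (- _).
by apply: eq_Rintegral => x _; rewrite mulrC.
Qed.

End integration_by_parts.

Section jensen.
Context d (T : measurableType d) (R : realType) (mu : {measure set T -> \bar R}).

(** Young's inequality at the constant m, the integral of w |g|, is integrated against w: p m^p <=
    (p-1) m^p plus the integral of w |g|^p. *)
Lemma rint_jensen (w g : T -> R) p : 1 < p -> (forall x, 0 <= w x) ->
  L1 mu w -> \int[mu]_x w x = 1 -> measurable_fun setT g ->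
  L1 mu (fun x => w x * `|g x| `^ p) ->
  L1 mu (fun x => w x * g x) /\
  `|\int[mu]_x (w x * g x)| `^ p <= \int[mu]_x (w x * `|g x| `^ p).
Proof.
move=> p1 w0 iw w1 mg ig; have p0 : 0 < p by exact: lt_trans p1.
have young m x : 0 <= m -> p * (m `^ (p - 1) * `|g x|) <= (p - 1) * m `^ p + `|g x| `^ p.
  by move=> m0; exact: young_le.
have mw := L1_measurable iw.
have iwg : L1 mu (fun x => w x * `|g x|).
  apply: (@L1_le _ _ _ _ _ (fun x => w x + w x * `|g x| `^ p)); last first.
  - move=> x; rewrite ger0_norm ?mulr_ge0// -[X in X + _]mulr1 -mulrDr ler_wpM2l//.
    have := young 1 x ler01; rewrite !powR1 mul1r mulr1 => h.
    rewrite -(ler_pM2l p0); apply: le_trans h _.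
    have := powR_ge0 `|g x| p; move: (_ `^ p) => a a0.
    by rewrite mulrDr mulr1 lerD// ?lerBlDr ?lerDl// ler_peMl// ltW.
  - exact: L1D.
  - by apply: measurable_funM => //; apply: measurableT_comp.
have iwg' : L1 mu (fun x => w x * g x).
  apply: (@L1_le _ _ _ _ _ (fun x => w x * `|g x|)) => //; first exact: measurable_funM.
  by move=> x; rewrite normrM (ger0_norm (w0 x)).
split => //; set m := \int[mu]_x (w x * `|g x|).
have m0 : 0 <= m by apply: rint_ge0 => x; rewrite mulr_ge0.
have hm : `|\int[mu]_x (w x * g x)| <= m.
  apply: le_trans (rint_norm iwg') _; rewrite le_eqVlt; apply/orP; left; apply/eqP.
  by apply: eq_Rintegral => x _; rewrite normrM (ger0_norm (w0 x)).
apply: (@le_trans _ _ (m `^ p)); first by rewrite ge0_ler_powR ?nnegrE ?(ltW p0).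
have : \int[mu]_x (p * m `^ (p - 1) * (w x * `|g x|)) <=
       \int[mu]_x ((p - 1) * m `^ p * w x + w x * `|g x| `^ p).
  apply: rint_le; [exact: L1Z|by apply: L1D => //; exact: L1Z|] => x.
  have := young m x m0; have := w0 x.
  move: (w x) (m `^ (p - 1)) (m `^ p) `|g x| (`|g x| `^ p) => a b c d' e a0 h.
  have := ler_wpM2l a0 h; rewrite mulrDr => h2.
  by rewrite -[p * b * _]mulrA (mulrCA b) (mulrCA p) [_ * _ * a]mulrC.
rewrite rintZ// rintD//; last exact: L1Z.
rewrite rintZ// w1 mulr1 -/m -mulrA powRB1 ?gt_eqF//.
by move: (m `^ p) (Rintegral _ _ _) => a b; lra.
Qed.

End jensen.

(** * Averages over dyadic cells *)

Section cell_averages.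
Context {R : realType} (n : nat).
Local Notation mu := (lebesgue_rV R n).
Implicit Types (u f : 'rV[R]_n -> R) (Omega : set 'rV[R]_n) (c : 'rV[int]_n).

(** The density of the uniform probability on the cell labelled c. *)
Definition wcell j c (y : 'rV[R]_n) : R := (2 ^+ j) ^+ n * \1_[set y | cell j y = c] y.

Definition avgc j u c : R := \int[mu]_y (wcell j c y * u y).

Definition avg j u (x : 'rV[R]_n) : R := avgc j u (cell j x).

Lemma lebesgue_cell j c : mu [set y | cell j y = c] = ((2^-1 ^+ j) ^+ n)%:E.
Proof.
rewrite cell_box lebesgue_box => [|i]; last exact: measurable_itv.
rewrite (eq_bigr (fun=> (2^-1 ^+ j : R)%:E)); first exact: prode_cst.
move=> i _; rewrite lebesgue_measure_itv/= lte_fin.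
have j0 : (0 : R) < 2 ^+ j by rewrite exprn_gt0.
rewrite ltr_pM2r ?invr_gt0// ltr_int ltrDl/= -EFinB -mulrBl -intrB addrAC subrr add0r.
by rewrite mul1r exprVn.
Qed.

Lemma wcell_ge0 j c y : 0 <= wcell j c y.
Proof. by rewrite mulr_ge0// !exprn_ge0. Qed.

Lemma wcellE j c y : wcell j c y = if cell j y == c then (2 ^+ j) ^+ n else 0.
Proof.
rewrite /wcell indicE; case: (boolP (y \in _)) => [/set_mem/= ->|]; rewrite ?eqxx ?mulr1//.
by case: eqP => [h|_ _]; [rewrite mem_set|rewrite mulr0].
Qed.

Lemma wcell_L1 j c : L1 mu (wcell j c) /\ \int[mu]_y wcell j c y = 1.
Proof.
have mc := @measurable_cell R n j c.
have [i e] : L1 mu (fun y => \1_[set y | cell j y = c] y) /\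
    \int[mu]_y (\1_[set y | cell j y = c] y) = (2^-1 ^+ j) ^+ n.
  have E : (\int[mu]_y (\1_[set y | cell j y = c] y)%:E = ((2^-1 ^+ j) ^+ n)%:E)%E.
    apply: (@eq_trans _ _ (mu [set y | cell j y = c])); last exact: lebesgue_cell.
    by rewrite integral_indic// setIT.
  split; last by rewrite /Rintegral E.
  by apply: L1_ge0P; [exact: measurable_indic|by []|rewrite E ltry].
split; first exact: L1Z.
by rewrite rintZ// e -exprMn exprVn divff ?expr1n// expf_neq0.
Qed.

Lemma measurable_cell_fun j (g : 'rV[int]_n -> R) : measurable_fun setT (fun x : 'rV[R]_n => g (cell j x)).
Proof.
move=> _ Y mY; rewrite setTI.
rewrite (_ : _ @^-1` _ = \bigcup_(c : 'rV[int]_n)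
   if `[< Y (g c) >] then [set x : 'rV[R]_n | cell j x = c] else set0).
  apply: countable_bigcupT_measurable; first exact: countableP.
  by move=> c; case: ifP => _; [exact: measurable_cell|exact: measurable0].
apply/seteqP; split => x /=.
  by move=> Yx; exists (cell j x) => //; rewrite asboolT.
by move=> [c _]; case: ifPn => // /asboolP Yc /= ->.
Qed.

Lemma measurable_avg j u : measurable_fun setT (avg j u).
Proof. exact: measurable_cell_fun. Qed.

Lemma cell_refine j (x y : 'rV[R]_n) : cell j.+1 x = cell j.+1 y -> cell j x = cell j y.
Proof.
move=> h; apply/rowP => i; have /rowP/(_ i) := h; rewrite !mxE exprSr !mulrA.
set a := x _ _ * _; set b := y _ _ * _ => e.
have aux (s t : R) : Num.floor (s * 2) = Num.floor (t * 2) -> Num.floor s <= Num.floor t.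
  move=> st; rewrite floor_ge_int -(ler_pM2r (x := 2))//.
  rewrite (_ : _ * 2 = (Num.floor s * 2)%:~R); last by rewrite intrM.
  rewrite -floor_ge_int -st floor_ge_int intrM ler_pM2r//; exact: floor_le.
by apply/eqP; rewrite eq_le !aux.
Qed.

Lemma avg_refine j u (x y : 'rV[R]_n) : cell j.+1 x = cell j.+1 y -> avg j u x = avg j u y.
Proof. by move=> /cell_refine; rewrite /avg => ->. Qed.

Lemma L1_wcell_bounded j c f M : measurable_fun setT f -> (forall x, `|f x| <= M) ->
  L1 mu (fun y => wcell j c y * f y).
Proof.
move=> mf fM; have [iw _] := wcell_L1 j c.
apply: (@L1_le _ _ _ _ _ (fun y => M * wcell j c y)); last first.
- by move=> y; rewrite normrM (ger0_norm (wcell_ge0 _ _ _)) mulrC ler_wpM2r ?wcell_ge0.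
- exact: L1Z.
- by apply: measurable_funM => //; exact: (L1_measurable iw).
Qed.

Lemma avg_deviation j c u M a p : 1 < p -> measurable_fun setT u -> (forall x, `|u x| <= M) ->
  `|a - avgc j u c| `^ p <= \int[mu]_y (wcell j c y * `|a - u y| `^ p).
Proof.
move=> p1 mu_ uM; have p0 : 0 < p by exact: lt_trans p1.
have [iw w1] := wcell_L1 j c.
have mau : measurable_fun setT (fun y => a - u y) by exact: measurable_funB.
have := @rint_jensen _ _ _ mu (wcell j c) (fun y => a - u y) p p1 (wcell_ge0 j c) iw w1 mau.
have -> : \int[mu]_y (wcell j c y * (a - u y)) = a - avgc j u c.
  have iu := L1_wcell_bounded j c mu_ uM.
  under eq_Rintegral do rewrite mulrBr [_ * a]mulrC.
  by rewrite rintB//; [rewrite rintZ// w1 mulr1|exact: L1Z].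
have h : L1 mu (fun y => wcell j c y * `|a - u y| `^ p).
  apply: (@L1_wcell_bounded _ _ _ ((`|a| + M) `^ p)).
    apply: (measurableT_comp (f := fun t : R => t `^ p)) => //.
    exact: measurableT_comp.
  have M0 : 0 <= M by apply: le_trans (uM 0).
  move=> x; rewrite ger0_norm ?powR_ge0// ge0_ler_powR ?nnegrE ?addr_ge0 ?(ltW p0)//.
  by rewrite (le_trans (ler_normB _ _))// lerD.
by move=> /(_ h)[].
Qed.

End cell_averages.

(** * The Sobolev inequality *)

Section geometric_tools.
Context {R : realType}.

Lemma pow2_powR j : (2 ^+ j : R) = 2 `^ j%:R.
Proof. by rewrite powR_mulrn. Qed.

Lemma nneseries_geometric (A x : R) : 0 <= A -> 0 < x < 1 ->
  (\sum_(0 <= k <oo) (A * x ^+ k)%:E = (A / (1 - x))%:E)%E.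
Proof.
move=> A0 /andP[x0 x1]; apply/cvg_lim => //.
rewrite (_ : (fun N => _) = EFin \o series (geometric A x)); last first.
  by apply/funext => N; rewrite /= sumEFin.
apply/fine_cvgP; split; first by near=> k.
by apply: cvg_geometric_series; rewrite ger0_norm// ltW.
Unshelve. all: by end_near.
Qed.

(** Iterating towards larger indices leaves the term l^N s (j + N), which the a priori decay E v^j
    sends to 0. The bound E v^j is used only qualitatively: the conclusion does not contain E. *)
Lemma backward_recursion (s : nat -> R) l B m E v : 0 <= l -> 0 <= m -> 0 <= v ->
  l * m < 1 -> l * v < 1 -> 0 <= B -> (forall j, 0 <= s j) ->
  (forall j, s j <= l * s j.+1 + B * m ^+ j) -> (forall j, s j <= E * v ^+ j) ->
  forall j, s j <= B * m ^+ j / (1 - l * m).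
Proof.
move=> l0 m0 v0 lm lv B0 s0 hs hE j; set A := _ / _.
have it N : s j <= l ^+ N * s (j + N)%N + (1 - (l * m) ^+ N) * A.
  elim: N => [|N IH]; first by rewrite expr0 mul1r addn0 expr0 subrr mul0r addr0.
  apply: le_trans IH _; rewrite addnS exprSr -mulrA.
  have h := ler_wpM2l (exprn_ge0 N l0) (hs (j + N)%N).
  apply: le_trans (lerD h (lexx _)) _; rewrite mulrDr -addrA lerD2l.
  have -> : l ^+ N * (B * m ^+ (j + N)) = (l * m) ^+ N * (1 - l * m) * A.
    rewrite /A -mulrA [(1 - _) * _]mulrC divfK ?gt_eqF ?subr_gt0// exprMn exprD.
    by move: (l ^+ N) (m ^+ j) (m ^+ N) => a b c; ring.
  by rewrite exprS; move: ((l * m) ^+ N) (l * m) => a b; rewrite le_eqVlt; apply/orP; left; apply/eqP; ring.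
have A0 : 0 <= A by rewrite divr_ge0 ?mulr_ge0 ?exprn_ge0// subr_ge0 ltW.
have c : (E * v ^+ j) * (l * v) ^+ N + A @[N --> \oo] --> 0 + A.
  apply: cvgD; last exact: cvg_cst.
  rewrite -[X in _ --> X](mulr0 (E * v ^+ j)); apply: cvgM; first exact: cvg_cst.
  by apply: cvg_expr; rewrite ger0_norm// mulr_ge0.
rewrite -[leRHS]add0r -(cvg_lim (@Rhausdorff R) c); apply: limr_ge.
  by apply/cvg_ex; eexists; exact: c.
apply: nearW => N; apply: le_trans (it N) _; rewrite lerD//.
  have := ler_wpM2l (exprn_ge0 N l0) (hE (j + N)%N) => /le_trans; apply.
  rewrite exprD exprMn le_eqVlt; apply/orP; left; apply/eqP.
  by move: (l ^+ N) (v ^+ j) (v ^+ N) => a b d; ring.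
by rewrite ler_piMl// gerBl exprn_ge0// mulr_ge0.
Qed.

Lemma powR_le_interp (a S p q : R) : 0 < p -> p <= q -> 0 <= a -> a `^ p <= S ->
  a `^ q <= S `^ (q / p - 1) * a `^ p.
Proof.
move=> p0 pq a0 aS.
have pn0 : p != 0 by rewrite gt_eqF.
have qpn0 : q / p != 0 by rewrite gt_eqF// divr_gt0// (lt_le_trans p0).
have -> : a `^ q = (a `^ p) `^ (q / p - 1) * a `^ p.
  by rewrite (powRB1 (powR_ge0 a p) qpn0) -powRrM mulrC divfK.
rewrite ler_wpM2r ?powR_ge0// ge0_ler_powR ?nnegrE ?powR_ge0//.
  by rewrite subr_ge0 ler_pdivlMr// mul1r.
by rewrite (le_trans _ aS)// powR_ge0.
Qed.

End geometric_tools.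

Section sobolev_estimates.
Context {R : realType} (n : nat) (p : R) (p1 : 1 < p).
Local Notation mu := (lebesgue_rV R n).
Implicit Types (u : 'rV[R]_n -> R) (z : 'rV[R]_n) (Omega : set 'rV[R]_n).

Let p0 : 0 < p. Proof. exact: lt_trans p1. Qed.

Lemma measurable_powR_norm d (T : measurableType d) (f : T -> R) q : measurable_fun setT f ->
  measurable_fun setT (fun x => `|f x| `^ q).
Proof.
move=> mf; apply: (measurableT_comp (f := fun t : R => t `^ q)) => //.
exact: measurableT_comp.
Qed.

Lemma tonelli_incr Omega u (w : 'rV[R]_n -> R) : Cc_infty Omega u ->
  measurable_fun setT w -> (forall z, 0 <= w z) ->
  (\int[mu]_x \int[mu]_z (w z * `|u (x + z)%R - u x| `^ p)%:E =
   \int[mu]_z (w z * incr p u z)%:E)%E.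
Proof.
move=> hu mw w0; have mU := Cc_meas hu.
rewrite (@fubini_tonelli _ _ _ _ R mu mu
  (fun xz => (w xz.2 * `|u (xz.1 + xz.2)%R - u xz.1| `^ p)%:E)) /=; last 2 first.
- apply/measurable_EFinP; apply: measurable_funM.
    by apply: (measurableT_comp mw); exact: measurable_snd.
  apply: measurable_powR_norm; apply: measurable_funB.
    by apply: (measurableT_comp mU); exact: measurable_fun_add2.
  by apply: (measurableT_comp mU); exact: measurable_fst.
- by move=> xz; rewrite lee_fin mulr_ge0// powR_ge0.
apply: eq_integral => z _.
have h := L1_increment z p0 hu.
by rewrite L1_integralE ?rintZ//; exact: L1Z.
Qed.

(** 2^n is the ratio of the volume of a cube of half side 2^-j to that of a cell of side 2^-j; n^p
    comes from [incr_le]. *)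
Definition avgC : R := 2 ^+ n * n%:R `^ p.

Lemma avgC_ge0 : 0 <= avgC.
Proof. by rewrite mulr_ge0 ?powR_ge0 ?exprn_ge0. Qed.

(** By Jensen the deviation at x is at most the mean of |u x - u y|^p over the cell of x, which lies
    in x + [cube rho]. After the substitution y = x + z and Tonelli, [incr_le] applies for each
    z. *)
Lemma avg_Lp Omega u j : Cc_infty Omega u ->
  L1 mu (fun x => `|u x - avg j u x| `^ p) /\
  \int[mu]_x (`|u x - avg j u x| `^ p) <=
    avgC * (2^-1 ^+ j) `^ p * energy mu p (grad u).
Proof.
move=> hu; have mU := Cc_meas hu; have [M M0 hM] := Cc_bounded hu.
set rho : R := 2^-1 ^+ j; have rho0 : 0 < rho by rewrite exprn_gt0// invr_gt0.
have I0 := energy_ge0 mu p (grad u).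
pose w z : R := (2 ^+ j) ^+ n * \1_(cube rho) z.
have w0 z : 0 <= w z by rewrite mulr_ge0 ?exprn_ge0.
have mc : measurable (cube rho : set 'rV[R]_n) by exact: measurable_cube.
have mw : measurable_fun setT w by apply: measurable_funM => //; exact: measurable_indic.
have mf : measurable_fun setT (fun x => `|u x - avg j u x| `^ p).
  by apply: measurable_powR_norm; apply: measurable_funB => //; exact: measurable_avg.
apply: L1_lty_rint => //.
apply: (@le_trans _ _ (\int[mu]_x \int[mu]_z (w z * `|u (x + z)%R - u x| `^ p)%:E)%E).
  apply: ge0_le_integral => //.
  - exact/measurable_EFinP.
  - have := @measurable_fun_fubini_tonelli_F _ _ _ _ R mu
      (fun xz : 'rV[R]_n * 'rV[R]_n => (w xz.2 * `|u (xz.1 + xz.2)%R - u xz.1| `^ p)%:E).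
    apply; last by move=> xz; rewrite lee_fin mulr_ge0// powR_ge0.
    apply/measurable_EFinP; apply: measurable_funM.
      by apply: (measurableT_comp mw); exact: measurable_snd.
    apply: measurable_powR_norm; apply: measurable_funB.
      by apply: (measurableT_comp mU); exact: measurable_fun_add2.
    by apply: (measurableT_comp mU); exact: measurable_fst.
  - move=> x _.
    have dev := @avg_deviation R n j (cell j x) u M (u x) p p1 mU hM.
    have mux : measurable_fun setT (fun y : 'rV[R]_n => u x - u y) by exact: measurable_funB.
    have iw : L1 mu (fun y => wcell j (cell j x) y * `|u x - u y| `^ p).
      apply: (@L1_wcell_bounded _ _ _ _ _ ((M + M) `^ p)); first exact: measurable_powR_norm.
      move=> y; rewrite ger0_norm ?powR_ge0// ge0_ler_powR ?nnegrE ?addr_ge0 ?(ltW p0)//.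
      by rewrite (le_trans (ler_normB _ _))// lerD.
    rewrite (le_trans (y := (\int[mu]_y (wcell j (cell j x) y * `|u x - u y| `^ p))%:E))//.
    rewrite -(L1_integralE iw).
    have <- : (\int[mu]_z (w (z + x - x)%R * `|u (z + x)%R - u x| `^ p)%:E =
      \int[mu]_z (w z * `|u (x + z)%R - u x| `^ p)%:E)%E.
      by apply: eq_integral => z _; rewrite addrK (addrC z x).
    have mwx : measurable_fun setT (fun z : 'rV[R]_n => w (z - x)%R).
      exact: (measurableT_comp mw (measurable_fun_addr (- x))).
    rewrite (@integral_translate R n x (fun y => (w (y - x)%R * `|u y - u x| `^ p)%:E)) /=; last 2 first.
    + apply/measurable_EFinP; apply: measurable_funM => //.
      by apply: measurable_powR_norm; apply: measurable_funB.
    + by move=> y; rewrite lee_fin mulr_ge0// powR_ge0.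
    apply: ge0_le_integral => //.
    + by move=> y _; rewrite lee_fin mulr_ge0 ?wcell_ge0 ?powR_ge0.
    + by apply/measurable_EFinP; exact: L1_measurable iw.
    + apply/measurable_EFinP; apply: measurable_funM => //.
      by apply: measurable_powR_norm; apply: measurable_funB.
    + move=> y _; rewrite lee_fin distrC wcellE; case: eqP => [e|_]; last first.
        by rewrite mul0r mulr_ge0// powR_ge0.
      rewrite ler_wpM2r ?powR_ge0// /w indicE mem_set ?mulr1//.
      by apply/cubeP => i; rewrite !mxE; exact: cell_dist.
rewrite (tonelli_incr hu mw w0).
apply: (@le_trans _ _ (\int[mu]_z (((2 ^+ j) ^+ n * ((n%:R * rho) `^ p * energy mu p (grad u)))%:E *
     (\1_(cube rho) z)%:E))%E).
  apply: ge0_le_integral => //.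
  - by move=> z _; rewrite lee_fin (mulr_ge0 (w0 z) (incr_ge0 p u z)).
  - apply/measurable_EFinP; apply: measurable_funM => //.
    have := @measurable_fun_fubini_tonelli_G _ _ _ _ R mu
      (fun xz : 'rV[R]_n * 'rV[R]_n => (`|u (xz.1 + xz.2)%R - u xz.1| `^ p)%:E).
    move=> H; apply/measurable_EFinP.
    rewrite (_ : (EFin \o _) = fubini_G mu
      (fun xz : 'rV[R]_n * 'rV[R]_n => (`|u (xz.1 + xz.2)%R - u xz.1| `^ p)%:E)).
      apply: H => [|xz]; last by rewrite lee_fin powR_ge0.
      apply/measurable_EFinP; apply: measurable_powR_norm; apply: measurable_funB.
        by apply: (measurableT_comp mU); exact: measurable_fun_add2.
      by apply: (measurableT_comp mU); exact: measurable_fst.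
    by apply/funext => z; rewrite /fubini_G/= L1_integralE//; exact: L1_increment hu.
  - by apply: emeasurable_funM => //; apply/measurable_EFinP; exact: measurable_indic.
  - move=> z _; rewrite -EFinM lee_fin /w indicE.
    case: (boolP (z \in _)) => [/set_mem/cubeP hz|_]; last by rewrite !mulr0 mul0r.
    by rewrite !mulr1 ler_wpM2l ?exprn_ge0//; exact: incr_le p1 hu (ltW rho0) hz.
rewrite ge0_integralZl//; last 2 first.
- by apply/measurable_EFinP; exact: measurable_indic.
- by rewrite lee_fin !mulr_ge0 ?exprn_ge0 ?powR_ge0.
rewrite integral_indic// setIT.
apply: (@le_trans _ _ ((((2 ^+ j) ^+ n * ((n%:R * rho) `^ p * energy mu p (grad u)))%:E * mu (cube rho))%E)) => //.
rewrite lebesgue_cube ?(ltW rho0)// -EFinM lee_fin /avgC powRM ?(ltW rho0)// exprMn.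
have e1 : (2 ^+ j) ^+ n * rho ^+ n = 1.
  by rewrite -exprMn /rho exprVn divff ?expr1n// expf_neq0.
move: e1; move: ((2 ^+ j) ^+ n) (rho ^+ n) (n%:R `^ p) (rho `^ p) (energy _ _ _) => t a b c e ta.
rewrite le_eqVlt; apply/orP; left; apply/eqP.
transitivity (t * a * (2 ^+ n * b * c * e)); first by ring.
by rewrite ta mul1r.
Qed.

(** [avg j u] is constant on the cell of level j + 1, so the difference is a mean of u - avg j u
    over that cell, whose density is (2^(j+1))^n. *)
Lemma avg_diff_sup Omega u j x : Cc_infty Omega u ->
  `|avg j.+1 u x - avg j u x| `^ p <=
  (2 ^+ j.+1) ^+ n * \int[mu]_x (`|u x - avg j u x| `^ p).
Proof.
move=> hu; have mU := Cc_meas hu; have [M M0 hM] := Cc_bounded hu.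
have [iA _] := avg_Lp j hu.
rewrite distrC.
apply: le_trans (@avg_deviation R n j.+1 (cell j.+1 x) u M (avg j u x) p p1 mU hM) _.
rewrite -(rintZ _ iA); apply: rint_le => [||y].
- apply: (@L1_wcell_bounded _ _ _ _ _ ((`|avg j u x| + M) `^ p)).
    by apply: measurable_powR_norm; exact: measurable_funB.
  move=> y; rewrite ger0_norm ?powR_ge0// ge0_ler_powR ?nnegrE ?addr_ge0 ?(ltW p0)//.
  by rewrite (le_trans (ler_normB _ _))// lerD.
- exact: L1Z.
- rewrite wcellE; case: eqP => [e|_]; last by rewrite mul0r mulr_ge0 ?exprn_ge0 ?powR_ge0.
  by rewrite -(avg_refine u e) distrC.
Qed.

Lemma avg_diff_Lp Omega u j : Cc_infty Omega u ->
  L1 mu (fun x => `|avg j.+1 u x - avg j u x| `^ p) /\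
  \int[mu]_x (`|avg j.+1 u x - avg j u x| `^ p) <=
    2 `^ p * (2 * avgC * (2^-1 ^+ j) `^ p * energy mu p (grad u)).
Proof.
move=> hu; have [i0 e0] := avg_Lp j hu; have [i1 e1] := avg_Lp j.+1 hu.
have I0 := energy_ge0 mu p (grad u).
have pt x : `|avg j.+1 u x - avg j u x| `^ p <=
    2 `^ p * (`|u x - avg j.+1 u x| `^ p + `|u x - avg j u x| `^ p).
  have := powR_add_le (ltW p1) (normr_ge0 (u x - avg j.+1 u x)) (normr_ge0 (u x - avg j u x)).
  apply: le_trans; rewrite ge0_ler_powR ?nnegrE ?addr_ge0 ?(ltW p0)//.
  have := ler_normB (u x - avg j u x) (u x - avg j.+1 u x).
  by rewrite [leRHS]addrC; congr (`|_| <= _); ring.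
have iD := L1Z (2 `^ p) (L1D i1 i0).
have iA : L1 mu (fun x => `|avg j.+1 u x - avg j u x| `^ p).
  apply: L1_le iD _; last by move=> x; rewrite ger0_norm ?powR_ge0.
  by apply: measurable_powR_norm; apply: measurable_funB; exact: measurable_avg.
split => //; apply: le_trans (rint_le iA iD pt) _.
rewrite rintZ ?rintD//; last exact: L1D.
rewrite ler_wpM2l ?powR_ge0//; apply: le_trans (lerD e1 e0) _.
have rr : (2^-1 ^+ j.+1 : R) `^ p <= (2^-1 ^+ j) `^ p.
  rewrite ge0_ler_powR ?nnegrE ?exprn_ge0 ?invr_ge0 ?(ltW p0)//.
  by rewrite exprS ler_piMl ?exprn_ge0 ?invr_ge0// invf_le1// ler1n.
have aux (A a b I : R) : 0 <= A -> 0 <= I -> a <= b -> A * a * I + A * b * I <= 2 * A * b * I.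
  move=> A0 hI ab; rewrite -!mulrA [leRHS]mulr_natl mulr2n lerD2r ler_wpM2l//.
  by rewrite ler_wpM2r.
exact: aux avgC_ge0 I0 rr.
Qed.

End sobolev_estimates.

Section powR_complements.
Context {R : realType}.
Implicit Types x e : R.

Lemma exprn_powR x e j : 0 <= x -> (x ^+ j) `^ e = (x `^ e) ^+ j.
Proof. by move=> x0; rewrite -powR_mulrn// -powRrM mulrC powRrM powR_mulrn ?powR_ge0. Qed.

Lemma powR_itv01 x e : 0 < x < 1 -> 0 < e -> 0 < x `^ e < 1.
Proof.
move=> /andP[x0 x1] e0; rewrite powR_gt0//=.
have -> : 1 = 1 `^ e :> R by rewrite powR1.
by rewrite gt0_ltr_powR ?nnegrE ?ler01// ltW.
Qed.

End powR_complements.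

Lemma rint_le_lin d (T : measurableType d) (R : realType)
    (mu : {measure set T -> \bar R}) (f g h : T -> R) a b :
  L1 mu f -> L1 mu g -> L1 mu h -> (forall x, f x <= a * g x + b * h x) ->
  \int[mu]_x f x <= a * \int[mu]_x g x + b * \int[mu]_x h x.
Proof.
move=> hf hg hh le; have i1 := L1Z a hg; have i2 := L1Z b hh.
by apply: le_trans (rint_le hf (L1D i1 i2) le) _; rewrite (rintD i1 i2) (rintZ _ hg) (rintZ _ hh).
Qed.

Section sobolev_inequality.
Context {R : realType} (n : nat) (p q : R).
Hypotheses (p1 : 1 < p) (pn : p < n%:R) (pq : p <= q) (qs : (n%:R - p) * (q / p - 1) < p).
Local Notation mu := (lebesgue_rV R n).
Implicit Types (u : 'rV[R]_n -> R) (z : 'rV[R]_n) (Omega : set 'rV[R]_n).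
Local Notation a := (q / p - 1).
Local Notation avgC := (avgC n p).

Let p0 : 0 < p. Proof. exact: lt_trans p1. Qed.
Let pn0 : p != 0. Proof. by rewrite gt_eqF. Qed.
Let q0 : 0 < q. Proof. exact: lt_le_trans pq. Qed.
Let q1 : 1 < q. Proof. exact: lt_le_trans pq. Qed.
Let a0 : 0 <= a. Proof. by rewrite subr_ge0 ler_pdivlMr// mul1r. Qed.
Let qp0 : q / p != 0. Proof. by rewrite gt_eqF// divr_gt0. Qed.
Let half0 : (0 : R) <= 2^-1. Proof. by rewrite invr_ge0. Qed.

(* [(2 ^ n (1/2)^p) ^ j] bounds the growth of the sup norm of the differences
   of consecutive averages, and [(1/2)^(p j)] the decay of their [L^p] norm. *)
Definition avg_ratio : R := (2 ^+ n * 2^-1 `^ p) `^ a * 2^-1 `^ p.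

Let half_powR : (2^-1 : R) `^ p = 2 `^ (- p).
Proof. by rewrite -[2^-1]powR_inv1// -powRrM mulN1r. Qed.

Lemma avg_ratioE : avg_ratio = 2 `^ ((n%:R - p) * a - p).
Proof.
rewrite /avg_ratio half_powR pow2_powR -powRD ?pnatr_eq0 ?implybT//.
by rewrite -powRrM -powRD ?pnatr_eq0 ?implybT.
Qed.

(** The subcriticality [qs] says exactly that the exponent in [avg_ratioE] is negative. *)
Lemma avg_ratio_lt1 : 0 < avg_ratio < 1.
Proof.
rewrite avg_ratioE powR_gt0//= /powR pnatr_eq0/= expR_lt1.
by rewrite pmulr_llt0 ?ln_gt0 ?ltr1n// subr_lt0.
Qed.

Lemma avg_ratio_ge : 2^-1 `^ p <= avg_ratio.
Proof.
by rewrite avg_ratioE half_powR ler_powR ?ler1n// lerBrDr addNr mulr_ge0// subr_ge0 ltW.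
Qed.

Lemma avg_le j u M x : measurable_fun setT u -> (forall x, `|u x| <= M) -> `|avg j u x| <= M.
Proof.
move=> mu_ hM; rewrite /avg /avgc; have [iw w1] := @wcell_L1 R n j (cell j x).
have i1 := L1_wcell_bounded j (cell j x) mu_ hM.
apply: le_trans (rint_norm i1) _.
rewrite -[M]mulr1 -w1 -(rintZ _ iw); apply: rint_le.
- exact: L1_norm.
- exact: L1Z.
- by move=> y; rewrite normrM (ger0_norm (wcell_ge0 _ _ _)) mulrC ler_wpM2r ?wcell_ge0.
Qed.

(** Interpolation between the sup norm and the L^p norm: the first may grow with j, and the decay of
    the second outweighs this growth since q is subcritical. *)
Lemma avg_diff_Lq : exists2 C, 0 <= C & forall Omega u j, Cc_infty Omega u ->
  L1 mu (fun x => `|avg j.+1 u x - avg j u x| `^ q) /\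
  \int[mu]_x (`|avg j.+1 u x - avg j u x| `^ q) <=
    C * energy mu p (grad u) `^ (q / p) * avg_ratio ^+ j.
Proof.
exists ((2 ^+ n * avgC) `^ a * (2 `^ p * 2 * avgC)).
  by rewrite !mulr_ge0 ?powR_ge0.
move=> Omega u j hu; set I := energy _ _ _; have I0 : 0 <= I by exact: energy_ge0.
have [iD eD] := avg_diff_Lp p1 j hu; have [_ e0] := avg_Lp p1 j hu.
set r := (2^-1 ^+ j) `^ p in eD e0; have r0 : 0 <= r by exact: powR_ge0.
set S := (2 ^+ j.+1) ^+ n * (avgC * r * I).
have pt x : `|avg j.+1 u x - avg j u x| `^ q <= S `^ a * `|avg j.+1 u x - avg j u x| `^ p.
  apply: powR_le_interp => //; apply: le_trans (avg_diff_sup p1 j x hu) _.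
  by rewrite ler_wpM2l ?exprn_ge0.
have iq : L1 mu (fun x => `|avg j.+1 u x - avg j u x| `^ q).
  apply: L1_le (L1Z (S `^ a) iD) _; last by move=> x; rewrite ger0_norm ?powR_ge0.
  by apply: measurable_powR_norm; apply: measurable_funB; exact: measurable_avg.
split => //; apply: le_trans (rint_le iq (L1Z _ iD) pt) _; rewrite (rintZ _ iD).
apply: le_trans (ler_wpM2l (powR_ge0 _ _) eD) _.
have -> : S = 2 ^+ n * avgC * (2 ^+ n * 2^-1 `^ p) ^+ j * I.
  rewrite /S /r exprn_powR// -exprM mulnC exprM exprSr exprMn -exprM mulnC exprM.
  by clearbody I; move: ((2 ^+ j) ^+ n) (2 ^+ n) (avgC) (_ `^ p ^+ j) => b c d e; ring.
rewrite /r (exprn_powR _ _ half0) /avg_ratio -(powRB1 I0 qp0).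
set b := 2 ^+ n * 2^-1 `^ p; rewrite (exprMn j (b `^ a)); have b0 : 0 <= b by rewrite mulr_ge0 ?powR_ge0 ?exprn_ge0.
rewrite powRM ?mulr_ge0 ?exprn_ge0// powRM ?mulr_ge0 ?exprn_ge0// exprn_powR//.
rewrite -/I; clearbody I; move: ((2 ^+ n * avgC) `^ a) (_ ^+ j) (_ ^+ j) (I `^ _) (2 `^ p) => A B D J P.
by rewrite le_eqVlt; apply/orP; left; apply/eqP; move: avgC => c; ring.
Qed.

Lemma avg_Lq : exists2 C, 0 <= C & forall Omega u j, Cc_infty Omega u ->
  L1 mu (fun x => `|u x - avg j u x| `^ q) /\
  \int[mu]_x (`|u x - avg j u x| `^ q) <=
    C * energy mu p (grad u) `^ (q / p) * avg_ratio ^+ j.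
Proof.
have [C9 C90 hC9] := avg_diff_Lq.
set nu := avg_ratio; have /andP[nu0 nu1] := avg_ratio_lt1.
(* Chosen so that k^(1-q) = nu^(-1/2): the loss l at each step of the recursion is then outweighed
   by the gain nu, since l nu = nu^(1/2) < 1. *)
pose k := nu `^ (2^-1 / (q - 1)).
have qm : 0 < q - 1 by rewrite subr_gt0.
have /andP[k0 k1] : 0 < k < 1 by apply: powR_itv01; [rewrite nu0 nu1|rewrite divr_gt0].
pose t := 1 - k; have t01 : 0 < t < 1 by rewrite subr_gt0 k1 ltrBlDr ltrDl k0.
pose l := nu `^ (- 2^-1).
have kl : (1 - t) `^ (1 - q) = l.
  rewrite /t opprB addrC subrK /k -powRrM /l; congr (_ `^ _).
  by rewrite -[1 - q]opprB mulrN divfK// gt_eqF.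
have l0 : 0 <= l by exact: powR_ge0.
have lnu : l * nu < 1.
  rewrite /l -[X in _ * X](powRr1 (ltW nu0)) -powRD ?(gt_eqF nu0) ?implybT//.
  have -> : - 2^-1 + 1 = 2^-1 :> R by lra.
  by have /andP[] : 0 < nu `^ 2^-1 < 1 by apply: powR_itv01; rewrite ?nu0 ?nu1 ?invr_gt0.
(* The decay rate of the L^p deviations. For a bounded u it is also an L^q rate, with a constant
   that depends on the bound of u; [backward_recursion] removes this dependence. *)
set v : R := 2^-1 `^ p.
exists (t `^ (1 - q) * C9 / (1 - l * nu)).
  by rewrite divr_ge0 ?mulr_ge0 ?powR_ge0// subr_ge0 ltW.
move=> Omega u j hu; have mU := Cc_meas hu; have [M M0 hM] := Cc_bounded hu.
set I := energy _ _ _; have I0 : 0 <= I by exact: energy_ge0.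
have bd i x : `|u x - avg i u x| <= M + M.
  by rewrite (le_trans (ler_normB _ _))// lerD//; exact: avg_le.
have pt i x : `|u x - avg i u x| `^ q <= ((M + M) `^ p) `^ a * `|u x - avg i u x| `^ p.
  by apply: powR_le_interp => //; rewrite ge0_ler_powR ?nnegrE ?addr_ge0 ?(ltW p0).
have mA i := measurable_funB mU (@measurable_avg R n i u).
have iq i : L1 mu (fun x => `|u x - avg i u x| `^ q).
  have [ip _] := avg_Lp p1 i hu.
  apply: L1_le (L1Z (((M + M) `^ p) `^ a) ip) _; last by move=> x; rewrite ger0_norm ?powR_ge0.
  exact: measurable_powR_norm (mA i).
split => //.
have h := @backward_recursion R (fun i => \int[mu]_x (`|u x - avg i u x| `^ q)) l
  (t `^ (1 - q) * C9 * I `^ (q / p)) nu (((M + M) `^ p) `^ a * (avgC * I)) v.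
have -> : t `^ (1 - q) * C9 / (1 - l * nu) * I `^ (q / p) * nu ^+ j =
  t `^ (1 - q) * C9 * I `^ (q / p) * nu ^+ j / (1 - l * nu).
  by move: (1 - l * nu)^-1 => w; ring.
apply: h.
- exact: l0.
- exact: ltW.
- exact: powR_ge0.
- exact: lnu.
- by apply: le_lt_trans lnu; rewrite ler_wpM2l//; exact: avg_ratio_ge.
- by rewrite !mulr_ge0 ?powR_ge0.
- by move=> i; apply: rint_ge0 => x; exact: powR_ge0.
- move=> i; have [iD eD] := hC9 _ _ i hu.
  have tr x : `|u x - avg i u x| `^ q <=
      l * `|u x - avg i.+1 u x| `^ q + t `^ (1 - q) * `|avg i.+1 u x - avg i u x| `^ q.
    rewrite -kl; apply: le_trans (powR_convex2 (ltW q1) t01 (normr_ge0 _) (normr_ge0 _)).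
    rewrite ge0_ler_powR ?nnegrE ?addr_ge0 ?(ltW q0)//.
    by have := ler_normD (u x - avg i.+1 u x) (avg i.+1 u x - avg i u x); rewrite addrA subrK.
  apply: le_trans (rint_le_lin (iq i) (iq i.+1) iD tr) _.
  apply: lerD; first exact: lexx.
  by have := ler_wpM2l (powR_ge0 t (1 - q)) eD; rewrite !mulrA.
- move=> i; have [ip ep] := avg_Lp p1 i hu.
  apply: le_trans (rint_le (iq i) (L1Z _ ip) (pt i)) _; rewrite (rintZ _ ip).
  rewrite -mulrA ler_wpM2l ?powR_ge0//; apply: le_trans ep _.
  by rewrite exprn_powR// mulrAC.
Qed.

(** A translation by 2L + 1, more than the width of [Omega], moves the support off itself; on the
    support, u is then equal to an increment up to sign. *)
Lemma poincare Omega : bounded_set Omega -> exists2 C, 0 <= C & forall u, Cc_infty Omega u ->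
  \int[mu]_x (`|u x| `^ p) <= C * energy mu p (grad u).
Proof.
move=> /bounded_set_box[L L0 hL].
have n0 : (0 < n)%N by rewrite -(ltr_nat R) (lt_trans p0).
pose i0 := Ordinal n0; pose rho := 2 * L + 1.
have rho0 : 0 <= rho by rewrite addr_ge0// mulr_ge0// ltW.
exists ((n%:R * rho) `^ p); first exact: powR_ge0.
move=> u hu; pose z : 'rV[R]_n := rho *: delta_mx ord0 i0.
have hz i : `|z ord0 i| <= rho.
  by rewrite !mxE eqxx/=; case: eqP => _; rewrite ?mulr1 ?mulr0 ?normr0// ger0_norm.
apply: le_trans (incr_le p1 hu rho0 hz); apply: rint_le.
- exact: Cc_L1_powR hu.
- exact: L1_increment hu.
- move=> x; have [ux|ux] := eqVneq (u x) 0.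
    by rewrite ux normr0 powR0// powR_ge0.
  have Ox : Omega x by apply: contrapT => /(Cc_outside hu)/eqP; rewrite (negbTE ux).
  have -> : u (x + z) = 0.
    apply: (Cc_outside hu) => Oxz; have := hL _ i0 Oxz; have := hL _ i0 Ox.
    rewrite !mxE !eqxx/= mulr1 !ler_norml /rho => /andP[h1 h2] /andP[h3 h4].
    by move: (x ord0 i0) h1 h2 h3 h4 => y h1 h2 h3 h4; lra.
  by rewrite sub0r normrN.
Qed.

(** u is split into its deviation from the averages of level 0, bounded by [avg_Lq], and these
    averages, bounded in sup norm and in L^p through Jensen and Poincare and interpolated between
    the two. *)
Lemma sobolev Omega : bounded_set Omega -> exists2 C, 0 <= C & forall u, Cc_infty Omega u ->
  \int[mu]_x (`|u x| `^ q) <= C * energy mu p (grad u) `^ (q / p).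
Proof.
move=> /poincare[K K0 hK]; have [C10 C100 hC] := avg_Lq.
exists (2 `^ q * (C10 + K `^ a * (2 `^ p * (avgC + K)))).
  by rewrite !(mulr_ge0, addr_ge0, powR_ge0).
move=> u hu; have mU := Cc_meas hu; have [M M0 hM] := Cc_bounded hu.
set I := energy _ _ _; have I0 : 0 <= I by exact: energy_ge0.
have [iq eq] := hC _ _ 0 hu; have [ip ep] := avg_Lp p1 0 hu.
have iu := Cc_L1_powR p0 hu; have hKu := hK u hu.
have tri (e x y : R) : 1 < e -> `|y| `^ e <= 2 `^ e * (`|x - y| `^ e + `|x| `^ e).
  move=> e1; apply: le_trans (powR_add_le (ltW e1) (normr_ge0 _) (normr_ge0 _)).
  rewrite ge0_ler_powR ?nnegrE ?addr_ge0// ?(ltW (lt_trans ltr01 e1))//.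
  by have := ler_normB x (x - y); rewrite opprB addrC subrK addrC.
have ptA x : `|avg 0 u x| `^ p <= K * I.
  apply: le_trans hKu.
  have := @avg_deviation R n 0 (cell 0 x) u M 0 p p1 mU hM.
  rewrite sub0r normrN => h; apply: le_trans h _; apply: rint_le => // [|y].
    apply: (@L1_wcell_bounded _ _ _ _ _ (M `^ p)).
      apply: measurable_powR_norm; exact: measurable_funB.
    by move=> y; rewrite sub0r normrN ger0_norm ?powR_ge0// ge0_ler_powR ?nnegrE ?(ltW p0).
  rewrite wcellE expr0 expr1n sub0r normrN; case: ifP => _; first by rewrite mul1r.
  by rewrite mul0r powR_ge0.
pose G x := 2 `^ p * (`|u x - avg 0 u x| `^ p + `|u x| `^ p).
have iG : L1 mu G by exact: L1Z (L1D ip iu).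
pose H x := 2 `^ q * (`|u x - avg 0 u x| `^ q + (K * I) `^ a * G x).
have iH : L1 mu H by apply: L1Z; apply: L1D => //; exact: L1Z.
have pt x : `|u x| `^ q <= H x.
  have := powR_add_le (ltW q1) (normr_ge0 (u x - avg 0 u x)) (normr_ge0 (avg 0 u x)).
  move=> h; apply: (le_trans (le_trans _ h)).
    rewrite ge0_ler_powR ?nnegrE ?addr_ge0 ?(ltW q0)//.
    by have := ler_normD (u x - avg 0 u x) (avg 0 u x); rewrite subrK.
  rewrite ler_wpM2l ?powR_ge0// lerD2l.
  apply: le_trans (powR_le_interp p0 pq (normr_ge0 _) (ptA x)) _.
  by rewrite ler_wpM2l ?powR_ge0//; exact: tri.
apply: le_trans (rint_le (Cc_L1_powR q0 hu) iH pt) _.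
rewrite (rintZ _ (L1D iq (L1Z ((K * I) `^ a) iG))) (rintD iq (L1Z ((K * I) `^ a) iG)) (rintZ _ iG).
rewrite (rintZ _ (L1D ip iu)) (rintD ip iu) -!mulrA ler_wpM2l ?powR_ge0// mulrDl.
apply: lerD; first by apply: le_trans eq _; rewrite expr0 mulr1.
rewrite powRM// -(powRB1 I0 qp0) -!mulrA; apply: ler_wpM2l; first exact: powR_ge0.
have -> : 2 `^ p * ((avgC + K) * (I `^ a * I)) = I `^ a * (2 `^ p * ((avgC + K) * I)).
  by clearbody I; move: (2 `^ p) (I `^ a) avgC => b c d; ring.
apply: ler_wpM2l; first exact: powR_ge0.
apply: ler_wpM2l; first exact: powR_ge0.
rewrite mulrDl; apply: lerD => //; apply: le_trans ep _.
by rewrite expr0 powR1 mulr1.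
Qed.

End sobolev_inequality.

(** * The nonlocal energy *)

Section dyadic_weight.
Context {R : realType} (n : nat) (p D : R).
Hypotheses (p0 : 0 < p) (Dn : n%:R < D) (Dnp : D < n%:R + p).
Local Notation mu := (lebesgue_rV R n).
Implicit Types (z : 'rV[R]_n) (h : 'rV[R]_n -> R).

Let half0 : (0 : R) <= 2^-1. Proof. by rewrite invr_ge0. Qed.
Let half_gt0 : (0 : R) < 2^-1. Proof. by rewrite invr_gt0. Qed.
Let D0 : 0 < D. Proof. exact: le_lt_trans (ler0n _ _) Dn. Qed.

Lemma measurable_weight : measurable_fun setT (fun z => (enorm z `^ D)^-1).
Proof.
under eq_fun do rewrite -powRN.
apply: (measurableT_comp (f := fun t : R => t `^ (- D))) => //.
apply: (@measurable_enorm _ _ _ _ (fun z : 'rV[R]_n => z)) => i; exact: measurable_coord.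
Qed.

Lemma dyadic_above (E : R) : 1 < E -> exists m, 2 ^+ m < E <= 2 ^+ m.+1.
Proof.
move=> E1.
have ex : exists k, E <= 2 ^+ k.
  have := archi_boundP (ltW (lt_trans ltr01 E1)); set N := Num.bound E => EN; exists N.
  by apply: le_trans (ltW EN) _; rewrite -natrX ler_nat ltnW// ltn_expl.
case: (ex_minnP ex) => -[|m] hm minm; first by move: hm; rewrite expr0 leNgt E1.
by exists m; rewrite hm andbT ltNge; apply/negP => /minm; rewrite ltnn.
Qed.

Lemma dyadic_below (E : R) : 0 < E <= 1 -> exists m, 2^-1 ^+ m.+1 < E <= 2^-1 ^+ m.
Proof.
move=> /andP[E0 E1]; have [->|E1'] := eqVneq E 1.
  by exists 0%N; rewrite expr0 lexx andbT expr1 invf_lt1// ltr1n.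
have lt1 : 1 < E^-1 by rewrite invf_gt1// lt_neqAle E1'.
have ex : exists k, E^-1 < 2 ^+ k.
  have := archi_boundP (ltW (lt_trans ltr01 lt1)); set N := Num.bound E^-1 => EN; exists N.
  by apply: lt_le_trans EN _; rewrite -natrX ler_nat ltnW// ltn_expl.
case: (ex_minnP ex) => -[|m] hm minm; first by move: hm; rewrite expr0 ltNge (ltW lt1).
exists m; rewrite !exprVn; apply/andP; split.
  by rewrite -[E]invrK ltf_pV2 ?posrE ?invr_gt0 ?exprn_gt0.
rewrite -[E]invrK lef_pV2 ?posrE ?invr_gt0 ?exprn_gt0// leNgt.
by apply/negP => /minm; rewrite ltnn.
Qed.

Let r : R := 2^-1.
Let a_ m : R := (2 ^+ m.+1) `^ D * (r ^+ m) `^ p.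
Let b_ m : R := (r ^+ m) `^ D.

Let a0 m : 0 <= a_ m. Proof. by rewrite mulr_ge0 ?powR_ge0. Qed.
Let b0 m : 0 <= b_ m. Proof. exact: powR_ge0. Qed.

Lemma weight_pointwise h K1 K2 z : (forall z, 0 <= h z) ->
  (forall rho z, 0 <= rho -> cube rho z -> h z <= K1 * rho `^ p) ->
  (forall z, h z <= K2) -> 0 <= K1 ->
  (enorm z `^ D)^-1 * h z = 0 \/ exists m, (enorm z `^ D)^-1 * h z <=
    K1 * a_ m * \1_(cube (r ^+ m)) z + K2 * b_ m * \1_(cube (2 ^+ m.+1)) z.
Proof.
move=> h0 hK1 hK2 K10; have K20 : 0 <= K2 by exact: le_trans (h0 0) (hK2 0).
have ind0 (A : set 'rV[R]_n) : 0 <= \1_A z :> R by rewrite indicE.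
have [->|zn] := eqVneq z 0.
  by left; rewrite enorm0 powR0 ?gt_eqF// invr0 mul0r.
right; have E0 : 0 < enorm z by rewrite enorm_gt0.
have w0 : 0 <= (enorm z `^ D)^-1 by rewrite invr_ge0 powR_ge0.
have [E1|E1] := leP (enorm z) 1.
  have /dyadic_below[m /andP[h1 h2]] : 0 < enorm z <= 1 by rewrite E0.
  exists m; have zc : cube (r ^+ m) z.
    by apply/cubeP => i; apply: le_trans (coord_le_enorm z i) h2.
  rewrite indicE mem_set// mulr1 -[leLHS]addr0; apply: lerD; last first.
    by rewrite !mulr_ge0 ?powR_ge0.
  have -> : K1 * a_ m = (2 ^+ m.+1) `^ D * (K1 * (r ^+ m) `^ p) by rewrite /a_ mulrCA.
  apply: ler_pM => //; last by apply: hK1 => //; rewrite exprn_ge0.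
  rewrite -powRN -[2]invrK -/r exprVn -powR_inv1 ?exprn_ge0// -powRrM mulN1r.
  rewrite !powRN lef_pV2 ?posrE ?powR_gt0 ?exprn_gt0//.
  by rewrite ge0_ler_powR ?nnegrE ?exprn_ge0 ?(ltW D0) ?(ltW E0) ?(ltW h1).
have [m /andP[h1 h2]] := dyadic_above E1.
exists m; have zc : cube (2 ^+ m.+1) z.
  by apply/cubeP => i; apply: le_trans (coord_le_enorm z i) h2.
have -> : \1_(cube (2 ^+ m.+1)) z = 1 :> R by rewrite indicE mem_set.
rewrite mulr1 -[leLHS]add0r; apply: lerD.
  by rewrite !mulr_ge0 ?powR_ge0.
rewrite mulrC; apply: ler_pM => //.
have -> : b_ m = ((2 ^+ m) `^ D)^-1.
  by rewrite /b_ /r exprVn -[(2 ^+ m)^-1]powR_inv1 ?exprn_ge0// -powRrM mulN1r powRN.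
rewrite lef_pV2 ?posrE ?powR_gt0 ?exprn_gt0//.
by rewrite ge0_ler_powR ?nnegrE ?exprn_ge0 ?(ltW D0) ?(ltW E0) ?(ltW h1).
Qed.

(** x1 = 2^(D-p-n) and x2 = 2^(n-D) are the ratios of the geometric series of the annuli near the
    origin and far from it; D < n + p and n < D make them smaller than 1. *)
Definition weightC : R :=
  let x1 := 2 `^ D * r `^ p * r ^+ n in let x2 := r `^ D * 2 ^+ n in
  2 `^ D * 2 ^+ n / (1 - x1) + 4 ^+ n / (1 - x2).

Let r_powR e : r `^ e = 2 `^ (- e).
Proof. by rewrite /r -[2^-1]powR_inv1// -powRrM mulN1r. Qed.

Let two_lt1 e : e < 0 -> 0 < (2 : R) `^ e < 1.
Proof.
by move=> e0; rewrite powR_gt0//= /powR pnatr_eq0/= expR_lt1 pmulr_llt0 ?ln_gt0 ?ltr1n.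
Qed.

Let x1_lt1 : 0 < 2 `^ D * r `^ p * r ^+ n < 1.
Proof.
rewrite -[r ^+ n]powR_mulrn// !r_powR -!powRD ?pnatr_eq0 ?implybT//; apply: two_lt1.
by rewrite -addrA -opprD subr_lt0 addrC.
Qed.

Let x2_lt1 : 0 < r `^ D * 2 ^+ n < 1.
Proof.
by rewrite pow2_powR r_powR -powRD ?pnatr_eq0 ?implybT//; apply: two_lt1; rewrite addrC subr_lt0.
Qed.

Lemma weightC_ge0 : 0 <= weightC.
Proof.
move: x1_lt1 x2_lt1 => /andP[_ h1] /andP[_ h2].
by rewrite addr_ge0// divr_ge0 ?mulr_ge0 ?powR_ge0 ?exprn_ge0// subr_ge0 ltW.
Qed.

(* Sum over the dyadic annuli of the bound [K1 |z|^p] near the origin and of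
   the bound [K2] far from it. *)
Lemma weight_integral h K1 K2 : measurable_fun setT h -> (forall z, 0 <= h z) ->
  (forall rho z, 0 <= rho -> cube rho z -> h z <= K1 * rho `^ p) ->
  (forall z, h z <= K2) -> 0 <= K1 ->
  (\int[mu]_z ((enorm z `^ D)^-1 * h z)%:E <= ((K1 + K2) * weightC)%:E)%E.
Proof.
move=> mh h0 hK1 hK2 K10; have K20 : 0 <= K2 by exact: le_trans (h0 0) (hK2 0).
have ind0 (A : set 'rV[R]_n) z : 0 <= \1_A z :> R by rewrite indicE.
pose f m z := (K1 * a_ m * \1_(cube (r ^+ m)) z + K2 * b_ m * \1_(cube (2 ^+ m.+1)) z)%:E.
have f0 m z : (0 <= f m z)%E.
  by rewrite lee_fin addr_ge0// !mulr_ge0 ?powR_ge0.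
have mc (L : R) : measurable (cube L : set 'rV[R]_n) by exact: measurable_cube.
have mi L c : measurable_fun setT (fun z : 'rV[R]_n => c * \1_(cube L) z : R).
  by apply: measurable_funM => //; exact: measurable_indic.
have mf m : measurable_fun setT (f m).
  by apply/measurable_EFinP; apply: measurable_funD; exact: mi.
have i1 L c : 0 <= L -> 0 <= c -> (\int[mu]_z (c * \1_(cube L) z)%:E = (c * (2 * L) ^+ n)%:E)%E.
  move=> L0 c0; under eq_integral do rewrite EFinM.
  rewrite ge0_integralZl//; last by apply/measurable_EFinP; exact: measurable_indic.
  apply: (@eq_trans _ _ (c%:E * mu (cube L))%E); last by rewrite lebesgue_cube.
  by rewrite integral_indic// setIT.
have if_ m : (\int[mu]_z f m z =
    (K1 * (2 `^ D * 2 ^+ n) * (2 `^ D * r `^ p * r ^+ n) ^+ m)%:E +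
    (K2 * 4 ^+ n * (r `^ D * 2 ^+ n) ^+ m)%:E)%E.
  rewrite /f; under eq_integral do rewrite EFinD.
  rewrite ge0_integralD//; last 4 first.
  - by move=> z _; rewrite lee_fin !mulr_ge0 ?powR_ge0.
  - by apply/measurable_EFinP; exact: mi.
  - by move=> z _; rewrite lee_fin !mulr_ge0 ?powR_ge0.
  - by apply/measurable_EFinP; exact: mi.
  have Ka0 : 0 <= K1 * a_ m by exact: mulr_ge0.
  have Kb0 : 0 <= K2 * b_ m by exact: mulr_ge0.
  rewrite (i1 (r ^+ m) _ (exprn_ge0 m half0) Ka0) (i1 (2 ^+ m.+1) _ (exprn_ge0 _ (ler0n R 2)) Kb0); congr (_%:E + _%:E)%E.
    rewrite /a_ exprn_powR// exprn_powR// exprSr [(2 * _) ^+ n]exprMn -[(r ^+ m) ^+ n]exprM mulnC exprM.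
    rewrite !exprMn; move: (_ `^ D) (_ ^+ m) (2 ^+ n) ((r ^+ n) ^+ m) => x y w v.
    by ring.
  rewrite /b_ exprn_powR// exprSr mulrCA [(2 ^+ m * _) ^+ n]exprMn -exprM mulnC exprM !exprMn.
  have -> : (4 : R) ^+ n = 2 ^+ n * 2 ^+ n by rewrite -exprMn; congr (_ ^+ _); lra.
  by move: (_ `^ _ ^+ m) (2 ^+ n) ((2 ^+ n) ^+ m) => x y w; ring.
apply: (@le_trans _ _ (\int[mu]_z \sum_(0 <= m <oo) f m z)%E).
  apply: ge0_le_integral => //.
  - by move=> z _; rewrite lee_fin mulr_ge0// invr_ge0 powR_ge0.
  - by apply/measurable_EFinP; apply: measurable_funM => //; exact: measurable_weight.
  - exact: ge0_emeasurable_sum.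
  - move=> z _; have [->|[m hm]] := weight_pointwise z h0 hK1 hK2 K10.
      by apply: nneseries_ge0.
    have fm : (((enorm z `^ D)^-1 * h z)%:E <= f m z)%E by rewrite lee_fin.
    apply: le_trans fm _; apply: le_trans (nneseries_lim_ge m.+1 _); last by move=> *; exact: f0.
    rewrite big_nat_recr//= leeDr//; apply: sume_ge0 => *; exact: f0.
rewrite integral_nneseries//.
rewrite (eq_eseriesr (fun m _ => if_ m)).
rewrite nneseriesD => [||m _ _]; last 2 first.
- by move=> m _ _; rewrite lee_fin !mulr_ge0 ?exprn_ge0 ?mulr_ge0 ?powR_ge0 ?exprn_ge0.
- by rewrite lee_fin !mulr_ge0 ?exprn_ge0 ?mulr_ge0 ?powR_ge0 ?exprn_ge0.
rewrite !nneseries_geometric ?mulr_ge0 ?powR_ge0 ?exprn_ge0// -EFinD lee_fin.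
move: x1_lt1 x2_lt1 => /andP[_ h1] /andP[_ h2].
rewrite /weightC -!mulrA.
have X0 : 0 <= 2 `^ D * (2 ^+ n / (1 - 2 `^ D * (r `^ p * r ^+ n))).
  by rewrite !mulr_ge0 ?powR_ge0 ?exprn_ge0// invr_ge0 subr_ge0 ltW// mulrA.
have Y0 : 0 <= 4 ^+ n / (1 - r `^ D * 2 ^+ n).
  by rewrite !mulr_ge0 ?exprn_ge0// invr_ge0 subr_ge0 ltW.
move: X0 Y0; set X := 2 `^ D * _; set Y := 4 ^+ n / _ => X0 Y0.
move: (mulr_ge0 K10 Y0) (mulr_ge0 K20 X0); rewrite mulrDl !mulrDr.
by move: (K1 * X) (K1 * Y) (K2 * X) (K2 * Y) => a b c d; lra.
Qed.

End dyadic_weight.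

Section nonlocal_field.
Context {R : realType} (n : nat) (p D : R).
Hypothesis p1 : 1 < p.
Local Notation mu := (lebesgue_rV R n).
Implicit Types (u : 'rV[R]_n -> R) (z : 'rV[R]_n * 'rV[R]_n) (Omega : set 'rV[R]_n).

Let p0 : 0 < p. Proof. exact: lt_trans p1. Qed.
Let pn0 : p != 0. Proof. by rewrite gt_eqF. Qed.

(* With this [R^1]-valued field on [R^n * R^n] in place of the gradient, the
   nonlocal form is the local one. *)
Definition nlfield u z : 'rV[R]_1 :=
  const_mx ((u z.1 - u z.2) / enorm (z.1 - z.2) `^ (D / p)).

Lemma enorm_const1 (a : R) : enorm (const_mx a : 'rV_1) = `|a|.
Proof. by rewrite /enorm /dotp big_ord1 !mxE -expr2 sqrtr_sqr. Qed.

Lemma nlfield_powR u z :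
  enorm (nlfield u z) `^ p = (enorm (z.1 - z.2) `^ D)^-1 * `|u z.1 - u z.2| `^ p.
Proof.
rewrite enorm_const1 normrM powRM// mulrC; congr (_ * _).
by rewrite -powRN ger0_norm ?powR_ge0// -powRrM mulNr divfK// powRN.
Qed.

Lemma nlfieldD u v z : nlfield (fun x => u x + v x) z = nlfield u z + nlfield v z.
Proof. by apply/rowP => i; rewrite !mxE -mulrDl opprD addrACA. Qed.

Lemma nlfieldZ a u z : nlfield (fun x => a * u x) z = a *: nlfield u z.
Proof. by apply/rowP => i; rewrite !mxE -mulrBr mulrA. Qed.

Lemma nlfieldB u v z : nlfield (fun x => u x - v x) z = nlfield u z - nlfield v z.
Proof. by apply/rowP => i; rewrite !mxE; move: (_ `^ _)^-1 => e; ring. Qed.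

Lemma measurable_diff : measurable_fun [set: 'rV[R]_n * 'rV[R]_n] (fun z => z.1 - z.2).
Proof.
apply: measurable_fun_rV => i; under eq_fun do rewrite !mxE.
by apply: measurable_funB; apply: (measurableT_comp (measurable_coord i));
  [exact: measurable_fst|exact: measurable_snd].
Qed.

Lemma measurable_enorm_diff (e : R) :
  measurable_fun [set: 'rV[R]_n * 'rV[R]_n] (fun z => enorm (z.1 - z.2) `^ e).
Proof.
apply: (measurableT_comp (f := fun t : R => t `^ e)) => //.
apply: (@measurable_enorm _ _ _ _ (fun z : 'rV[R]_n * 'rV[R]_n => z.1 - z.2)) => i.
by apply: (measurableT_comp (measurable_coord i)); exact: measurable_diff.
Qed.

Lemma vmeas_nlfield u : measurable_fun setT u -> vmeas (nlfield u).
Proof.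
move=> mU i; under eq_fun do rewrite mxE; apply: measurable_funM.
  by apply: measurable_funB; apply: (measurableT_comp mU);
    [exact: measurable_fst|exact: measurable_snd].
by under eq_fun do rewrite -powRN; exact: measurable_enorm_diff.
Qed.

Lemma measurable_incr Omega u : Cc_infty Omega u -> measurable_fun setT (incr p u).
Proof.
move=> hu; have mU := Cc_meas hu.
have H := @measurable_fun_fubini_tonelli_G _ _ _ _ R mu
  (fun xz : 'rV[R]_n * 'rV[R]_n => (`|u (xz.1 + xz.2)%R - u xz.1| `^ p)%:E).
apply/measurable_EFinP.
rewrite (_ : (EFin \o _) = fubini_G mu
  (fun xz : 'rV[R]_n * 'rV[R]_n => (`|u (xz.1 + xz.2)%R - u xz.1| `^ p)%:E)).
  apply: H => [|xz]; last by rewrite lee_fin powR_ge0.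
  apply/measurable_EFinP; apply: measurable_powR_norm; apply: measurable_funB.
    by apply: (measurableT_comp mU); exact: measurable_fun_add2.
  by apply: (measurableT_comp mU); exact: measurable_fst.
by apply/funext => z; rewrite /fubini_G/= L1_integralE//; exact: L1_increment hu.
Qed.

Lemma incr_le_norm Omega u (z : 'rV[R]_n) : Cc_infty Omega u ->
  incr p u z <= 2 `^ p * (2 * \int[mu]_x (`|u x| `^ p)).
Proof.
move=> hu; have iu := Cc_L1_powR p0 hu.
have [it et] := rint_translate_ge0 z iu (fun x => powR_ge0 _ _).
have pt x : `|u (x + z) - u x| `^ p <= 2 `^ p * `|u (x + z)| `^ p + 2 `^ p * `|u x| `^ p.
  rewrite -mulrDr; apply: le_trans (powR_add_le (ltW p1) (normr_ge0 _) (normr_ge0 _)).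
  by rewrite ge0_ler_powR ?nnegrE ?addr_ge0 ?(ltW p0)// ler_normB.
have := rint_le_lin (L1_increment z p0 hu) it iu pt.
by rewrite et -mulrDr mulr_natl mulr2n.
Qed.

(** With y = x + z the nonlocal energy is the integral of |z|^(-D) [incr p u z]. The increment is at
    most n^p |z|^p times the gradient energy near 0, in sup norm of z, and at most a multiple of the
    integral of |u|^p elsewhere, hence of the gradient energy by Poincare. *)
Lemma Cc_nonlocal Omega : p < n%:R -> n%:R < D -> D < n%:R + p -> bounded_set Omega ->
  exists2 C, 0 <= C & forall u, Cc_infty Omega u ->
    inLp (mu \x mu)%E p (nlfield u) /\
    energy (mu \x mu)%E p (nlfield u) <= C * energy mu p (grad u).
Proof.
move=> pn Dn Dnp /(poincare p1 pn)[K K0 hK].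
have W0 := weightC_ge0 Dn Dnp.
exists ((n%:R `^ p + 2 `^ p * (2 * K)) * weightC n p D).
  by rewrite mulr_ge0// addr_ge0 ?mulr_ge0 ?powR_ge0.
move=> u hu; have mU := Cc_meas hu.
set I := energy mu p (grad u); have I0 : 0 <= I by exact: energy_ge0.
have mF := vmeas_nlfield mU.
have mf := measurable_enorm_powR p mF.
suff H : (\int[(mu \x mu)%E]_z (enorm (nlfield u z) `^ p)%:E <=
    ((n%:R `^ p + 2 `^ p * (2 * K)) * weightC n p D * I)%:E)%E.
  by have [i e] := L1_lty_rint mf (fun z => powR_ge0 _ _) H.
rewrite fubini_tonelli1; last 2 first.
- exact/measurable_EFinP.
- by move=> z; rewrite lee_fin powR_ge0.
pose w (z : 'rV[R]_n) := (enorm z `^ D)^-1.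
have w0 (z : 'rV[R]_n) : 0 <= w z by rewrite invr_ge0 powR_ge0.
rewrite /fubini_F; apply: (@le_trans _ _
   (\int[mu]_x \int[mu]_z (w z * `|u (x + z)%R - u x| `^ p)%:E)%E).
  rewrite le_eqVlt; apply/orP; left; apply/eqP; apply: eq_integral => x _.
  rewrite -(@integral_translate R n x (fun y => (enorm (nlfield u (x, y)) `^ p)%:E)) /=; last 2 first.
  - apply/measurable_EFinP.
    exact: (measurableT_comp (f := fun z => enorm (nlfield u z) `^ p) mf (pair1_measurable x)).
  - by move=> y; rewrite lee_fin powR_ge0.
  apply: eq_integral => z _; rewrite nlfield_powR/= enormBC addrK distrC.
  by rewrite (addrC z x).
rewrite (tonelli_incr p1 hu (@measurable_weight R n D) w0).
have -> : (n%:R `^ p + 2 `^ p * (2 * K)) * weightC n p D * I =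
  (n%:R `^ p * I + 2 `^ p * (2 * (K * I))) * weightC n p D.
  by clearbody I; move: (weightC _ _ _) (_ `^ _) (_ `^ _) => W x y; ring.
apply: weight_integral => //.
- exact: measurable_incr hu.
- by move=> z; exact: incr_ge0.
- move=> rho z rho0 /cubeP hz; apply: le_trans (incr_le p1 hu rho0 hz) _.
  by rewrite powRM// mulrAC.
- move=> z; apply: le_trans (incr_le_norm z hu) _.
  by rewrite ler_wpM2l ?powR_ge0// ler_wpM2l//; exact: hK.
- by rewrite mulr_ge0 ?powR_ge0.
Qed.

End nonlocal_field.

(** * Compactness of dyadic averages *)

(** Along an ultrafilter every bounded real sequence converges, so all cell averages and all
    energies converge along the same filter. *)
Lemma ultra_bounded_cvg (R : realType) (F : set_system nat) (v : nat -> R) B :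
  UltraFilter F -> (forall k, `|v k| <= B) ->
  exists a, forall e, 0 < e -> F [set k | `|v k - a| <= e].
Proof.
move=> UF vB; have PF : ProperFilter F by apply: ultra_proper.
have vF : F [set k | `[- B, B]%classic (v k)].
  by apply: filterS filterT => k _; rewrite /= in_itv/= -ler_norml; exact: vB.
have [a [_ ca]] := @segment_compact R (- B) B (v @ F) (fmap_proper_filter v PF) vF.
exists a => e e0; case: (in_ultra_setVsetC [set k | `|v k - a| <= e] UF) => [//|nF].
have vn : (v @ F) [set y | ~ `|y - a| <= e] by exact: nF.
have [y [/= yn ya]] := ca _ _ vn (nbhsx_ballx a e e0).
by exfalso; apply: yn; move: ya; rewrite -ball_normE/= distrC => /ltW.
Qed.

Lemma finite_int_box n N : finite_set [set c : 'rV[int]_n | forall i, - N%:Z <= c ord0 i <= N%:Z].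
Proof.
pose f (g : {ffun 'I_n -> 'I_(2 * N).+1}) : 'rV[int]_n := \row_i ((g i)%:Z - N%:Z).
apply: (@sub_finite_set _ _ (f @` setT)) => [c /= hc|]; last first.
  by apply: finite_image; exact: finite_finset.
exists [ffun i => inord (absz (c ord0 i + N%:Z))] => //; apply/rowP => i; rewrite !mxE ffunE inordK.
  by have := hc i; move: (c ord0 i) => t ?; lia.
by have := hc i; move: (c ord0 i) => t ?; lia.
Qed.

Section compactness.
Context {R : realType} (n : nat) (p q : R).
Hypotheses (p1 : 1 < p) (pn : p < n%:R) (pq : p <= q) (qs : (n%:R - p) * (q / p - 1) < p).
Local Notation mu := (lebesgue_rV R n).
Variables (Omega : set 'rV[R]_n) (bO : bounded_set Omega) (E : R) (u : nat -> 'rV[R]_n -> R).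
Hypotheses (hu : forall k, Cc_infty Omega (u k)) (uE : forall k, energy mu p (grad (u k)) <= E).
Variables (F : set_system nat) (UF : UltraFilter F).

Let p0 : 0 < p. Proof. exact: lt_trans p1. Qed.
Let q0 : 0 < q. Proof. exact: lt_le_trans pq. Qed.
Let q1 : 1 < q. Proof. exact: lt_le_trans pq. Qed.
Let E0 : 0 <= E. Proof. exact: le_trans (energy_ge0 mu p _) (uE 0). Qed.

Let avgc_bounded J c : exists B, forall k, `|avgc J (u k) c| <= B.
Proof.
have [K K0 hK] := poincare p1 pn bO.
exists (1 + (2 ^+ J) ^+ n * (K * E)) => k.
have [M M0 hM] := Cc_bounded (hu k); have mU := Cc_meas (hu k).
have iu := Cc_L1_powR p0 (hu k).
have S0 : 0 <= (2 ^+ J) ^+ n * (K * E) by rewrite !mulr_ge0 ?exprn_ge0.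
have h : `|avgc J (u k) c| `^ p <= (2 ^+ J) ^+ n * (K * E).
  have := @avg_deviation R n J c (u k) M 0 p p1 mU hM; rewrite sub0r normrN => h.
  apply: le_trans h _; apply: (@le_trans _ _ (\int[mu]_y ((2 ^+ J) ^+ n * `|u k y| `^ p))).
    apply: rint_le; last first.
    - move=> y; rewrite sub0r normrN ler_wpM2r ?powR_ge0// wcellE.
      by case: ifP => // _; rewrite exprn_ge0.
    - exact: L1Z.
    - apply: (@L1_wcell_bounded _ _ _ _ _ (M `^ p)).
        by apply: measurable_powR_norm; exact: measurable_funB.
      by move=> y; rewrite sub0r normrN ger0_norm ?powR_ge0// ge0_ler_powR ?nnegrE ?(ltW p0).
  rewrite (rintZ _ iu) ler_wpM2l ?exprn_ge0//.
  by apply: le_trans (hK _ (hu k)) _; rewrite ler_wpM2l.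
have [s1|s1] := leP `|avgc J (u k) c| 1; first by rewrite (le_trans s1)// lerDl.
by rewrite (le_trans (le1r_powR (ltW s1) (ltW p1)))// (le_trans h)// lerDr.
Qed.

Let avg_zero L J v x : Cc_infty Omega v -> (forall x i, Omega x -> `|x ord0 i| <= L) ->
  ~ cube (L + 1) x -> avg J v x = 0.
Proof.
move=> hv hL xL; rewrite /avg /avgc.
rewrite (_ : (fun y => _) = (fun=> 0)); last first.
  apply/funext => y; rewrite wcellE; case: eqP => [e|_]; last by rewrite mul0r.
  rewrite (Cc_outside hv) ?mulr0// => Oy; apply: xL; apply/cubeP => i.
  have h1 := @cell_dist R n J x y i (esym e); have h2 := hL _ i Oy.
  rewrite -(subrK (y ord0 i) (x ord0 i)) (le_trans (ler_normD _ _))// addrC lerD//.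
  by apply: le_trans h1 _; rewrite exprn_ile1 ?invr_ge0// invf_le1// ler1n.
by rewrite /Rintegral integral0.
Qed.

Let cell_range L J : exists N : nat, forall x : 'rV[R]_n, cube L x ->
  forall i, - N%:Z <= cell J x ord0 i <= N%:Z.
Proof.
exists (Num.bound (`|L| * 2 ^+ J)) => x /cubeP hx i; rewrite mxE.
have J0 : (0 : R) <= 2 ^+ J by rewrite exprn_ge0.
have h := archi_boundP (mulr_ge0 (normr_ge0 L) J0); set N := Num.bound _ in h *.
have : `|x ord0 i * 2 ^+ J| < N%:R.
  by rewrite (le_lt_trans _ h)// normrM (ger0_norm J0) ler_wpM2r// (le_trans (hx i))// ler_norm.
rewrite ltr_norml => /andP[h1 h2]; rewrite floor_ge_int mulrNz (ltW h1)/=.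
by rewrite -ltzD1 floor_lt_int; apply: lt_le_trans h2 _; rewrite pmulrn ler_int lerDl.
Qed.

(** By [avg_Lq] a function of bounded energy is uniformly close in L^q to its averages of a fixed
    level J. In a bounded set only finitely many of these averages are nonzero, and each of them
    converges along the ultrafilter. *)
Lemma ultra_Lq_cauchy e : 0 < e ->
  exists2 S, F S & forall k l, S k -> S l -> \int[mu]_x (`|u k x - u l x| `^ q) <= e.
Proof.
move=> e0; have [L L0 hL] := bounded_set_box bO.
have [C C0 hC] := avg_Lq p1 pn pq qs.
have /andP[nu0 nu1] := avg_ratio_lt1 qs; set nu := avg_ratio n p q in nu0 nu1 hC.
pose A : R := 2 `^ q; have A0 : 0 < A by exact: powR_gt0.
have A1 : 1 <= A by rewrite -[leLHS](powRr0 2) ler_powR ?ler1n// ltW.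
(* Two applications of [powR_add_le] cost A^2, and three errors have to be accommodated. *)
pose e3 := e / (A * A * 3); have e30 : 0 < e3 by rewrite divr_gt0// !mulr_gt0.
have [J hJ] : exists J, C * E `^ (q / p) * nu ^+ J <= e3.
  have cv : (C * E `^ (q / p)) * nu ^+ J @[J --> \oo] --> C * E `^ (q / p) * 0.
    by apply: cvgM; [exact: cvg_cst|apply: cvg_expr; rewrite ger0_norm// ltW].
  rewrite mulr0 in cv.
  have [J _ hJ] := (cvgrPdist_le _ _).1 cv e3 e30; exists J.
  by have := hJ J (leqnn J); rewrite sub0r normrN; apply: le_trans; exact: ler_norm.
pose L1' := L + 1; have L1'0 : 0 < L1' by rewrite addr_gt0.
have [N hN] := cell_range L1' J.
(* Solves (2 d)^q (2 L1')^n = e3: two averages within d of the same limit differ by at most 2 d, on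
   a cube of volume (2 L1')^n. *)
pose d := (e3 / (2 * L1') ^+ n) `^ q^-1 / 2.
have d0 : 0 < d by rewrite divr_gt0// powR_gt0// divr_gt0// exprn_gt0// mulr_gt0.
have lim c : exists a, F [set k | `|avgc J (u k) c - a| <= d].
  have [B hB] := avgc_bounded J c.
  by have [a ha] := ultra_bounded_cvg UF hB; exists a; exact: ha.
pose a c := xget 0 [set a | F [set k | `|avgc J (u k) c - a| <= d]].
have ha c : F [set k | `|avgc J (u k) c - a c| <= d].
  by have [b hb] := lim c; rewrite /a; case: xgetP => [y -> //|/(_ b)].
have /finite_fsetP[X hX] := finite_int_box n N.
pose S := \bigcap_(c in [set c : 'rV[int]_n | forall i, - N%:Z <= c ord0 i <= N%:Z]) [set k | `|avgc J (u k) c - a c| <= d].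
exists S; first by rewrite /S hX; apply: filter_bigI => c _; exact: ha.
move=> k l Sk Sl.
have [ik ek] := hC _ _ J (hu k); have [il el] := hC _ _ J (hu l).
have pt (c : 'rV[int]_n) : (forall i, - N%:Z <= c ord0 i <= N%:Z) -> `|avgc J (u k) c - avgc J (u l) c| <= 2 * d.
  move=> Xc; have h1 := Sk c Xc; have h2 := Sl c Xc; rewrite /= in h1 h2.
  rewrite -(subrKA (a c)) (le_trans (ler_normD _ _))// mulr_natl mulr2n lerD//.
  by rewrite distrC.
have iM : L1 mu (fun x => \1_(cube L1') x) /\ \int[mu]_x \1_(cube L1') x = (2 * L1') ^+ n.
  have mc : measurable (cube L1' : set 'rV[R]_n) by exact: measurable_cube.
  have e1 : (\int[mu]_x (\1_(cube L1') x)%:E = ((2 * L1') ^+ n)%:E)%E.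
    apply: (@eq_trans _ _ (mu (cube L1'))); last by rewrite lebesgue_cube ?(ltW L1'0).
    by rewrite integral_indic// setIT.
  split; last by rewrite /Rintegral e1.
  apply: L1_ge0P => [|x|]; first exact: measurable_indic.
    by rewrite indicE.
  by apply: le_lt_trans (ltry ((2 * L1') ^+ n)); rewrite -e1.
have [i1 e1] := iM.
have pm x : `|avg J (u k) x - avg J (u l) x| `^ q <= (2 * d) `^ q * \1_(cube L1') x.
  rewrite indicE; have [xL|xL] := boolP (x \in cube L1').
    have dd0 : 0 <= 2 * d by rewrite mulr_ge0// ltW.
    rewrite mulr1 ge0_ler_powR ?nnegrE ?(ltW q0)//.
    exact: (pt (cell J x) (hN x (set_mem xL))).
  have nx : ~ cube L1' x by move=> /mem_set; rewrite (negbTE xL).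
  by rewrite !(avg_zero _ (hu _) hL nx) subrr normr0 powR0 ?gt_eqF// mulr0.
have ed : (2 * d) `^ q * (2 * L1') ^+ n = e3.
  rewrite /d mulrC mulrCA mulfV// mulr1 -powRrM mulVf ?gt_eqF// powRr1 ?(ltW (divr_gt0 _ _))//.
    by rewrite mulrC divfK// gt_eqF// exprn_gt0// mulr_gt0.
  by rewrite exprn_gt0// mulr_gt0.
have mk j := Cc_meas (hu j).
pose H x := A * (A * (`|u k x - avg J (u k) x| `^ q + `|u l x - avg J (u l) x| `^ q) +
   (2 * d) `^ q * \1_(cube L1') x).
have iH : L1 mu H.
  by apply: L1Z; apply: L1D; [apply: L1Z; exact: L1D|exact: L1Z].
have iu : L1 mu (fun x => `|u k x - u l x| `^ q) by exact: Cc_L1_powR q0 (Cc_sub (hu k) (hu l)).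
apply: (@le_trans _ _ (\int[mu]_x H x)).
  apply: rint_le => // x.
  have q1' := ltW q1; have q0' := ltW q0.
  have t1 := powR_add_le q1' (normr_ge0 (u k x - avg J (u k) x - (u l x - avg J (u l) x)))
     (normr_ge0 (avg J (u k) x - avg J (u l) x)).
  have t2 := powR_add_le q1' (normr_ge0 (u k x - avg J (u k) x)) (normr_ge0 (u l x - avg J (u l) x)).
  apply: (@le_trans _ _ ((`|u k x - avg J (u k) x - (u l x - avg J (u l) x)| +
     `|avg J (u k) x - avg J (u l) x|) `^ q)).
    rewrite ge0_ler_powR ?nnegrE ?addr_ge0//.
    apply: le_trans (ler_normD _ _); rewrite le_eqVlt; apply/orP; left; apply/eqP; congr `|_|.
    by move: (u k x) (u l x) (avg _ _ _) (avg _ _ _) => b c f g; ring.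
  apply: le_trans t1 _; rewrite /H; apply: ler_wpM2l; first exact: ltW.
  apply: lerD; last exact: pm.
  apply: le_trans t2; rewrite ge0_ler_powR ?nnegrE ?addr_ge0//; exact: ler_normB.
have iD1 := L1D ik il.
rewrite /H (rintZ _ (L1D (L1Z A iD1) (L1Z ((2 * d) `^ q) i1))).
rewrite (rintD (L1Z A iD1) (L1Z ((2 * d) `^ q) i1)) (rintZ _ iD1) (rintZ _ i1) (rintD ik il) e1 ed.
have up j : energy mu p (grad (u j)) `^ (q / p) <= E `^ (q / p).
  by rewrite ge0_ler_powR ?nnegrE ?energy_ge0// divr_ge0// ltW.
have bd j : C * energy mu p (grad (u j)) `^ (q / p) * nu ^+ J <= e3.
  apply: le_trans hJ; rewrite ler_wpM2r ?exprn_ge0 ?(ltW nu0)// ler_wpM2l//.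
have := le_trans ek (bd k); have := le_trans el (bd l).
move: (\int[mu]_x _) (\int[mu]_x _) => y z hy hz.
have -> : e = A * (A * (e3 + e3) + A * e3).
  by rewrite /e3; field; rewrite gt_eqF.
rewrite ler_wpM2l ?(ltW A0)// lerD// ?ler_wpM2l ?(ltW A0)// ?lerD//.
by rewrite ler_peMl// ltW.
Qed.

End compactness.

(** Each finite intersection of the [S i], cut by a tail, belongs to the filter and so has a point;
    choosing such points recursively gives one subsequence adapted to all the [S i]. *)
Lemma ultra_extract (F : set_system nat) (S : nat -> set nat) : ProperFilter F -> \oo `<=` F ->
  (forall i, F (S i)) ->
  exists2 sigma : nat -> nat, (forall i, (sigma i < sigma i.+1)%N) &
    forall i j, (i <= j)%N -> S i (sigma j).
Proof.
move=> PF ooF hS.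
pose T i := \bigcap_(j in [set j | (j <= i)%N]) S j.
have hT i : F (T i).
  elim: i => [|i IH].
    by apply: filterS (hS 0%N) => k h j /=; rewrite leqn0 => /eqP ->.
  apply: filterS (filterI IH (hS i.+1)) => k [h1 h2] j /=.
  by rewrite leq_eqVlt => /orP[/eqP ->|] //; rewrite ltnS; exact: h1.
have pick i m : exists k, T i k /\ (m < k)%N.
  have : F (T i `&` [set k | (m < k)%N]).
    by apply: filterI => //; apply: ooF; exists m.+1.
  by move=> /filter_ex[k [h1 h2]]; exists k.
pose f i m := xget 0%N [set k | T i k /\ (m < k)%N].
have hf i m : T i (f i m) /\ (m < f i m)%N.
  by have [k hk] := pick i m; rewrite /f; case: xgetP => [y -> //|/(_ k)].
pose fix s i := if i is i'.+1 then f i'.+1 (s i') else f 0%N 0%N.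
exists s => [i|i j ij]; first exact: (hf i.+1 (s i)).2.
case: j ij => [|j] ij; first by have := (hf 0%N 0%N).1 i ij.
exact: (hf j.+1 (s j)).1 i ij.
Qed.

(** * The energy space *)

Section energy_bound.
Context d (T : measurableType d) (R : realType) (m : nat).
Variable mu : {measure set T -> \bar R}.
Implicit Types (F G : T -> 'rV[R]_m) (p e : R).

(** The bound is paired with membership because the real integral of a non-integrable function is a
    default value, about which an inequality says nothing. *)
Definition en_le p e F := inLp mu p F /\ energy mu p F <= e.

Lemma en_leW p e e' F : e <= e' -> en_le p e F -> en_le p e' F.
Proof. by move=> ee' [h1 h2]; split => //; exact: le_trans ee'. Qed.

Lemma en_leD p e e' F G : 1 < p -> en_le p e F -> en_le p e' G ->
  en_le p (2 `^ p * (e + e')) (fun x => F x + G x).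
Proof.
move=> p1 [h1 h2] [h3 h4]; split; first exact: inLpD.
by apply: le_trans (energyD_le p1 h1 h3) _; rewrite ler_wpM2l ?powR_ge0// lerD.
Qed.

Lemma en_leZ p e a F : 1 < p -> en_le p e F -> en_le p (`|a| `^ p * e) (fun x => a *: F x).
Proof.
by move=> p1 [h1 h2]; split; [exact: inLpZ|rewrite energyZ// ler_wpM2l ?powR_ge0].
Qed.

Lemma en_leBC p e F G : en_le p e (fun x => F x - G x) -> en_le p e (fun x => G x - F x).
Proof.
move=> [[m1 i1] h]; split; last by rewrite energyBC.
split.
  move=> i; under eq_fun do rewrite -opprB mxE.
  by apply: measurable_funN; exact: m1.
by under eq_fun do rewrite enormBC.
Qed.

Lemma en_leB p e e' F G : 1 < p -> en_le p e F -> en_le p e' G ->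
  en_le p (2 `^ p * (e + e')) (fun x => F x - G x).
Proof.
move=> p1 hF hG; have := en_leD p1 hF (en_leZ (-1) p1 hG).
rewrite normrN1 powR1 mul1r; under eq_fun do rewrite scaleN1r.
exact.
Qed.

End energy_bound.

Section scalar_field.
Context d (T : measurableType d) (R : realType).
Variable mu : {measure set T -> \bar R}.

(** A scalar function seen as an R^1-valued field, so that the lemmas on energies also cover L^p and
    L^q norms of functions. *)
Definition Sf (u : T -> R) (x : T) : 'rV[R]_1 := const_mx (u x).

Lemma vmeas_Sf u : measurable_fun setT u -> vmeas (Sf u).
Proof. by move=> mu_ i; under eq_fun do rewrite mxE. Qed.

Lemma enorm_Sf u x : enorm (Sf u x) = `|u x|.
Proof. exact: enorm_const1. Qed.

Lemma SfD u v : Sf (fun x => u x + v x) = (fun x => Sf u x + Sf v x).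
Proof. by apply/funext => x; apply/rowP => i; rewrite !mxE. Qed.

Lemma SfZ a u : Sf (fun x => a * u x) = (fun x => a *: Sf u x).
Proof. by apply/funext => x; apply/rowP => i; rewrite !mxE. Qed.

Lemma SfB u v : Sf (fun x => u x - v x) = (fun x => Sf u x - Sf v x).
Proof. by apply/funext => x; apply/rowP => i; rewrite !mxE. Qed.

Lemma en_leSf p e u : en_le mu p e (Sf u) <->
  [/\ measurable_fun setT u, L1 mu (fun x => `|u x| `^ p) & \int[mu]_x (`|u x| `^ p) <= e].
Proof.
rewrite /en_le /inLp /energy; under eq_fun do rewrite enorm_Sf.
split=> [[[mS i] h]|[mS i h]].
  by split => //; have := mS ord0; under eq_fun do rewrite mxE.
by split => //; split => //; exact: vmeas_Sf.
Qed.

End scalar_field.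

Lemma ae_prod2 d (T : measurableType d) (R : realType)
    (mu : {sigma_finite_measure set T -> \bar R}) (P : T -> Prop) :
  {ae mu, forall x, P x} -> {ae (mu \x mu)%E, forall z, P z.1 /\ P z.2}.
Proof.
move=> [N [mN N0 hN]].
exists (N `*` setT `|` setT `*` N); split.
- by apply: measurableU; exact: measurableX.
- have e1 : (mu \x mu)%E (N `*` setT) = 0%E by transitivity (0 * mu setT)%E; [rewrite -N0; exact: product_measure1E|rewrite mul0e].
  have e2 : (mu \x mu)%E (setT `*` N) = 0%E by transitivity (mu setT * 0)%E; [rewrite -N0; exact: product_measure1E|rewrite mule0].
  apply/eqP; rewrite -measure_le0; apply: le_trans (measureU2 _ _ _) _; try exact: measurableX.
  rewrite -[leRHS]adde0; apply: leeD.
    by move/eqP: e1; rewrite eq_le => /andP[].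
  by move/eqP: e2; rewrite eq_le => /andP[].
- move=> z /= hz; have [h1|h1] := pselect (P z.1).
    by right; split => //; apply: hN => h2; apply: hz.
  by left; split => //; apply: hN.
Qed.

(* The exponents of the problem: [q = r + 1] and [D = n + s p]; the third condition
   is the subcriticality [q < n p / (n - p)]. *)
Definition admissible (R : realType) n (p q D : R) :=
  [/\ 1 < p < n%:R, p < q, (n%:R - p) * (q / p - 1) < p & n%:R < D < n%:R + p].

Section sobolev_space.
Context {R : realType} (n : nat) (p q D : R) (adm : admissible n p q D).
Variables (Omega : set 'rV[R]_n) (bO : bounded_set Omega).
Local Notation mu := (lebesgue_rV R n).
Local Notation nu := (mu \x mu)%E.
Implicit Types (u v w : 'rV[R]_n -> R) (G H : 'rV[R]_n -> 'rV[R]_n) (e : R).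
Local Notation nlf := (nlfield p D).

Let p1 : 1 < p. Proof. by case: adm => /andP[]. Qed.
Let pn : p < n%:R. Proof. by case: adm => /andP[]. Qed.
Let pq : p < q. Proof. by case: adm. Qed.
Let qs : (n%:R - p) * (q / p - 1) < p. Proof. by case: adm. Qed.
Let Dn : n%:R < D. Proof. by case: adm => _ _ _ /andP[]. Qed.
Let Dnp : D < n%:R + p. Proof. by case: adm => _ _ _ /andP[]. Qed.
Let p0 : 0 < p. Proof. exact: lt_trans p1. Qed.
Let q1 : 1 < q. Proof. exact: lt_trans pq. Qed.
Let q0 : 0 < q. Proof. exact: lt_trans q1. Qed.

Definition small e w H :=
  [/\ en_le mu p e H, en_le mu p e (Sf w), en_le mu q e (Sf w) & en_le nu p e (nlf w)].

(* [W_0^{1,p}] as the set of pairs (function, weak gradient): the closure of the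
   pairs [(phi, grad phi)] in a norm that also controls the nonlocal energy. *)
Definition X u G := [/\ measurable_fun setT u, vmeas G &
  forall e, 0 < e -> exists2 phi, Cc_infty Omega phi &
    small e (fun x => u x - phi x) (fun x => G x - grad phi x)].

Let nlfDE u v : nlf (fun x => u x + v x) = (fun z => nlf u z + nlf v z).
Proof. by apply/funext => z; exact: nlfieldD. Qed.

Let nlfZE a u : nlf (fun x => a * u x) = (fun z => a *: nlf u z).
Proof. by apply/funext => z; exact: nlfieldZ. Qed.

Let nlfBE u v : nlf (fun x => u x - v x) = (fun z => nlf u z - nlf v z).
Proof. by apply/funext => z; exact: nlfieldB. Qed.

Let pow2_le : (2 : R) `^ p <= 2 `^ q.
Proof. by rewrite ler_powR ?ler1n// ltW. Qed.

Lemma smallW e e' w H : e <= e' -> small e w H -> small e' w H.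
Proof. by move=> ee' [h1 h2 h3 h4]; split; apply: en_leW ee' _. Qed.

Lemma small_ge0 e w H : small e w H -> 0 <= e.
Proof. by move=> [[_ h] _ _ _]; apply: le_trans h; exact: energy_ge0. Qed.

Lemma smallD e e' w w' H H' : small e w H -> small e' w' H' ->
  small (2 `^ q * (e + e')) (fun x => w x + w' x) (fun x => H x + H' x).
Proof.
move=> h h'; have e0 := small_ge0 h; have e0' := small_ge0 h'.
have le : 2 `^ p * (e + e') <= 2 `^ q * (e + e') by rewrite ler_wpM2r// addr_ge0.
case: h => [h1 h2 h3 h4]; case: h' => [k1 k2 k3 k4]; split.
- by apply: en_leW le _; exact: en_leD.
- by rewrite SfD; apply: en_leW le _; exact: en_leD.
- by rewrite SfD; exact: en_leD.
- by rewrite nlfDE; apply: en_leW le _; exact: en_leD.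
Qed.

Lemma smallZ e a w H : small e w H ->
  small ((`|a| `^ p + `|a| `^ q) * e) (fun x => a * w x) (fun x => a *: H x).
Proof.
move=> h; have e0 := small_ge0 h; case: h => [h1 h2 h3 h4].
have lp : `|a| `^ p * e <= (`|a| `^ p + `|a| `^ q) * e by rewrite ler_wpM2r// lerDl powR_ge0.
have lq : `|a| `^ q * e <= (`|a| `^ p + `|a| `^ q) * e by rewrite ler_wpM2r// lerDr powR_ge0.
rewrite /small SfZ nlfZE; split.
- by apply: en_leW lp _; exact: en_leZ.
- by apply: en_leW lp _; exact: en_leZ.
- by apply: en_leW lq _; exact: en_leZ.
- by apply: en_leW lp _; exact: en_leZ.
Qed.

Lemma smallBC e u v G H : small e (fun x => u x - v x) (fun x => G x - H x) ->
  small e (fun x => v x - u x) (fun x => H x - G x).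
Proof.
rewrite /small (SfB u v) (SfB v u) (nlfBE u v) (nlfBE v u) => -[h1 h2 h3 h4].
by split; [exact: en_leBC h1|exact: en_leBC h2|exact: en_leBC h3|exact: en_leBC h4].
Qed.

(** For test functions the gradient energy controls all four quantities of [small], hence a sequence
    of test functions that is Cauchy for gradients is Cauchy for the whole norm. *)
Lemma small_Cc : exists2 K, 0 <= K & forall phi t, Cc_infty Omega phi ->
  energy mu p (grad phi) <= t -> small (K * (t + t `^ (q / p))) phi (grad phi).
Proof.
have [K1 K10 h1] := poincare p1 pn bO.
have [K2 K20 h2] := sobolev p1 pn (ltW pq) qs bO.
have [K3 K30 h3] := Cc_nonlocal p1 pn Dn Dnp bO.
exists (1 + K1 + K2 + K3); first by rewrite !addr_ge0.
move=> phi t hphi It; have t0 : 0 <= t by apply: le_trans It; exact: energy_ge0.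
have mphi := Cc_meas hphi; set A := t `^ (q / p); have A0 : 0 <= A by exact: powR_ge0.
have IA : energy mu p (grad phi) `^ (q / p) <= A.
  by rewrite ge0_ler_powR ?nnegrE ?energy_ge0// divr_ge0// ltW.
set K := 1 + K1 + K2 + K3.
have b k s : 0 <= k -> k <= K -> s <= t -> k * s <= K * (t + A).
  move=> k0 kK st; apply: le_trans (ler_wpM2l k0 st) _.
  apply: le_trans (ler_wpM2r t0 kK) _.
  by rewrite ler_wpM2l ?lerDl// (le_trans k0).
split.
- split; first exact: grad_inLp hphi.
  by rewrite -[leLHS]mul1r; apply: b => //; rewrite /K -!addrA lerDl !addr_ge0.
- apply/en_leSf; split => //; first exact: Cc_L1_powR hphi.
  by apply: le_trans (h1 _ hphi) _; apply: b => //; rewrite /K; lra.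
- apply/en_leSf; split => //; first exact: Cc_L1_powR hphi.
  apply: le_trans (h2 _ hphi) _; apply: le_trans (ler_wpM2l K20 IA) _.
  apply: ler_pM => //; first by rewrite /K; lra.
  by rewrite lerDr.
- have [i le] := h3 _ hphi; split => //.
  by apply: le_trans le _; apply: b => //; rewrite /K; lra.
Qed.

Let small_of_tend K : 0 <= K -> forall e, 0 < e ->
  exists2 t, 0 < t & K * (t + t `^ (q / p)) <= e.
Proof.
move=> K0 e e0; pose t := Num.min 1 (e / (2 * (K + 1))).
have d0 : 0 < 2 * (K + 1) by rewrite mulr_gt0// ltr_wpDl.
have t0 : 0 < t by rewrite lt_min ltr01 divr_gt0.
exists t => //; have tle : t `^ (q / p) <= t.
  rewrite -[leRHS](powRr1 (ltW t0)); apply: ger_powR; first by rewrite t0 ge_min lexx.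
  by rewrite ler_pdivlMr// mul1r ltW.
have h : t <= e / (2 * (K + 1)) by rewrite ge_min lexx orbT.
rewrite ler_pdivlMr// in h.
apply: le_trans (ler_wpM2l K0 (lerD (lexx t) tle)) _; apply: le_trans h.
have -> : t * (2 * (K + 1)) = K * (t + t) + 2 * t by ring.
by rewrite lerDl mulr_ge0// ltW.
Qed.

(** Only the gradients are assumed to converge in energy. The differences phi k - phi l are then
    small in every norm by [small_Cc], and Fatou in l transfers this to phi k - u, the limit being
    identified almost everywhere. *)
Lemma X_of_seq (phi : nat -> 'rV[R]_n -> R) u G (a : nat -> R) : (forall k, Cc_infty Omega (phi k)) ->
  (forall k, en_le mu p (a k) (fun x => G x - grad (phi k) x)) -> a k @[k --> \oo] --> (0 : R) ->
  measurable_fun setT u -> vmeas G -> {ae mu, forall x, phi k x @[k --> \oo] --> u x} -> X u G.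
Proof.
move=> hphi hG a0 mU mG cv; split => // e e0.
have [K K0 hK] := small_Cc; have [t t0 ht] := small_of_tend K0 e0.
pose s := Num.min e (t / (2 `^ p * 2)).
have s0 : 0 < s by rewrite lt_min e0 divr_gt0// mulr_gt0// powR_gt0.
have [N _ hN] := (cvgrPdist_le _ _).1 a0 s s0.
have hs k : (N <= k)%N -> en_le mu p s (fun x => G x - grad (phi k) x).
  move=> Nk; apply: en_leW (hG k); have := hN k Nk; rewrite sub0r normrN.
  by apply: le_trans; exact: ler_norm.
have hkl k l : (N <= k)%N -> (N <= l)%N ->
    small e (fun x => phi k x - phi l x) (fun x => grad (phi k) x - grad (phi l) x).
  move=> Nk Nl; apply: (smallW ht).
  have := hK _ t (Cc_sub (hphi k) (hphi l)); rewrite (gradB (hphi k) (hphi l)); apply.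
  have [_] := en_leD p1 (en_leBC (hs k Nk)) (hs l Nl).
  under eq_fun do rewrite subrKA.
  move=> h; apply: le_trans h _; have -> : 2 `^ p * (s + s) = s * (2 `^ p * 2) by move: (2 `^ p) => ?; ring.
  by rewrite -ler_pdivlMr ?mulr_gt0 ?powR_gt0// ge_min lexx orbT.
have sphi k : exists c, small c (phi k) (grad (phi k)).
  by eexists; apply: hK (hphi k) (lexx _).
have cvS : {ae mu, forall x, Sf (phi k) x @[k --> \oo] --> Sf u x}.
  by apply: filterS cv => x c; apply: cvg_rV => i; under eq_fun do rewrite mxE; rewrite mxE.
have cvN : {ae nu, forall z, nlf (phi k) z @[k --> \oo] --> nlf u z}.
  apply: filterS (ae_prod2 cv) => z [c1 c2]; apply: cvg_rV => i.
  under eq_fun do rewrite mxE; rewrite mxE.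
  by apply: cvgM; [exact: cvgB|exact: cvg_cst].
have NN := leqnn N.
exists (phi N) => //; apply: smallBC; split.
- by apply: en_leBC; apply: en_leW (hs N NN); rewrite ge_min lexx.
- rewrite SfB; apply: (energy_cauchy_limit p1 _ _ cvS _ NN) => [k||k l Nk Nl].
  + by have [c [_ [i _] _ _]] := sphi k.
  + exact: vmeas_Sf.
  + by have [_ [_]] := hkl k l Nk Nl; rewrite SfB.
- rewrite SfB; apply: (energy_cauchy_limit q1 _ _ cvS _ NN) => [k||k l Nk Nl].
  + by have [c [_ _ [i _] _]] := sphi k.
  + exact: vmeas_Sf.
  + by have [_ _ [_]] := hkl k l Nk Nl; rewrite SfB.
- rewrite nlfBE; apply: (energy_cauchy_limit p1 _ _ cvN _ NN) => [k||k l Nk Nl].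
  + by have [c [_ _ _ [i _]]] := sphi k.
  + exact: vmeas_nlfield.
  + by have [_ _ _ [_]] := hkl k l Nk Nl; rewrite nlfBE.
Qed.

Lemma X_Cc phi : Cc_infty Omega phi -> X phi (grad phi).
Proof.
move=> hphi; apply: (@X_of_seq (fun=> phi) _ _ (fun=> 0)) => //.
- move=> k; under eq_fun do rewrite subrr.
  split; last by rewrite /energy; under eq_Rintegral do rewrite enorm0 powR0 ?gt_eqF//; rewrite Rintegral_cst// ?mul0r.
  split; first by move=> i; under eq_fun do rewrite mxE; exact: measurable_cst.
  by under eq_fun do rewrite enorm0 powR0 ?gt_eqF//; exact: L1_0.
- exact: cvg_cst.
- exact: Cc_meas hphi.
- exact: vmeas_grad hphi.
- by apply: nearW => x; exact: cvg_cst.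
Qed.

Lemma X_small u G : X u G -> exists e, small e u G.
Proof.
move=> [mU mG /(_ 1 ltr01)[phi hphi h]]; have [K _ hK] := small_Cc.
have := smallD h (hK _ _ hphi (lexx _)).
under eq_fun do rewrite subrK.
by under [Y in small _ _ Y]eq_fun do rewrite subrK; eexists; eassumption.
Qed.

Lemma X_inLp u G : X u G -> inLp mu p G.
Proof. by move=> /X_small[e [[]]]. Qed.

Lemma X_nl_inLp u G : X u G -> inLp nu p (nlf u).
Proof. by move=> /X_small[e [_ _ _ []]]. Qed.

Lemma X_L1p u G : X u G -> L1 mu (fun x => `|u x| `^ p).
Proof. by move=> /X_small[e [_ /en_leSf[]]]. Qed.

Lemma X_L1q u G : X u G -> L1 mu (fun x => `|u x| `^ q).
Proof. by move=> /X_small[e [_ _ /en_leSf[]]]. Qed.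

Lemma XD u v G H : X u G -> X v H -> X (fun x => u x + v x) (fun x => G x + H x).
Proof.
move=> [mu_ mG hu] [mv mH hv]; split; [exact: measurable_funD|exact: vmeasD|move=> e e0].
pose t := e / (2 `^ q * 2); have t0 : 0 < t by rewrite divr_gt0// mulr_gt0// powR_gt0.
have [phi hphi h1] := hu t t0; have [psi hpsi h2] := hv t t0.
exists (fun x => phi x + psi x); first exact: Cc_add.
have := smallD h1 h2.
rewrite (_ : 2 `^ q * (t + t) = e); last first.
  have -> : 2 `^ q * (t + t) = t * (2 `^ q * 2) by move: (2 `^ q) t {t0 h1 h2} => a b; ring.
  by rewrite /t divfK// gt_eqF// mulr_gt0// powR_gt0.
rewrite (gradD hphi hpsi).
under eq_fun do rewrite addrACA -opprD.
by under [Y in small _ _ Y]eq_fun do rewrite addrACA -opprD.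
Qed.

Lemma XZ a u G : X u G -> X (fun x => a * u x) (fun x => a *: G x).
Proof.
move=> [mu_ mG hu]; split; [exact: measurable_funM|exact: vmeasZ|move=> e e0].
set c := `|a| `^ p + `|a| `^ q; have c0 : 0 <= c by rewrite addr_ge0 ?powR_ge0.
have [phi hphi h1] := hu (e / (c + 1)) (divr_gt0 e0 (ltr_wpDl c0 ltr01)).
exists (fun x => a * phi x); first exact: Cc_scale.
have := smallZ a h1; rewrite (gradZ a hphi).
under eq_fun do rewrite mulrBr.
under [Y in small _ _ Y]eq_fun do rewrite scalerBr.
apply: smallW; rewrite mulrA ler_pdivrMr ?ltr_wpDl// mulrC ler_wpM2l ?(ltW e0)// lerDl.
by rewrite ler01.
Qed.

Lemma XB u v G H : X u G -> X v H -> X (fun x => u x - v x) (fun x => G x - H x).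
Proof.
move=> hu hv; have := XD hu (XZ (-1) hv).
under eq_fun do rewrite mulN1r.
by under [Y in X _ Y]eq_fun do rewrite scaleN1r.
Qed.

Let fast_small k : (0 : R) < 2^-1 ^+ k. Proof. by rewrite exprn_gt0// invr_gt0. Qed.

(** Each w k is replaced by a test function within 2^-k of it; the errors are summable, so the
    almost everywhere limit is unchanged and [X_of_seq] applies. *)
Lemma X_closed (w : nat -> 'rV[R]_n -> R) (H : nat -> 'rV[R]_n -> 'rV[R]_n) u G (a : nat -> R) :
  (forall k, X (w k) (H k)) ->
  (forall k, en_le mu p (a k) (fun x => G x - H k x)) -> a k @[k --> \oo] --> (0 : R) ->
  measurable_fun setT u -> vmeas G -> {ae mu, forall x, w k x @[k --> \oo] --> u x} -> X u G.
Proof.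
move=> hX hG a0 mU mG cv.
have ex k : exists phi, Cc_infty Omega phi /\
    small (2^-1 ^+ k) (fun x => w k x - phi x) (fun x => H k x - grad phi x).
  by have [_ _ /(_ _ (fast_small k))[phi h1 h2]] := hX k; exists phi.
pose phi k := sval (cid (ex k)).
have [hphi hs] : (forall k, Cc_infty Omega (phi k)) /\ (forall k,
    small (2^-1 ^+ k) (fun x => w k x - phi k x) (fun x => H k x - grad (phi k) x)).
  by split=> k; rewrite /phi; case: (cid (ex k)) => f [].
apply: (@X_of_seq phi _ _ (fun k => 2 `^ p * (a k + 2^-1 ^+ k))) => //.
- move=> k; have [h _ _ _] := hs k; have := en_leD p1 (hG k) h.
  by under eq_fun do rewrite subrKA.
- rewrite -[X in _ --> X](mulr0 (2 `^ p)); apply: cvgM; first exact: cvg_cst.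
  rewrite -[X in _ --> X]addr0; apply: cvgD => //.
  by apply: cvg_expr; rewrite ger0_norm ?invr_ge0// invf_lt1// ltr1n.
- have z : {ae mu, forall x, `|w k x - phi k x| `^ p @[k --> \oo] --> (0 : R)}.
    apply: (@ae_cvg0_of_summable _ _ _ mu (fun k x => `|w k x - phi k x| `^ p)) => [k|k x|k].
    + apply: measurable_powR_norm; apply: measurable_funB; first by case: (hX k).
      exact: Cc_meas (hphi k).
    + exact: powR_ge0.
    + by have [_ /en_leSf[_ i le] _ _] := hs k; rewrite L1_integralE.
  apply: filterS2 z cv => x z c.
  have z1 : w k x - phi k x @[k --> \oo] --> (0 : R).
    have c1 : (`|w k x - phi k x| `^ p) `^ p^-1 @[k --> \oo] --> (`|0 : R|) `^ p^-1.
      have pi0 : 0 < p^-1 by rewrite invr_gt0.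
      have cc : `|t| `^ p^-1 @[t --> (0 : R)] --> `|0 : R| `^ p^-1 by exact: normr_powR_continuous.
      have := @cvg_comp _ _ _ _ (fun t : R => `|t| `^ p^-1) _ _ _ z cc.
      rewrite (_ : (fun t : R => `|t| `^ p^-1) \o _ = (fun k => (`|w k x - phi k x| `^ p) `^ p^-1))//.
      by apply/funext => k /=; rewrite ger0_norm ?powR_ge0.
    move: c1; rewrite normr0 powR0 ?invr_eq0 ?gt_eqF//.
    under eq_fun do rewrite -powRrM mulfV ?gt_eqF// powRr1//.
    by move=> c1; apply/norm_cvg0P.
  have -> : (fun k => phi k x) = (fun k => w k x - (w k x - phi k x)).
    by apply/funext => k; rewrite opprB addrC subrK.
  by rewrite -[u x]subr0; exact: cvgB.
Qed.

Lemma X_ae u u' G G' : X u G -> measurable_fun setT u' -> vmeas G' ->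
  {ae mu, forall x, u x = u' x} -> {ae mu, forall x, G x = G' x} -> X u' G'.
Proof.
move=> hX mu' mG' uu' GG'; have [mU mG _] := hX.
apply: (@X_closed (fun=> u) (fun=> G) u' G' (fun=> 0)) => //.
- move=> k; have mB := vmeasB mG' mG.
  have m2 := measurable_enorm_powR p mB.
  have z : ae_eq mu setT (cst 0) (fun x => enorm (G' x - G x) `^ p).
    by apply: filterS GG' => x e _; rewrite e subrr enorm0 powR0 ?gt_eqF.
  split; first by split => //; apply: (L1_ae m2 z); exact: L1_0.
  rewrite /energy -(rint_ae _ m2 z)//.
  by rewrite Rintegral_cst// mul0r.
- exact: cvg_cst.
- by apply: filterS uu' => x ->; exact: cvg_cst.
Qed.

End sobolev_space.

Section limits.
Context {R : realType}.

Lemma ler_cvg_seq (x l : R) (y : nat -> R) : (forall k, x <= y k) -> y k @[k --> \oo] --> l -> x <= l.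
Proof.
move=> xy cv; rewrite -(cvg_lim (@Rhausdorff R) cv); apply: limr_ge.
  by apply/cvg_ex; eexists; exact: cv.
exact: nearW.
Qed.

Lemma cvg_half : 2^-1 ^+ k @[k --> \oo] --> (0 : R).
Proof. by apply: cvg_expr; rewrite ger0_norm ?invr_ge0// invf_lt1// ltr1n. Qed.

Lemma cvg_powR (y : nat -> R) l a : 0 < a -> (forall k, 0 <= y k) -> y k @[k --> \oo] --> l ->
  y k `^ a @[k --> \oo] --> l `^ a.
Proof.
move=> a0 y0 cv; have l0 : 0 <= l by exact: ler_cvg_seq y0 cv.
have cc : `|t| `^ a @[t --> l] --> `|l| `^ a by exact: normr_powR_continuous.
have := @cvg_comp _ _ _ _ (fun t : R => `|t| `^ a) _ _ _ cv cc.
rewrite (ger0_norm l0) (_ : (fun t : R => `|t| `^ a) \o _ = (fun k => y k `^ a))//.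
by apply/funext => k /=; rewrite ger0_norm.
Qed.

Lemma cvg_powR0 (y : nat -> R) a : 0 < a -> `|y k| `^ a @[k --> \oo] --> (0 : R) ->
  y k @[k --> \oo] --> (0 : R).
Proof.
move=> a0 cv; have pi0 : 0 < a^-1 by rewrite invr_gt0.
have := cvg_powR pi0 (fun k => powR_ge0 _ _) cv.
rewrite powR0 ?gt_eqF//; under eq_fun do rewrite -powRrM mulfV ?gt_eqF// powRr1//.
by move=> c; apply/norm_cvg0P.
Qed.

End limits.

Section energy_bound_limits.
Context d (T : measurableType d) (R : realType) (m : nat).
Variable mu : {measure set T -> \bar R}.
Implicit Types (F G : T -> 'rV[R]_m) (p e : R).

Lemma en_le_scal p e F (c : T -> R) : 0 < p -> measurable_fun setT c -> (forall x, `|c x| <= 1) ->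
  en_le mu p e F -> en_le mu p e (fun x => c x *: F x).
Proof.
move=> p0 mc c1 [[mF iF] h].
have mcF : vmeas (fun x => c x *: F x).
  by move=> i; under eq_fun do rewrite mxE; exact: measurable_funM.
have le x : enorm (c x *: F x) `^ p <= enorm (F x) `^ p.
  rewrite enorm_powRZ ler_piMl ?powR_ge0//.
  apply: (@le_trans _ _ (1 `^ p)); last by rewrite powR1.
  by rewrite ge0_ler_powR ?nnegrE ?(ltW p0).
have i : L1 mu (fun x => enorm (c x *: F x) `^ p).
  by apply: L1_le iF _; [exact: measurable_enorm_powR|move=> x; rewrite ger0_norm ?powR_ge0].
split; first by split.
by apply: le_trans h; exact: rint_le.
Qed.

Lemma en_dct p F (c : nat -> T -> R) : 0 < p -> (forall k, measurable_fun setT (c k)) ->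
  (forall k x, `|c k x| <= 1) -> inLp mu p F -> {ae mu, forall x, c k x @[k --> \oo] --> (0 : R)} ->
  energy mu p (fun x => c k x *: F x) @[k --> \oo] --> (0 : R).
Proof.
move=> p0 mc c1 [mF iF] cv.
have [_] : L1 mu (fun=> 0 : R) /\
    \int[mu]_x (enorm (c k x *: F x) `^ p) @[k --> \oo] --> \int[mu]_x (fun=> 0 : R) x.
  apply: (@rint_dct _ _ _ mu (fun k x => enorm (c k x *: F x) `^ p) _ (fun x => enorm (F x) `^ p)) => //.
  - move=> k; apply: measurable_enorm_powR => i.
    by under eq_fun do rewrite mxE; exact: measurable_funM.
  - apply: nearW => x k; rewrite ger0_norm ?powR_ge0// enorm_powRZ ler_piMl ?powR_ge0//.
    apply: (@le_trans _ _ (1 `^ p)); last by rewrite powR1.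
    by rewrite ge0_ler_powR ?nnegrE ?(ltW p0).
  - apply: filterS cv => x c0.
    suff h : enorm (c k x *: F x) `^ p @[k --> \oo] --> (0 : R) by exact: h.
    have -> : (fun k => enorm (c k x *: F x) `^ p) = (fun k => `|c k x| `^ p * enorm (F x) `^ p).
      by apply/funext => k; rewrite enorm_powRZ.
    rewrite -[X in _ --> X](mul0r (enorm (F x) `^ p)); apply: cvgM; last exact: cvg_cst.
    have nc : `|c k x| @[k --> \oo] --> `|0 : R| by exact: cvg_norm.
    have h := cvg_powR p0 (fun k => normr_ge0 (c k x)) nc.
    by rewrite normr0 powR0 ?gt_eqF// in h.
by rewrite /Rintegral integral0.
Qed.

Lemma ae_cvg_of_en_le p (w : nat -> T -> R) : 0 < p ->
  (forall k, en_le mu p (2^-1 ^+ k) (Sf (w k))) -> {ae mu, forall x, w k x @[k --> \oo] --> (0 : R)}.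
Proof.
move=> p0 hw.
have : {ae mu, forall x, `|w k x| `^ p @[k --> \oo] --> (0 : R)}.
  apply: (@ae_cvg0_of_summable _ _ _ mu (fun k x => `|w k x| `^ p)) => [k|k x|k].
  + by apply: measurable_powR_norm; have /en_leSf[] := hw k.
  + exact: powR_ge0.
  + by have /en_leSf[_ i le] := hw k; rewrite L1_integralE.
by apply: filterS => x c; exact: cvg_powR0 c.
Qed.

End energy_bound_limits.

Section sobolev_space_inequalities.
Context {R : realType} (n : nat) (p q D : R) (adm : admissible n p q D).
Variables (Omega : set 'rV[R]_n) (bO : bounded_set Omega).
Local Notation mu := (lebesgue_rV R n).
Local Notation nu := (mu \x mu)%E.
Implicit Types (u v w : 'rV[R]_n -> R) (G H : 'rV[R]_n -> 'rV[R]_n) (e : R).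
Local Notation nlf := (nlfield p D).
Local Notation X := (X p q D Omega).
Local Notation small := (small p q D).

Let p1 : 1 < p. Proof. by case: adm => /andP[]. Qed.
Let pn : p < n%:R. Proof. by case: adm => /andP[]. Qed.
Let pq : p < q. Proof. by case: adm. Qed.
Let qs : (n%:R - p) * (q / p - 1) < p. Proof. by case: adm. Qed.
Let Dn : n%:R < D. Proof. by case: adm => _ _ _ /andP[]. Qed.
Let Dnp : D < n%:R + p. Proof. by case: adm => _ _ _ /andP[]. Qed.
Let p0 : 0 < p. Proof. exact: lt_trans p1. Qed.
Let q1 : 1 < q. Proof. exact: lt_trans pq. Qed.
Let q0 : 0 < q. Proof. exact: lt_trans q1. Qed.
Let half0 k : (0 : R) < 2^-1 ^+ k. Proof. by rewrite exprn_gt0// invr_gt0. Qed.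

Lemma X_approx u G : X u G -> exists phi : nat -> 'rV[R]_n -> R,
  [/\ forall k, Cc_infty Omega (phi k),
      forall k, small (2^-1 ^+ k) (fun x => u x - phi k x) (fun x => G x - grad (phi k) x) &
      {ae mu, forall x, phi k x @[k --> \oo] --> u x}].
Proof.
move=> [mU mG h].
have ex k : exists phi, Cc_infty Omega phi /\
    small (2^-1 ^+ k) (fun x => u x - phi x) (fun x => G x - grad phi x).
  by have [phi h1 h2] := h _ (half0 k); exists phi.
pose phi k := sval (cid (ex k)).
have [hphi hs] : (forall k, Cc_infty Omega (phi k)) /\ (forall k,
    small (2^-1 ^+ k) (fun x => u x - phi k x) (fun x => G x - grad (phi k) x)).
  by split=> k; rewrite /phi; case: (cid (ex k)) => f [].
exists phi; split => //.
have : {ae mu, forall x, (u x - phi k x) @[k --> \oo] --> (0 : R)}.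
  by apply: (ae_cvg_of_en_le p0) => k; have [_] := hs k.
apply: filterS => x c.
have -> : (fun k => phi k x) = (fun k => u x - (u x - phi k x)).
  by apply/funext => k; rewrite opprB addrC subrK.
by rewrite -[X in _ --> X]subr0; apply: cvgB => //; exact: cvg_cst.
Qed.

(** The inequalities for test functions pass to the limit; the powers of 2 in the constant come from
    the triangle inequality for p-th and q-th powers. *)
Lemma X_sobolev : exists2 K, 0 <= K & forall u G, X u G ->
  [/\ \int[mu]_x (`|u x| `^ p) <= K * energy mu p G,
      \int[mu]_x (`|u x| `^ q) <= K * energy mu p G `^ (q / p) &
      energy nu p (nlf u) <= K * energy mu p G].
Proof.
have [K1 K10 h1] := poincare p1 pn bO.
have [K2 K20 h2] := sobolev p1 pn (ltW pq) qs bO.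
have [K3 K30 h3] := Cc_nonlocal p1 pn Dn Dnp bO.
set P : R := 2 `^ p; set Q : R := 2 `^ q; set QP : R := P `^ (q / p).
have P0 : 0 <= P by exact: powR_ge0.
have Q0 : 0 <= Q by exact: powR_ge0.
have qp0 : 0 < q / p by rewrite divr_gt0.
exists (P * (K1 * P) + Q * (K2 * QP) + P * (K3 * P)).
  by rewrite !addr_ge0// !mulr_ge0// powR_ge0.
move=> u G hX; set I := energy mu p G; have I0 : 0 <= I by exact: energy_ge0.
have [phi [hphi hs _]] := X_approx hX; have hG := X_inLp adm bO hX.
have Ip k : energy mu p (grad (phi k)) <= P * (I + 2^-1 ^+ k).
  have [hk _ _ _] := hs k.
  have [_] := en_leB p1 (conj hG (lexx I)) hk.
  by under eq_fun do rewrite opprB addrC subrK.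
have cvI : P * (I + 2^-1 ^+ k) @[k --> \oo] --> P * I.
  apply: cvgM; first exact: cvg_cst.
  by rewrite -[X in _ --> X]addr0; apply: cvgD; [exact: cvg_cst|exact: cvg_half].
have split3 (x y z : R) : 0 <= y -> 0 <= z -> x <= x + y + z by lra.
have lin k s t : 0 <= k -> 0 <= s -> 0 <= t -> P * (K1 * P) + Q * (K2 * QP) + P * (K3 * P) >= k ->
    s <= k * t -> s <= (P * (K1 * P) + Q * (K2 * QP) + P * (K3 * P)) * t.
  by move=> k0 s0 t0 kK h; apply: le_trans h _; rewrite ler_wpM2r.
have T1 : 0 <= P * (K1 * P) by rewrite !mulr_ge0.
have T2 : 0 <= Q * (K2 * QP) by rewrite !mulr_ge0 ?powR_ge0.
have T3 : 0 <= P * (K3 * P) by rewrite !mulr_ge0.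
have trick (w f : 'rV[R]_n -> R) : (fun x => Sf w x) = (fun x => Sf (fun x => w x - f x) x + Sf f x).
  by apply/funext => x; apply/rowP => i; rewrite !mxE subrK.
split.
- apply: (lin (P * (K1 * P))); [exact: T1|by apply: rint_ge0 => x; exact: powR_ge0|exact: I0|lra|].
  apply: (@ler_cvg_seq _ _ _ (fun k => P * (2^-1 ^+ k + K1 * (P * (I + 2^-1 ^+ k))))).
    move=> k; have [_ h _ _] := hs k.
    have e1 : en_le mu p (K1 * (P * (I + 2^-1 ^+ k))) (Sf (phi k)).
      apply/en_leSf; split; [exact: Cc_meas (hphi k)|exact: Cc_L1_powR (hphi k)|].
      by apply: le_trans (h1 _ (hphi k)) _; rewrite ler_wpM2l.
    have := en_leD p1 h e1; rewrite -trick => /en_leSf[_ _].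
    exact.
  rewrite -!mulrA; apply: cvgM; first exact: cvg_cst.
  rewrite -[X in _ --> X]add0r; apply: cvgD; first exact: cvg_half.
  by apply: cvgM => //; exact: cvg_cst.
- apply: (lin (Q * (K2 * QP))); [exact: T2|by apply: rint_ge0 => x; exact: powR_ge0|exact: powR_ge0|lra|].
  apply: (@ler_cvg_seq _ _ _ (fun k => Q * (2^-1 ^+ k + K2 * (P * (I + 2^-1 ^+ k)) `^ (q / p)))).
    move=> k; have [_ _ h _] := hs k.
    have e1 : en_le mu q (K2 * (P * (I + 2^-1 ^+ k)) `^ (q / p)) (Sf (phi k)).
      apply/en_leSf; split; [exact: Cc_meas (hphi k)|exact: Cc_L1_powR (hphi k)|].
      apply: le_trans (h2 _ (hphi k)) _; rewrite ler_wpM2l//.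
      rewrite ge0_ler_powR ?nnegrE ?energy_ge0 ?(ltW qp0)//.
      by rewrite mulr_ge0// addr_ge0// ltW.
    have := en_leD q1 h e1; rewrite -trick => /en_leSf[_ _].
    exact.
  rewrite -!mulrA; apply: cvgM; first exact: cvg_cst.
  rewrite -[X in _ --> X]add0r; apply: cvgD; first exact: cvg_half.
  apply: cvgM; first exact: cvg_cst.
  rewrite /QP -powRM//; apply: cvg_powR => // k.
  by rewrite mulr_ge0// addr_ge0// ltW.
- apply: (lin (P * (K3 * P))); [exact: T3|exact: energy_ge0|exact: I0|lra|].
  apply: (@ler_cvg_seq _ _ _ (fun k => P * (2^-1 ^+ k + K3 * (P * (I + 2^-1 ^+ k))))).
    move=> k; have [_ _ _ h] := hs k; have [i le] := h3 _ (hphi k).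
    have e1 : en_le nu p (K3 * (P * (I + 2^-1 ^+ k))) (nlf (phi k)).
      by split => //; apply: le_trans le _; rewrite ler_wpM2l.
    have [_] := en_leD p1 h e1.
    rewrite (_ : (fun z => _) = nlf u)//.
    by apply/funext => z; rewrite nlfieldB subrK.
  rewrite -!mulrA; apply: cvgM; first exact: cvg_cst.
  rewrite -[X in _ --> X]add0r; apply: cvgD; first exact: cvg_half.
  by apply: cvgM => //; exact: cvg_cst.
Qed.

(** For approximating test functions phi, h'(u) G - h'(phi) grad phi = (h'(u) - h'(phi)) G + h'(phi)
    (G - grad phi). The first term vanishes by dominated convergence, the second because |h'| <=
    1. *)
Lemma X_smooth_comp (h h' : R -> R) u G : smooth1 h -> h 0 = 0 -> continuous h' ->
  (forall x, is_derive x (1 : R) h (h' x)) -> (forall x, 0 <= h' x <= 1) ->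
  X u G -> X (h \o u) (fun x => h' (u x) *: G x).
Proof.
move=> sh h0 ch' dh b hX; have [mU mG _] := hX; have hG := X_inLp adm bO hX.
have [phi [hphi hs cv]] := X_approx hX.
have mh' : measurable_fun setT h' by exact: continuous_measurable_fun.
have ch : continuous h by exact: smooth1_continuous.
have mhu : measurable_fun setT (fun x => h' (u x)) by exact: measurableT_comp mh' mU.
have mhp k : measurable_fun setT (fun x => h' (phi k x)).
  by apply: (measurableT_comp mh'); exact: Cc_meas (hphi k).
pose c k x := h' (u x) - h' (phi k x).
have mc k : measurable_fun setT (c k) by exact: measurable_funB.
have c1 k x : `|c k x| <= 1.
  have /andP[b1 b2] := b (u x); have /andP[b3 b4] := b (phi k x).
  by rewrite ler_norml /c; apply/andP; split; lra.
have c0 : {ae mu, forall x, c k x @[k --> \oo] --> (0 : R)}.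
  apply: filterS cv => x cx; rewrite -(subrr (h' (u x))).
  apply: cvgB; first exact: cvg_cst.
  by apply: (@cvg_comp _ _ _ _ h' _ _ _ cx); exact: ch'.
apply: (@X_of_seq _ _ _ _ _ adm _ bO (fun k => h \o phi k) _ _
  (fun k => 2 `^ p * (energy mu p (fun x => c k x *: G x) + 2^-1 ^+ k))).
- by move=> k; exact: Cc_comp.
- move=> k; have [hk _ _ _] := hs k.
  have e1 : en_le mu p (2^-1 ^+ k) (fun x => h' (phi k x) *: (G x - grad (phi k) x)).
    apply: en_le_scal => // x; have /andP[b3 b4] := b (phi k x).
    by rewrite ger0_norm.
  have e2 : en_le mu p (energy mu p (fun x => c k x *: G x)) (fun x => c k x *: G x).
    split => //; have := en_le_scal p0 (mc k) (c1 k) (conj hG (lexx (energy mu p G))).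
    by case.
  have := en_leD p1 e2 e1; rewrite (grad_comp dh (hphi k)).
  rewrite (_ : (fun x => c k x *: G x + _) =
    (fun x => h' (u x) *: G x - h' (phi k x) *: grad (phi k) x))//.
  by apply/funext => x; rewrite /c scalerBl scalerBr addrA subrK.
- rewrite -[X in _ --> X](mulr0 (2 `^ p)); apply: cvgM; first exact: cvg_cst.
  rewrite -[X in _ --> X]addr0; apply: cvgD; last exact: cvg_half.
  exact: en_dct.
- by apply: measurableT_comp mU; exact: continuous_measurable_fun.
- by move=> i; under eq_fun do rewrite mxE; apply: measurable_funM.
- by apply: filterS cv => x cx; apply: (@cvg_comp _ _ _ _ h _ _ _ cx); exact: ch.
Qed.

(* The derivative of [t |-> (t - l)^+], with its middle value at the kink. *)
Definition trh (l t : R) : R := if t < l then 0 else if l < t then 1 else 2^-1.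

Lemma sigm_cvg l t : sigm ((t - l) / k.+1%:R^-1) @[k --> \oo] --> trh l t.
Proof.
have e (s : R) : (fun k : nat => sigm (s / k.+1%:R^-1)) = (fun k => (1 + expR (- s) * expR (- s) ^+ k)^-1).
  by apply/funext => k; rewrite /sigm invrK -mulNr mulrC expRM_natl -exprS.
rewrite e /trh; have [tl|lt|->] := ltgtP t l.
- rewrite -e; set s := t - l; have s0 : 0 < - s by rewrite oppr_gt0 subr_lt0.
  have le k : 0 <= sigm (s / k.+1%:R^-1) <= expR s ^+ k.+1.
    have /andP[h1 _] := sigm_bound (s / k.+1%:R^-1); rewrite (ltW h1)/=.
    rewrite /sigm invrK -[leRHS]invrK lef_pV2 ?posrE ?invr_gt0 ?exprn_gt0 ?expR_gt0 ?addr_gt0 ?expR_gt0//.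
    rewrite -expRM_natl -expRN mulrC; rewrite ler_wpDl//.
  apply: (@squeeze_cvgr _ _ _ _ (fun=> 0) (fun k => expR s ^+ k.+1) (fun k => sigm (s / k.+1%:R^-1))).
  + by apply: nearW => k; exact: le.
  + exact: cvg_cst.
  + rewrite (cvg_shiftS (fun k => expR s ^+ k)); apply: cvg_expr.
    by rewrite ger0_norm ?expR_ge0// -expR0 ltr_expR -oppr_gt0.
- set s := t - l; have s0 : 0 < s by rewrite subr_gt0.
  rewrite -[X in _ --> X]invr1; apply: cvgV; first exact: oner_neq0.
  rewrite -[X in _ --> X]addr0; apply: cvgD; first exact: cvg_cst.
  rewrite -[X in _ --> X](mulr0 (expR (- s))); apply: cvgM; first exact: cvg_cst.
  by apply: cvg_expr; rewrite ger0_norm ?expR_ge0// -expR0 ltr_expR oppr_lt0.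
- rewrite subrr oppr0 expR0; under eq_fun do rewrite expr1n mulr1.
  by rewrite (_ : (1 + 1)^-1 = 2^-1 :> R)//; exact: cvg_cst.
Qed.

Lemma softplus_dist (l d t : R) : 0 < l -> 0 < d ->
  `|softplus l d t - Num.max (t - l) 0| <= d * ln 2.
Proof.
move=> l0 d0; pose f (s : R) := d * ln (1 + expR (s / d)).
have fb s : Num.max s 0 <= f s <= Num.max s 0 + d * ln 2.
  have e0 := expR_gt0 (s / d).
  have qq0 : 0 < 1 + expR (s / d) by rewrite addr_gt0.
  rewrite /f; have [s0|s0] := leP s 0.
    rewrite mulr_ge0 ?(ltW d0) ?ln_ge0 ?lerDl ?(ltW e0)//= add0r ler_wpM2l ?(ltW d0)//.
    rewrite ler_ln ?posrE// -[leRHS]/(1 + 1) lerD2l -expR0 ler_expR.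
    by rewrite pmulr_lle0 ?invr_gt0.
  have hs : s = d * ln (expR (s / d)) by rewrite expRK mulrC divfK// gt_eqF.
  apply/andP; split.
    by rewrite [leLHS]hs ler_wpM2l ?(ltW d0)// ler_ln ?posrE// lerDr.
  have -> : s + d * ln 2 = d * (ln (expR (s / d)) + ln 2) by rewrite mulrDr -hs.
  rewrite ler_wpM2l ?(ltW d0)// -lnM ?posrE//.
  rewrite ler_ln ?posrE ?mulr_gt0// mulrDr mulr1 lerD2r -expR0 ler_expR.
  by rewrite divr_ge0 ?ltW.
have -> : softplus l d t = f (t - l) - f (- l) by rewrite /softplus mulrBr.
have /andP[h1 h2] := fb (t - l); have /andP[h3 h4] := fb (- l).
(* Since l > 0, the normalising constant f (-l) of [softplus] is itself at most d ln 2. *)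
have e : Num.max (- l) 0 = 0 by apply/max_idPr; rewrite oppr_le0 ltW.
rewrite e in h3 h4; rewrite ler_norml; apply/andP; split.
  by move: (Num.max _ _) h1 h2 => M h1 h2; lra.
by move: (Num.max _ _) h1 h2 => M h1 h2; lra.
Qed.

(** The functions [softplus l d] of u belong to the space by the chain rule. As d -> 0 their
    gradients converge in energy by domination, and the functions converge uniformly. *)
Lemma X_trunc l u G : 0 < l -> X u G ->
  X (fun x => Num.max (u x - l) 0) (fun x => trh l (u x) *: G x).
Proof.
move=> l0 hX; have [mU mG _] := hX; have hG := X_inLp adm bO hX.
pose dl k : R := k.+1%:R^-1; have dl0 k : 0 < dl k by rewrite invr_gt0.
pose s k x := sigm ((u x - l) / dl k).
have csig k : continuous (fun t : R => sigm ((t - l) / dl k)).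
  move=> t; apply: (@cvg_comp _ _ _ (fun t : R => (t - l) / dl k) sigm _ (nbhs ((t - l) / dl k))).
    apply: cvgM; last exact: cvg_cst.
    by apply: cvgB; [exact: cvg_id|exact: cvg_cst].
  have dv := sigm_derive ((t - l) / dl k).
  by apply: differentiable_continuous; apply/derivable1_diffP; case: dv.
have ms k : measurable_fun setT (s k).
  exact: (measurableT_comp (continuous_measurable_fun (csig k)) mU).
have mt : measurable_fun setT (fun x => trh l (u x)).
  apply: (@measurable_fun_cvg _ _ _ setT (fun k => s k)) => // x _.
  exact: sigm_cvg.
have hk k : X (softplus l (dl k) \o u) (fun x => s k x *: G x).
  apply: (@X_smooth_comp _ (fun t => sigm ((t - l) / dl k))) => //.
  - exact: softplus_smooth.
  - by rewrite /softplus sub0r subrr mulr0.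
  - by move=> t; exact: softplus_derive.
  - by move=> t; have /andP[h1 h2] := sigm_bound ((t - l) / dl k); rewrite !ltW.
pose c k x := trh l (u x) - s k x.
have tb t : 0 <= trh l t <= 1.
  by rewrite /trh; case: ifP => _; [|case: ifP => _]; lra.
have c1 k x : `|c k x| <= 1.
  have /andP[b1 b2] := tb (u x); have /andP[b3 b4] := sigm_bound ((u x - l) / dl k).
  by rewrite ler_norml /c /s; apply/andP; split; lra.
have mc k : measurable_fun setT (c k) by exact: measurable_funB.
apply: (@X_closed _ _ _ _ _ adm _ bO (fun k => softplus l (dl k) \o u)
  (fun k x => s k x *: G x) _ _ (fun k => energy mu p (fun x => c k x *: G x))).
- exact: hk.
- move=> k; have := en_le_scal p0 (mc k) (c1 k) (conj hG (lexx (energy mu p G))).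
  move=> [i _]; have eF : (fun x => trh l (u x) *: G x - s k x *: G x) = (fun x => c k x *: G x).
    by apply/funext => x; rewrite scalerBl.
  by rewrite eF; split; [exact: i|exact: lexx].
- apply: en_dct => //; apply: nearW => x; rewrite -(subrr (trh l (u x))).
  by apply: cvgB; [exact: cvg_cst|exact: sigm_cvg].
- by apply: measurable_maxr => //; exact: measurable_funB.
- by move=> i; under eq_fun do rewrite mxE; exact: measurable_funM.
- apply: nearW => x; apply/cvgrPdist_le => e e0.
  have cv : dl k * ln 2 @[k --> \oo] --> (0 : R).
    by rewrite -[X in _ --> X](mul0r (ln 2)); apply: cvgM; [exact: cvg_harmonic|exact: cvg_cst].
  have [N _ hN] := (cvgrPdist_le _ _).1 cv e e0; exists N => // k Nk /=.
  have := hN k Nk; rewrite sub0r normrN distrC => h.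
  apply: le_trans (softplus_dist (u x) l0 (dl0 k)) _.
  by apply: le_trans h; exact: ler_norm.
Qed.

(** As u is a limit of functions of compact support, the test function may live on any set, in
    particular on the whole space. Products are estimated by t <= d + C t^p from [powR_interp], in
    place of Hoelder's inequality. *)
Lemma X_ibp Omega' u G phi i : X u G -> Cc_infty Omega' phi ->
  [/\ L1 mu (fun x => u x * pderiv i phi x), L1 mu (fun x => G x ord0 i * phi x) &
   \int[mu]_x (u x * pderiv i phi x) = - \int[mu]_x (G x ord0 i * phi x)].
Proof.
move=> hX hphi; have [mU mG _] := hX; have [mGp iG] := X_inLp adm bO hX; have iu := X_L1p adm bO hX.
have hd := Cc_pderiv i hphi; have ip := Cc_L1 hphi; have id_ := Cc_L1 hd.
have [M M0 hM] := Cc_bounded hphi; have [M' M'0 hM'] := Cc_bounded hd.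
have mult (f g : 'rV[R]_n -> R) c d C : measurable_fun setT f -> L1 mu (fun x => `|f x| `^ p) ->
    L1 mu g -> (forall x, `|g x| <= c) -> 0 <= c -> 0 < d -> 0 <= C ->
    (forall x, 0 <= x -> x `^ 1 <= d + C * x `^ p) ->
    L1 mu (fun x => f x * g x) /\ \int[mu]_x `|f x * g x| <= d * \int[mu]_x `|g x| +
      (C * c) * \int[mu]_x (`|f x| `^ p).
  move=> mf hf ig gc c0 d0 C0 hC; have mg := L1_measurable ig.
  have pt x : `|f x * g x| <= d * `|g x| + (C * c) * `|f x| `^ p.
    rewrite normrM; have := hC _ (normr_ge0 (f x)); rewrite powRr1// => h.
    apply: le_trans (ler_wpM2r (normr_ge0 (g x)) h) _; rewrite mulrDl lerD2l -!mulrA.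
    by rewrite ler_wpM2l// mulrC ler_wpM2r ?powR_ge0.
  have ifg : L1 mu (fun x => f x * g x).
    apply: L1_le (L1D (L1Z d (L1_norm ig)) (L1Z (C * c) hf)) pt; exact: measurable_funM.
  by split => //; exact: (rint_le_lin (L1_norm ifg) (L1_norm ig) hf pt).
have p01 : (0 : R) < 1 < p by rewrite ltr01.
have Gi_le x : `|G x ord0 i| `^ p <= enorm (G x) `^ p.
  by rewrite ge0_ler_powR ?nnegrE ?enorm_ge0 ?(ltW p0)// coord_le_enorm.
have iGi : L1 mu (fun x => `|G x ord0 i| `^ p).
  apply: L1_le iG _; first by apply: measurable_powR_norm; exact: mG.
  by move=> x; rewrite ger0_norm ?powR_ge0.
have [C C0 hC] := @powR_interp R 1 p 1 p01 ltr01.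
have [i1 _] := mult u _ _ _ _ mU iu id_ hM' M'0 ltr01 C0 hC.
have [i2 _] := mult (fun x => G x ord0 i) _ _ _ _ (mG i) iGi ip hM M0 ltr01 C0 hC.
split => //; apply/eqP; rewrite -addr_eq0 -normr_le0; apply/ler_addgt0Pr => e e0; rewrite add0r.
have [phik [hk hs _]] := X_approx hX.
set N1 := \int[mu]_x `|phi x|; set N2 := \int[mu]_x `|pderiv i phi x|.
have N10 : 0 <= N1 by exact: rint_ge0.
have N20 : 0 <= N2 by exact: rint_ge0.
pose d := e / (N1 + N2 + 1).
have d0 : 0 < d by rewrite divr_gt0// ltr_wpDl ?addr_ge0.
have [C' C'0 hC'] := @powR_interp R 1 p d p01 d0.
have key k : `|\int[mu]_x (u x * pderiv i phi x) + \int[mu]_x (G x ord0 i * phi x)| <=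
   d * (N1 + N2) + (C' * M + C' * M') * 2^-1 ^+ k.
  have [[[mB iB] eB] /en_leSf[muk iuk euk] _ _] := hs k.
  have hpk := Cc_pderiv i (hk k); have [Mk Mk0 hMk] := Cc_bounded (hk k).
  have mBi : measurable_fun setT (fun x => G x ord0 i - pderiv i (phik k) x).
    by apply: measurable_funB => //; exact: Cc_meas hpk.
  have Bi_le x : `|G x ord0 i - pderiv i (phik k) x| `^ p <= enorm (G x - grad (phik k) x) `^ p.
    rewrite ge0_ler_powR ?nnegrE ?enorm_ge0 ?(ltW p0)//.
    by have := coord_le_enorm (G x - grad (phik k) x) i; rewrite !mxE.
  have iBi : L1 mu (fun x => `|G x ord0 i - pderiv i (phik k) x| `^ p).
    apply: L1_le iB _; first exact: measurable_powR_norm.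
    by move=> x; rewrite ger0_norm ?powR_ge0.
  have [j1 le1] := mult _ _ _ _ _ muk iuk id_ hM' M'0 d0 C'0 hC'.
  have [j2 le2] := mult _ _ _ _ _ mBi iBi ip hM M0 d0 C'0 hC'.
  have cphik : forall k0, Ck k0 (phik k) by case: (hk k).
  have cphi : forall k0, Ck k0 phi by case: hphi.
  have hkT : Cc_infty setT (phik k) by case: (hk k) => a b _; split.
  have hphiT : Cc_infty setT phi by case: hphi => a b _; split.
  have ibp := integration_by_parts_rV i hkT hphiT.
  have j3 : L1 mu (fun x => phik k x * pderiv i phi x).
    by apply: (@Cc_L1 _ _ setT); apply: Cc_mulr => //; case: (Cc_pderiv i hphiT).
  have j4 : L1 mu (fun x => pderiv i (phik k) x * phi x).
    by apply: (@Cc_L1 _ _ setT); apply: Cc_mulr => //; exact: Cc_pderiv.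
  have e1 : \int[mu]_x ((u x - phik k x) * pderiv i phi x) =
      \int[mu]_x (u x * pderiv i phi x) - \int[mu]_x (phik k x * pderiv i phi x).
    by rewrite -(rintB i1 j3); congr Rintegral; apply/funext => x; rewrite mulrBl.
  have e2 : \int[mu]_x ((G x ord0 i - pderiv i (phik k) x) * phi x) =
      \int[mu]_x (G x ord0 i * phi x) - \int[mu]_x (pderiv i (phik k) x * phi x).
    by rewrite -(rintB i2 j4); congr Rintegral; apply/funext => x; rewrite mulrBl.
  have -> : \int[mu]_x (u x * pderiv i phi x) + \int[mu]_x (G x ord0 i * phi x) =
     \int[mu]_x ((u x - phik k x) * pderiv i phi x) +
     \int[mu]_x ((G x ord0 i - pderiv i (phik k) x) * phi x).
    by rewrite e1 e2 ibp opprK addrACA subrr addr0.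
  apply: le_trans (ler_normD _ _) _.
  have r1 := le_trans (rint_norm j1) le1; have r2 := le_trans (rint_norm j2) le2.
  have iBle : \int[mu]_x (`|G x ord0 i - pderiv i (phik k) x| `^ p) <= 2^-1 ^+ k.
    by apply: le_trans eB; exact: rint_le.
  have s1 := ler_wpM2l (mulr_ge0 C'0 M'0) euk.
  have s2 := ler_wpM2l (mulr_ge0 C'0 M0) iBle.
  apply: le_trans (lerD r1 r2) _; rewrite -/N1 -/N2.
  apply: (@le_trans _ _ (d * N2 + C' * M' * 2^-1 ^+ k + (d * N1 + C' * M * 2^-1 ^+ k))).
    by rewrite !lerD.
  by rewrite le_eqVlt; apply/orP; left; apply/eqP; ring.
apply: (@le_trans _ _ (d * (N1 + N2))).
  apply: (ler_cvg_seq key); rewrite -[X in _ --> X]addr0; apply: cvgD; first exact: cvg_cst.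
  rewrite -[X in _ --> X](mulr0 (C' * M + C' * M')).
  by apply: cvgM; [exact: cvg_cst|exact: cvg_half].
rewrite /d mulrAC ler_pdivrMr ?ltr_wpDl ?addr_ge0// ler_wpM2l ?(ltW e0)// lerDl.
by rewrite ler01.
Qed.

End sobolev_space_inequalities.

(** * Uniqueness of weak gradients *)

Section bump.
Context {R : realType} (n : nat).
Implicit Types (x : 'rV[R]_n) (rho : R).

Definition bump x0 rho x : R := psi (rho ^+ 2 - dotp (x - x0) (x - x0)).

Lemma bump_ge0 x0 rho x : 0 <= bump x0 rho x.
Proof. exact: psi_ge0. Qed.

Lemma bump_gt0 x0 rho x : 0 < rho -> (0 < bump x0 rho x) = (enorm (x - x0) < rho).
Proof.
move=> r0; rewrite psi_gt0 subr_gt0 -enorm_sqr ltr_pXn2r ?nnegrE ?enorm_ge0//.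
exact: ltW.
Qed.

Lemma Ck_sqdist k x0 : Ck k (fun x => dotp (x - x0) (x - x0)).
Proof.
rewrite /dotp; apply: Ck_sum => i.
have h : Ck k (fun x : 'rV[R]_n => (x - x0) ord0 i).
  rewrite (_ : (fun x => _) = (fun x : 'rV[R]_n => x ord0 i - x0 ord0 i)).
    by apply: CkB; [exact: Ck_coord|exact: Ck_cst].
  by apply/funext => x; rewrite !mxE.
exact: CkM.
Qed.

Lemma Ck_bump k x0 rho : Ck k (bump x0 rho).
Proof. by apply: (Ck_comp psi_smooth); apply: CkB; [exact: Ck_cst|exact: Ck_sqdist]. Qed.

Lemma compact_enorm_ball x0 rho : 0 < rho -> compact [set x | enorm (x - x0) <= rho].
Proof.
move=> r0.
have Bc : compact [set x : 'rV[R]_n | forall i, `[x0 ord0 i - rho, x0 ord0 i + rho]%classic (x ord0 i)].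
  apply: (@rV_compact R n (fun i => `[x0 ord0 i - rho, x0 ord0 i + rho]%classic)) => i.
  exact: segment_compact.
apply: (subclosed_compact _ Bc).
- rewrite (_ : [set x | _] = (fun x => dotp (x - x0) (x - x0)) @^-1` [set t | t <= rho ^+ 2]).
    apply: closed_comp; last exact: closed_le.
    by move=> x _; exact: (Ck_continuous (Ck_sqdist 0 x0)).
  apply/funext => x; apply/propext; split=> /=.
    by rewrite -enorm_sqr ler_pXn2r ?nnegrE ?enorm_ge0 ?(ltW r0).
  by rewrite -enorm_sqr ler_pXn2r ?nnegrE ?enorm_ge0 ?(ltW r0).
- move=> x /= h i; rewrite /= in_itv/= -ler_distl.
  by apply: le_trans h; have := coord_le_enorm (x - x0) i; rewrite !mxE.
Qed.

Lemma Cc_bump Omega x0 rho : 0 < rho -> (forall x, enorm (x - x0) <= rho -> Omega x) ->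
  Cc_infty Omega (bump x0 rho).
Proof.
move=> r0 h; apply: (@Cc_intro _ _ _ [set x | enorm (x - x0) <= rho]) => //.
- by move=> k; exact: Ck_bump.
- exact: compact_enorm_ball r0.
- move=> x bx; have : 0 < bump x0 rho x by rewrite lt_neqAle eq_sym bx bump_ge0.
  by rewrite bump_gt0// => /ltW.
Qed.

Lemma open_enorm_ball (Omega : set 'rV[R]_n) x0 : open Omega -> Omega x0 ->
  exists2 rho, 0 < rho & forall x, enorm (x - x0) <= rho -> Omega x.
Proof.
move=> oO Ox; have /nbhs_ballP[e /= e0 he] : nbhs x0 Omega by exact: open_nbhs_nbhs.
exists (e / 2); first by rewrite divr_gt0.
move=> x hx; apply: he; rewrite -ball_normE/= distrC.
have e2 : e / 2 < e by rewrite ltr_pdivrMr// ltr_pMr// ltr1n.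
apply: le_lt_trans e2; rewrite [leLHS]/Num.Def.normr/= mx_normrE.
apply: bigmax_le; first by rewrite divr_ge0// ltW.
move=> [i j] _ /=; rewrite ord1; apply: le_trans hx; exact: coord_le_enorm.
Qed.

Lemma cell_in_ball x0 rho : 0 < rho ->
  exists j, forall y, cell j y = cell j x0 -> enorm (y - x0) < rho.
Proof.
move=> r0; have [j jr] : exists j, n%:R * 2^-1 ^+ j < rho.
  have cv : n%:R * 2^-1 ^+ j @[j --> \oo] --> (n%:R * 0 : R).
    by apply: cvgM; [exact: cvg_cst|exact: cvg_half].
  rewrite mulr0 in cv; have [j _ hj] := (cvgrPdist_lt _ _).1 cv rho r0; exists j.
  by have := hj j (leqnn j); rewrite sub0r normrN; apply: le_lt_trans; exact: ler_norm.
exists j => y yx; apply: le_lt_trans jr; apply: le_trans (enorm_le_sum _) _.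
apply: (@le_trans _ _ (\sum_(i < n) 2^-1 ^+ j)).
  by apply: ler_sum => i _; rewrite !mxE; exact: cell_dist.
by rewrite sumr_const card_ord mulr_natl.
Qed.

Lemma sigma_compact (Omega : set 'rV[R]_n) : open Omega -> exists2 F : nat -> set 'rV[R]_n,
  forall k, compact (F k) /\ F k `<=` Omega & Omega = \bigcup_k F k.
Proof.
move=> oO; pose ctr (jc : nat * 'rV[int]_n) : 'rV[R]_n := xget 0 [set y | cell jc.1 y = jc.2].
pose B (jcm : nat * 'rV[int]_n * nat) := [set x | enorm (x - ctr jcm.1) <= 2^-1 ^+ jcm.2].
pose F k : set 'rV[R]_n :=
  if unpickle k is Some jcm then if `[< B jcm `<=` Omega >] then B jcm else set0 else set0.
have half0 m : 0 < (2^-1 ^+ m : R) by rewrite exprn_gt0// invr_gt0.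
exists F => [k|].
  rewrite /F; case: (unpickle k) => [jcm|]; last by split => //; exact: compact0.
  by case: asboolP => BO; split => //; [exact: compact_enorm_ball|exact: compact0].
apply/seteqP; split => x; last first.
  by move=> [k _]; rewrite /F; case: (unpickle k) => // jcm; case: asboolP => // h /h.
move=> Ox; have [r r0 hr] := open_enorm_ball oO Ox.
have [m mr] : exists m, 2 * 2^-1 ^+ m <= r.
  have cm : 2 * 2^-1 ^+ m @[m --> \oo] --> (2 * 0 : R).
    by apply: cvgM; [exact: cvg_cst|exact: cvg_half].
  rewrite mulr0 in cm; have [N _ hN] := (cvgr_le _ cm _ r0 : \forall m \near \oo, _).
  by exists N; exact: hN (leqnn N).
have [j jr] := cell_in_ball x (half0 m).
have hc : cell j (ctr (j, cell j x)) = cell j x by exact: (@xgetPex _ 0 [set y | cell j y = cell j x] (ex_intro _ x erefl)).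
have xB : B (j, cell j x, m) x by rewrite /B /= enormBC ltW// jr.
have BO : B (j, cell j x, m) `<=` Omega.
  move=> y; rewrite /B /= => hy; apply: hr; apply: le_trans mr.
  rewrite -(subrK (ctr (j, cell j x)) y) -addrA (le_trans (enormD _ _))// mulr_natl mulr2n.
  by rewrite lerD// ltW// jr.
by exists (pickle (j, cell j x, m)) => //; rewrite /F pickleK; case: asboolP.
Qed.

(** The ball on which the bump is positive contains a dyadic cell, of positive measure. *)
Lemma bump_not_ae0 x0 rho : 0 < rho -> ~ {ae lebesgue_rV R n, forall x, bump x0 rho x = 0}.
Proof.
move=> r0 [N [mN N0 hN]]; have [j hj] := cell_in_ball x0 r0.
have mc := @measurable_cell R n j (cell j x0).
have sub : [set y | cell j y = cell j x0] `<=` N.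
  move=> y /= /hj yr; apply: hN => /= h; have := bump_gt0 x0 y r0.
  by rewrite h ltxx yr.
have z : lebesgue_rV R n [set y | cell j y = cell j x0] = 0%E := subset_measure0 mc mN sub N0.
move: z; rewrite lebesgue_cell => -[] /eqP.
by rewrite gt_eqF// !exprn_gt0// invr_gt0.
Qed.

End bump.

Section fundamental_lemma.
Context {R : realType} (n : nat).
Local Notation mu := (lebesgue_rV R n).
Implicit Types (f g : 'rV[R]_n -> R) (Omega : set 'rV[R]_n).

Definition orthant (a : 'rV[R]_n) : set 'rV[R]_n := [set x | forall i, a ord0 i < x ord0 i].

Definition orthants : set (set 'rV[R]_n) := [set A | exists a, A = orthant a].

Lemma measurable_orthant a : measurable (orthant a).
Proof.
rewrite (_ : orthant a = box (fun i => `]a ord0 i, +oo[%classic)).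
  by apply: measurable_box => i; exact: measurable_itv.
by apply/seteqP; split=> x h i; have := h i; rewrite /= in_itv/= andbT.
Qed.

Lemma orthant_setI : setI_closed orthants.
Proof.
move=> A B [a ->] [b ->]; exists (\row_i Num.max (a ord0 i) (b ord0 i)).
apply/seteqP; split=> [x [h1 h2] i|x h]; first by rewrite mxE gt_max h1 h2.
by split=> i; have := h i; rewrite mxE gt_max => /andP[].
Qed.

Lemma measurable_orthantE : @measurable _ 'rV[R]_n = <<s orthants >>.
Proof.
apply/seteqP; split=> A mA.
  move: A mA; apply: smallest_sub; first exact: smallest_sigma_algebra.
  rewrite -bigcup_seq; apply: bigcup_sub => i _ B [C mC <-]; rewrite setTI.
  have -> : (fun x : 'rV[R]_n => x ord0 i) @^-1` C =
      (fun x : 'rV[R]_n => x ord0 i) @^-1` C by [].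
  have : (@RGenOInfty.G R).-sigma.-measurable C by rewrite -RGenOInfty.measurableE.
  move: C {mC}; apply: smallest_sub.
    split.
    - by rewrite /= preimage_set0; exact: sigma_algebra0.
    - by move=> C hC; rewrite /= setTD preimage_setC; exact: sigma_algebraC.
    - by move=> F hF; rewrite /= preimage_bigcup; exact: sigma_algebra_bigcup.
  move=> _ [a ->] /=.
  rewrite (_ : _ @^-1` _ = \bigcup_k orthant (\row_j if j == i then a else - k%:R)).
    by apply: sigma_algebra_bigcup => k; apply: sub_sigma_algebra; eexists.
  apply/seteqP; split=> x /=.
    rewrite in_itv/= andbT => ax; exists (Num.bound (\sum_j `|x ord0 j|)) => // j; rewrite mxE.
    case: eqP => [-> //|_].
    have s0 : 0 <= \sum_j `|x ord0 j| by exact: sumr_ge0.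
    have h := archi_boundP s0; rewrite ltrNl; apply: le_lt_trans h.
    apply: le_trans (ler_norm _) _; rewrite normrN (bigD1 j)//= lerDl.
    exact: sumr_ge0.
  by move=> [k _ /(_ i)]; rewrite mxE eqxx in_itv/= andbT.
move: A mA; apply: smallest_sub; first exact: sigma_algebra_measurable.
by move=> _ [a ->]; exact: measurable_orthant.
Qed.

Let L1_ind f (A : set 'rV[R]_n) : L1 mu f -> measurable A -> L1 mu (fun x => f x * \1_A x).
Proof.
move=> hf mA; apply: L1_le (L1_norm hf) _.
  by apply: measurable_funM; [exact: L1_measurable hf|exact: measurable_indic].
by move=> x; rewrite normrM ler_piMr// indicE; case: (_ \in _); rewrite ?normr1 ?normr0.
Qed.

Let dct_ind f (B : nat -> set 'rV[R]_n) (A : set 'rV[R]_n) : L1 mu f -> (forall k, measurable (B k)) ->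
  measurable A -> (forall k, \int[mu]_x (f x * \1_(B k) x) = 0) ->
  (forall x, \forall k \near \oo, (B k) x <-> A x) -> \int[mu]_x (f x * \1_A x) = 0.
Proof.
move=> hf mB mA h0 hB.
have dom : {ae mu, forall x, forall k, `|f x * \1_(B k) x| <= `|f x|}.
  apply: nearW => x k; rewrite normrM ler_piMr// indicE.
  by case: (_ \in _); rewrite ?normr1 ?normr0.
have lim : {ae mu, forall x, f x * \1_(B k) x @[k --> \oo] --> f x * \1_A x}.
  apply: nearW => x; apply: cvg_near_cst; have := hB x; apply: filterS => k e.
  rewrite !indicE; congr (_ * _); congr (_%:R); congr (nat_of_bool _).
  by apply/idP/idP => /set_mem h; apply/mem_set; apply/e.
have [_ cv] := @rint_dct _ _ _ mu (fun k x => f x * \1_(B k) x) (fun x => f x * \1_A x)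
  (fun x => `|f x|) (fun k => L1_measurable (L1_ind hf (mB k))) (L1_measurable (L1_ind hf mA))
  (L1_norm hf) dom lim.
have : (fun=> 0 : R) @ \oo --> \int[mu]_x (f x * \1_A x).
  by move: cv; under eq_fun do rewrite h0; apply.
by move=> c; rewrite -(cvg_lim (@Rhausdorff R) c) lim_cst.
Qed.

(* Dynkin's lemma: the orthants form an intersection-stable generating system. *)
Lemma ae0_of_orthants f : L1 mu f -> (forall a, \int[mu]_x (f x * \1_(orthant a) x) = 0) ->
  {ae mu, forall x, f x = 0}.
Proof.
move=> hf h; have mf := L1_measurable hf.
have T0 : \int[mu]_x (f x * \1_setT x) = 0.
  apply: (@dct_ind _ (fun k => orthant (\row_i (- k%:R)))) => //.
  - by move=> k; exact: measurable_orthant.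
  - move=> x; exists (Num.bound (\sum_j `|x ord0 j|)) => // k /= hk; split => // _ j; rewrite mxE.
    have s0 : 0 <= \sum_j `|x ord0 j| by exact: sumr_ge0.
    have := archi_boundP s0; rewrite ltrNl => hb.
    apply: (@lt_le_trans _ _ (Num.bound (\sum_j `|x ord0 j|))%:R); last by rewrite ler_nat.
    apply: le_lt_trans hb; apply: le_trans (ler_norm _) _; rewrite normrN (bigD1 j)//= lerDl.
    exact: sumr_ge0.
have all A : measurable A -> \int[mu]_x (f x * \1_A x) = 0.
  move=> mA; have sA : <<s orthants >> A by rewrite -measurable_orthantE.
  move: A sA {mA}; apply: (dynkin_induction (G := orthants)) => //.
  - exact: measurable_orthantE.
  - exact: orthant_setI.
  - by move=> _ [a ->].
  - move=> B mB B0; have e x : f x * \1_(~` B) x = f x * \1_setT x - f x * \1_B x.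
      by rewrite !indicE in_setC in_setT; case: (x \in B); rewrite /= ?mulr1 ?mulr0 ?subrr ?subr0.
    rewrite (_ : (fun x => f x * \1_(~` B) x) = (fun x => f x * \1_setT x - f x * \1_B x)); last exact/funext.
    by rewrite rintB ?T0 ?B0 ?subrr//; exact: L1_ind.
  - move=> F mF tF F0.
    pose B N := \bigcup_(k in [set k | (k < N)%N]) F k.
    have mB N : measurable (B N) by apply: bigcup_measurable => k _; exact: mF.
    apply: (@dct_ind _ B) => //.
    + exact: bigcup_measurable.
    + elim=> [|N IH].
        rewrite (_ : B 0%N = set0); last by apply/seteqP; split=> x // [].
        by under eq_Rintegral do rewrite indic0 mulr0; rewrite /Rintegral integral0.
      have e x : f x * \1_(B N.+1) x = f x * \1_(B N) x + f x * \1_(F N) x.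
        rewrite -mulrDr !indicE; congr (_ * _).
        have [h1|h1] := boolP (x \in B N); have [h2|h2] := boolP (x \in F N).
        - exfalso; move: h1 h2 => /set_mem[k /= kN Fk] /set_mem FN.
          have := tF k N I I; rewrite (_ : k = N)//; last by apply: tF => //; exists x.
          by move=> _; move: kN; rewrite (tF k N I I (ex_intro _ x (conj Fk FN))) ltnn.
        - rewrite mem_set ?addr0//; move/set_mem: h1 => [k /= kN Fk]; exists k => //=.
          exact: ltnW.
        - by rewrite mem_set ?add0r//; exists N => //=; exact: set_mem.
        - rewrite memNset ?addr0// => -[k /=]; rewrite ltnS leq_eqVlt => /orP[/eqP ->|kN Fk].
            by move/mem_set; apply/negP.
          by move/negP: h1; apply; apply/mem_set; exists k.
      rewrite (_ : (fun x => f x * \1_(B N.+1) x) = (fun x => f x * \1_(B N) x + f x * \1_(F N) x)); last exact/funext.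
      by rewrite rintD ?IH ?F0 ?addr0//; exact: L1_ind.
    + move=> x; have [[k _ Fk]|nF] := pselect ((\bigcup_k F k) x).
        exists k.+1 => // N /= kN; split => _; last by exists k.
        by exists k.
      by exists 0%N => // N _; split => // -[k _ Fk]; exists k.
pose P : set 'rV[R]_n := [set x | 0 <= f x].
have mP : measurable P.
  rewrite (_ : P = f @^-1` `[0, +oo[%classic); last first.
    by apply/seteqP; split=> x /=; rewrite in_itv/= andbT.
  by rewrite -[X in measurable X]setTI; apply: mf => //; exact: measurable_itv.
have z : \int[mu]_x `|f x| = 0.
  rewrite (_ : (fun x => `|f x|) = (fun x => f x * \1_P x - f x * \1_(~` P) x)).
    by rewrite rintB ?all ?subrr//; [exact: measurableC|exact: L1_ind|apply: L1_ind => //; exact: measurableC].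
  apply/funext => x; rewrite !indicE in_setC; have [xP|xP] := boolP (x \in P).
    by rewrite mulr1 mulr0 subr0 ger0_norm//; move/set_mem: xP.
  rewrite mulr0 mulr1 sub0r ltr0_norm// ltNge; apply: contra xP => xP.
  exact/mem_set.
have := (@ae_eq_integral_abs _ _ _ mu setT measurableT (EFin \o f) _).1.
move=> H; have : ae_eq mu setT (EFin \o f) (cst 0%E).
  apply: H; first exact/measurable_EFinP.
  by rewrite (L1_integralE (L1_norm hf)) z.
by apply: filterS => x /(_ I)/= [].
Qed.

Lemma Rintegral_support (A : set 'rV[R]_n) f : (forall x, ~ A x -> f x = 0) ->
  \int[mu]_(x in A) f x = \int[mu]_x f x.
Proof.
move=> h; rewrite Rintegral_mkcond; congr Rintegral; apply/funext => x; rewrite patchE.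
by case: ifPn => // /negP xA; rewrite h// => /mem_set.
Qed.

Lemma locally_integrable_mul Omega g phi : locally_integrable_on Omega g -> Cc_infty Omega phi ->
  L1 mu (fun x => g x * phi x).
Proof.
move=> lg hphi; have [M M0 hM] := Cc_bounded hphi; have [_ kphi sphi] := hphi.
set K := closure _ in kphi sphi.
have mK : measurable K by apply: closed_measurable_rV; exact: closed_closure.
have iK : L1 mu (g \_ K).
  have := (integrable_mkcond (EFin \o g) mK).1 (lg K kphi sphi).
  by rewrite restrict_EFin.
have e x : g x * phi x = (g \_ K) x * phi x.
  rewrite patchE; case: ifPn => // /negP xK.
  have -> : phi x = 0 by apply/eqP; apply: contra_notT xK => h; apply/mem_set; exact: subset_closure.
  by rewrite !mulr0.
apply: (L1_le _ (L1Z M (L1_norm iK))).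
  under eq_fun do rewrite e; apply: measurable_funM; first exact: L1_measurable iK.
  exact: Cc_meas hphi.
by move=> x; rewrite e normrM mulrC ler_wpM2r.
Qed.

(** Multiplied by a cut-off chi, g becomes integrable, and smooth approximations of indicators of
    orthants are admissible factors of chi; so g chi = 0 almost everywhere for every chi. *)
Lemma fundamental_lemma Omega g : open Omega -> locally_integrable_on Omega g ->
  (forall phi, Cc_infty Omega phi -> \int[mu]_(x in Omega) (g x * phi x) = 0) ->
  {ae mu, forall x, Omega x -> g x = 0}.
Proof.
move=> oO lg h.
have key chi : Cc_infty Omega chi -> {ae mu, forall x, g x * chi x = 0}.
  move=> hchi; have iL := locally_integrable_mul lg hchi.
  apply: ae0_of_orthants => // a.
  (* A smooth function that is positive exactly on the orthant; [satur k] of it tends to the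
     indicator. *)
  pose P (x : 'rV[R]_n) := \prod_(i < n) psi (x ord0 i - a ord0 i).
  have P0 x : 0 <= P x by apply: prodr_ge0 => i _; exact: psi_ge0.
  have CP k : Ck k P.
    apply: Ck_prod => i; apply: (Ck_comp psi_smooth).
    by apply: CkB; [exact: Ck_coord|exact: Ck_cst].
  have Ppos x : (0 < P x) = (x \in orthant a).
    apply/idP/idP => [Px|/set_mem ax]; last first.
      by apply: prodr_gt0 => i _; rewrite psi_gt0 subr_gt0.
    apply/mem_set => i; have : psi (x ord0 i - a ord0 i) != 0.
      by apply: contraTneq Px => e; rewrite /P (bigD1 i)//= e mul0r ltxx.
    by move=> h1; rewrite -subr_gt0 -psi_gt0 lt_neqAle eq_sym h1 psi_ge0.
  pose S k x := satur k (P x).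
  have Sb k x : 0 <= S k x <= 1.
    rewrite /S /satur subr_ge0 gerBl expR_ge0 andbT -expR0 ler_expR oppr_le0.
    by rewrite mulr_ge0.
  have CS k j : Ck j (S k) by apply: Ck_comp; [exact: satur_smooth|exact: CP].
  have z k : \int[mu]_x ((g x * chi x) * S k x) = 0.
    have hk : Cc_infty Omega (fun x => chi x * S k x) by exact: Cc_mulr.
    transitivity (\int[mu]_(x in Omega) (g x * (chi x * S k x))); last exact: h.
    rewrite (@Rintegral_support Omega); last by move=> x xO; rewrite (Cc_outside hk xO) mulr0.
    by congr Rintegral; apply/funext => x; rewrite mulrA.
  have mS k : measurable_fun setT (S k) by apply: continuous_measurable_rV; exact: Ck_continuous (CS k 0%N).
  have dom : {ae mu, forall x, forall k, `|(g x * chi x) * S k x| <= `|g x * chi x|}.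
    by apply: nearW => x k; have /andP[s0 s1] := Sb k x; rewrite normrM ler_piMr// ger0_norm.
  have lim : {ae mu, forall x, (g x * chi x) * S k x @[k --> \oo] --> (g x * chi x) * \1_(orthant a) x}.
    apply: nearW => x; apply: cvgM; first exact: cvg_cst.
    rewrite indicE -Ppos /S /satur; have := P0 x; rewrite le_eqVlt => /orP[/eqP <-|Px].
      by rewrite ltxx; under eq_fun do rewrite mulr0 oppr0 expR0 subrr; exact: cvg_cst.
    rewrite Px /=; rewrite -[X in _ --> X]subr0; apply: cvgB; first exact: cvg_cst.
    under eq_fun do rewrite -mulrN expRM_natl.
    by apply: cvg_expr; rewrite ger0_norm ?expR_ge0// -expR0 ltr_expR oppr_lt0.
  have [_ cv] := @rint_dct _ _ _ mu (fun k x => (g x * chi x) * S k x)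
    (fun x => (g x * chi x) * \1_(orthant a) x) (fun x => `|g x * chi x|)
    (fun k => measurable_funM (L1_measurable iL) (mS k))
    (measurable_funM (L1_measurable iL) (measurable_indic (measurable_orthant a)))
    (L1_norm iL) dom lim.
  have : (fun=> 0 : R) @ \oo --> \int[mu]_x ((g x * chi x) * \1_(orthant a) x).
    by move: cv; under eq_fun do rewrite z; apply.
  by move=> c; rewrite -(cvg_lim (@Rhausdorff R) c) lim_cst.
(* To keep the exceptional set null, [Omega] is covered by the countably many dyadic cells on which
   some cut-off is positive. *)
pose good (jc : nat * 'rV[int]_n) := exists2 chi, Cc_infty Omega chi &
  forall x, cell jc.1 x = jc.2 -> 0 < chi x.
pose N k : set 'rV[R]_n := if unpickle k is Some jc then
  [set x | good jc /\ cell jc.1 x = jc.2 /\ g x != 0] else set0.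
have nN k : mu.-negligible (N k).
  rewrite /N; case: (unpickle k) => [jc|]; last exact: negligible_set0.
  have [[chi hchi pos]|ng] := pselect (good jc); last first.
    by apply: negligibleS (negligible_set0 mu) => x [].
  have [B [mB B0 hB]] := key _ hchi.
  exists B; split => // x [_ [/pos cx gx]]; apply: hB => /= /eqP.
  by rewrite mulf_eq0 (negbTE gx) gt_eqF.
have := negligible_bigcup nN; apply: negligibleS => x /= /not_implyP[Ox /eqP gx].
have [rho r0 hr] := open_enorm_ball oO Ox.
have hb := Cc_bump r0 hr.
have [j jr] := cell_in_ball x r0.
exists (pickle (j, cell j x)) => //; rewrite /N pickleK /=; split => //.
by exists (bump x rho) => //= y yx; rewrite bump_gt0//; exact: jr.
Qed.

Lemma weak_gradient_unique Omega u G H : open Omega -> weak_gradient Omega u G ->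
  weak_gradient Omega u H -> {ae mu, forall x, Omega x -> G x = H x}.
Proof.
move=> oO [_ lG hG] [_ lH hH].
have coord i : {ae mu, forall x, Omega x -> G x ord0 i - H x ord0 i = 0}.
  apply: (@fundamental_lemma Omega (fun x => G x ord0 i - H x ord0 i)) => //.
    move=> K kK KO; have := integrableB _ (lG i K kK KO) (lH i K kK KO).
    by apply; apply: closed_measurable_rV; apply: compact_closed => //; exact: norm_hausdorff.
  move=> phi hphi; have iG := locally_integrable_mul (lG i) hphi.
  have iH := locally_integrable_mul (lH i) hphi.
  have e1 := hG _ hphi i; have e2 := hH _ hphi i; rewrite e1 in e2; move/oppr_inj: e2.
  have out x : ~ Omega x -> phi x = 0 by move=> xO; exact: (Cc_outside hphi xO).
  have zz (k : 'rV[R]_n -> R) x : ~ Omega x -> k x * phi x = 0 by move=> /out ->; rewrite mulr0.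
  rewrite (@Rintegral_support Omega (fun x => G x ord0 i * phi x) (zz _)).
  rewrite (@Rintegral_support Omega (fun x => H x ord0 i * phi x) (zz _)) => e.
  rewrite (@Rintegral_support Omega (fun x => (G x ord0 i - H x ord0 i) * phi x) (zz (fun x => G x ord0 i - H x ord0 i))).
  have -> : (fun x => (G x ord0 i - H x ord0 i) * phi x) =
    (fun x => G x ord0 i * phi x - H x ord0 i * phi x) by apply/funext => x; rewrite mulrBl.
  by rewrite (rintB iG iH) e subrr.
have : {ae mu, forall x, forall i : 'I_n, Omega x -> G x ord0 i - H x ord0 i = 0}.
  exact: filter_forall.
by apply: filterS => x h Ox; apply/rowP => i; apply/eqP; rewrite -subr_eq0 h.
Qed.

End fundamental_lemma.

(** * The three integrals of the functional *)

Section powR_more.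
Context {R : realType}.
Implicit Types x y a b c p q t : R.

(** [powR_convex2] with the weight tuned so that the first coefficient is c. With c close to 1 it
    gives the continuity of the energy. *)
Lemma powR_almost p c : 1 < p -> 1 < c ->
  exists2 K, 0 <= K & forall x y, 0 <= x -> 0 <= y -> (x + y) `^ p <= c * x `^ p + K * y `^ p.
Proof.
move=> p1 c1; have pm : 0 < p - 1 by rewrite subr_gt0.
have c0 : 0 < c by exact: lt_trans c1.
pose k := c^-1 `^ (p - 1)^-1.
have /andP[k0 k1] : 0 < k < 1 by apply: powR_itv01; rewrite ?invr_gt0 ?invf_lt1 ?c0.
have t01 : 0 < 1 - k < 1 by rewrite subr_gt0 k1 ltrBlDr ltrDl k0.
exists ((1 - k) `^ (1 - p)) => [|x y x0 y0]; first exact: powR_ge0.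
have := powR_convex2 (ltW p1) t01 x0 y0.
have -> : (1 - (1 - k)) `^ (1 - p) = c => //.
rewrite opprB addrC subrK /k -powRrM -[1 - p]opprB mulrN mulVf ?gt_eqF//.
by rewrite powRN powRr1 ?invr_ge0 ?(ltW c0)// invrK.
Qed.

Lemma powR_ge_tangent1 q t : 1 < q -> 0 <= t -> 1 + q * (t - 1) <= t `^ q.
Proof.
move=> q1 t0; have [->|t1] := eqVneq t 1; first by rewrite subrr mulr0 addr0 powR1.
by rewrite addrC ltW// powR_gt_affine.
Qed.

Lemma powR_le_tangent1 a t : 0 < a < 1 -> 0 <= t -> t `^ a <= 1 + a * (t - 1).
Proof.
move=> a01 t0; have [->|t1] := eqVneq t 1; first by rewrite subrr mulr0 addr0 powR1.
have := powR_lt_affine a01 t0 t1 => /ltW h; apply: le_trans h _.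
by rewrite mulrBr mulr1 addrCA.
Qed.

Lemma powR_convex_tangent q x y : 1 < q -> 0 <= x -> 0 <= y ->
  x `^ q + q * x `^ (q - 1) * (y - x) <= y `^ q.
Proof.
move=> q1 x0 y0; have q0 : 0 < q by exact: lt_trans q1.
have := young_le q1 x0 y0; have := powRB1 x0 (lt0r_neq0 q0).
by move: (x `^ (q - 1)) (x `^ q) (y `^ q) => a b c h1 h2; rewrite mulrBr -[q * a * x]mulrA h1 -mulrA; lra.
Qed.

(** [powR_interp] at the point t x, divided by t^a; t is chosen with t^(p-a) = e / (C+1), which
    makes the coefficient of x^p as small as required. *)
Lemma powR_absorb a p e : 0 < a < p -> 0 < e ->
  exists2 K, 0 <= K & forall x, 0 <= x -> x `^ a <= K + e * x `^ p.
Proof.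
move=> /andP[a0 ap] e0; have p0 : 0 < p by exact: lt_trans ap.
have [C C0 hC] := @powR_interp R a p 1 (introT andP (conj a0 ap)) ltr01.
have pa : 0 < p - a by rewrite subr_gt0.
pose t := (e / (C + 1)) `^ (p - a)^-1.
have d0 : 0 < e / (C + 1) by rewrite divr_gt0// ltr_wpDl.
have t0 : 0 < t by exact: powR_gt0.
exists (t `^ (- a)); first exact: powR_ge0.
move=> x x0; have := hC (t * x) (mulr_ge0 (ltW t0) x0).
rewrite !powRM ?(ltW t0)// => h.
have ta0 : 0 < t `^ a by exact: powR_gt0.
rewrite -(ler_pM2l ta0) mulrDr -powRD ?subrr ?powRr0 ?(gt_eqF t0) ?implybT//.
apply: le_trans h _; rewrite lerD2l.
have -> : t `^ p = t `^ a * (e / (C + 1)).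
  have -> : e / (C + 1) = t `^ (p - a) by rewrite /t -powRrM mulVf ?gt_eqF// powRr1// ltW.
  by rewrite -powRD ?(gt_eqF t0) ?implybT// addrC subrK.
have y0 := powR_ge0 x p; have C1 : C / (C + 1) <= 1.
  by rewrite ler_pdivrMr ?mul1r ?lerDl// ltr_wpDl.
have -> : C * (t `^ a * (e / (C + 1)) * x `^ p) = C / (C + 1) * (t `^ a * (e * x `^ p)).
  by move: (t `^ a) (x `^ p) (C + 1)^-1 => b y c; ring.
by rewrite ler_piMl// !mulr_ge0// ltW.
Qed.

Lemma almost_dist (E f h z e : R) : 0 <= E -> 0 <= f -> 0 < h -> h <= 1 -> 0 <= z ->
  8 * z <= e -> 4 * h * E <= e -> f <= (1 + h) * E + z -> E <= (1 + h) * f + z -> `|E - f| <= e.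
Proof.
move=> E0 f0 h0 h1 z0 ze hE u1 u2.
have hf : h * f <= h * ((1 + h) * E + z) by rewrite ler_wpM2l// ltW.
have hz : h * z <= z by rewrite ler_piMl.
have hhE : h * (h * E) <= h * E by rewrite ler_piMl// mulr_ge0// ltW.
have e1 : (1 + h) * E = E + h * E by rewrite mulrDl mul1r.
have e2 : (1 + h) * f = f + h * f by rewrite mulrDl mul1r.
have e3 : h * ((1 + h) * E + z) = h * E + h * (h * E) + h * z by rewrite e1 !mulrDr.
move: u1 u2 hf hE; rewrite e3 e1 e2 -mulrA ler_norml.
move: (h * E) (h * f) (h * z) (h * (h * E)) hz hhE {e1 e2 e3} => a b c g hz hhE u1 u2 hf hE.
by apply/andP; split; lra.
Qed.

End powR_more.

Section energy_continuity.
Context d (T : measurableType d) (R : realType) (m : nat).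
Variable mu : {measure set T -> \bar R}.
Implicit Types (F G : T -> 'rV[R]_m) (p e : R).

Lemma energy_almost p c : 1 < p -> 1 < c -> exists2 K, 0 <= K &
  forall F G, inLp mu p F -> inLp mu p G ->
    energy mu p (fun x => F x + G x) <= c * energy mu p F + K * energy mu p G.
Proof.
move=> p1 c1; have p0 : 0 < p by exact: lt_trans p1.
have [K K0 hK] := powR_almost p1 c1; exists K => // F G hF hG.
apply: (rint_le_lin (inLpD p1 hF hG).2 hF.2 hG.2) => x.
apply: le_trans (hK _ _ (enorm_ge0 _) (enorm_ge0 _)).
by rewrite ge0_ler_powR ?nnegrE ?addr_ge0 ?enorm_ge0 ?(ltW p0)// enormD.
Qed.

(** [energy_almost] is applied in both directions between F k and G, with the leading constant 1 + h
    close to 1 and the remainder sent to 0. *)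
Lemma energy_cvg p (F : nat -> T -> 'rV[R]_m) G : 1 < p -> (forall k, inLp mu p (F k)) ->
  inLp mu p G -> energy mu p (fun x => F k x - G x) @[k --> \oo] --> (0 : R) ->
  energy mu p (F k) @[k --> \oo] --> energy mu p G.
Proof.
move=> p1 hF hG cv; apply/cvgrPdist_le => e e0.
set E := energy mu p G; have E0 : 0 <= E by exact: energy_ge0.
pose h := Num.min 1 (e / (4 * (E + 1))).
have h0 : 0 < h by rewrite lt_min ltr01 divr_gt0// mulr_gt0// ltr_wpDl.
have h1 : h <= 1 by rewrite ge_min lexx.
have hE : 4 * h * E <= e.
  have : h <= e / (4 * (E + 1)) by rewrite ge_min lexx orbT.
  rewrite ler_pdivlMr ?mulr_gt0 ?ltr_wpDl// => hh; apply: le_trans hh.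
  rewrite mulrCA mulrA ler_wpM2l ?mulr_ge0 ?(ltW h0)//.
  by rewrite lerDl.
have c1 : 1 < 1 + h by rewrite ltrDl.
have [K K0 hK] := energy_almost p1 c1.
have d0 : 0 < e / (8 * (K + 1)) by rewrite divr_gt0// mulr_gt0// ltr_wpDl.
have [N _ hN] := (cvgrPdist_le _ _).1 cv _ d0; exists N => // k Nk /=.
have := hN k Nk; rewrite sub0r normrN => hk.
set D := energy mu p (fun x => F k x - G x) in hk.
have D0 : 0 <= D by exact: energy_ge0.
rewrite (ger0_norm D0) ler_pdivlMr ?mulr_gt0 ?ltr_wpDl// in hk.
have iD := inLpB p1 (hF k) hG.
have u1 : energy mu p (F k) <= (1 + h) * E + K * D.
  by have := hK _ _ hG iD; under eq_fun do rewrite addrC subrK.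
have u2 : E <= (1 + h) * energy mu p (F k) + K * D.
  have iD' : inLp mu p (fun x => G x - F k x) by exact: inLpB.
  have := hK _ _ (hF k) iD'; rewrite energyBC -/D.
  by under eq_fun do rewrite addrC subrK.
have KD : 8 * (K * D) <= e.
  apply: le_trans hk; have -> : D * (8 * (K + 1)) = 8 * (K * D) + 8 * D by ring.
  by rewrite lerDl mulr_ge0.
set f := energy mu p (F k) in u1 u2 *.
have f0 : 0 <= f by exact: energy_ge0.
have KD0 : 0 <= K * D by exact: mulr_ge0.
exact: almost_dist E0 f0 h0 h1 KD0 KD hE u1 u2.
Qed.

End energy_continuity.

Section functionals.
Context {R : realType} (n : nat) (p q D : R) (adm : admissible n p q D).
Variables (Omega : set 'rV[R]_n) (bO : bounded_set Omega) (oO : open Omega).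
Variables (a lam : R) (a01 : 0 < a < 1) (lam0 : 0 < lam).
Local Notation mu := (lebesgue_rV R n).
Local Notation nu := (mu \x mu)%E.
Implicit Types (u v w : 'rV[R]_n -> R) (G H : 'rV[R]_n -> 'rV[R]_n) (e : R).
Local Notation nlf := (nlfield p D).
Local Notation X := (X p q D Omega).

Let p1 : 1 < p. Proof. by case: adm => /andP[]. Qed.
Let pq : p < q. Proof. by case: adm. Qed.
Let p0 : 0 < p. Proof. exact: lt_trans p1. Qed.
Let q1 : 1 < q. Proof. exact: lt_trans pq. Qed.
Let q0 : 0 < q. Proof. exact: lt_trans q1. Qed.
Let a0 : 0 < a. Proof. by case/andP: a01. Qed.
Let a1 : a < 1. Proof. by case/andP: a01. Qed.

(** A normalised representative: the sign and the vanishing outside [Omega] hold at every point, so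
    that powers are manipulated without exceptional sets. *)
Definition Xp u G := [/\ X u G, forall x, 0 <= u x & forall x, ~ Omega x -> u x = 0].

Definition dirichlet u G := energy mu p G + energy nu p (nlf u).
Definition singular_int u := \int[mu]_x (`|u x| `^ a).
Definition power_int u := \int[mu]_x (`|u x| `^ q).

Lemma dirichlet_ge0 u G : 0 <= dirichlet u G. Proof. by rewrite addr_ge0// energy_ge0. Qed.
Lemma singular_int_ge0 u : 0 <= singular_int u. Proof. by apply: rint_ge0 => x; exact: powR_ge0. Qed.
Lemma power_int_ge0 u : 0 <= power_int u. Proof. by apply: rint_ge0 => x; exact: powR_ge0. Qed.

Lemma dirichlet_bounds : exists2 K, 0 <= K & forall u G, X u G ->
  [/\ \int[mu]_x (`|u x| `^ p) <= K * dirichlet u G, power_int u <= K * dirichlet u G `^ (q / p) &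
      dirichlet u G <= (1 + K) * energy mu p G].
Proof.
have [K K0 hK] := X_sobolev adm bO; exists K => // u G /hK[h1 h2 h3].
have le : energy mu p G <= dirichlet u G by rewrite lerDl energy_ge0.
split.
- by apply: le_trans h1 _; rewrite ler_wpM2l.
- apply: le_trans h2 _; rewrite ler_wpM2l// ge0_ler_powR ?nnegrE ?dirichlet_ge0 ?energy_ge0//.
  by rewrite divr_ge0// ltW.
- by rewrite mulrDl mul1r lerD2l.
Qed.

Lemma dirichletZ t u G : X u G -> dirichlet (fun x => t * u x) (fun x => t *: G x) = `|t| `^ p * dirichlet u G.
Proof.
move=> hX; rewrite /dirichlet energyZ; last exact: X_inLp hX.
have -> : nlf (fun x => t * u x) = (fun z => t *: nlf u z).
  by apply/funext => z; exact: nlfieldZ.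
by rewrite energyZ ?mulrDr//; exact: X_nl_inLp hX.
Qed.

Lemma L1_indic_Omega : L1 mu (\1_Omega : 'rV[R]_n -> R).
Proof.
have [L L0 hL] := bounded_set_box bO.
apply: (@L1_bounded_cube _ _ _ L 1).
- by apply: measurable_indic; exact: open_measurable_rV.
- by move=> x; rewrite indicE; case: (_ \in _); rewrite ?normr1 ?normr0.
- move=> x; rewrite indicE; have [/set_mem xO _|] := boolP (x \in Omega); last by rewrite eqxx.
  by apply/cubeP => i; exact: hL.
Qed.

Definition mOmega : R := \int[mu]_x (\1_Omega : 'rV[R]_n -> R) x.

Lemma mOmega_ge0 : 0 <= mOmega.
Proof. by apply: rint_ge0 => x; rewrite indicE. Qed.

Lemma L1_lower_power w (e d c : R) : measurable_fun setT w -> (forall x, ~ Omega x -> w x = 0) ->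
  0 < e -> L1 mu (fun x => `|w x| `^ e) -> (forall x, 0 <= x -> x `^ a <= d + c * x `^ e) ->
  L1 mu (fun x => `|w x| `^ a) /\ singular_int w <= d * mOmega + c * \int[mu]_x (`|w x| `^ e).
Proof.
move=> mw w0 e0 iw h.
have pt x : `|w x| `^ a <= d * \1_Omega x + c * `|w x| `^ e.
  rewrite indicE; have [xO|/negP xO] := boolP (x \in Omega); first by rewrite mulr1 h.
  rewrite w0 ?normr0 ?powR0 ?gt_eqF// ?mulr0 ?addr0// => /mem_set; exact: xO.
have i : L1 mu (fun x => `|w x| `^ a).
  apply: L1_le (L1D (L1Z d L1_indic_Omega) (L1Z c iw)) _; first exact: measurable_powR_norm.
  by move=> x; rewrite ger0_norm ?powR_ge0.
by split => //; exact: (rint_le_lin i L1_indic_Omega iw pt).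
Qed.

Lemma L1_singular_int u G : Xp u G -> L1 mu (fun x => `|u x| `^ a).
Proof.
move=> [hX _ out]; have [mU _ _] := hX.
have aq : 0 < a < q by rewrite a0 (lt_trans a1).
have [C C0 hC] := @powR_interp R a q 1 aq ltr01.
by have [] := L1_lower_power mU out q0 (X_L1q adm bO hX) hC.
Qed.

Lemma singular_intZ t u G : Xp u G -> singular_int (fun x => t * u x) = `|t| `^ a * singular_int u.
Proof.
move=> hX; rewrite /singular_int -(rintZ _ (L1_singular_int hX)); congr Rintegral; apply/funext => x.
by rewrite normrM powRM.
Qed.

Lemma power_intZ t u G : X u G -> power_int (fun x => t * u x) = `|t| `^ q * power_int u.
Proof.
move=> hX; rewrite /power_int -(rintZ _ (X_L1q adm bO hX)); congr Rintegral; apply/funext => x.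
by rewrite normrM powRM.
Qed.

Lemma dirichlet_cvg (w : nat -> 'rV[R]_n -> R) (H : nat -> 'rV[R]_n -> 'rV[R]_n) u G :
  (forall k, X (w k) (H k)) -> X u G -> energy mu p (fun x => H k x - G x) @[k --> \oo] --> (0 : R) ->
  dirichlet (w k) (H k) @[k --> \oo] --> dirichlet u G.
Proof.
move=> hw hX cv; have [K K0 hK] := X_sobolev adm bO.
apply: cvgD; first by apply: energy_cvg => // [k|]; exact: X_inLp (hw k) || exact: X_inLp hX.
apply: energy_cvg => // [k||].
- exact: X_nl_inLp (hw k).
- exact: X_nl_inLp hX.
- have le k : 0 <= energy nu p (fun z => nlf (w k) z - nlf u z) <=
      K * energy mu p (fun x => H k x - G x).
    rewrite energy_ge0 /=; have [_ _] := hK _ _ (XB adm (hw k) hX).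
    by rewrite (_ : nlf _ = (fun z => nlf (w k) z - nlf u z))//; apply/funext => z; exact: nlfieldB.
  apply: (@squeeze_cvgr _ _ _ _ (fun=> 0) (fun k => K * energy mu p (fun x => H k x - G x))).
  + by apply: nearW => k; exact: le.
  + exact: cvg_cst.
  + by rewrite -[X in _ --> X](mulr0 K); apply: cvgM => //; exact: cvg_cst.
Qed.

Lemma power_int_cvg (w : nat -> 'rV[R]_n -> R) u :
  (forall k, measurable_fun setT (w k)) -> (forall k, L1 mu (fun x => `|w k x| `^ q)) ->
  measurable_fun setT u -> L1 mu (fun x => `|u x| `^ q) ->
  power_int (fun x => w k x - u x) @[k --> \oo] --> (0 : R) -> power_int (w k) @[k --> \oo] --> power_int u.
Proof.
move=> mw iw mu_ iu cv.
have inL (v : 'rV[R]_n -> R) : measurable_fun setT v -> L1 mu (fun x => `|v x| `^ q) -> inLp mu q (Sf v).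
  by move=> mv iv; have [] := (en_leSf mu q (power_int v) v).2 (And3 mv iv (lexx _)).
have e (v : 'rV[R]_n -> R) : power_int v = energy mu q (Sf v).
  by rewrite /energy; under eq_Rintegral do rewrite enorm_Sf.
have cv' : energy mu q (fun x => Sf (w k) x - Sf u x) @[k --> \oo] --> (0 : R).
  have -> : (fun k => energy mu q (fun x => Sf (w k) x - Sf u x)) = (fun k => power_int (fun x => w k x - u x)).
    by apply/funext => k; rewrite e SfB.
  exact: cv.
have := energy_cvg q1 (fun k => inL _ (mw k) (iw k)) (inL _ mu_ iu) cv'.
have -> : (fun k => energy mu q (Sf (w k))) = (fun k => power_int (w k)) by apply/funext => k; rewrite e.
by rewrite -e.
Qed.

(** |w^a - u^a| <= |w - u|^a because a < 1, and the integral of the latter is controlled by the L^q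
    distance since [Omega] has finite measure. *)
Lemma singular_int_cvg (w : nat -> 'rV[R]_n -> R) (H : nat -> 'rV[R]_n -> 'rV[R]_n) u G :
  (forall k, Xp (w k) (H k)) -> Xp u G ->
  power_int (fun x => w k x - u x) @[k --> \oo] --> (0 : R) -> singular_int (w k) @[k --> \oo] --> singular_int u.
Proof.
move=> hw hu cv; have [hX u0 uout] := hu; have [mu_ _ _] := hX.
have aq : 0 < a < q by rewrite a0 (lt_trans a1).
apply/cvgrPdist_le => e e0.
have m1 : 0 < 2 * (mOmega + 1) by rewrite mulr_gt0// ltr_wpDl// mOmega_ge0.
pose d := e / (2 * (mOmega + 1)); have d0 : 0 < d by rewrite divr_gt0.
have [C C0 hC] := @powR_interp R a q d aq d0.
have c0 : 0 < e / (2 * (C + 1)) by rewrite divr_gt0// mulr_gt0// ltr_wpDl.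
have [N _ hN] := (cvgrPdist_le _ _).1 cv _ c0; exists N => // k Nk /=.
have := hN k Nk; rewrite sub0r normrN ger0_norm ?power_int_ge0// => hk.
have [hXk wk0 wkout] := hw k; have [mwk _ _] := hXk.
have mD := measurable_funB mwk mu_.
have out x : ~ Omega x -> w k x - u x = 0 by move=> xO; rewrite uout// wkout// subrr.
have iD := X_L1q adm bO (XB adm hXk hX).
have [iB leB] := L1_lower_power mD out q0 iD hC.
have iu := L1_singular_int hu; have iw := L1_singular_int (hw k).
rewrite /singular_int distrC -(rintB iw iu); apply: le_trans (rint_norm (L1B iw iu)) _.
apply: (@le_trans _ _ (singular_int (fun x => w k x - u x))).
  apply: rint_le => //; first exact/L1_norm/L1B.
  by move=> x; rewrite (ger0_norm (wk0 x)) (ger0_norm (u0 x)); exact: powR_dist.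
apply: le_trans leB _; rewrite -/(power_int (fun x => w k x - u x)).
have h1 : d * mOmega <= e / 2.
  rewrite /d mulrAC ler_pdivrMr// [leRHS]mulrA divfK// ler_wpM2l ?(ltW e0)// lerDl.
  by rewrite ler01.
have h2 : C * power_int (fun x => w k x - u x) <= e / 2.
  apply: le_trans (ler_wpM2l C0 hk) _; rewrite mulrA ler_pdivrMr ?mulr_gt0 ?ltr_wpDl//.
  by rewrite [leRHS]mulrA divfK// mulrC ler_wpM2l ?(ltW e0)// lerDl ler01.
by rewrite [leRHS]splitr lerD.
Qed.

End functionals.

(** * Compactness of energy sublevels *)

Section compactness_Xp.
Context {R : realType} (n : nat) (p q D : R) (adm : admissible n p q D).
Variables (Omega : set 'rV[R]_n) (bO : bounded_set Omega) (oO : open Omega).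
Local Notation mu := (lebesgue_rV R n).
Local Notation nu := (mu \x mu)%E.
Implicit Types (u v w : 'rV[R]_n -> R) (G H : 'rV[R]_n -> 'rV[R]_n) (e : R).
Local Notation nlf := (nlfield p D).
Local Notation X := (X p q D Omega).
Local Notation Xp := (Xp p q D Omega).
Local Notation fA := (dirichlet p D).
Local Notation fC := (power_int q).

Let p1 : 1 < p. Proof. by case: adm => /andP[]. Qed.
Let pq : p < q. Proof. by case: adm. Qed.
Let p0 : 0 < p. Proof. exact: lt_trans p1. Qed.
Let q1 : 1 < q. Proof. exact: lt_trans pq. Qed.
Let q0 : 0 < q. Proof. exact: lt_trans q1. Qed.
Let half0 k : (0 : R) < 2^-1 ^+ k. Proof. by rewrite exprn_gt0// invr_gt0. Qed.
Let half1 k : (2^-1 ^+ k : R) <= 1. Proof. by rewrite exprn_ile1 ?invr_ge0// invf_le1// ler1n. Qed.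
Let halfW (k l : nat) : (k <= l)%N -> (2^-1 ^+ l : R) <= 2^-1 ^+ k.
Proof. by move=> kl; rewrite ler_wiXn2l ?invr_ge0// invf_le1// ler1n. Qed.

(** The rate required by [Lp_fast_cauchy] for the exponent s. *)
Definition fast (s : R) k : R := 2^-1 ^+ k * (2^-1 ^+ k) `^ s.

Lemma fast_gt0 s k : 0 < fast s k.
Proof. by rewrite mulr_gt0// powR_gt0. Qed.

Lemma fast_le s k : 0 < s -> fast s k <= 2^-1 ^+ k.
Proof.
move=> s0; rewrite ler_piMr ?(ltW (half0 k))//.
apply: (@le_trans _ _ (1 `^ s)); last by rewrite powR1.
by rewrite ge0_ler_powR ?nnegrE ?(ltW s0) ?(ltW (half0 k)).
Qed.

Lemma fast_decr s k l : 0 < s -> (k <= l)%N -> fast s l <= fast s k.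
Proof.
move=> s0 kl; apply: ler_pM; rewrite ?powR_ge0 ?(ltW (half0 _)) ?halfW//.
by rewrite ge0_ler_powR ?nnegrE ?(ltW s0) ?(ltW (half0 _)) ?halfW.
Qed.

Lemma en_le_power_int e u : measurable_fun setT u -> L1 mu (fun x => `|u x| `^ q) -> fC u <= e ->
  en_le mu q e (Sf u).
Proof. by move=> mu_ iu le; apply/en_leSf. Qed.

Lemma X_ultra_cauchy (F : set_system nat) (w : nat -> 'rV[R]_n -> R)
    (H : nat -> 'rV[R]_n -> 'rV[R]_n) E e : UltraFilter F -> \oo `<=` F ->
  (forall k, X (w k) (H k)) -> (forall k, fA (w k) (H k) <= E) -> 0 < e ->
  exists2 S, F S & forall k l, S k -> S l -> fC (fun x => w k x - w l x) <= e.
Proof.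
move=> UF ooF hX hE e0.
have ex k : exists phi, Cc_infty Omega phi /\
    small p q D (2^-1 ^+ k) (fun x => w k x - phi x) (fun x => H k x - grad phi x).
  by have [_ _ /(_ _ (half0 k))[phi h1 h2]] := hX k; exists phi.
pose phi k := sval (cid (ex k)).
have [hphi hs] : (forall k, Cc_infty Omega (phi k)) /\ (forall k,
    small p q D (2^-1 ^+ k) (fun x => w k x - phi k x) (fun x => H k x - grad (phi k) x)).
  by split=> k; rewrite /phi; case: (cid (ex k)) => f [].
have hEphi k : energy mu p (grad (phi k)) <= 2 `^ p * (E + 1).
  have [hk _ _ _] := hs k; have hG : en_le mu p E (H k).
    split; first exact: (X_inLp adm bO (hX k)).
    by apply: le_trans (hE k); rewrite lerDl energy_ge0.
  have [_] := en_leB p1 hG hk; under eq_fun do rewrite opprB addrC subrK.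
  by move=> h; apply: le_trans h _; rewrite ler_wpM2l ?powR_ge0// lerD2l.
pose Q : R := 2 `^ q; have Q0 : 0 < Q by exact: powR_gt0.
pose e1 := e / (Q * (Q * 2 + 1)).
have c0 : 0 < Q * (Q * 2 + 1) by rewrite !mulr_gt0// addr_gt0// mulr_gt0.
have e10 : 0 < e1 by rewrite divr_gt0.
have [_ pn] : 1 < p /\ p < n%:R by case: adm => /andP[].
have qs : (n%:R - p) * (q / p - 1) < p by case: adm.
have [S FS hS] := ultra_Lq_cauchy p1 pn (ltW pq) qs bO hphi hEphi UF e10.
have [N _ hN] := (cvgrPdist_le _ _).1 cvg_half _ e10.
have PF : ProperFilter F by exact: ultra_proper.
exists (S `&` [set k | (N <= k)%N]).
  by apply: filterI => //; apply: ooF; exists N.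
move=> k l [Sk Nk] [Sl Nl].
have sm j : (N <= j)%N -> en_le mu q e1 (Sf (fun x => w j x - phi j x)).
  move=> Nj; have [_ _ h _] := hs j; apply: en_leW h.
  by have := hN j Nj; rewrite sub0r normrN ger0_norm// ltW.
have h1 := sm k Nk; have h3 := sm l Nl.
have h2 : en_le mu q e1 (Sf (fun x => phi k x - phi l x)).
  apply/en_leSf; split; [|exact: Cc_L1_powR q0 (Cc_sub (hphi k) (hphi l))|exact: hS].
  exact: Cc_meas (Cc_sub (hphi k) (hphi l)).
rewrite SfB in h3; have h4 := en_leBC h3; rewrite -SfB in h4.
have := en_leD q1 (en_leD q1 h1 h2) h4.
rewrite (_ : (fun x => _) = Sf (fun x => w k x - w l x)); last first.
  by apply/funext => x; apply/rowP => i; rewrite !mxE !subrKA.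
move=> /en_leSf[_ _ h]; apply: le_trans h _; rewrite le_eqVlt; apply/orP; left; apply/eqP.
rewrite -/Q; transitivity (e1 * (Q * (Q * 2 + 1))); last by rewrite /e1 divfK// gt_eqF.
by ring.
Qed.

Let half_sum_le (x y t : R) : x <= t -> y <= t -> 2^-1 * (x + y) <= t.
Proof. by lra. Qed.

Let dist_le2 (x y t d : R) : `|x - y| <= d -> `|x - t| <= d -> y - t <= 2 * d.
Proof. by rewrite !ler_norml => /andP[? ?] /andP[? ?]; lra. Qed.

Let gap_le (eN eM em nN nM nm x1 x2 mN mM d : R) : mN <= em + nm -> nm <= 2^-1 * (nN + nM) ->
  eN + nN <= mN + x1 -> eM + nM <= mM + x2 -> mM - mN <= 2 * d -> x1 <= d -> x2 <= d ->
  2^-1 * (eN + eM) - em <= 2 * d.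
Proof. by lra. Qed.

Lemma Xp_mid u v G H : Xp u G -> Xp v H ->
  Xp (fun x => 2^-1 * (u x + v x)) (fun x => 2^-1 *: (G x + H x)).
Proof.
move=> [h1 h2 h3] [k1 k2 k3]; split.
- exact: XZ (XD adm h1 k1).
- by move=> x; rewrite mulr_ge0 ?invr_ge0// addr_ge0.
- by move=> x xO; rewrite h3// k3// addr0 mulr0.
Qed.

(* A minimising sequence of the strictly convex functional [dirichlet] over the
   decreasing convex sets of competitors [fast]-close to [U] converges strongly,
   by the quantitative midpoint convexity. *)
Lemma lsc_attained (U : 'rV[R]_n -> R) (w : nat -> 'rV[R]_n -> R) (H : nat -> 'rV[R]_n -> 'rV[R]_n) l :
  measurable_fun setT U -> (forall N, Xp (w N) (H N)) ->
  (forall N, L1 mu (fun x => `|w N x - U x| `^ q)) ->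
  (forall N, fC (fun x => w N x - U x) <= fast q N) ->
  fA (w N) (H N) @[N --> \oo] --> l ->
  exists2 G, X U G & fA U G <= l.
Proof.
move=> mU hw iw hwU cvl.
pose S N := [set wH : ('rV[R]_n -> R) * ('rV[R]_n -> 'rV[R]_n) | Xp wH.1 wH.2 /\
   en_le mu q (fast q N) (Sf (fun x => wH.1 x - U x))].
have SW N M : (N <= M)%N -> S M `<=` S N.
  by move=> NM wH [h1 h2]; split => //; apply: en_leW h2; exact: fast_decr.
have wS N : S N (w N, H N).
  have [[mw _ _] _ _] := hw N.
  have h := en_le_power_int (measurable_funB mw mU) (iw N) (hwU N).
  by split; [exact: hw|exact: h].
pose VN N := [set fA wH.1 wH.2 | wH in S N].
have hasV N : has_inf (VN N).
  split; first by exists (fA (w N) (H N)); exists (w N, H N).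
  by exists 0 => _ [wH _ <-]; exact: dirichlet_ge0.
pose m N := inf (VN N).
have mle N wH : S N wH -> m N <= fA wH.1 wH.2.
  by move=> h; apply: ge_inf; [by case: (hasV N)|exists wH].
have mW N M : (N <= M)%N -> m N <= m M.
  move=> NM; apply: lb_le_inf; first by case: (hasV M).
  by move=> _ [wH h <-]; apply: mle; exact: SW NM _ h.
have ml N : m N <= l.
  have cv : fA (w (k + N)%N) (H (k + N)%N) @[k --> \oo] --> l.
    by rewrite (cvg_shiftn N (fun k => fA (w k) (H k))).
  apply: ler_cvg_seq cv => k; apply: (mle _ (w (k + N)%N, H (k + N)%N)).
  by apply: (SW N (k + N)%N) (wS _); exact: leq_addl.
have exz N : exists zN, S N zN /\ fA zN.1 zN.2 <= m N + 2^-1 ^+ N.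
  have [_ [wH h <-] lt] := inf_adherent (half0 N) (hasV N).
  by exists wH; split => //; exact: ltW.
have [z hz] := choice exz.
have l0 : 0 <= l by apply: ler_cvg_seq cvl => N; exact: dirichlet_ge0.
have zA N : fA (z N).1 (z N).2 <= l + 1.
  by apply: le_trans (hz N).2 _; rewrite lerD.
have zX N : X (z N).1 (z N).2 by have [[[]]] := hz N.
have zE N : energy mu p (z N).2 <= l + 1.
  by apply: le_trans (zA N); rewrite lerDl energy_ge0.
have mcv : cvgn m.
  apply: nondecreasing_is_cvgn; first by move=> N M; exact: mW.
  by exists l => _ [N _ <-]; exact: ml.
have cauchy c : 0 < c -> exists N0, forall N M, (N0 <= N)%N -> (N0 <= M)%N ->
    energy mu p (fun x => (z N).2 x - (z M).2 x) <= c.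
  (* [c1] and, below, [d] make each of the two terms of [energy_midgap] at most c / 2, the energies
     of the z N being at most l + 1. *)
  move=> c0; pose c1 := c / (4 * (l + 1)).
  have l1 : 0 < l + 1 by rewrite ltr_wpDl.
  have c10 : 0 < c1 by rewrite divr_gt0// mulr_gt0.
  have [C C0 hC] := @energy_midgap _ _ R n mu p p1 c1 c10.
  pose d := c / (4 * (C + 1)); have d0 : 0 < d by rewrite divr_gt0// mulr_gt0// ltr_wpDl.
  have [N1 _ hN1] := (cvgrPdist_le _ _).1 mcv _ d0.
  have [N2 _ hN2] := (cvgrPdist_le _ _).1 cvg_half _ d0.
  exists (maxn N1 N2) => N M; rewrite !geq_max => /andP[N1N N2N] /andP[N1M N2M].
  wlog NM : N M N1N N2N N1M N2M / (N <= M)%N.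
    move=> W; have [NM|MN] := leqP N M; first exact: W.
    by rewrite energyBC; apply: W => //; exact: ltnW.
  have iN := X_inLp adm bO (zX N); have iM := X_inLp adm bO (zX M).
  have jN := X_nl_inLp adm bO (zX N); have jM := X_nl_inLp adm bO (zX M).
  apply: le_trans (hC _ _ iN iM) _.
  have b1 : c1 * (energy mu p (z N).2 + energy mu p (z M).2) <= c / 2.
    apply: (@le_trans _ _ (c1 * ((l + 1) + (l + 1)))).
      by rewrite ler_wpM2l ?(ltW c10)// lerD.
    rewrite le_eqVlt; apply/orP; left; apply/eqP.
    by rewrite /c1; field; rewrite gt_eqF.
  have [[zpN eN] aN] := hz N; have [[zpM eM] aM] := hz M.
  (* For N <= M the midpoint of z N and z M still belongs to S N, so its energy is at least m N,
     while both ends have energy close to the limit of m: little room is left for the midpoint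
     gap. *)
  have midS : S N (fun x => 2^-1 * ((z N).1 x + (z M).1 x), fun x => 2^-1 *: ((z N).2 x + (z M).2 x)).
    split => /=; first exact: Xp_mid.
    have eM' := en_leW (fast_decr q0 NM) eM.
    rewrite (_ : (fun x => _) = (fun x => 2^-1 * (((z N).1 x - U x) + ((z M).1 x - U x)))).
      rewrite SfZ SfD; split; first exact: inLpZ (inLpD q1 eN.1 eM'.1).
      apply: le_trans (energy_midpoint_le q1 eN.1 eM'.1) _.
      exact: half_sum_le eN.2 eM'.2.
    by apply/funext => x; move: ((z N).1 x) ((z M).1 x) (U x) => r1 r2 r3; field.
  have am := mle N _ midS; rewrite /fA /= in am.
  (* The nonlocal energy contributes by its plain convexity; the quantitative gap is drawn from the
     local one. *)
  have nlmid : energy nu p (nlf (fun x => 2^-1 * ((z N).1 x + (z M).1 x))) <=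
      2^-1 * (energy nu p (nlf (z N).1) + energy nu p (nlf (z M).1)).
    have -> : nlf (fun x => 2^-1 * ((z N).1 x + (z M).1 x)) =
        (fun y => 2^-1 *: (nlf (z N).1 y + nlf (z M).1 y)).
      by apply/funext => y; rewrite nlfieldZ nlfieldD.
    exact: (energy_midpoint_le p1 jN jM).
  rewrite /fA in aN aM.
  have gap : 2^-1 * (energy mu p (z N).2 + energy mu p (z M).2) -
      energy mu p (fun x => 2^-1 *: ((z N).2 x + (z M).2 x)) <= 2 * d.
    have t1 : m M - m N <= 2 * d.
      exact: dist_le2 (hN1 M N1M) (hN1 N N1N).
    have t2 : 2^-1 ^+ N <= d by have := hN2 N N2N; rewrite sub0r normrN ger0_norm// ltW.
    have t3 : 2^-1 ^+ M <= d by have := hN2 M N2M; rewrite sub0r normrN ger0_norm// ltW.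
    exact: gap_le am nlmid aN aM t1 t2 t3.
  have b2 : C * (2^-1 * (energy mu p (z N).2 + energy mu p (z M).2) -
      energy mu p (fun x => 2^-1 *: ((z N).2 x + (z M).2 x))) <= c / 2.
    apply: le_trans (ler_wpM2l C0 gap) _.
    have <- : d * (4 * (C + 1)) = c by rewrite /d divfK// gt_eqF// mulr_gt0// ltr_wpDl.
    have -> : d * (4 * (C + 1)) / 2 = C * (2 * d) + 2 * d by field.
    by rewrite lerDl mulr_ge0// ltW.
  by rewrite [leRHS]splitr lerD.
have [kap hkap] := choice (fun i => cauchy _ (fast_gt0 p i)).
(* Partial sums make the indices nondecreasing while keeping s i above both i and kap i. *)
pose s i := (\sum_(j < i.+1) (kap j).+1)%N.
have sW i j : (i <= j)%N -> (s i <= s j)%N.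
  move=> ij; rewrite /s -(subnKC ij) -addSn.
  by rewrite big_split_ord /= leq_addr.
have ski i j : (i <= j)%N -> (kap i <= s j)%N.
  move=> ij; apply: leq_trans (sW _ _ ij); rewrite /s big_ord_recr/=.
  by rewrite (leq_trans (leqnSn _))// leq_addl.
have si i : (i <= s i)%N.
  by rewrite /s; elim: i => // i IH; rewrite big_ord_recr/= addnS ltnS (leq_trans IH)// leq_addr.
have fc i k j : (i <= k)%N -> (i <= j)%N ->
    energy mu p (fun x => (z (s k)).2 x - (z (s j)).2 x) <= fast p i.
  by move=> ik ij; apply: hkap; exact: ski.
have [||G mG cvG] := @Lp_fast_cauchy _ _ R n mu p p1 (fun i => (z (s i)).2).
- by move=> i; exact: (X_inLp adm bO (zX _)).
- by move=> i; apply: fc.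
have hG i : en_le mu p (fast p i) (fun x => G x - (z (s i)).2 x).
  apply: en_leBC; apply: (energy_cauchy_limit p1 _ mG cvG (N := i)) => //.
    by move=> k; exact: (X_inLp adm bO (zX _)).
  by move=> k j; exact: fc.
have fcv : fast p i @[i --> \oo] --> (0 : R).
  apply: (@squeeze_cvgr _ _ _ _ (fun=> 0) (fun i => 2^-1 ^+ i)).
  - by apply: nearW => i; rewrite (ltW (fast_gt0 p i)) fast_le.
  - exact: cvg_cst.
  - exact: cvg_half.
have hXU : X U G.
  apply: (X_closed adm bO (w := fun i => (z (s i)).1) (H := fun i => (z (s i)).2) (a := fast p)).
- by move=> i; exact: zX.
- exact: hG.
- exact: fcv.
- exact: mU.
- exact: mG.
- have c0 : {ae mu, forall x, ((z (s i)).1 x - U x) @[i --> \oo] --> (0 : R)}.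
    apply: (ae_cvg_of_en_le q0) => i; have [[_ h] _] := hz (s i); apply: en_leW h.
    by apply: le_trans (fast_le _ q0) _; apply: halfW.
  apply: filterS c0 => x c.
  have -> : (fun i => (z (s i)).1 x) = (fun i => ((z (s i)).1 x - U x) + U x).
    by apply/funext => i; rewrite subrK.
  by rewrite -[X in _ --> X]add0r; apply: cvgD => //; exact: cvg_cst.
exists G => //.
have cvA := dirichlet_cvg adm bO (fun i => zX (s i)) hXU.
have cvA' : fA (z (s i)).1 (z (s i)).2 @[i --> \oo] --> fA U G.
  apply: cvA; apply: (@squeeze_cvgr _ _ _ _ (fun=> 0) (fast p)) => //; last exact: cvg_cst.
  by apply: nearW => i; rewrite energy_ge0 /=; have [_] := en_leBC (hG i).
have cvr : l + 2^-1 ^+ i @[i --> \oo] --> l.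
  by rewrite -[X in _ --> X]addr0; apply: cvgD; [exact: cvg_cst|exact: cvg_half].
rewrite -subr_ge0.
apply: (@ler_cvg_seq _ _ _ (fun i => l + 2^-1 ^+ i - fA (z (s i)).1 (z (s i)).2)); last exact: cvgB.
move=> i; rewrite subr_ge0.
by apply: le_trans (hz (s i)).2 _; rewrite lerD// halfW.
Qed.

(** Along an ultrafilter the sequence is Cauchy in L^q and its energies converge; one subsequence is
    extracted for both. The limit of the energies may exceed the energy of the limit, so l is
    returned as well. *)
Lemma Xp_compact (w : nat -> 'rV[R]_n -> R) (H : nat -> 'rV[R]_n -> 'rV[R]_n) E :
  (forall k, Xp (w k) (H k)) -> (forall k, fA (w k) (H k) <= E) ->
  exists (s : nat -> nat) U G l, [/\ forall i, (s i < s i.+1)%N, Xp U G,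
    fC (fun x => w (s i) x - U x) @[i --> \oo] --> (0 : R),
    fA (w (s i)) (H (s i)) @[i --> \oo] --> l & fA U G <= l].
Proof.
move=> hw hE.
have [F [UF ooF]] := ultraFilterLemma (@eventually_filter).
have PF : ProperFilter F by exact: ultra_proper.
have hX k : X (w k) (H k) by have [] := hw k.
have AB k : `|fA (w k) (H k)| <= E by rewrite ger0_norm ?dirichlet_ge0.
have [l hl] := ultra_bounded_cvg UF AB.
have exS i : exists Si : set nat, F Si /\ forall k j : nat, Si k -> Si j ->
    fC (fun x => w k x - w j x) <= fast q i /\ `|fA (w k) (H k) - l| <= 2^-1 ^+ i.
  have [S FS hS] := X_ultra_cauchy UF ooF hX hE (fast_gt0 q i).
  exists (S `&` [set k | `|fA (w k) (H k) - l| <= 2^-1 ^+ i]); split.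
    by apply: filterI => //; exact: hl.
  by move=> k j [Sk lk] [Sj _]; split => //; exact: hS.
have [S hS] := choice exS.
have [s sinc sS] := ultra_extract PF ooF (fun i => (hS i).1).
have fast_kj i k j : (i <= k)%N -> (i <= j)%N -> fC (fun x => w (s k) x - w (s j) x) <= fast q i.
  by move=> ik ij; have [] := (hS i).2 _ _ (sS i k ik) (sS i j ij).
have iS k : inLp mu q (Sf (w (s k))).
  by have [[mw _ _] _ _] := hw (s k); have [] := en_le_power_int mw (X_L1q adm bO (hX (s k))) (lexx _).
have enS k j : energy mu q (fun x => Sf (w (s k)) x - Sf (w (s j)) x) = fC (fun x => w (s k) x - w (s j) x).
  by rewrite -SfB /energy; under eq_Rintegral do rewrite enorm_Sf.
have [|W mW cvW] := @Lp_fast_cauchy _ _ R 1 mu q q1 (fun i => Sf (w (s i))) iS.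
  by move=> i; rewrite enS; exact: fast_kj.
(* The pointwise limit is corrected to be nonnegative everywhere and zero off [Omega]; it changes
   only where the subsequence does not converge. *)
pose U x := \1_Omega x * `|W x ord0 ord0|.
have mU : measurable_fun setT U.
  apply: measurable_funM; first by apply: measurable_indic; exact: open_measurable_rV.
  by apply: measurableT_comp => //; exact: mW.
have cvU : {ae mu, forall x, w (s i) x @[i --> \oo] --> U x}.
  apply: filterS cvW => x c.
  have c1 : w (s i) x @[i --> \oo] --> W x ord0 ord0.
    have c2 : (Sf (w (s i)) x) ord0 ord0 @[i --> \oo] --> W x ord0 ord0.
      apply: (@cvg_comp _ _ _ _ (fun y : 'rV[R]_1 => y ord0 ord0) _ _ _ c).
      exact: coord_continuous.
    by move: c2; under eq_fun do rewrite mxE.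
  have W0 : 0 <= W x ord0 ord0.
    by apply: ler_cvg_seq c1 => i; have [_ ->] := hw (s i).
  suff <- : W x ord0 ord0 = U x by exact: c1.
  rewrite /U indicE; have [/set_mem xO|/negP xO] := boolP (x \in Omega).
    by rewrite mul1r ger0_norm.
  rewrite mul0r; move: c1; under eq_fun => i.
    by have [_ _ ->] := hw (s i); [over|move=> h; apply: xO; exact/mem_set].
  by move=> c1; rewrite -(cvg_lim (@Rhausdorff R) c1) lim_cst.
have cvS : {ae mu, forall x, Sf (w (s i)) x @[i --> \oo] --> Sf U x}.
  by apply: filterS cvU => x c; apply: cvg_rV => i; under eq_fun do rewrite mxE; rewrite mxE.
have close i : en_le mu q (fast q i) (Sf (fun x => w (s i) x - U x)).
  rewrite SfB; apply: (energy_cauchy_limit q1 iS (vmeas_Sf mU) cvS (N := i)) => //.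
  by move=> k j ik ij; rewrite enS; exact: fast_kj.
have cvA : fA (w (s i)) (H (s i)) @[i --> \oo] --> l.
  apply/cvgrPdist_le => e e0; have [N _ hN] := (cvgrPdist_le _ _).1 cvg_half _ e0.
  exists N => // k Nk /=; rewrite distrC.
  have [_ h] := (hS k).2 _ _ (sS k k (leqnn k)) (sS k k (leqnn k)); apply: le_trans h _.
  by have := hN k Nk; rewrite sub0r normrN; apply: le_trans; exact: ler_norm.
have [||||G hXU le] := @lsc_attained U (fun i => w (s i)) (fun i => H (s i)) l mU.
- by move=> i; exact: hw.
- by move=> i; have /en_leSf[] := close i.
- by move=> i; have /en_leSf[] := close i.
- exact: cvA.
exists s, U, G, l; split => //.
- split => // x; rewrite /U indicE.
    by rewrite mulr_ge0.
  by move=> xO; rewrite memNset// mul0r.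
- apply: (@squeeze_cvgr _ _ _ _ (fun=> 0) (fun i => 2^-1 ^+ i)); [|exact: cvg_cst|exact: cvg_half].
  apply: nearW => i; rewrite power_int_ge0 /=; have /en_leSf[_ _ h] := close i.
  by apply: le_trans h _; exact: fast_le.
Qed.

End compactness_Xp.

(** * The fibering map *)

Section fiber.
Context {R : realType} (p q a : R).
Hypotheses (p1 : 1 < p) (pq : p < q) (a01 : 0 < a < 1).
Implicit Types (lam al be c t : R).

Let p0 : 0 < p. Proof. exact: lt_trans p1. Qed.
Let q1 : 1 < q. Proof. exact: lt_trans pq. Qed.
Let q0 : 0 < q. Proof. exact: lt_trans q1. Qed.
Let a0 : 0 < a. Proof. by case/andP: a01. Qed.
Let a1 : a < 1. Proof. by case/andP: a01. Qed.
Let ap : 0 < p - a. Proof. by rewrite subr_gt0 (lt_trans a1). Qed.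

(* [J(t u)] as a function of [t], where [al], [be], [c] are the integrals of [u]. *)
Definition fib lam al be c t : R :=
  al / p * `|t| `^ p - lam / a * be * `|t| `^ a - c / q * `|t| `^ q.

Lemma fib1 lam al be c : fib lam al be c 1 = al / p - lam / a * be - c / q.
Proof. by rewrite /fib normr1 !powR1 !mulr1. Qed.

Lemma fibZ lam al be c t s :
  fib lam (`|t| `^ p * al) (`|t| `^ a * be) (`|t| `^ q * c) s = fib lam al be c (t * s).
Proof.
rewrite /fib normrM !powRM//.
by move: (`|t| `^ p) (`|t| `^ a) (`|t| `^ q) => x y z; congr (_ - _ - _); ring.
Qed.

Lemma fib_cvg lam (al be c t : nat -> R) al' be' c' t' : al k @[k --> \oo] --> al' ->
  be k @[k --> \oo] --> be' -> c k @[k --> \oo] --> c' -> t k @[k --> \oo] --> t' ->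
  fib lam (al k) (be k) (c k) (t k) @[k --> \oo] --> fib lam al' be' c' t'.
Proof.
move=> ha hb hc ht; have nt : `|t k| @[k --> \oo] --> `|t'| by exact: cvg_norm.
have pw e : 0 < e -> `|t k| `^ e @[k --> \oo] --> `|t'| `^ e.
  by move=> e0; apply: cvg_powR.
apply: cvgB; last by apply: cvgM; [apply: cvgM => //; exact: cvg_cst|exact: pw].
apply: cvgB; first by apply: cvgM; [apply: cvgM => //; exact: cvg_cst|exact: pw].
by apply: cvgM; [apply: cvgM => //; exact: cvg_cst|exact: pw].
Qed.

(** The solution of al / p t^p = c / q t^q: beyond it the power term alone outweighs the energy. *)
Definition fib_bound al c : R := (q * al / (p * c)) `^ (q - p)^-1.

Lemma fib_le_bound lam al be c t : 0 <= lam -> 0 <= al -> 0 <= be -> 0 < c -> 0 < t ->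
  0 < fib lam al be c t -> t <= fib_bound al c.
Proof.
move=> l0 al0 be0 c0 t0; rewrite /fib gtr0_norm// => h.
have qp : 0 < q - p by rewrite subr_gt0.
have h1 : c / q * t `^ q < al / p * t `^ p.
  rewrite -subr_gt0; apply: lt_le_trans h _; rewrite lerD2r gerBl.
  by rewrite !mulr_ge0 ?powR_ge0// invr_ge0 ltW.
have e : t `^ q = t `^ (q - p) * t `^ p.
  by rewrite -powRD ?(gt_eqF t0) ?implybT// subrK.
have h2 : t `^ (q - p) < q * al / (p * c).
  move: h1; rewrite e mulrA ltr_pM2r ?powR_gt0// ltr_pdivlMr// => h1.
  rewrite ltr_pdivlMr ?mulr_gt0// mulrC -ltr_pdivrMl// .
  by apply: le_lt_trans h1; rewrite le_eqVlt; apply/orP; left; apply/eqP; move: (t `^ _) => x; field; rewrite gt_eqF.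
rewrite /fib_bound -[leLHS](powRr1 (ltW t0)) -(mulfV (lt0r_neq0 qp)) powRrM.
by rewrite ge0_ler_powR ?nnegrE ?powR_ge0 ?invr_ge0 ?(ltW qp) ?(ltW h2)// (le_trans _ (ltW h2)) ?powR_ge0.
Qed.

Lemma fib_continuous lam al be c : continuous (fib lam al be c).
Proof.
move=> t; apply: cvgB.
  apply: cvgB; first by apply: cvgM; [exact: cvg_cst|exact: normr_powR_continuous].
  by apply: cvgM; [exact: cvg_cst|exact: normr_powR_continuous].
by apply: cvgM; [exact: cvg_cst|exact: normr_powR_continuous].
Qed.

Lemma fib0 lam al be c : fib lam al be c 0 = 0.
Proof. by rewrite /fib normr0 !powR0 ?gt_eqF// !mulr0 !subr0. Qed.

Lemma fib_max lam al be c : 0 <= lam -> 0 <= al -> 0 <= be -> 0 < c ->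
  (exists2 t, 0 < t & 0 < fib lam al be c t) ->
  exists T, [/\ 0 < T, 0 < fib lam al be c T & forall t, 0 <= t -> fib lam al be c t <= fib lam al be c T].
Proof.
move=> l0 al0 be0 c0 [t t0 ft].
have tb := fib_le_bound l0 al0 be0 c0 t0 ft; set M := fib_bound al c in tb.
have M0 : 0 <= M by exact: powR_ge0.
have cf : {within `[0, M], continuous (fib lam al be c)}.
  by apply: continuous_subspaceT => x; exact: fib_continuous.
have [T TM hT] := EVT_max M0 cf.
have fT : 0 < fib lam al be c T.
  by apply: lt_le_trans ft _; apply: hT; rewrite in_itv/= (ltW t0).
exists T; split => //.
  have T0 : 0 <= T by rewrite (itvP TM).
  by rewrite lt_neqAle T0 andbT; apply: contraTneq fT => <-; rewrite fib0 ltxx.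
move=> s s0; have [sM|Ms] := leP s M; first by apply: hT; rewrite in_itv/= s0.
apply: le_trans (ltW fT); rewrite leNgt; apply/negP => fs.
have spos : 0 < s by exact: le_lt_trans Ms.
by have := fib_le_bound l0 al0 be0 c0 spos fs; rewrite leNgt Ms.
Qed.

Lemma powR_mid_lt (s x y : R) : 1 < s -> 0 < x -> 0 < y -> x != y ->
  2 * ((x + y) / 2) `^ s < x `^ s + y `^ s.
Proof.
move=> s1 x0 y0 xy; set m := (x + y) / 2; have m0 : 0 < m by rewrite divr_gt0// addr_gt0.
have mn0 : m != 0 by rewrite gt_eqF.
have xm : x / m != 1.
  by apply: contra xy => /eqP; rewrite /m => /(congr1 ( *%R^~ m)); rewrite divfK// mul1r /m => e; apply/eqP; lra.
have ym : y / m != 1.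
  by apply: contra xy => /eqP; rewrite /m => /(congr1 ( *%R^~ m)); rewrite divfK// mul1r /m => e; apply/eqP; lra.
have h1 := powR_gt_affine s1 (ltW (divr_gt0 x0 m0)) xm.
have h2 := powR_gt_affine s1 (ltW (divr_gt0 y0 m0)) ym.
have e : x / m + y / m = 2 by rewrite -mulrDl /m invf_div mulrC divfK// gt_eqF// addr_gt0.
have h : 2 < (x / m) `^ s + (y / m) `^ s.
  have : s * (x / m - 1) + s * (y / m - 1) = 0.
    by rewrite -mulrDr addrACA e -opprD subrr mulr0.
  by move: h1 h2; move: (s * _) (s * _) (_ `^ _) (_ `^ _) => b1 b2 b3 b4; lra.
rewrite -(powR_divK s m0 (ltW x0)) -(powR_divK s m0 (ltW y0)) -mulrDl.
by rewrite ltr_pM2r// powR_gt0.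
Qed.

(** After division by the midpoint, u + v = 2; hence u v <= 1, u^(-s) v^(-s) >= 1, and two positive
    numbers of product at least 1 have sum at least 2. *)
Lemma powRN_mid_le (s x y : R) : 0 <= s -> 0 < x -> 0 < y ->
  2 * ((x + y) / 2) `^ (- s) <= x `^ (- s) + y `^ (- s).
Proof.
move=> s0 x0 y0; set m := (x + y) / 2; have m0 : 0 < m by rewrite divr_gt0// addr_gt0.
have mn0 : m != 0 by rewrite gt_eqF.
rewrite -(powR_divK (- s) m0 (ltW x0)) -(powR_divK (- s) m0 (ltW y0)) -mulrDl.
rewrite ler_pM2r ?powR_gt0//; set u := x / m; set v := y / m.
have u0 : 0 < u by rewrite divr_gt0.
have v0 : 0 < v by rewrite divr_gt0.
have e : u + v = 2 by rewrite -mulrDl /m invf_div mulrC divfK// gt_eqF// addr_gt0.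
clearbody u v.
have uv : 1 <= u `^ (- s) * v `^ (- s).
  rewrite -powRM ?(ltW u0) ?(ltW v0)// powRN invf_ge1 ?powR_gt0 ?mulr_gt0//.
  apply: (@le_trans _ _ (1 `^ s)); last by rewrite powR1.
  rewrite ge0_ler_powR ?nnegrE ?mulr_ge0 ?(ltW u0) ?(ltW v0)//.
  have -> : v = 2 - u by lra.
  by rewrite -subr_ge0 (_ : _ - _ = (1 - u) ^+ 2) ?sqr_ge0//; ring.
have U0 : 0 < u `^ (- s) by exact: powR_gt0.
have V0 : 0 < v `^ (- s) by exact: powR_gt0.
move: (u `^ _) (v `^ _) U0 V0 uv => U V U0 V0 UV.
rewrite -(@ler_pXn2r _ 2) ?nnegrE ?addr_ge0 ?(ltW U0) ?(ltW V0)// -subr_ge0.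
have -> : (U + V) ^+ 2 - 2 ^+ 2 = (U - V) ^+ 2 + 4 * (U * V - 1) by ring.
by rewrite addr_ge0 ?sqr_ge0// mulr_ge0// subr_ge0.
Qed.

(* In the variable [tau = t ^ (p - a)], [fib t / t ^ a] is strictly concave while
   [max / t ^ a] is convex, so they touch at most once. *)
Lemma fib_max_unique lam al be c t : 0 < c -> (forall t, 0 <= t -> fib lam al be c t <= fib lam al be c 1) ->
  0 <= fib lam al be c 1 -> 0 < t -> fib lam al be c t = fib lam al be c 1 -> t = 1.
Proof.
move=> c0 hmax m0 t0 ft; apply/eqP; apply: contraT => t1; exfalso.
set M := fib lam al be c 1 in m0 ft hmax.
pose h tau := al / p * tau - lam / a * be - c / q * tau `^ ((q - a) / (p - a)).
have fE s : 0 < s -> fib lam al be c s = s `^ a * h (s `^ (p - a)).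
  move=> s0; rewrite /fib gtr0_norm// /h -powRrM mulrCA divff ?gt_eqF// mulr1.
  have e1 : s `^ p = s `^ a * s `^ (p - a) by rewrite -powRD ?(gt_eqF s0) ?implybT// addrC subrK.
  have e2 : s `^ q = s `^ a * s `^ (q - a) by rewrite -powRD ?(gt_eqF s0) ?implybT// addrC subrK.
  by rewrite e1 e2; move: (s `^ a) (s `^ (p - a)) (s `^ (q - a)) => x y z; ring.
pose tau := t `^ (p - a); have tau0 : 0 < tau by exact: powR_gt0.
have tau1 : 1 != tau.
  apply: contra t1 => /eqP e; apply/eqP.
  have : tau `^ (p - a)^-1 = 1 by rewrite -e powR1.
  by rewrite /tau -powRrM mulfV ?gt_eqF// powRr1// ltW.
pose ee := a / (p - a); have ee0 : 0 <= ee by rewrite divr_ge0// ltW.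
have hk s : 0 < s -> h (s `^ (p - a)) <= M * (s `^ (p - a)) `^ (- ee).
  move=> s0; have sa : 0 < s `^ a by exact: powR_gt0.
  rewrite -powRrM mulrN /ee mulrCA divff ?gt_eqF// mulr1 powRN.
  by rewrite ler_pdivlMr// mulrC -fE//; apply: hmax; exact: ltW.
have h1 : h 1 = M by rewrite /M fE// !powR1 mul1r.
have ht : h tau = M * tau `^ (- ee).
  have sa : 0 < t `^ a by exact: powR_gt0.
  rewrite -powRrM mulrN /ee mulrCA divff ?gt_eqF// mulr1 powRN -ft fE//.
  by rewrite mulrC mulKf// gt_eqF.
pose m := (1 + tau) / 2; have mpos : 0 < m by rewrite divr_gt0// addr_gt0.
have hm : h m <= M * m `^ (- ee).
  have s0 : 0 < m `^ (p - a)^-1 by exact: powR_gt0.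
  have := hk _ s0; have -> : (m `^ (p - a)^-1) `^ (p - a) = m => //.
  by rewrite -powRrM mulVf ?gt_eqF// powRr1// ltW.
have sg : 1 < (q - a) / (p - a) by rewrite ltr_pdivlMr// mul1r ltrD2r.
have s1 := powR_mid_lt sg ltr01 tau0 tau1; rewrite -/m powR1 in s1.
have s2 := powRN_mid_le ee0 ltr01 tau0; rewrite -/m powR1 in s2.
have cq : 0 < c / q by rewrite divr_gt0.
have s3 : c / q * (2 * m `^ ((q - a) / (p - a))) < c / q * (1 + tau `^ ((q - a) / (p - a))).
  by rewrite ltr_pM2l.
have s4 : M * (2 * m `^ (- ee)) <= M * (1 + tau `^ (- ee)) by rewrite ler_wpM2l.
have em : al / p * m = 2^-1 * (al / p) + 2^-1 * (al / p * tau) by rewrite /m; field; rewrite gt_eqF.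
move: hm h1 ht s3 s4; rewrite /h em powR1 !mulr1 (mulrCA _ 2) (mulrCA M 2) !(mulrDr _ 1) !mulr1.
move: (al / p) (al / p * tau) (lam / a * be) (c / q) => x1 x2 x3 x4.
move: (x4 * m `^ _) (x4 * tau `^ _) (M * m `^ _) (M * tau `^ _) => y1 y2 y3 y4.
by move=> *; lra.
Qed.

(** The left derivative at a maximum is nonnegative: fib t <= fib 1 is divided by 1 - t for t
    increasing to 1, and tangent inequalities take the place of derivatives. *)
Lemma fib_stationary lam al be c : 0 <= lam -> 0 <= be -> 0 <= c ->
  (forall t, 0 <= t -> fib lam al be c t <= fib lam al be c 1) -> 0 <= al ->
  lam * be + c <= al.
Proof.
move=> l0 be0 c0 hmax al0.
pose t k : R := 1 - 2^-1 ^+ k.+1.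
have half k : 0 < (2^-1 ^+ k.+1 : R) /\ (2^-1 ^+ k.+1 : R) < 1.
  rewrite exprn_gt0 ?invr_gt0//= exprS; split => //.
  have h : (2^-1 ^+ k : R) <= 1 by rewrite exprn_ile1 ?invr_ge0// invf_le1// ler1n.
  by move: (2^-1 ^+ k) h => x h; lra.
have key k : c * t k `^ (q - 1) <= al - lam * be.
  have [h0 h1] := half k.
  have t0 : 0 < t k by rewrite subr_gt0.
  have d0 : 0 < 1 - t k by rewrite /t opprB addrC subrK.
  have := hmax _ (ltW t0); rewrite fib1 /fib gtr0_norm//.
  have b1 := powR_ge_tangent1 p1 (ltW t0).
  have b2 := powR_le_tangent1 a01 (ltW t0).
  have b3 := powR_convex_tangent q1 (ltW t0) ler01; rewrite powR1 in b3.
  have c1 : al / p * (1 - t k `^ p) <= al * (1 - t k).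
    rewrite [leRHS](_ : _ = al / p * (p * (1 - t k))); last by field; rewrite gt_eqF.
    rewrite ler_wpM2l ?divr_ge0 ?(ltW p0)//.
    by move: b1; rewrite !mulrBr; move: (t k `^ p) (p * t k) => x y; lra.
  have c2 : lam * be * (1 - t k) <= lam / a * be * (1 - t k `^ a).
    rewrite [leLHS](_ : _ = lam / a * be * (a * (1 - t k))); last by field; rewrite gt_eqF.
    rewrite ler_wpM2l ?mulr_ge0 ?invr_ge0 ?(ltW a0)//.
    by move: b2; rewrite !mulrBr; move: (t k `^ a) (a * t k) => x y; lra.
  have c3 : c * t k `^ (q - 1) * (1 - t k) <= c / q * (1 - t k `^ q).
    rewrite [leLHS](_ : _ = c / q * (q * t k `^ (q - 1) * (1 - t k))); last first.
      by move: (t k `^ _) => x; field; rewrite gt_eqF.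
    rewrite ler_wpM2l ?divr_ge0 ?(ltW q0)//.
    by move: b3; move: (q * _ * _) (t k `^ q) => x y; lra.
  move=> hm; rewrite -(ler_pM2r d0) mulrBl.
  move: c1 c2 c3 hm; rewrite !(mulrBr _ 1) !mulr1.
  move: (al / p) (lam / a * be) (c / q) => x1 x2 x3.
  move: (x1 * _) (x2 * _) (x3 * _) (al * t k) (lam * be * t k) (c * t k `^ (q - 1)) => y1 y2 y3 y4 y5 y6.
  by move: (y6 * t k) => y7 *; lra.
have cv : (al - lam * be) - c * t k `^ (q - 1) @[k --> \oo] --> (al - lam * be) - c * 1.
  apply: cvgB; first exact: cvg_cst.
  apply: cvgM; first exact: cvg_cst.
  have cp : t k `^ (q - 1) @[k --> \oo] --> (1 : R) `^ (q - 1).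
    apply: cvg_powR; first by rewrite subr_gt0.
      by move=> k; have [h0 h1] := half k; rewrite subr_ge0 ltW.
    rewrite -[X in _ --> X]subr0; apply: cvgB; first exact: cvg_cst.
    by rewrite (cvg_shiftS (fun k => 2^-1 ^+ k : R)); exact: cvg_half.
  by rewrite powR1 in cp.
rewrite mulr1 in cv.
have := ler_cvg_seq (fun k => _) cv; move=> H.
have : 0 <= al - lam * be - c by apply: H => k; rewrite subr_ge0; exact: key.
by move: (lam * be) => x; lra.
Qed.

(** Since a < p, the singular term dominates the energy near t = 0. *)
Lemma fib_neg_small lam al be c rho : 0 < lam -> 0 <= al -> 0 < be -> 0 <= c -> 0 < rho ->
  exists t, [/\ 0 < t, t `^ p * al <= rho & fib lam al be c t < 0].
Proof.
move=> l0 al0 be0 c0 r0.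
have lb : 0 < lam / a * be by rewrite mulr_gt0// divr_gt0.
have pw e : 0 < e -> (2^-1 ^+ k : R) `^ e @[k --> \oo] --> (0 : R).
  move=> e0; have h0 k : (0 : R) <= 2^-1 ^+ k by rewrite exprn_ge0// invr_ge0.
  by have := cvg_powR e0 h0 cvg_half; rewrite powR0 ?gt_eqF.
have c1 : (2^-1 ^+ k : R) `^ p * al @[k --> \oo] --> (0 * al : R).
  by apply: cvgM; [exact: pw|exact: cvg_cst].
have c2 : al / p * (2^-1 ^+ k) `^ (p - a) @[k --> \oo] --> (al / p * 0 : R).
  by apply: cvgM; [exact: cvg_cst|exact: pw].
rewrite mul0r in c1; rewrite mulr0 in c2.
have [N1 _ h1] := (cvgrPdist_le _ _).1 c1 _ r0.
have [N2 _ h2] := (cvgrPdist_lt _ _).1 c2 _ lb.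
set N := maxn N1 N2; exists (2^-1 ^+ N).
have t0 : (0 : R) < 2^-1 ^+ N by rewrite exprn_gt0// invr_gt0.
split => //.
  have := h1 N (leq_maxl _ _); rewrite sub0r normrN; apply: le_trans; exact: ler_norm.
have := h2 N (leq_maxr _ _); rewrite sub0r normrN => /(le_lt_trans (ler_norm _)) h.
rewrite /fib gtr0_norm//; set t := 2^-1 ^+ N in t0 h *.
have e : t `^ p = t `^ (p - a) * t `^ a.
  by rewrite -powRD ?(gt_eqF t0) ?implybT// subrK.
have ta : 0 < t `^ a by exact: powR_gt0.
rewrite e mulrA -mulrBl; apply: (@le_lt_trans _ _ ((al / p * t `^ (p - a) - lam / a * be) * t `^ a)).
  by rewrite gerBl !mulr_ge0 ?powR_ge0// invr_ge0 ltW.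
by rewrite pmulr_llt0// subr_lt0.
Qed.

End fiber.

Lemma bounded_subseq (R : realType) (v : nat -> R) B : (forall k, `|v k| <= B) ->
  exists (s : nat -> nat) (l : R), (forall i, (s i < s i.+1)%N) /\ v (s i) @[i --> \oo] --> l.
Proof.
move=> vB; have [F [UF ooF]] := ultraFilterLemma (@eventually_filter).
have PF : ProperFilter F by exact: ultra_proper.
have [l hl] := ultra_bounded_cvg UF vB.
have [|s sinc sS] := @ultra_extract F (fun i => [set k | `|v k - l| <= 2^-1 ^+ i]) PF ooF.
  by move=> i; apply: hl; rewrite exprn_gt0// invr_gt0.
exists s, l; split => //; apply/cvgrPdist_le => e e0.
have [N _ hN] := (cvgrPdist_le _ _).1 (@cvg_half R) _ e0; exists N => // k Nk /=.
have h : `|v (s k) - l| <= 2^-1 ^+ k by exact: (sS k k).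
rewrite distrC; apply: le_trans h _.
by have := hN k Nk; rewrite sub0r normrN; apply: le_trans; exact: ler_norm.
Qed.

Lemma cvg_subseq (T : topologicalType) (v : nat -> T) (l : T) (s : nat -> nat) :
  (forall i, (s i < s i.+1)%N) -> v k @[k --> \oo] --> l -> v (s i) @[i --> \oo] --> l.
Proof.
move=> sinc cv; apply: (@cvg_comp _ _ _ s v _ \oo); last exact: cv.
move=> A [N _ hN]; exists N => // i /= Ni; apply: hN => /=; apply: leq_trans Ni _.
by elim: i => // i IH; exact: leq_ltn_trans IH (sinc i).
Qed.

(** * Two critical points *)

Section int_powR_eq0.
Context d (T : measurableType d) (R : realType).
Variable mu : {measure set T -> \bar R}.

Lemma rint_powR_eq0 (e : R) (u : T -> R) : 0 < e -> L1 mu (fun x => `|u x| `^ e) ->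
  \int[mu]_x (`|u x| `^ e) = 0 -> {ae mu, forall x, u x = 0}.
Proof.
move=> e0 iu z.
have := (@ae_eq_integral_abs _ _ _ mu setT measurableT (EFin \o (fun x => `|u x| `^ e)) _).1.
move=> H; have : ae_eq mu setT (EFin \o (fun x => `|u x| `^ e)) (cst 0%E).
  apply: H; first by apply/measurable_EFinP; exact: L1_measurable iu.
  rewrite (eq_integral (fun x => (`|u x| `^ e)%:E)).
    by rewrite (L1_integralE iu); congr EFin.
  by move=> x _ /=; rewrite ger0_norm ?powR_ge0.
apply: filterS => x /(_ I)/= [] /eqP.
by rewrite powR_eq0_pos// normr_eq0 => /eqP.
Qed.

End int_powR_eq0.

Section critical_points.
Context {R : realType} (n : nat) (p q D : R) (adm : admissible n p q D).
Variables (Omega : set 'rV[R]_n) (bO : bounded_set Omega) (oO : open Omega).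
Variables (a : R) (a01 : 0 < a < 1).
Local Notation mu := (lebesgue_rV R n).
Local Notation nu := (mu \x mu)%E.
Implicit Types (u v w : 'rV[R]_n -> R) (G H : 'rV[R]_n -> 'rV[R]_n) (e lam : R).
Local Notation nlf := (nlfield p D).
Local Notation X := (X p q D Omega).
Local Notation Xp := (Xp p q D Omega).
Local Notation fA := (dirichlet p D).
Local Notation fB := (singular_int a).
Local Notation fC := (power_int q).

Let p1 : 1 < p. Proof. by case: adm => /andP[]. Qed.
Let pq : p < q. Proof. by case: adm. Qed.
Let p0 : 0 < p. Proof. exact: lt_trans p1. Qed.
Let q1 : 1 < q. Proof. exact: lt_trans pq. Qed.
Let q0 : 0 < q. Proof. exact: lt_trans q1. Qed.
Let a0 : 0 < a. Proof. by case/andP: a01. Qed.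
Let a1 : a < 1. Proof. by case/andP: a01. Qed.
Let ap : a < p. Proof. exact: lt_trans a1 p1. Qed.

Definition fibu lam u G t := fib p q a lam (fA u G) (fB u) (fC u) t.

Definition shift u (e : R) phi : 'rV[R]_n -> R := fun x => u x + e * phi x.
Definition shiftg G (e : R) H : 'rV[R]_n -> 'rV[R]_n := fun x => G x + e *: H x.

(* What both solutions provide: along an admissible direction [J] does not decrease,
   up to rescalings [t k --> 1]. These are needed since the second solution is a
   minimum of [u |-> max_t J(t u)] rather than of [J]. *)
Definition critical lam v G := Xp v G /\ forall phi H, X phi H ->
  (exists2 e0, 0 < e0 & forall e, 0 < e < e0 -> Xp (shift v e phi) (shiftg G e H)) ->
  exists e t : nat -> R,
    [/\ forall k, 0 < e k <= 1 /\ Xp (shift v (e k) phi) (shiftg G (e k) H),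
        e k @[k --> \oo] --> (0 : R), forall k, 0 < t k, t k @[k --> \oo] --> (1 : R) &
        forall k, fibu lam v G (t k) <= fibu lam (shift v (e k) phi) (shiftg G (e k) H) (t k)].

Lemma shift_cvg v G phi H (e : nat -> R) : Xp v G -> X phi H ->
  (forall k, Xp (shift v (e k) phi) (shiftg G (e k) H)) -> e k @[k --> \oo] --> (0 : R) ->
  [/\ fA (shift v (e k) phi) (shiftg G (e k) H) @[k --> \oo] --> fA v G,
      fB (shift v (e k) phi) @[k --> \oo] --> fB v &
      fC (shift v (e k) phi) @[k --> \oo] --> fC v].
Proof.
move=> hv hphi hs e0.
have pw r : 0 < r -> `|e k| `^ r @[k --> \oo] --> (0 : R).
  move=> r0; have ce : `|e k| @[k --> \oo] --> (0 : R) by rewrite -(normr0 R); exact: cvg_norm.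
  by have := cvg_powR r0 (fun k => normr_ge0 (e k)) ce; rewrite powR0 ?gt_eqF.
have cC : fC (fun x => shift v (e k) phi x - v x) @[k --> \oo] --> (0 : R).
  have -> : (fun k => fC (fun x => shift v (e k) phi x - v x)) = (fun k => `|e k| `^ q * fC phi).
    apply/funext => k; rewrite -(power_intZ adm bO (e k) hphi); congr fC.
    by apply/funext => x; rewrite /shift addrC addKr.
  by rewrite -(mul0r (fC phi)); apply: cvgM; [exact: pw|exact: cvg_cst].
have [hX v0 vout] := hv; have hsX k : X (shift v (e k) phi) (shiftg G (e k) H) by case: (hs k).
split.
- apply: (dirichlet_cvg adm bO hsX hX).
  have -> : (fun k => energy mu p (fun x => shiftg G (e k) H x - G x)) = (fun k => `|e k| `^ p * energy mu p H).
    apply/funext => k; rewrite -(energyZ (e k) (X_inLp adm bO hphi)); congr energy.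
    by apply/funext => x; rewrite /shiftg addrC addKr.
  by rewrite -(mul0r (energy mu p H)); apply: cvgM; [exact: pw|exact: cvg_cst].
- exact: (singular_int_cvg adm bO oO a01 hs hv cC).
- apply: (power_int_cvg adm _ _ _ _ cC).
  + by move=> k; case: (hsX k).
  + by move=> k; exact: (X_L1q adm bO (hsX k)).
  + by case: hX.
  + exact: (X_L1q adm bO hX).
Qed.

Lemma XpZ t u G : 0 <= t -> Xp u G -> Xp (fun x => t * u x) (fun x => t *: G x).
Proof.
move=> t0 [h1 h2 h3]; split; first exact: (XZ adm).
  by move=> x; rewrite mulr_ge0.
by move=> x /h3 ->; rewrite mulr0.
Qed.

Lemma fibuZ lam t u G s : Xp u G ->
  fibu lam (fun x => t * u x) (fun x => t *: G x) s = fibu lam u G (t * s).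
Proof.
move=> hu; have [hX _ _] := hu.
by rewrite /fibu (dirichletZ adm bO)// (singular_intZ adm bO oO a01 _ hu) (power_intZ adm bO _ hX) fibZ.
Qed.

Lemma small_steps v G phi H (e0 : R) : 0 < e0 ->
  (forall e, 0 < e < e0 -> Xp (shift v e phi) (shiftg G e H)) ->
  exists e : nat -> R, (forall k, 0 < e k <= 1 /\ Xp (shift v (e k) phi) (shiftg G (e k) H)) /\
    e k @[k --> \oo] --> (0 : R).
Proof.
move=> e00 h; pose m := Num.min (e0 / 2) 1.
have m0 : 0 < m by rewrite lt_min ltr01 andbT divr_gt0.
have half0 k : 0 < (2^-1 ^+ k : R) by rewrite exprn_gt0// invr_gt0.
have half1 k : (2^-1 ^+ k : R) <= 1 by rewrite exprn_ile1 ?invr_ge0// invf_le1// ler1n.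
exists (fun k => m * 2^-1 ^+ k); split; last first.
  by rewrite -(mulr0 m); apply: cvgM; [exact: cvg_cst|exact: cvg_half].
move=> k; have le : m * 2^-1 ^+ k <= m by rewrite ler_piMr// ltW.
have gt : 0 < m * 2^-1 ^+ k by rewrite mulr_gt0.
split; first by rewrite gt (le_trans le)// ge_min lexx orbT.
apply: h; rewrite gt (le_lt_trans le)//.
apply: (@le_lt_trans _ _ (e0 / 2)); first by rewrite ge_min lexx.
by rewrite gtr_pMr// invf_lt1// ltr1n.
Qed.

Lemma singular_int_absorb e : 0 < e -> exists2 K, 0 <= K & forall u G, Xp u G -> fB u <= K + e * fA u G.
Proof.
move=> e0; have [K K0 hK] := dirichlet_bounds adm bO.
have eK : 0 < e / (K + 1) by rewrite divr_gt0// ltr_wpDl.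
have [C C0 hC] := powR_absorb (introT andP (conj a0 ap)) eK.
exists (C * mOmega Omega); first by rewrite mulr_ge0// mOmega_ge0.
move=> u G hu; have [hX _ out] := hu; have [mU _ _] := hX; have [h1 _ _] := hK _ _ hX.
have [_ h2] := L1_lower_power bO oO a01 mU out p0 (X_L1p adm bO hX) hC.
apply: (le_trans h2); rewrite lerD2l -mulrA ler_wpM2l ?(ltW e0)//.
rewrite mulrC ler_pdivrMr ?ltr_wpDl//; apply: (le_trans h1).
by rewrite mulrC ler_wpM2l ?dirichlet_ge0// lerDl.
Qed.

Lemma bump_Xp : Omega !=set0 -> exists u G, [/\ Xp u G, 0 < fB u & 0 < fC u].
Proof.
move=> [x0 Ox0]; have [rho r0 hr] := open_enorm_ball oO Ox0.
have hb := Cc_bump r0 hr; have hX := X_Cc adm bO hb.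
have hp : Xp (bump x0 rho) (grad (bump x0 rho)).
  by split => // [x|x xO]; [exact: bump_ge0|exact: Cc_outside hb xO].
exists (bump x0 rho), (grad (bump x0 rho)); split => //.
- rewrite lt0r singular_int_ge0 andbT; apply/eqP => z; case: (@bump_not_ae0 R n x0 rho r0).
  exact: rint_powR_eq0 a0 (L1_singular_int adm bO oO a01 hp) z.
- rewrite lt0r power_int_ge0 andbT; apply/eqP => z; case: (@bump_not_ae0 R n x0 rho r0).
  exact: rint_powR_eq0 q0 (X_L1q adm bO hX) z.
Qed.

Lemma mountain_geometry : exists rho Lam : R, [/\ 0 < rho, 0 < Lam & forall lam u G, 0 < lam < Lam ->
  Xp u G -> fA u G = rho -> rho / (2 * p) <= fibu lam u G 1].
Proof.
have [K K0 hK] := dirichlet_bounds adm bO.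
have [B B0 hB] := singular_int_absorb ltr01.
have qp : 0 < q / p - 1 by rewrite subr_gt0 ltr_pdivlMr// mul1r.
have K1 : 0 < K + 1 by rewrite ltr_wpDl.
(* With rho^(q/p) = rho b, the power term on the sphere [fA = rho] is at most rho / (4 p). *)
pose b := q / (4 * p * (K + 1)); have b0 : 0 < b by rewrite divr_gt0// !mulr_gt0.
pose rho := b `^ (q / p - 1)^-1; have r0 : 0 < rho by exact: powR_gt0.
have rE : rho `^ (q / p) = rho * b.
  rewrite (_ : q / p = 1 + (q / p - 1)); last by rewrite addrC subrK.
  rewrite powRD ?(gt_eqF r0) ?implybT// powRr1 ?(ltW r0)//; congr (_ * _).
  by rewrite /rho -powRrM mulVf ?gt_eqF// powRr1 ?(ltW b0).
(* On that sphere the singular integral is at most B + rho, so the threshold for lam makes the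
   singular term at most rho / (4 p) too; of rho / p there remains rho / (2 p). *)
pose B' := B + rho + 1; have B'0 : 0 < B' by rewrite /B' ltr_wpDl// addr_ge0// ltW.
exists rho, (a * rho / (4 * p * B')); split => //.
  by rewrite divr_gt0// !mulr_gt0.
move=> lam u G /andP[l0 lL] hu Au; have [hX _ _] := hu.
have [_ h2 _] := hK _ _ hX; have h3 := hB _ _ hu.
rewrite Au in h2 h3; rewrite mul1r in h3; rewrite rE in h2.
have t1 : lam / a * fB u <= rho / (4 * p).
  apply: (@le_trans _ _ ((rho / (4 * p * B')) * B')); last first.
    by rewrite le_eqVlt; apply/orP; left; apply/eqP; field; rewrite !gt_eqF.
  apply: ler_pM; rewrite ?singular_int_ge0 ?divr_ge0 ?(ltW l0) ?(ltW a0)//.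
    rewrite ler_pdivrMr//; move: (ltW lL); congr (_ <= _).
    by field; rewrite !gt_eqF.
  by apply: (le_trans h3); rewrite lerDl.
have t2 : fC u / q <= rho / (4 * p).
  rewrite ler_pdivrMr//; apply: (le_trans h2).
  apply: (@le_trans _ _ ((K + 1) * (rho * b))).
    by rewrite ler_wpM2r// ?lerDl// mulr_ge0// ltW.
  by rewrite le_eqVlt; apply/orP; left; apply/eqP; rewrite /b; field; rewrite !gt_eqF.
rewrite /fibu fib1 Au.
have e : rho / (2 * p) = rho / p - rho / (4 * p) - rho / (4 * p) by field; rewrite gt_eqF.
by rewrite e; move: t1 t2; move: (lam / a * _) (fC u / q) => x y; lra.
Qed.

Lemma fib1_cvg lam (w : nat -> 'rV[R]_n -> R) (H : nat -> 'rV[R]_n -> 'rV[R]_n) u G l t :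
  (forall k, Xp (w k) (H k)) -> Xp u G -> fC (fun x => w k x - u x) @[k --> \oo] --> (0 : R) ->
  fA (w k) (H k) @[k --> \oo] --> l ->
  fibu lam (w k) (H k) t @[k --> \oo] --> fib p q a lam l (fB u) (fC u) t.
Proof.
move=> hw hu cC cA; have [hX _ _] := hu.
have hwX k : X (w k) (H k) by case: (hw k).
have cB := singular_int_cvg adm bO oO a01 hw hu cC.
have cC' : fC (w k) @[k --> \oo] --> fC u.
  apply: (power_int_cvg adm _ _ _ _ cC).
  - by move=> k; case: (hwX k).
  - by move=> k; exact: (X_L1q adm bO (hwX k)).
  - by case: hX.
  - exact: (X_L1q adm bO hX).
have ct : (fun=> t : R) k @[k --> \oo] --> t by exact: cvg_cst.
exact: (fib_cvg p1 pq a01 cA cB cC' ct).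
Qed.

Lemma minimizing_seq (T : Type) (P : set T) (J : T -> R) L :
  P !=set0 -> (forall z, P z -> L <= J z) ->
  exists m (w : nat -> T), [/\ forall k, P (w k), forall z, P z -> m <= J z, L <= m,
    forall k, J (w k) <= m + 1 & J (w k) @[k --> \oo] --> m].
Proof.
move=> [w0 Pw0] hL; pose S := J @` P; pose m := inf S.
have hasi : has_inf S by split; [exists (J w0); exists w0|exists L => _ [w Pw <-]; exact: hL].
have lb z : P z -> m <= J z by move=> Pz; apply: ge_inf; [case: hasi|exists z].
have half0 k : 0 < (2^-1 ^+ k : R) by rewrite exprn_gt0// invr_gt0.
have half1 k : (2^-1 ^+ k : R) <= 1 by rewrite exprn_ile1 ?invr_ge0// invf_le1// ler1n.
have ex k : exists z : T, P z /\ J z < m + 2^-1 ^+ k.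
  by have [_ [w Pw <-] h] := inf_adherent (half0 k) hasi; exists w.
have [w hw] := choice ex; exists m, w; split.
- by move=> k; case: (hw k).
- exact: lb.
- by apply: lb_le_inf => [|_ [v Pv <-]]; [case: hasi|exact: hL].
- by move=> k; case: (hw k) => _ /ltW h; apply: (le_trans h); rewrite lerD2l.
- have cm : m + 2^-1 ^+ k @[k --> \oo] --> (m : R).
    by rewrite -[Y in _ --> Y]addr0; apply: cvgD; [exact: cvg_cst|exact: cvg_half].
  apply: (@squeeze_cvgr _ _ _ _ (fun=> m) (fun k => m + 2^-1 ^+ k)) => //; last exact: cvg_cst.
  by apply: nearW => k; have [Pw /ltW ->] := hw k; rewrite lb.
Qed.

Let sub_mono (A x x' y y' : R) : 0 <= A -> x <= x' -> y <= y' -> - x' - y' <= A - x - y.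
Proof. by lra. Qed.

Let half_absorb (x y z d m : R) : y <= z + d / 2 * x -> x * d - y <= m -> x * (d / 2) <= m + z.
Proof. by lra. Qed.

Lemma dirichlet_le_fib1 lam u G E : 0 < lam -> fA u G <= E ->
  fib p q a lam (fA u G) (fB u) (fC u) 1 <= fib p q a lam E (fB u) (fC u) 1.
Proof.
by move=> l0 AE; rewrite !fib1 !lerD2r ler_wpM2r// invr_ge0 ltW.
Qed.

Lemma first_solution lam rho : 0 < lam -> 0 < rho -> Omega !=set0 ->
  (forall u G, Xp u G -> fA u G = rho -> 0 < fibu lam u G 1) ->
  exists u G, critical lam u G /\ fibu lam u G 1 < 0.
Proof.
move=> l0 r0 O0 geo.
have [K K0 hK] := dirichlet_bounds adm bO; have [B B0 hB] := singular_int_absorb ltr01.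
pose P := [set w : ('rV[R]_n -> R) * ('rV[R]_n -> 'rV[R]_n) | Xp w.1 w.2 /\ fA w.1 w.2 <= rho].
pose J (w : ('rV[R]_n -> R) * ('rV[R]_n -> 'rV[R]_n)) := fibu lam w.1 w.2 1.
have [b [Hb [hb Bb Cb]]] := bump_Xp O0.
(* A small multiple of a bump shows that the infimum over the ball is negative. *)
have [t [t0 tA tn]] := @fib_neg_small _ p q a p1 pq a01 lam _ _ _ _ l0 (dirichlet_ge0 p D b Hb) Bb (ltW Cb) r0.
have [bX _ _] := hb.
have Pt : P (fun x => t * b x, fun x => t *: Hb x).
  by split; [exact: XpZ (ltW t0) hb|rewrite /= (dirichletZ adm bO _ bX) gtr0_norm].
have Jt : J (fun x => t * b x, fun x => t *: Hb x) < 0.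
  by rewrite /J /= (fibuZ _ _ _ hb) mulr1.
pose L := - (lam / a * (B + rho)) - (K * rho `^ (q / p)) / q.
have hL (w : ('rV[R]_n -> R) * ('rV[R]_n -> 'rV[R]_n)) : P w -> L <= J w.
  move=> [hw wr]; rewrite /J /fibu fib1 /L; have [wX _ _] := hw.
  have h1 := hB _ _ hw; have [_ h2 _] := hK _ _ wX.
  have A0 : 0 <= fA w.1 w.2 / p by rewrite divr_ge0 ?dirichlet_ge0// ltW.
  have h3 : lam / a * fB w.1 <= lam / a * (B + rho).
    by rewrite ler_wpM2l ?divr_ge0 ?(ltW l0) ?(ltW a0)// (le_trans h1)// lerD2l mul1r.
  have h4 : fC w.1 / q <= (K * rho `^ (q / p)) / q.
    rewrite ler_wpM2r ?invr_ge0 ?(ltW q0)// (le_trans h2)// ler_wpM2l//.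
    by rewrite ge0_ler_powR ?nnegrE ?divr_ge0 ?(ltW q0) ?(ltW p0) ?dirichlet_ge0 ?(ltW r0).
  exact: sub_mono A0 h3 h4.
have [m [w [hP mle _ _ cJ]]] := minimizing_seq (ex_intro P _ Pt) hL.
have hw k : Xp (w k).1 (w k).2 by case: (hP k).
have hr k : fA (w k).1 (w k).2 <= rho by case: (hP k).
have [s [U [G [l [sinc hU cC cA Al]]]]] := Xp_compact adm bO oO hw hr.
have lr : l <= rho.
  rewrite -subr_ge0; apply: (ler_cvg_seq (y := fun i => rho - fA (w (s i)).1 (w (s i)).2)).
    by move=> i; rewrite subr_ge0.
  by apply: cvgB => //; exact: cvg_cst.
have cJ1 := fib1_cvg (lam := lam) (t := 1) (fun i => hw (s i)) hU cC cA.
have cJ2 : J (w (s i)) @[i --> \oo] --> m by exact: cvg_subseq sinc cJ.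
have e : fib p q a lam l (fB U) (fC U) 1 = m by exact: (cvg_unique _ cJ1 cJ2).
have PU : P (U, G) by split => //; exact: le_trans lr.
have Um : fibu lam U G 1 = m.
  by apply/eqP; rewrite eq_le (mle _ PU) andbT -e; exact: dirichlet_le_fib1.
have m0 : m < 0 by exact: le_lt_trans (mle _ Pt) Jt.
exists U, G; rewrite Um; split => //; split => // phi H hphi [e0 e00 he].
(* The minimiser is interior because J is positive on the sphere; small perturbations then stay in
   the ball and compete, with t = 1. *)
have Ulr : fA U G < rho.
  rewrite lt_neqAle (le_trans Al lr) andbT; apply/eqP => /(geo _ _ hU).
  by rewrite Um ltNge (ltW m0).
have [ee [hee cee]] := small_steps e00 he.
have [cvA _ _] := shift_cvg hU hphi (fun k => (hee k).2) cee.
have [N _ hN] := (cvgr_lt _ cvA _ Ulr : \forall k \near \oo, _).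
have Ns : forall i, (i + N < i.+1 + N)%N by move=> i; rewrite addSn.
exists (fun k => ee (k + N)%N), (fun=> 1); split.
- by move=> k; exact: hee.
- exact: (cvg_subseq Ns cee).
- by move=> k; exact: ltr01.
- exact: cvg_cst.
- move=> k; rewrite Um; apply: (mle (_, _)); split; first exact: (hee _).2.
  by apply: ltW; apply: hN => /=; rewrite leq_addl.
Qed.

Lemma second_solution lam rho m0 : 0 < lam -> 0 < rho -> 0 < m0 -> Omega !=set0 ->
  (forall u G, Xp u G -> fA u G = rho -> m0 <= fibu lam u G 1) ->
  exists u G, critical lam u G /\ 0 < fibu lam u G 1.
Proof.
move=> l0 r0 m00 O0 geo.
have [K K0 hK] := dirichlet_bounds adm bO.
(* Each ray is represented by its highest point, so that on P the functional J equals max_t J(t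
   u). *)
pose P := [set w : ('rV[R]_n -> R) * ('rV[R]_n -> 'rV[R]_n) | [/\ Xp w.1 w.2, 0 < fC w.1 &
  forall t, 0 <= t -> fibu lam w.1 w.2 t <= fibu lam w.1 w.2 1]].
pose J (w : ('rV[R]_n -> R) * ('rV[R]_n -> 'rV[R]_n)) := fibu lam w.1 w.2 1.
have ray u G : Xp u G -> 0 < fC u -> exists2 t, 0 < t & m0 <= fibu lam u G t.
  move=> hu Cu; have [hX _ _] := hu; have [_ h2 _] := hK _ _ hX.
  have Au : 0 < fA u G.
    rewrite lt0r dirichlet_ge0 andbT; apply/eqP => z; move: (lt_le_trans Cu h2).
    by rewrite z powR0 ?mulr0 ?ltxx// gt_eqF// divr_gt0.
  pose t := (rho / fA u G) `^ p^-1; have t0 : 0 < t by rewrite powR_gt0// divr_gt0.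
  exists t => //; rewrite -[t]mulr1 -(fibuZ _ _ _ hu); apply: geo; first exact: XpZ (ltW t0) hu.
  rewrite (dirichletZ adm bO _ hX) gtr0_norm// /t -powRrM mulVf ?gt_eqF// powRr1 ?divr_ge0 ?(ltW r0) ?(ltW Au)//.
  by rewrite divfK// gt_eqF.
have top u G : Xp u G -> 0 < fC u -> exists T, [/\ 0 < T, P (fun x => T * u x, fun x => T *: G x) &
    0 < fibu lam u G T].
  move=> hu Cu; have [t t0 ft] := ray _ _ hu Cu.
  have [|T [T0 fT hT]] := @fib_max _ p q a p1 pq a01 lam (fA u G) (fB u) (fC u) (ltW l0) (dirichlet_ge0 _ _ _ _) (singular_int_ge0 _ _) Cu.
    by exists t => //; exact: lt_le_trans ft.
  exists T; split; [exact: T0| |exact: fT].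
  split; first exact: (XpZ (ltW T0) hu).
    by have [hX _ _] := hu; rewrite /= (power_intZ adm bO _ hX) mulr_gt0// powR_gt0// normr_gt0 gt_eqF.
  move=> s s0 /=; rewrite !(fibuZ _ _ _ hu) mulr1; apply: hT; exact: mulr_ge0 (ltW T0) s0.
have hL (w : ('rV[R]_n -> R) * ('rV[R]_n -> 'rV[R]_n)) : P w -> m0 <= J w.
  by move=> [hw Cw max]; have [t t0 ft] := ray _ _ hw Cw; apply: (le_trans ft); apply: max; exact: ltW.
have [b [Hb [hb Bb Cb]]] := bump_Xp O0; have [Tb [_ PT _]] := top _ _ hb Cb.
have [m [w [hP mle m0m Jm1 cJ]]] := minimizing_seq (ex_intro P _ PT) hL.
have m_gt0 : 0 < m by exact: lt_le_trans m0m.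
have hw k : Xp (w k).1 (w k).2 by case: (hP k).
(* Coercivity on P: by [fib_stationary] C <= A - lam B, hence J >= (1/p - 1/q) A - lam (1/a - 1/q)
   B, and the last term is absorbed by half of the first. *)
pose d := p^-1 - q^-1; have d0 : 0 < d by rewrite subr_gt0 ltf_pV2 ?posrE.
pose la := lam * (a^-1 - q^-1); have la0 : 0 < la.
  by rewrite mulr_gt0// subr_gt0 ltf_pV2 ?posrE// (lt_trans ap).
have [|B B0 hB] := @singular_int_absorb (d / 2 / la); first by rewrite !divr_gt0.
have hE k : fA (w k).1 (w k).2 <= (m + 1 + la * B) / (d / 2).
  have [_ Cw max] := hP k.
  have st := @fib_stationary _ p q a p1 pq a01 lam _ _ _ (ltW l0) (singular_int_ge0 _ _) (ltW Cw) max (dirichlet_ge0 _ _ _ _).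
  have := Jm1 k; rewrite /J /fibu fib1 => hJ; have hBk := hB _ _ (hw k).
  rewrite ler_pdivlMr ?divr_gt0//.
  have h1 : la * fB (w k).1 <= la * B + d / 2 * fA (w k).1 (w k).2.
    apply: (le_trans (ler_wpM2l (ltW la0) hBk)); rewrite mulrDr lerD2l mulrA.
    by rewrite [la * _]mulrC divfK// gt_eqF.
  have h2 : fA (w k).1 (w k).2 * d - la * fB (w k).1 <= m + 1.
    apply: le_trans hJ; have q' : 0 <= q^-1 by rewrite invr_ge0 ltW.
    have := ler_wpM2r q' st; rewrite /d /la mulrDl.
    move: (fA _ _) (fB _) (fC _) (p^-1) (q^-1) (a^-1) => A B' C x y z h.
    rewrite -subr_ge0; rewrite -subr_ge0 in h; apply: le_trans h _; rewrite le_eqVlt; apply/orP; left; apply/eqP; ring.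
  exact: half_absorb h1 h2.
have [s [U [G [l [sinc hU cC cA Al]]]]] := Xp_compact adm bO oO hw hE.
have [UX _ _] := hU.
have cJ1 t := fib1_cvg (lam := lam) (t := t) (fun i => hw (s i)) hU cC cA.
have cJ2 : J (w (s i)) @[i --> \oo] --> m by exact: cvg_subseq sinc cJ.
have e1 : fib p q a lam l (fB U) (fC U) 1 = m by exact: (cvg_unique _ (cJ1 1) cJ2).
have le t : 0 <= t -> fib p q a lam l (fB U) (fC U) t <= m.
  move=> t0; rewrite -subr_ge0.
  apply: (ler_cvg_seq (y := fun i => J (w (s i)) - fibu lam (w (s i)).1 (w (s i)).2 t)); last exact: cvgB.
  by move=> i; rewrite subr_ge0; have [_ _ h] := hP (s i); exact: h.
(* If U vanished, the limiting fibering map would be l / p t^p with l > 0, and its value at 2 would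
   exceed the supremum m attained at 1. *)
have CU : 0 < fC U.
  rewrite lt0r power_int_ge0 andbT; apply/eqP => CU.
  have U0 := rint_powR_eq0 q0 (X_L1q adm bO UX) CU.
  have BU : fB U = 0.
    have mB := L1_measurable (L1_singular_int adm bO oO a01 hU).
    have e0 : ae_eq mu setT (fun x => `|U x| `^ a) (fun=> 0).
      by apply: filterS U0 => x -> _; rewrite normr0 powR0 ?gt_eqF.
    by have := rint_ae mB (measurable_cst (0 : R)) e0; rewrite /Rintegral integral0.
  have := le 2 (ler0n _ 2); rewrite -e1 /fib BU CU normr1 !powR1 gtr0_norm// !mulr0 !mul0r !subr0 mulr1.
  have lp : 0 < l / p by move: m_gt0; rewrite -e1 fib1 BU CU mulr0 mul0r !subr0.
  rewrite -[leRHS]mulr1 ler_pM2l// leNgt => /negP; apply.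
  have : (1 : R) `^ p < 2 `^ p by rewrite gt0_ltr_powR ?nnegrE// ltr1n.
  by rewrite powR1.
(* U itself may fail to lie in P. It is moved to the top of its ray, where its value is at most m
   because its energy is at most l and the limiting map is bounded by m. *)
have [T [T0 PT' fT]] := top _ _ hU CU.
set v := (fun x => T * U x) in PT'; set Gv := (fun x => T *: G x) in PT'.
have vm : fibu lam v Gv 1 = m.
  apply/eqP; rewrite eq_le (mle _ PT') andbT /v /Gv (fibuZ _ _ _ hU) mulr1.
  apply: le_trans (le T (ltW T0)); rewrite /fibu /fib !lerD2r.
  by rewrite ler_wpM2r ?powR_ge0// ler_wpM2r// invr_ge0 ltW.
have [hv Cv vmax] := PT'; rewrite /= vm in vmax; rewrite /= in hv Cv.
exists v, Gv; rewrite vm; split => //; split => // phi H hphi [e0 e00 he].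
have [ee [hee cee]] := small_steps e00 he.
have [cvA cvB cvC] := shift_cvg hv hphi (fun k => (hee k).2) cee.
have [N _ hN] := (cvgr_gt _ cvC _ Cv : \forall k \near \oo, _).
pose f k := ee (k + N)%N.
have Ns : forall i, (i + N < i.+1 + N)%N by move=> i; rewrite addSn.
have hf k : 0 < f k <= 1 /\ Xp (shift v (f k) phi) (shiftg Gv (f k) H) by exact: hee.
have cf : f k @[k --> \oo] --> (0 : R) by exact: (cvg_subseq Ns cee).
have Cf k : 0 < fC (shift v (f k) phi) by apply: hN => /=; rewrite leq_addl.
have {cvA cvB cvC} [cvA cvB cvC] := shift_cvg hv hphi (fun k => (hf k).2) cf.
have [t ht] := choice (fun k => top _ _ (hf k).2 (Cf k)).
have t0 k : 0 < t k by case: (ht k).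
have ft k : m <= fibu lam (shift v (f k) phi) (shiftg Gv (f k) H) (t k).
  by have [_ h _] := ht k; have := mle _ h; rewrite /J /= (fibuZ _ _ _ (hf k).2) mulr1.
(* The tops t k are bounded by [fib_bound], which converges because the integrals of the perturbed
   functions do. *)
have [M hM] : exists M, forall k, `|t k| <= M.
  have cb : fib_bound p q (fA (shift v (f k) phi) (shiftg Gv (f k) H)) (fC (shift v (f k) phi)) @[k --> \oo]
     --> fib_bound p q (fA v Gv) (fC v).
    have qp : 0 < (q - p)^-1 by rewrite invr_gt0 subr_gt0.
    apply: (cvg_powR qp).
      by move=> k; rewrite divr_ge0 ?mulr_ge0 ?dirichlet_ge0 ?(ltW q0) ?(ltW p0) ?(ltW (Cf k)).
    apply: cvgM; first by apply: cvgM => //; exact: cvg_cst.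
    apply: cvgV; first by rewrite gt_eqF// mulr_gt0.
    by apply: cvgM => //; exact: cvg_cst.
  have /cvg_seq_bounded[M [_ hM]] := cvgP _ cb; exists (M + 1) => k.
  rewrite gtr0_norm//; have [_ _ tk] := ht k.
  apply: (le_trans (fib_le_bound p1 pq a01 (ltW l0) (dirichlet_ge0 _ _ _ _) (singular_int_ge0 _ _) (Cf k) (t0 k) tk)).
  by apply: (le_trans (ler_norm _)); apply: hM => //; rewrite ltrDl.
have [s' [tl [s'inc ct]]] := bounded_subseq hM.
have cE : fibu lam (shift v (f (s' k)) phi) (shiftg Gv (f (s' k)) H) (t (s' k)) @[k --> \oo] -->
  fibu lam v Gv tl.
  exact: (fib_cvg p1 pq a01 (cvg_subseq s'inc cvA) (cvg_subseq s'inc cvB) (cvg_subseq s'inc cvC) ct).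
have mtl : m <= fibu lam v Gv tl by apply: ler_cvg_seq cE => k; exact: ft.
have tl0 : 0 < tl.
  rewrite lt0r; apply/andP; split.
    by apply/eqP => z; move: mtl; rewrite z /fibu (fib0 p1 pq a01) leNgt m_gt0.
  by apply: ler_cvg_seq ct => k; exact: ltW.
(* At a limit of the tops the fibering map of v again reaches its maximum m, which it attains only
   at 1. *)
have tl1 : tl = 1.
  apply: (@fib_max_unique _ p q a p1 pq a01 lam (fA v Gv) (fB v) (fC v)) => //.
  - by rewrite -/(fibu lam v Gv 1) vm.
  - by rewrite -/(fibu lam v Gv 1) vm ltW.
  - by rewrite -/(fibu lam v Gv 1) -/(fibu lam v Gv tl) vm; apply/eqP; rewrite eq_le mtl vmax// ltW.
rewrite tl1 in ct.
exists (f \o s'), (t \o s'); split; rewrite /=.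
- by move=> k; exact: hf.
- exact: (cvg_subseq s'inc cf).
- by move=> k; exact: t0.
- exact: ct.
- by move=> k; apply: le_trans (ft (s' k)); apply: vmax; exact: ltW.
Qed.

Lemma two_critical : Omega !=set0 -> exists2 Lam : R, 0 < Lam & forall lam, 0 < lam < Lam ->
  exists u G v H, [/\ critical lam u G, critical lam v H & fibu lam u G 1 < 0 < fibu lam v H 1].
Proof.
move=> O0; have [rho [Lam [r0 L0 geo]]] := mountain_geometry.
exists Lam => // lam hl; have /andP[l0 _] := hl.
have m0 : 0 < rho / (2 * p) by rewrite divr_gt0// mulr_gt0.
have [|u [G [cu nu_]]] := first_solution l0 r0 O0.
  by move=> u G hu Au; apply: lt_le_trans m0 _; exact: geo.
have [|v [H [cv pv]]] := second_solution l0 r0 m0 O0; first by move=> v H; exact: geo.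
by exists u, G, v, H; split => //; rewrite nu_ pv.
Qed.

End critical_points.

(** * The Euler-Lagrange inequality *)

Section pointwise_bounds.
Context {R : realType}.
Implicit Types x y p q : R.

Lemma powR_mul_le x y q : 1 < q -> 0 <= x -> 0 <= y -> x `^ (q - 1) * y <= x `^ q + y `^ q.
Proof.
move=> q1 x0 y0; have q0 : 0 < q by exact: lt_trans q1.
have qn0 : q != 0 by rewrite gt_eqF.
have qm : 0 <= q - 1 by rewrite subr_ge0 ltW.
have [xy|yx] := leP x y.
  apply: (@le_trans _ _ (y `^ q)); last by rewrite lerDr powR_ge0.
  by rewrite -(powRB1 y0 qn0) ler_wpM2r// ge0_ler_powR.
apply: (@le_trans _ _ (x `^ q)); last by rewrite lerDl powR_ge0.
by rewrite -(powRB1 x0 qn0) ler_wpM2l ?powR_ge0// ltW.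
Qed.

Let absorb_arith (A B S N T c : R) : A <= 2^-1 * A + T * B - S -> N <= c * (B + A) -> 0 <= c ->
  N <= (c + 2 * c * T) * B - 2 * c * S.
Proof.
move=> h1 h2 c0; have h3 : A <= 2 * (T * B) - 2 * S by lra.
apply: (le_trans h2); rewrite mulrDr mulrDl -addrA lerD2l.
by apply: (le_trans (ler_wpM2l c0 h3)); rewrite le_eqVlt; apply/orP; left; apply/eqP; ring.
Qed.

(** To be used with a the gradient of v and b that of k eta. The pairing of a with b - a on the
    right is the quantity whose sign the supersolution property controls. *)
Lemma powR_enorm_test m p (a b : 'rV[R]_m) : 1 < p ->
  enorm (b - a) `^ p <= (2 `^ p + 2 * 2 `^ p * 2 `^ p) * enorm b `^ p
    - 2 * 2 `^ p * (enorm a `^ (p - 2) * dotp a (b - a)).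
Proof.
move=> p1; have p0 : 0 < p by exact: lt_trans p1.
have pn0 : p != 0 by rewrite gt_eqF.
have pm : 0 <= p - 1 by rewrite subr_ge0 ltW.
have A0 := enorm_ge0 a; have B0 := enorm_ge0 b.
have e1 : enorm a `^ (p - 2) * dotp a a = enorm a `^ p.
  rewrite -enorm_sqr -powR_mulrn// -powRD ?subrK// gt_eqF//.
have cross : enorm a `^ (p - 2) * dotp a b <= 2^-1 * enorm a `^ p + 2 `^ p * enorm b `^ p.
  apply: (le_trans (ler_norm _)); apply: (le_trans (norm_pairing_le p1 a b)).
  have [h|h] := leP (enorm b) (2^-1 * enorm a).
    apply: (@le_trans _ _ (2^-1 * enorm a `^ p)); last by rewrite lerDl mulr_ge0 ?powR_ge0.
    by rewrite -(powRB1 A0 pn0) mulrCA ler_wpM2l ?powR_ge0.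
  apply: (@le_trans _ _ (2 `^ p * enorm b `^ p)); last by rewrite lerDr mulr_ge0 ?powR_ge0// invr_ge0.
  have h' : enorm a <= 2 * enorm b by rewrite mulrC -ler_pdivrMr// mulrC ltW.
  have b20 : 0 <= 2 * enorm b by rewrite mulr_ge0.
  rewrite -powRM// -(powRB1 b20 pn0); apply: ler_pM; rewrite ?powR_ge0//.
    by rewrite ge0_ler_powR ?nnegrE.
  by rewrite ler_peMl// ler1n.
apply: (absorb_arith (A := enorm a `^ p) (T := 2 `^ p)); last exact: powR_ge0.
  rewrite (_ : dotp a (b - a) = dotp a b - dotp a a); last by rewrite dotpDr dotpNr.
  rewrite mulrBr e1; move: cross.
  by move: (enorm a `^ (p - 2) * dotp a b) (enorm a `^ p) (2 `^ p * _) => x y z; lra.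
by apply: (le_trans (enormB_powR_le p1 b a)).
Qed.

(* The product on the left only counts where the difference [a] of [v] and that
   of the truncation have the same sign, and there [a] lies between [0] and [b]. *)
Lemma powR_diff_test p (vx vy ex ey l : R) : 1 < p ->
  let a := vx - vy in let b := ex - ey in
  `|a| `^ (p - 2) * a * (Num.max (ex - vx - l) 0 - Num.max (ey - vy - l) 0) <=
  `|b| `^ p * ((l <= ex - vx)%R%:R + (l <= ey - vy)%R%:R).
Proof.
move=> p1 /=; have p0 : 0 < p by exact: lt_trans p1.
wlog h : vx vy ex ey / ey - vy <= ex - vx.
  move=> H; have [h|/ltW h] := leP (ey - vy) (ex - vx); first exact: H.
  have hs := H vy vx ey ex h; rewrite (distrC vy vx) (distrC ey ex) [(_ <= ey - vy)%R%:R + _]addrC in hs.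
  apply: le_trans hs; rewrite le_eqVlt; apply/orP; left; apply/eqP.
  by move: (`|_| `^ _) (Num.max _ _) (Num.max _ _) => x y z; ring.
set wx := ex - vx in h *; set wy := ey - vy in h *.
have i0 (c : bool) : 0 <= c%:R :> R by case: c.
have rhs0 : 0 <= `|ex - ey| `^ p * ((l <= wx)%R%:R + (l <= wy)%R%:R).
  by rewrite mulr_ge0 ?powR_ge0// addr_ge0.
have d0 : 0 <= Num.max (wx - l) 0 - Num.max (wy - l) 0.
  by rewrite subr_ge0 ge_max !le_max lerD2r h lexx orbT.
have [a0|a0] := leP (vx - vy) 0.
  apply: le_trans rhs0; rewrite mulr_le0_ge0// mulr_ge0_le0// powR_ge0.
have [lx|lx] := leP l wx; last first.
  rewrite [Num.max (wx - l) 0]max_r ?[Num.max (wy - l) 0]max_r ?subr0 ?mulr0//.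
  - by rewrite subr_le0 (le_trans h)// ltW.
  - by rewrite subr_le0 ltW.
apply: (@le_trans _ _ (`|ex - ey| `^ p)); last by rewrite ler_peMr ?powR_ge0// lerDl.
have db : Num.max (wx - l) 0 - Num.max (wy - l) 0 <= (ex - ey) - (vx - vy).
  have : wy - l <= Num.max (wy - l) 0 by rewrite le_max lexx.
  rewrite [Num.max (wx - l) 0]max_l ?subr_ge0//.
  by move: (Num.max _ _) => y; rewrite /wx /wy; lra.
have ab : vx - vy <= ex - ey by rewrite -subr_ge0 (le_trans d0).
have b0 : 0 < ex - ey by exact: lt_le_trans ab.
have hb : Num.max (wx - l) 0 - Num.max (wy - l) 0 <= ex - ey.
  by apply: (le_trans db); rewrite gerBl ltW.
rewrite (gtr0_norm a0) (gtr0_norm b0).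
have -> : (vx - vy) `^ (p - 2) * (vx - vy) = (vx - vy) `^ (p - 1).
  rewrite -[X in _ * X]powRr1 ?(ltW a0)// -powRD ?(gt_eqF a0) ?implybT//.
  by congr (_ `^ _); lra.
rewrite -(powRB1 (ltW b0) (lt0r_neq0 p0)); apply: ler_pM; rewrite ?powR_ge0//.
by apply: ge0_ler_powR => //; rewrite ?nnegrE ?(ltW a0) ?(ltW b0)// subr_ge0 ltW.
Qed.

End pointwise_bounds.

Section euler_lagrange.
Context {R : realType} (n : nat) (p q D : R) (adm : admissible n p q D).
Variables (Omega : set 'rV[R]_n) (bO : bounded_set Omega) (oO : open Omega).
Variables (a : R) (a01 : 0 < a < 1).
Local Notation mu := (lebesgue_rV R n).
Local Notation nu := (mu \x mu)%E.
Implicit Types (u v w : 'rV[R]_n -> R) (G H : 'rV[R]_n -> 'rV[R]_n) (e lam : R).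
Local Notation nlf := (nlfield p D).
Local Notation X := (X p q D Omega).
Local Notation Xp := (Xp p q D Omega).
Local Notation fA := (dirichlet p D).
Local Notation fB := (singular_int a).
Local Notation fC := (power_int q).
Local Notation critical := (critical p q D Omega a).

Let p1 : 1 < p. Proof. by case: adm => /andP[]. Qed.
Let pq : p < q. Proof. by case: adm. Qed.
Let p0 : 0 < p. Proof. exact: lt_trans p1. Qed.
Let q1 : 1 < q. Proof. exact: lt_trans pq. Qed.
Let q0 : 0 < q. Proof. exact: lt_trans q1. Qed.
Let a0 : 0 < a. Proof. by case/andP: a01. Qed.
Let a1 : a < 1. Proof. by case/andP: a01. Qed.

(** [dA] and [dC] are the derivatives of the Dirichlet energy and of the power integral in the
    direction phi, divided by p and by q. *)
Definition dA v G phi H := pairing mu p G H + pairing nu p (nlf v) (nlf phi).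
Definition dC v phi := \int[mu]_x (v x `^ (q - 1) * phi x).

Lemma L1_dC v G phi H : Xp v G -> X phi H -> L1 mu (fun x => v x `^ (q - 1) * phi x).
Proof.
move=> [hv v0 _] hphi; have [mv _ _] := hv; have [mphi _ _] := hphi.
apply: (L1_le _ (L1D (X_L1q adm bO hv) (X_L1q adm bO hphi))).
  apply: measurable_funM => //.
  by apply: (measurableT_comp (f := fun t : R => t `^ (q - 1))) => //; exact: measurable_powR.
move=> x; rewrite normrM ger0_norm ?powR_ge0// (ger0_norm (v0 x)).
exact: powR_mul_le.
Qed.

Let step_arith (A A' B B' C C' lp la lq e t1 t2 t3 dC P : R) :
  A / lp * t1 - la * B * t2 - C / lq * t3 <= A' / lp * t1 - la * B' * t2 - C' / lq * t3 ->
  A' - A <= lp * (e * P) -> C + lq * (e * dC) <= C' -> 0 < e -> 0 < lp -> 0 < lq -> 0 <= t1 -> 0 <= t3 ->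
  la * t2 * ((B' - B) / e) + t3 * dC <= t1 * P.
Proof.
move=> h hA hC e0 lp0 lq0 t10 t30; rewrite -(ler_pM2r e0) mulrDl.
have -> : la * t2 * ((B' - B) / e) * e = la * t2 * (B' - B) by rewrite mulrA divfK// gt_eqF.
have h1 : (A' - A) / lp * t1 <= e * P * t1.
  by rewrite ler_wpM2r// ler_pdivrMr// mulrC.
have h2 : e * dC * t3 <= (C' - C) / lq * t3.
  by rewrite ler_wpM2r// ler_pdivlMr// mulrC lerBrDl.
move: h h1 h2; rewrite ![(_ - _) / _]mulrBl.
move: (A / lp) (A' / lp) (C / lq) (C' / lq) => x x' z z'.
by rewrite !mulrBl => h h1 h2; nra.
Qed.

Lemma nlf_shift v e phi : nlf (shift v e phi) = (fun z => nlf v z + e *: nlf phi z).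
Proof. by apply/funext => z; rewrite /shift nlfieldD nlfieldZ. Qed.

Lemma dirichlet_shift_le v G phi H e : X v G -> X phi H ->
  fA (shift v e phi) (shiftg G e H) - fA v G <= p * (e * dA (shift v e phi) (shiftg G e H) phi H).
Proof.
move=> hv hphi; have hs : X (shift v e phi) (shiftg G e H) by exact: (XD adm hv (XZ adm e hphi)).
(* The tangent inequality is taken at the perturbed point, looking back to v: this bounds the
   increment of energy from above. *)
have h1 := @energy_gradient _ _ _ _ mu p p1 (- e) _ _ (X_inLp adm bO hs) (X_inLp adm bO hphi).
have h2 := @energy_gradient _ _ _ _ nu p p1 (- e) _ _ (X_nl_inLp adm bO hs) (X_nl_inLp adm bO hphi).
have e1 : (fun x => shiftg G e H x + - e *: H x) = G.
  by apply/funext => x; rewrite /shiftg scaleNr addrK.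
have e2 : (fun z => nlf (shift v e phi) z + - e *: nlf phi z) = nlf v.
  by rewrite nlf_shift; apply/funext => z; rewrite scaleNr addrK.
rewrite e1 in h1; rewrite e2 in h2.
rewrite /dirichlet /dA; move: h1 h2.
move: (energy _ _ _) (energy _ _ _) (energy _ _ _) (energy _ _ _) (pairing _ _ _ _) (pairing _ _ _ _) => x1 x2 x3 x4 x5 x6.
by rewrite !mulrN !mulNr mulrDr mulrDr !mulrA => h1 h2; lra.
Qed.

Lemma power_int_shift_ge v G phi H e : Xp v G -> X phi H -> Xp (shift v e phi) (shiftg G e H) ->
  fC v + q * (e * dC v phi) <= fC (shift v e phi).
Proof.
move=> hv hphi hs; have [vX v0 _] := hv; have [sX s0 _] := hs.
have i1 := X_L1q adm bO vX; have i2 := L1_dC hv hphi; have i3 := X_L1q adm bO sX.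
rewrite /power_int mulrA -(rintZ _ i2) -(rintD i1 (L1Z _ i2)).
apply: rint_le => //; first by apply: L1D => //; exact: L1Z.
move=> x; rewrite !ger0_norm//; apply: le_trans (powR_convex_tangent q1 (v0 x) (s0 x)).
by rewrite lerD2l /shift [v x + _]addrC addrK le_eqVlt; apply/orP; left; apply/eqP; ring.
Qed.

Lemma dA_cvg v G phi H (e : nat -> R) : X v G -> X phi H -> (forall k, 0 < e k <= 1) ->
  e k @[k --> \oo] --> (0 : R) ->
  dA (shift v (e k) phi) (shiftg G (e k) H) phi H @[k --> \oo] --> dA v G phi H.
Proof.
move=> hv hphi e1 e0; have ne k : `|e k| <= 1 by have /andP[h1 h2] := e1 k; rewrite gtr0_norm.
apply: cvgD; first exact: (pairing_cvg p1 (X_inLp adm bO hv) (X_inLp adm bO hphi) e0 ne).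
have E : (fun k => pairing nu p (nlf (shift v (e k) phi)) (nlf phi)) =
    (fun k => pairing nu p (fun z => nlf v z + e k *: nlf phi z) (nlf phi)).
  by apply/funext => k; rewrite nlf_shift.
rewrite E; exact: (pairing_cvg p1 (X_nl_inLp adm bO hv) (X_nl_inLp adm bO hphi) e0 ne).
Qed.

(** The minimality inequality divided by e. Energy and power terms are linearised by convexity; the
    singular term keeps its difference quotient, which may be unbounded where v vanishes. *)
Lemma critical_ineq lam v G phi H : 0 <= lam -> critical lam v G -> X phi H ->
  (exists2 e0, 0 < e0 & forall e, 0 < e < e0 -> Xp (shift v e phi) (shiftg G e H)) ->
  exists e t P : nat -> R, [/\ forall k, 0 < e k <= 1 /\ Xp (shift v (e k) phi) (shiftg G (e k) H),
    e k @[k --> \oo] --> (0 : R), (forall k, 0 < t k) /\ t k @[k --> \oo] --> (1 : R),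
    P k @[k --> \oo] --> dA v G phi H &
    forall k, lam / a * t k `^ a * ((fB (shift v (e k) phi) - fB v) / e k) +
      t k `^ q * dC v phi <= t k `^ p * P k].
Proof.
move=> l0 [hv hcrit] hphi /(hcrit _ _ hphi)[e [t [he ce t0 ct hJ]]].
have [vX _ _] := hv.
exists e, t, (fun k => dA (shift v (e k) phi) (shiftg G (e k) H) phi H); split => //.
  by apply: dA_cvg => // k; case: (he k).
move=> k; have [/andP[e0 _] hs] := he k.
have := hJ k; rewrite /fibu /fib (gtr0_norm (t0 k)) => h.
apply: (step_arith h (dirichlet_shift_le _ vX hphi) (power_int_shift_ge hv hphi hs)) => //; exact: powR_ge0.
Qed.

Lemma shift_Xp v G phi H : Xp v G -> Xp phi H ->
  forall e, 0 < e -> Xp (shift v e phi) (shiftg G e H).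
Proof.
move=> [hv v0 vout] [hphi phi0 phiout] e e0; split.
- exact: (XD adm hv (XZ adm e hphi)).
- by move=> x; rewrite addr_ge0// mulr_ge0// ltW.
- by move=> x xO; rewrite /shift vout// phiout// mulr0 addr0.
Qed.

Lemma dC_ge0 v G phi H : Xp v G -> Xp phi H -> 0 <= dC v phi.
Proof.
by move=> _ [_ phi0 _]; apply: rint_ge0 => x; rewrite mulr_ge0// powR_ge0.
Qed.

(** In a nonnegative direction the singular and power contributions are nonnegative, and they are
    dropped before the limit. *)
Lemma supersolution lam v G phi H : 0 <= lam -> critical lam v G -> Xp phi H -> 0 <= dA v G phi H.
Proof.
move=> l0 hc hphi; have [hv _] := hc; have [phiX phi0 _] := hphi.
have [|e [t [P [he ce [t0 ct] cP h]]]] := critical_ineq l0 hc phiX.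
  by exists 1; [exact: ltr01|move=> e /andP[e0 _]; exact: (shift_Xp hv hphi e0)].
apply: (ler_cvg_seq _ cP) => k; have [/andP[e0 _] hs] := he k.
rewrite -(pmulr_rge0 _ (powR_gt0 p (t0 k))); apply: le_trans (h k).
rewrite addr_ge0//; last by rewrite mulr_ge0 ?powR_ge0// (dC_ge0 hv hphi).
have la0 : 0 <= lam / a by rewrite divr_ge0// ltW.
apply: mulr_ge0; first by rewrite mulr_ge0 ?powR_ge0.
apply: divr_ge0; last exact: ltW.
rewrite subr_ge0; apply: rint_le; [exact: (L1_singular_int adm bO oO a01 hv)|exact: (L1_singular_int adm bO oO a01 hs)|].
have [_ v0 _] := hv; have [_ s0 _] := hs => x.
by rewrite ge0_ler_powR ?nnegrE ?(ltW a0)// !ger0_norm// lerDl mulr_ge0// ltW.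
Qed.

(* On [v = 0] the singular term gains [(e phi)^a], which is not [O(e)]. *)
Lemma critical_pos lam v G phi H : 0 < lam -> critical lam v G -> Xp phi H ->
  {ae mu, forall x, v x = 0 -> phi x = 0}.
Proof.
move=> l0 hc hphi; have [hv _] := hc; have [phiX phi0 _] := hphi.
have [vX v0 _] := hv; have [mv _ _] := vX; have [mphi _ _] := phiX.
(* The part of phi carried by the zero set of v. *)
pose Z x := \1_(v @^-1` [set 0]) x * phi x.
have mZ : measurable_fun setT Z.
  apply: measurable_funM => //; apply: measurable_indic.
  by rewrite -[Y in measurable Y]setTI; exact: mv.
have Zphi x : `|Z x| <= `|phi x|.
  by rewrite /Z indicE; case: (_ \in _); rewrite ?mul1r// mul0r normr0.
have iZ : L1 mu (fun x => `|Z x| `^ a).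
  apply: (L1_le _ (L1_singular_int adm bO oO a01 hphi)).
    apply: (measurableT_comp (f := fun t : R => t `^ a)); first exact: measurable_powR.
    exact: measurableT_comp.
  move=> x; rewrite ger0_norm ?powR_ge0// ge0_ler_powR ?nnegrE ?(ltW a0)//.
have [|e [t [P [he ce [t0 ct] cP h]]]] := critical_ineq (ltW l0) hc phiX.
  by exists 1; [exact: ltr01|move=> e /andP[e0 _]; exact: (shift_Xp hv hphi e0)].
set I := \int[mu]_x (`|Z x| `^ a).
(* The singular increment is at least e^a I, while the other terms are O(e); dividing by e and
   multiplying by e^(1-a) bounds I by a quantity that tends to 0. *)
have le k : lam / a * t k `^ a * I <= t k `^ p * P k * e k `^ (1 - a).
  have [/andP[e0 _] hs] := he k; have [_ s0 _] := hs.
  have hB : e k `^ a * I <= fB (shift v (e k) phi) - fB v.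
    rewrite lerBrDl -(rintZ _ iZ) -(rintD (L1_singular_int adm bO oO a01 hv) (L1Z _ iZ)).
    apply: rint_le; [|exact: (L1_singular_int adm bO oO a01 hs)|].
      by apply: L1D; [exact: (L1_singular_int adm bO oO a01 hv)|exact: L1Z].
    move=> x; rewrite -powRM ?(ltW e0)// !ger0_norm//; last first.
      by rewrite /Z mulr_ge0// indicE.
    rewrite /Z indicE; have [/set_mem/= vx|_] := boolP (x \in _).
      by rewrite /shift vx powR0 ?gt_eqF// add0r mul1r add0r.
    rewrite mul0r mulr0 [Y in _ + Y]powR0 ?gt_eqF// addr0 ge0_ler_powR ?nnegrE ?(ltW a0)//.
    by rewrite lerDl mulr_ge0// ltW.
  have h1 : lam / a * t k `^ a * (e k `^ a * I / e k) <= t k `^ p * P k.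
    apply: le_trans (h k); apply: le_trans (_ : _ <= lam / a * t k `^ a * ((fB (shift v (e k) phi) - fB v) / e k)) _.
      have la0 : 0 <= lam / a by rewrite divr_ge0 ?(ltW a0)// ltW.
      apply: ler_wpM2l; first by rewrite mulr_ge0 ?powR_ge0.
      by rewrite ler_wpM2r// invr_ge0 ltW.
    by rewrite lerDl mulr_ge0 ?powR_ge0// (dC_ge0 hv hphi).
  have := ler_wpM2r (powR_ge0 (e k) (1 - a)) h1; apply: le_trans.
  rewrite le_eqVlt; apply/orP; left; apply/eqP.
  have ee : e k `^ a * e k `^ (1 - a) = e k.
    by rewrite -powRD ?(gt_eqF e0) ?implybT// addrC subrK powRr1// ltW.
  have -> : lam / a * t k `^ a * (e k `^ a * I / e k) * e k `^ (1 - a) =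
      lam / a * t k `^ a * I * ((e k `^ a * e k `^ (1 - a)) / e k).
    by move: (lam / a * _) (e k `^ a) (e k `^ (1 - a)) ((e k)^-1) => x1 x2 x3 x4; ring.
  by rewrite ee divff ?mulr1// gt_eqF.
have t1 r : 0 < r -> t k `^ r @[k --> \oo] --> (1 : R).
  by move=> r0; have := cvg_powR r0 (fun k => ltW (t0 k)) ct; rewrite powR1.
have cv : t k `^ p * P k * e k `^ (1 - a) - lam / a * t k `^ a * I @[k --> \oo] -->
    1 * dA v G phi H * 0 - lam / a * 1 * I.
  apply: cvgB; last by apply: cvgM; [apply: cvgM; [exact: cvg_cst|exact: t1]|exact: cvg_cst].
  apply: cvgM; first by apply: cvgM => //; exact: t1.
  have a1' : 0 < 1 - a by rewrite subr_gt0.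
  have e0' k : 0 <= e k by case: (he k) => /andP[/ltW].
  by have := cvg_powR a1' e0' ce; rewrite powR0 ?gt_eqF.
have I0 : I = 0.
  apply/eqP; rewrite eq_le; apply/andP; split; last by apply: rint_ge0 => x; exact: powR_ge0.
  have : 0 <= 1 * dA v G phi H * 0 - lam / a * 1 * I.
    by apply: (ler_cvg_seq _ cv) => k; rewrite subr_ge0.
  by rewrite mulr0 sub0r mulr1 oppr_ge0 pmulr_rle0// divr_gt0.
have := rint_powR_eq0 a0 iZ I0; apply: filterS => x + vx.
by rewrite /Z indicE mem_set// mul1r.
Qed.

End euler_lagrange.

(** * Local lower bounds by De Giorgi iteration *)

Section fast_decay.
Context {R : realType}.
Implicit Types C b al : R.

(** Induction on Y j <= dl r^j: the power r^al = 1/b cancels the growth b^j, and dl is small enough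
    that C dl^al <= r supplies the next factor r. *)
Lemma fast_decay C b al : 0 <= C -> 1 < b -> 0 < al -> exists2 dl : R, 0 < dl &
  forall Y : nat -> R, (forall j, 0 <= Y j) ->
    (forall j, Y j.+1 <= C * b ^+ j * Y j `^ (1 + al)) -> Y 0%N <= dl -> Y j @[j --> \oo] --> (0 : R).
Proof.
move=> C0 b1 al0; have b0 : 0 < b by exact: lt_trans b1.
pose r := b^-1 `^ al^-1.
have /andP[r0 r1] : 0 < r < 1 by apply: powR_itv01; rewrite ?invr_gt0 ?invf_lt1 ?b0.
have C1 : 0 < C + 1 by rewrite ltr_wpDl.
pose dl := (r / (C + 1)) `^ al^-1; have d0 : 0 < dl by rewrite powR_gt0// divr_gt0.
have dal : C * dl `^ al <= r.
  rewrite /dl -powRrM mulVf ?gt_eqF// powRr1 ?divr_ge0 ?(ltW r0) ?(ltW C1)//.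
  by rewrite mulrCA ler_piMr ?(ltW r0)// ler_pdivrMr// mul1r lerDl.
have ral : r `^ al = b^-1 by rewrite /r -powRrM mulVf ?gt_eqF// powRr1// invr_ge0 ltW.
exists dl => // Y Y0 hY Yd.
have bound j : Y j <= dl * r ^+ j.
  elim: j => [|j IH]; first by rewrite expr0 mulr1.
  have rj0 : 0 < r ^+ j by exact: exprn_gt0.
  apply: (le_trans (hY j)).
  apply: (@le_trans _ _ (C * b ^+ j * (dl * r ^+ j) `^ (1 + al))).
    rewrite ler_wpM2l ?mulr_ge0 ?exprn_ge0 ?(ltW b0)//.
    by rewrite ge0_ler_powR ?nnegrE ?addr_ge0 ?(ltW al0) ?mulr_ge0 ?(ltW d0) ?(ltW rj0).
  rewrite powRM ?(ltW d0) ?(ltW rj0)//.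
  rewrite !powRD ?(gt_eqF d0) ?(gt_eqF rj0) ?implybT// !powRr1 ?(ltW d0) ?(ltW rj0)//.
  have -> : (r ^+ j) `^ al = b^-1 ^+ j by rewrite exprn_powR ?(ltW r0)// ral.
  have -> : C * b ^+ j * (dl * dl `^ al * (r ^+ j * b^-1 ^+ j)) =
      (C * dl `^ al) * (dl * r ^+ j) * (b ^+ j * b^-1 ^+ j).
    by move: (dl `^ al) (b ^+ j) (b^-1 ^+ j) (r ^+ j) => x y z w; ring.
  rewrite -exprMn mulfV ?gt_eqF// expr1n mulr1 exprS [leRHS]mulrCA.
  by apply: ler_wpM2r => //; rewrite mulr_ge0 ?(ltW d0) ?(ltW rj0).
apply: (@squeeze_cvgr _ _ _ _ (fun=> 0) (fun j => dl * r ^+ j)).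
- by apply: nearW => j; rewrite Y0 bound.
- exact: cvg_cst.
- rewrite -(mulr0 dl); apply: cvgM; first exact: cvg_cst.
  by apply: cvg_expr; rewrite gtr0_norm.
Qed.

End fast_decay.

Section nonlocal_indicator.
Context {R : realType} (n : nat) (p D : R).
Hypotheses (p1 : 1 < p) (Dn : n%:R < D) (Dnp : D < n%:R + p).
Local Notation mu := (lebesgue_rV R n).
Local Notation nu := (mu \x mu)%E.
Local Notation e_ i := (delta_mx ord0 i : 'rV[R]_n).
Implicit Types (f : 'rV[R]_n -> R) (Omega : set 'rV[R]_n).

Let p0 : 0 < p. Proof. exact: lt_trans p1. Qed.

Lemma Cc_lipschitz Omega f : Cc_infty Omega f -> exists2 M, 0 <= M &
  forall rho x z, 0 <= rho -> cube rho z -> `|f (x + z) - f x| <= M * rho.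
Proof.
move=> hf; have [M hM] := choice (fun i => let: ex_intro2 M M0 h := Cc_bounded (Cc_pderiv i hf) in
  ex_intro (fun M => 0 <= M /\ forall x, `|pderiv i f x| <= M) M (conj M0 h)).
exists (\sum_i M i); first by apply: sumr_ge0 => i _; case: (hM i).
move=> rho x z rho0 /cubeP hz; have [w [w0 wn wS]] := axis_path z.
have -> : f (x + z) - f x = \sum_(k < n) (f (x + w k.+1) - f (x + w k)).
  by rewrite -(big_mkord xpredT (fun k => f (x + w k.+1) - f (x + w k))) telescope_sumr// wn w0 addr0.
apply: (le_trans (ler_norm_sum _ _ _)); rewrite mulr_suml; apply: ler_sum => k _.
rewrite wS addrA; apply: (le_trans (Cc_increment_le _ _ hf (hM k).2)).
by rewrite mulrC ler_wpM2l//; case: (hM k).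
Qed.

Lemma Cc_weight_bounded Omega f : Cc_infty Omega f -> exists2 C, 0 <= C & forall x,
  (\int[mu]_y (enorm (nlfield p D f (x, y)) `^ p)%:E <= C%:E)%E.
Proof.
move=> hf; have [M M0 hM] := Cc_lipschitz hf; have [B B0 hB] := Cc_bounded hf.
have W0 := weightC_ge0 Dn Dnp.
exists ((M `^ p + (B + B) `^ p) * weightC n p D) => [|x].
  by rewrite mulr_ge0// addr_ge0 ?powR_ge0.
have mF := measurable_enorm_powR p (@vmeas_nlfield R n p D f (Cc_meas hf)).
have mf : measurable_fun setT (fun z => `|f (x + z) - f x| `^ p).
  apply: (measurableT_comp (f := fun t : R => t `^ p)); first exact: measurable_powR.
  apply: measurableT_comp => //; apply: measurable_funB => //.
  rewrite (_ : (fun z => f (x + z)) = (fun z => f (z + x))); last by apply/funext => z; rewrite addrC.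
  by apply: measurable_translate; exact: (Cc_meas hf).
apply: (@le_trans _ _ (\int[mu]_z ((enorm z `^ D)^-1 * `|f (x + z)%R - f x| `^ p)%:E)%E).
  rewrite le_eqVlt; apply/orP; left; apply/eqP.
  rewrite -(@integral_translate R n x (fun y => (enorm (nlfield p D f (x, y)) `^ p)%:E)) /=; last 2 first.
  - apply/measurable_EFinP.
    exact: (measurableT_comp (f := fun z => enorm (nlfield p D f z) `^ p) mF (pair1_measurable x)).
  - by move=> y; rewrite lee_fin powR_ge0.
  apply: eq_integral => z _; rewrite nlfield_powR//= enormBC addrK distrC.
  by rewrite (addrC z x).
apply: weight_integral => //.
- move=> rho z rho0 hz; rewrite -powRM// ge0_ler_powR ?nnegrE ?(ltW p0) ?mulr_ge0//.
  exact: hM.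
- move=> z; rewrite ge0_ler_powR ?nnegrE ?(ltW p0) ?addr_ge0//.
  by apply: (le_trans (ler_normB _ _)); rewrite lerD.
- exact: powR_ge0.
Qed.

Lemma nlfield_sym f x y : enorm (nlfield p D f (x, y)) = enorm (nlfield p D f (y, x)).
Proof.
have E (w1 w2 s t : R) : w1 = w2 -> `|(s - t) / w1| = `|(t - s) / w2|.
  by move=> ->; rewrite !normrM distrC.
apply: (etrans (enorm_const1 _)); apply: (etrans _ (esym (enorm_const1 _))).
by apply: E; exact: (congr1 (fun t => t `^ (D / p)) (enormBC x y)).
Qed.

(** The integral of the nonlocal density of f in y is bounded uniformly in x, so over the strips A x
    R^n and R^n x A it contributes at most a multiple of the measure of A. *)
Lemma nlfield_indicator Omega f : Cc_infty Omega f -> exists2 C, 0 <= C & forall A, measurable A ->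
  L1 mu (\1_A : 'rV[R]_n -> R) ->
  L1 nu (fun z => enorm (nlfield p D f z) `^ p * (\1_A z.1 + \1_A z.2)) /\
  \int[nu]_z (enorm (nlfield p D f z) `^ p * (\1_A z.1 + \1_A z.2)) <= C * \int[mu]_x \1_A x.
Proof.
move=> hf; have [C C0 hC] := Cc_weight_bounded hf; exists (2 * C); first by rewrite mulr_ge0.
move=> A mA iA; pose g z := enorm (nlfield p D f z) `^ p.
have mg : measurable_fun setT g := measurable_enorm_powR p (@vmeas_nlfield R n p D f (Cc_meas hf)).
have g0 z : 0 <= g z by exact: powR_ge0.
have A0 (x : 'rV[R]_n) : 0 <= (\1_A x : R) by rewrite indicE.
have gC x y : g (x, y) = g (y, x).
  exact: (congr1 (fun t => t `^ p) (nlfield_sym f x y)).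
have mI : measurable_fun setT (\1_A : 'rV[R]_n -> R) by exact: measurable_indic.
have m1 : measurable_fun setT (fun z : 'rV[R]_n * 'rV[R]_n => \1_A z.1 : R).
  exact: (measurableT_comp mI measurable_fst).
have m2 : measurable_fun setT (fun z : 'rV[R]_n * 'rV[R]_n => \1_A z.2 : R).
  exact: (measurableT_comp mI measurable_snd).
have fin x : (\int[mu]_y (g (x, y) * \1_A x)%:E <= (C * \1_A x)%:E)%E.
  under eq_integral do rewrite mulrC EFinM.
  rewrite ge0_integralZl_EFin//.
  - by rewrite mulrC EFinM lee_wpmul2l// ?lee_fin//; exact: hC.
  - by move=> y _; rewrite lee_fin.
  - apply/measurable_EFinP; exact: (measurableT_comp mg (pair1_measurable x)).
have tot : (\int[mu]_x (C * \1_A x)%:E = (C * \int[mu]_x \1_A x)%:E)%E.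
  by rewrite (L1_integralE (L1Z C iA)) rintZ.
have b1 : (\int[nu]_z (g z * \1_A z.1)%:E <= (C * \int[mu]_x \1_A x)%:E)%E.
  rewrite fubini_tonelli1; last 2 first.
  - by apply/measurable_EFinP; exact: measurable_funM.
  - by move=> z; rewrite lee_fin mulr_ge0.
  rewrite /fubini_F -tot; apply: ge0_le_integral => //.
  - by move=> x _; apply: integral_ge0 => y _; rewrite lee_fin mulr_ge0.
  - have := @measurable_fun_fubini_tonelli_F _ _ _ _ R mu (fun z => (g z * \1_A z.1)%:E).
    apply; last by move=> z; rewrite lee_fin mulr_ge0.
    by apply/measurable_EFinP; exact: measurable_funM.
  - by apply/measurable_EFinP; apply: measurable_funM => //; exact: measurable_indic.
have b2 : (\int[nu]_z (g z * \1_A z.2)%:E <= (C * \int[mu]_x \1_A x)%:E)%E.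
  rewrite fubini_tonelli2; last 2 first.
  - by apply/measurable_EFinP; exact: measurable_funM.
  - by move=> z; rewrite lee_fin mulr_ge0.
  rewrite /fubini_G -tot; apply: ge0_le_integral => //.
  - by move=> x _; apply: integral_ge0 => y _; rewrite lee_fin mulr_ge0.
  - have := @measurable_fun_fubini_tonelli_G _ _ _ _ R mu (fun z => (g z * \1_A z.2)%:E).
    apply; last by move=> z; rewrite lee_fin mulr_ge0.
    by apply/measurable_EFinP; exact: measurable_funM.
  - by apply/measurable_EFinP; apply: measurable_funM => //; exact: measurable_indic.
  - by move=> y _ /=; under eq_integral do rewrite gC; exact: fin.
have [i1 e1] := L1_lty_rint (measurable_funM mg m1) (fun z => mulr_ge0 (g0 z) (A0 z.1)) b1.
have [i2 e2] := L1_lty_rint (measurable_funM mg m2) (fun z => mulr_ge0 (g0 z) (A0 z.2)) b2.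
have E : (fun z => g z * (\1_A z.1 + \1_A z.2)) = (fun z => g z * \1_A z.1 + g z * \1_A z.2).
  by apply/funext => z; rewrite mulrDr.
rewrite -/g E; split; first exact: L1D.
by rewrite (rintD i1 i2) -mulrA mulr_natl mulr2n; exact: lerD.
Qed.

End nonlocal_indicator.

Section degiorgi.
Context {R : realType} (n : nat) (p q D : R) (adm : admissible n p q D).
Variables (Omega : set 'rV[R]_n) (bO : bounded_set Omega) (oO : open Omega).
Variables (a : R) (a01 : 0 < a < 1).
Local Notation mu := (lebesgue_rV R n).
Local Notation nu := (mu \x mu)%E.
Implicit Types (u v w : 'rV[R]_n -> R) (G H : 'rV[R]_n -> 'rV[R]_n) (e lam : R).
Local Notation nlf := (nlfield p D).
Local Notation X := (X p q D Omega).
Local Notation Xp := (Xp p q D Omega).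
Local Notation critical := (critical p q D Omega a).

Let p1 : 1 < p. Proof. by case: adm => /andP[]. Qed.
Let pq : p < q. Proof. by case: adm. Qed.
Let p0 : 0 < p. Proof. exact: lt_trans p1. Qed.
Let q1 : 1 < q. Proof. exact: lt_trans pq. Qed.
Let q0 : 0 < q. Proof. exact: lt_trans q1. Qed.

Lemma trh_bounds (l t : R) : 0 <= trh l t <= (l <= t)%R%:R.
Proof.
rewrite /trh; case: (ltgtP t l) => _; rewrite ?lexx ?ler01//.
by rewrite invr_ge0 ler0n invf_le1// ler1n.
Qed.

Lemma grad_bounded eta : Cc_infty Omega eta -> exists2 L, 0 <= L & forall x, enorm (grad eta x) <= L.
Proof.
move=> hf; have [M hM] := choice (fun i => let: ex_intro2 M M0 h := Cc_bounded (Cc_pderiv i hf) in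
  ex_intro (fun M => 0 <= M /\ forall x, `|pderiv i eta x| <= M) M (conj M0 h)).
exists (\sum_i M i); first by apply: sumr_ge0 => i _; case: (hM i).
move=> x; apply: (le_trans (enorm_le_sum _)); apply: ler_sum => i _.
by rewrite gradE; exact: (hM i).2.
Qed.

(** Carries the weight w = |x - y|^(-D/p) of [nlfield] through the scalar inequality
    [powR_diff_test] by homogeneity of degree p. *)
Lemma scaled_test (s b' c h w : R) : 0 <= w -> `|s| `^ (p - 2) * s * h <= `|b'| `^ p * c ->
  `|s * w| `^ (p - 2) * ((s * w) * (h * w)) <= `|b' * w| `^ p * c.
Proof.
move=> w0 hs; have [->|wn0] := eqVneq w 0.
  by rewrite !mulr0 normr0 [0 `^ p]powR0 ?gt_eqF// mul0r.
have wp : 0 < w by rewrite lt0r wn0.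
rewrite !normrM (ger0_norm w0) !powRM//.
have -> : w `^ p = w `^ (p - 2) * w * w.
  rewrite -mulrA -[w * w]expr2 -powR_mulrn// -powRD ?subrK// wn0 implybT//.
have ww : 0 <= w `^ (p - 2) * w * w by rewrite !mulr_ge0 ?powR_ge0.
have := ler_wpM2r ww hs; congr (is_true (_ <= _)).
  by move: (`|s| `^ _) (w `^ _) => x y; ring.
by move: (`|b'| `^ _) (w `^ _) => x y; ring.
Qed.

Definition excess (k : R) eta v : 'rV[R]_n -> R := fun x => k * eta x - v x.
Definition superlevel l u : set 'rV[R]_n := [set x | l <= u x].

Lemma indic_superlevel l u x : \1_(superlevel l u) x = (l <= u x)%R%:R :> R.
Proof. rewrite indicE (_ : (x \in superlevel l u) = (l <= u x)%R)//.
by apply/idP/idP; rewrite inE. Qed.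

Let combine (E x1 x2 kp Lp C I P1 P2 : R) : E <= x1 * (kp * Lp) * I - x2 * P1 ->
  P2 <= kp * (C * I) -> 0 <= P1 + P2 -> 0 <= x2 -> E <= (x1 * Lp + x2 * C) * kp * I.
Proof.
move=> h1 h2 h3 h4; apply: (le_trans h1).
have h5 : x2 * - P1 <= x2 * (kp * (C * I)) by rewrite ler_wpM2l//; lra.
have -> : (x1 * Lp + x2 * C) * kp * I = x1 * (kp * Lp) * I + x2 * (kp * (C * I)) by ring.
by rewrite lerD2l -mulrN.
Qed.

(* The truncation [(k eta - v - l)^+] as a test function. *)
Lemma caccioppoli lam v G eta : 0 < lam -> critical lam v G -> Cc_infty Omega eta ->
  (forall x, 0 <= eta x) -> exists2 K, 0 <= K & forall k l, 0 < k -> 0 < l ->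
  let u := excess k eta v in let A := superlevel l u in
  [/\ L1 mu (\1_A : 'rV[R]_n -> R), measurable A &
    exists2 H, X (fun x => Num.max (u x - l) 0) H & energy mu p H <= K * k `^ p * \int[mu]_x \1_A x].
Proof.
move=> l0 hc heta eta0; have [hv _] := hc; have [vX v0 vout] := hv; have [mv _ _] := vX.
have [L L0 hL] := grad_bounded heta.
have [_ _ _ /andP[Dn Dnp]] := adm.
have [C C0 hC] := nlfield_indicator p1 Dn Dnp heta.
pose K1 : R := 2 `^ p + 2 * 2 `^ p * 2 `^ p; pose K2 : R := 2 * 2 `^ p.
have K10 : 0 <= K1 by rewrite addr_ge0 ?mulr_ge0 ?powR_ge0.
have K20 : 0 <= K2 by rewrite mulr_ge0 ?powR_ge0.
exists (K1 * L `^ p + K2 * C); first by rewrite addr_ge0 ?mulr_ge0 ?powR_ge0.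
move=> k l k0 ll0 u A.
have hu : X u (fun x => k *: grad eta x - G x) := XB adm (XZ adm k (X_Cc adm bO heta)) vX.
have [mu_ _ _] := hu.
have mA : measurable A.
  rewrite (_ : A = u @^-1` `[l, +oo[%classic); last by apply/seteqP; split => x /=; rewrite in_itv/= andbT.
  by rewrite -[Y in measurable Y]setTI; exact: mu_.
have iA : L1 mu (\1_A : 'rV[R]_n -> R).
  apply: (L1_le _ (L1Z (k / l) (Cc_L1 heta))); first exact: measurable_indic.
  move=> x; rewrite indic_superlevel; have [h|h] := leP l (u x); last first.
    by rewrite normr0; apply: mulr_ge0 => //; rewrite divr_ge0 ?(ltW k0) ?(ltW ll0).
  rewrite normr1 mulrAC ler_pdivlMr// mul1r (le_trans h)// /u /excess gerBl//.
pose phi x := Num.max (u x - l) 0; pose H x := trh l (u x) *: (k *: grad eta x - G x).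
have hphi : X phi H := X_trunc adm bO ll0 hu.
split => //; exists H => //.
have hphip : Xp phi H.
  split => // [x|x xO]; first by rewrite le_max lexx orbT.
  by rewrite /phi /u /excess (Cc_outside heta xO) vout// mulr0 subr0 sub0r max_r// oppr_le0 ltW.
have sup := supersolution adm bO oO a01 (ltW l0) hc hphip.
have iS := L1_pairing p1 (X_inLp adm bO vX) (X_inLp adm bO hphi).
have loc x : enorm (H x) `^ p <= (K1 * (k `^ p * L `^ p)) * \1_A x -
    K2 * (enorm (G x) `^ (p - 2) * dotp (G x) (H x)).
  rewrite /H indic_superlevel; have /andP[th0 th1] := trh_bounds l (u x).
  move: (trh l (u x)) th0 th1 => th th0 th1.
  (* The weight lies in [0, 1], so its p-th power is at most its first power, the one that occurs in
     the pairing. *)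
  have thp : th `^ p <= th.
    have th1' : th <= 1 by apply: (le_trans th1); rewrite lern1 leq_b1.
    rewrite -(powRB1 th0 (lt0r_neq0 p0)) ler_piMl//.
    have : th `^ (p - 1) <= 1 `^ (p - 1) by rewrite ge0_ler_powR ?nnegrE// subr_ge0 ltW.
    by rewrite powR1.
  rewrite enorm_powRZ (ger0_norm th0) dotpZr.
  have h1 := powR_enorm_test (G x) (k *: grad eta x) p1.
  have h2 : enorm (k *: grad eta x) `^ p <= k `^ p * L `^ p.
    rewrite enorm_powRZ gtr0_norm// ler_wpM2l ?powR_ge0//.
    by rewrite ge0_ler_powR ?nnegrE ?enorm_ge0 ?(ltW p0).
  apply: (@le_trans _ _ (th * enorm (k *: grad eta x - G x) `^ p)).
    by rewrite ler_wpM2r ?powR_ge0.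
  apply: (le_trans (ler_wpM2l th0 h1)); rewrite mulrBr; apply: lerB.
    rewrite -/K1 mulrCA -mulrA; apply: ler_wpM2l => //; rewrite [th * _]mulrC.
    by apply: ler_pM => //; exact: powR_ge0.
  by rewrite le_eqVlt; apply/orP; left; apply/eqP; rewrite /K2; move: (enorm _ `^ _) (dotp _ _) => y z; ring.
have hE : energy mu p H <= K1 * (k `^ p * L `^ p) * \int[mu]_x \1_A x - K2 * pairing mu p G H.
  rewrite -(rintZ _ iA) -(rintZ _ iS) -(rintB (L1Z _ iA) (L1Z _ iS)).
  exact: (rint_le (X_inLp adm bO hphi).2 (L1B (L1Z _ iA) (L1Z _ iS)) loc).
have [iC leC] := hC _ mA iA.
have iN := L1_pairing p1 (X_nl_inLp adm bO vX) (X_nl_inLp adm bO hphi).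
have hN : pairing nu p (nlf v) (nlf phi) <= k `^ p * (C * \int[mu]_x \1_A x).
  apply: le_trans (ler_wpM2l (powR_ge0 k p) leC); rewrite -(rintZ _ iC).
  apply: (rint_le iN (L1Z _ iC)) => z.
  have dot1 (s t : R) : dotp (const_mx s : 'rV_1) (const_mx t) = s * t.
    by rewrite /dotp big_ord1 !mxE.
  have w0 : 0 <= (enorm (z.1 - z.2) `^ (D / p))^-1 by rewrite invr_ge0 powR_ge0.
  rewrite /nlfield dot1 !enorm_const1 !indic_superlevel.
  apply: (le_trans (scaled_test w0 (powR_diff_test (v z.1) (v z.2) (k * eta z.1) (k * eta z.2) l p1))).
  rewrite -mulrBr -mulrA normrM powRM// gtr0_norm// -mulrA lexx//.
(* The local pairing enters with a minus sign; by [sup] its opposite is at most the nonlocal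
   pairing, which [hN] bounds. *)
exact: combine hE hN sup K20.
Qed.

(** Starts the iteration: where eta > 0 also v > 0, so each such point leaves the sets when the
    scale 2^-m goes to 0; on these sets 2^-m eta >= 2^-m / 4, whence the domination by 4 eta. *)
Lemma pos_decay v eta : measurable_fun setT v -> (forall x, 0 <= v x) -> Cc_infty Omega eta ->
  (forall x, 0 <= eta x) -> {ae mu, forall x, v x = 0 -> eta x = 0} ->
  (forall m, L1 mu (\1_(superlevel (2^-1 ^+ m / 4) (excess (2^-1 ^+ m) eta v)) : 'rV[R]_n -> R)) ->
  \int[mu]_x \1_(superlevel (2^-1 ^+ m / 4) (excess (2^-1 ^+ m) eta v)) x @[m --> \oo] --> (0 : R).
Proof.
move=> mv v0 heta eta0 vpos iA.
have half0 m : 0 < (2^-1 ^+ m : R) by rewrite exprn_gt0// invr_gt0.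
have dom : {ae mu, forall x, forall m : nat,
    `|\1_(superlevel (2^-1 ^+ m / 4) (excess (2^-1 ^+ m) eta v)) x| <= 4 * eta x}.
  apply: nearW => x m; rewrite indic_superlevel; have [h|h] := leP (2^-1 ^+ m / 4) (excess (2^-1 ^+ m) eta v x); last first.
    by rewrite normr0 mulr_ge0.
  rewrite normr1 -ler_pdivrMl// mulr1 -(ler_pM2l (half0 m)); apply: (le_trans h).
  by rewrite /excess gerBl.
have cv : {ae mu, forall x, \1_(superlevel (2^-1 ^+ m / 4) (excess (2^-1 ^+ m) eta v)) x
    @[m --> \oo] --> (0 : R)}.
  apply: filterS vpos => x vx; have [ex|ex] := eqVneq (eta x) 0.
    have -> : (fun m => \1_(superlevel (2^-1 ^+ m / 4) (excess (2^-1 ^+ m) eta v)) x) = (fun=> 0 : R).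
      apply/funext => m; rewrite indic_superlevel /excess ex mulr0 sub0r leNgt.
      by rewrite (le_lt_trans (_ : _ <= 0)) ?divr_gt0// oppr_le0.
    exact: cvg_cst.
  have vx0 : 0 < v x by rewrite lt0r v0 andbT; apply: contra ex => /eqP/vx/eqP.
  have ce : 2^-1 ^+ m * eta x @[m --> \oo] --> (0 * eta x : R).
    by apply: cvgM; [exact: cvg_half|exact: cvg_cst].
  rewrite mul0r in ce; have [N _ hN] := (cvgr_lt _ ce _ vx0 : \forall m \near \oo, _).
  apply: (cvg_near_cst (0 : R)); exists N => // m /= Nm.
  rewrite indic_superlevel /excess leNgt (lt_trans (_ : _ < 0)) ?divr_gt0// subr_lt0; exact: hN.
have [_] := rint_dct (fun m => L1_measurable (iA m)) (measurable_cst (0 : R)) (L1Z 4 (Cc_L1 heta)) dom cv.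
by rewrite /Rintegral integral0.
Qed.

Let cancel_scale (kq dq x1 x2 x3 y : R) : 0 < kq -> 0 < dq ->
  kq * dq * y <= x1 * (x2 * kq * x3) -> y <= x1 * x2 / dq * x3.
Proof.
move=> k0 d0; have -> : x1 * (x2 * kq * x3) = kq * (x1 * x2 * x3) by ring.
rewrite -mulrA ler_pM2l// => h; rewrite mulrAC ler_pdivlMr//.
by rewrite [y * dq]mulrC.
Qed.

(** Chebyshev at height k d, then the Sobolev inequality, then Caccioppoli. All three scale like
    k^q, so k cancels and the recursion is uniform in the scale. *)
Lemma degiorgi_step lam v G eta : 0 < lam -> critical lam v G -> Cc_infty Omega eta ->
  (forall x, 0 <= eta x) -> exists2 K, 0 <= K & forall k l d, 0 < k -> 0 < l -> 0 < d ->
  \int[mu]_x \1_(superlevel (l + k * d) (excess k eta v)) x <=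
  K * (d `^ q)^-1 * (\int[mu]_x \1_(superlevel l (excess k eta v)) x) `^ (q / p).
Proof.
move=> l0 hc heta eta0; have [K K0 hK] := caccioppoli l0 hc heta eta0.
have [K' K'0 hK'] := X_sobolev adm bO.
exists (K' * K `^ (q / p)); first by rewrite mulr_ge0 ?powR_ge0.
move=> k l d k0 ll0 d0; set u := excess k eta v.
have [iA mA [H hX hE]] := hK k l k0 ll0; rewrite -/u in iA mA hX hE.
have [|iB _ _] := hK k (l + k * d) k0; first by rewrite addr_gt0// mulr_gt0.
rewrite -/u in iB.
set Y := \int[mu]_x \1_(superlevel l u) x in hE *; set Y' := \int[mu]_x _.
have Y0 : 0 <= Y by apply: rint_ge0 => x; rewrite indicE.
have [_ hq _] := hK' _ _ hX.
have qp : 0 <= q / p by rewrite divr_ge0 ?(ltW q0) ?(ltW p0).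
have h1 : energy mu p H `^ (q / p) <= K `^ (q / p) * k `^ q * Y `^ (q / p).
  have -> : K `^ (q / p) * k `^ q * Y `^ (q / p) = (K * k `^ p * Y) `^ (q / p).
    rewrite !powRM ?mulr_ge0 ?powR_ge0// -[(k `^ p) `^ _]powRrM.
    by rewrite [p * _]mulrC divfK// gt_eqF.
  by apply: ge0_ler_powR => //; rewrite nnegrE ?energy_ge0 ?mulr_ge0 ?powR_ge0.
have h2 : (k * d) `^ q * Y' <= \int[mu]_x (`|Num.max (u x - l) 0| `^ q).
  rewrite -(rintZ _ iB); apply: (rint_le (L1Z _ iB) (X_L1q adm bO hX)) => x.
  rewrite indic_superlevel; have [h|h] := leP _ (u x); last by rewrite mulr0 powR_ge0.
  have kd : k * d <= u x - l by rewrite lerBrDl.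
  have kd0 : 0 <= k * d by rewrite mulr_ge0 ?(ltW k0) ?(ltW d0).
  rewrite mulr1 max_l ?(le_trans kd0 kd)// ger0_norm ?(le_trans kd0 kd)//.
  by rewrite ge0_ler_powR ?nnegrE ?(ltW q0) ?(le_trans kd0 kd).
have kd : (k * d) `^ q = k `^ q * d `^ q by rewrite powRM ?(ltW k0) ?(ltW d0).
rewrite kd in h2; apply: (cancel_scale (powR_gt0 q k0) (powR_gt0 q d0)).
exact: (le_trans h2 (le_trans hq (ler_wpM2l K'0 h1))).
Qed.

Lemma degiorgi lam v G eta : 0 < lam -> critical lam v G -> Cc_infty Omega eta ->
  (forall x, 0 <= eta x) -> exists2 k, 0 < k & {ae mu, forall x, k * (eta x - 2^-1) < v x}.
Proof.
move=> l0 hc heta eta0; have [hv _] := hc; have [vX v0 _] := hv; have [mv _ _] := vX.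
have half0 m : 0 < (2^-1 ^+ m : R) by rewrite exprn_gt0// invr_gt0.
have half1 m : (2^-1 ^+ m : R) <= 1 by rewrite exprn_ile1 ?invr_ge0// invf_le1// ler1n.
have h20 : (0 : R) < 2^-1 by rewrite invr_gt0.
have eX : Xp eta (grad eta).
  by split; [exact: (X_Cc adm bO heta)|exact: eta0|move=> x xO; exact: Cc_outside heta xO].
have vpos := critical_pos adm bO oO a01 l0 hc eX.
have [K1 K10 hcac] := caccioppoli l0 hc heta eta0.
have [K K0 step] := degiorgi_step l0 hc heta eta0.
pose b := 2 `^ q; have b1 : 1 < b.
  have : (1 : R) `^ q < 2 `^ q by rewrite gt0_ltr_powR ?nnegrE// ltr1n.
  by rewrite powR1.
have al0 : 0 < q / p - 1 by rewrite subr_gt0 ltr_pdivlMr// mul1r.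
(* The level increments are d = 2^-(j+3) in units of k, whence d^(-q) = b^(j+3). *)
have C0 : 0 <= K * b ^+ 3 by rewrite mulr_ge0// exprn_ge0// powR_ge0.
have [dl dl0 hdl] := fast_decay C0 b1 al0.
pose u m := excess (2^-1 ^+ m) eta v.
(* The levels increase from 2^-m / 4 towards 2^-m / 2. *)
pose lv m j : R := 2^-1 ^+ m * (2^-1 - 2^-1 ^+ j.+2).
have quarter : (2^-1 : R) - 2^-1 ^+ 2 = 4^-1 by rewrite exprS expr1; field.
have lv0 m j : 0 < lv m j.
  apply: mulr_gt0 => //; rewrite subr_gt0 exprS gtr_pMr// exprS.
  apply: (@le_lt_trans _ _ 2^-1); last by rewrite invf_lt1// ltr1n.
  by rewrite ler_piMr ?half1 ?(ltW h20).
have lvS m j : lv m j.+1 = lv m j + 2^-1 ^+ m * 2^-1 ^+ j.+3.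
  by rewrite /lv [in LHS]exprS [2^-1 ^+ j.+3]exprS; move: (2^-1 ^+ j.+2) (2^-1 ^+ m) => x y; field.
have lvE m : lv m 0%N = 2^-1 ^+ m / 4 by rewrite /lv quarter.
have cv := pos_decay mv v0 heta eta0 vpos (fun m => let: And3 i _ _ := hcac _ _ (half0 m)
  (divr_gt0 (half0 m) (ltr0n R 4)) in i).
(* The threshold [dl] is independent of the scale 2^-m, so a scale can be chosen at which the first
   superlevel set is small enough. *)
have [m _ hm] := (cvgr_le _ cv _ dl0 : \forall m \near \oo, _).
exists (2^-1 ^+ m) => //; set k : R := 2^-1 ^+ m.
pose Y j := \int[mu]_x \1_(superlevel (lv m j) (u m)) x.
have cY : Y j @[j --> \oo] --> (0 : R).
  apply: hdl.
  - by move=> j; apply: rint_ge0 => x; rewrite indicE.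
  - move=> j; rewrite /Y lvS (_ : 1 + (q / p - 1) = q / p); last by rewrite addrC subrK.
    apply: (le_trans (step k (lv m j) (2^-1 ^+ j.+3) (half0 _) (lv0 _ _) (half0 _))).
    rewrite le_eqVlt; apply/orP; left; apply/eqP; congr (_ * _); rewrite -mulrA; congr (_ * _).
    rewrite exprn_powR ?(ltW h20)// -exprVn -exprD [RHS](_ : _ = b ^+ j.+3)//; congr (_ ^+ _).
    apply: (mulfI (lt0r_neq0 (powR_gt0 q h20))); rewrite mulfV ?gt_eqF ?powR_gt0//.
    by rewrite /b -powRM ?(ltW h20)// mulVf// powR1.
  - by rewrite /Y lvE; apply: hm => /=.
have iB := let: And3 i _ _ := hcac k (k / 2) (half0 m) (divr_gt0 (half0 m) (ltr0n R 2)) in i.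
have B0 : \int[mu]_x \1_(superlevel (k / 2) (u m)) x = 0.
  apply/eqP; rewrite eq_le; apply/andP; split; last by apply: rint_ge0 => x; rewrite indicE.
  rewrite -oppr_ge0 -[- _]add0r; apply: (ler_cvg_seq (y := fun j => Y j - \int[mu]_x \1_(superlevel (k / 2) (u m)) x)).
    move=> j; rewrite subr_ge0 /Y; have [iA _ _] := hcac k (lv m j) (half0 m) (lv0 m j).
    apply: (rint_le iB iA) => x; rewrite !indic_superlevel ler_nat.
    have [h|//] := leP (k / 2) _; rewrite (le_trans _ h)//.
    by rewrite /lv -/k ler_wpM2l ?(ltW (half0 m))// gerBl (ltW (half0 _)).
  by apply: cvgB => //; exact: cvg_cst.
have e1 : (fun x => `|\1_(superlevel (k / 2) (u m)) x| `^ 1) = (\1_(superlevel (k / 2) (u m)) : _ -> R).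
  by apply/funext => x; rewrite powRr1// ger0_norm// indicE.
have := @rint_powR_eq0 _ _ _ mu 1 (\1_(superlevel (k / 2) (u m))) ltr01.
rewrite e1 => /(_ iB B0); apply: filterS => x /eqP.
rewrite indic_superlevel pnatr_eq0 eqb0 -ltNge /u /excess -/k => h.
by move: h; rewrite mulrBr; move: (k * eta x) (k / 2) (v x) => y1 y2 y3; lra.
Qed.

End degiorgi.

(** * The weak equation *)

Section lower_bounds.
Context {R : realType} (n : nat) (p q D : R) (adm : admissible n p q D).
Variables (Omega : set 'rV[R]_n) (bO : bounded_set Omega) (oO : open Omega).
Variables (a : R) (a01 : 0 < a < 1).
Variables (lam : R) (v : 'rV[R]_n -> R) (G : 'rV[R]_n -> 'rV[R]_n).
Hypotheses (lam0 : 0 < lam) (hc : critical p q D Omega a lam v G).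
Local Notation mu := (lebesgue_rV R n).
Local Notation nu := (mu \x mu)%E.
Local Notation nlf := (nlfield p D).
Local Notation X := (X p q D Omega).
Local Notation Xp := (Xp p q D Omega).

Let p1 : 1 < p. Proof. by case: adm => /andP[]. Qed.
Let pq : p < q. Proof. by case: adm. Qed.
Let p0 : 0 < p. Proof. exact: lt_trans p1. Qed.
Let q1 : 1 < q. Proof. exact: lt_trans pq. Qed.
Let q0 : 0 < q. Proof. exact: lt_trans q1. Qed.
Let a0 : 0 < a. Proof. by case/andP: a01. Qed.
Let a1 : a < 1. Proof. by case/andP: a01. Qed.
Let hv : Xp v G. Proof. by case: hc. Qed.

Lemma local_lower_bound x0 : Omega x0 -> exists c U, [/\ 0 < c, open U, U x0 &
  {ae mu, forall x, U x -> c <= v x}].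
Proof.
move=> Ox; have [rho r0 hr] := open_enorm_ball oO Ox.
have hb := Cc_bump r0 hr; set b0 := bump x0 rho x0.
have b00 : 0 < b0 by rewrite bump_gt0// subrr enorm0.
(* Normalised to be 1 at x0; where eta > 3/4, the bound k (eta - 1/2) of [degiorgi] exceeds k /
   4. *)
have heta := Cc_scale b0^-1 hb; set eta := (fun x => b0^-1 * bump x0 rho x) in heta.
have eta0 x : 0 <= eta x by rewrite mulr_ge0 ?bump_ge0// invr_ge0 ltW.
have [k k0 hk] := degiorgi adm bO oO a01 lam0 hc heta eta0.
exists (k / 4), (eta @^-1` `]3 / 4, +oo[%classic); split.
- by rewrite divr_gt0.
- by apply: open_comp; [move=> x _; exact: (Cc_cont heta)|exact: interval_open].
- by rewrite /= in_itv/= andbT /eta mulVf ?gt_eqF//; lra.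
- apply: filterS hk => x h; rewrite /= in_itv/= andbT => ex; apply/ltW/(le_lt_trans _ h).
  by rewrite ler_wpM2l ?(ltW k0)//; move: ex; move: (eta x) => y; lra.
Qed.

Lemma compact_lower_bound K : compact K -> K `<=` Omega ->
  exists2 c, 0 < c & {ae mu, forall x, K x -> c <= v x}.
Proof.
move=> cK KO.
have ex x : exists cU : R * set 'rV[R]_n, [/\ 0 < cU.1, open cU.2, Omega x -> cU.2 x &
    {ae mu, forall x, cU.2 x -> cU.1 <= v x}].
  have [/local_lower_bound[c [U [c0 oU Ux hU]]]|xO] := pselect (Omega x); first by exists (c, U).
  by exists (1, set0); split; [exact: ltr01|exact: open0|move=> /xO|exact: nearW].
have [cU hcU] := choice ex.
move: cK; rewrite compact_cover => /(_ _ Omega (fun x => (cU x).2)).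
case.
- by move=> x _; case: (hcU x).
- by move=> x Kx; exists x; [exact: KO|have [_ _ h _] := hcU x; apply: h; exact: KO].
move=> s _ Ks.
have [c c0 hcs] : exists2 c, 0 < c & {ae mu, forall x, (exists2 i, i \in finmap.enum_fset s & (cU i).2 x) -> c <= v x}.
  elim: (finmap.enum_fset s) => [|i t [c c0 IH]]; first by exists 1 => //; apply: nearW => x [].
  have [ci0 _ _ hi] := hcU i; exists (Num.min (cU i).1 c); first by rewrite lt_min ci0.
  apply: filterS2 IH hi => x h1 h2 [l]; rewrite inE ge_min => /orP[/eqP ->|lt] xl.
    by rewrite h2.
  by rewrite h1 ?orbT//; exists l.
by exists c => //; apply: filterS hcs => x h /Ks[i si xi]; apply: h; exists i.
Qed.

(** Compact lower bounds hold outside null sets depending on the compact set; countably many compact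
    sets exhaust [Omega]. *)
Lemma critical_gt0 : {ae mu, forall x, Omega x -> 0 < v x}.
Proof.
have [F hF OF] := sigma_compact oO.
have nN k : mu.-negligible (~` [set x | F k x -> 0 < v x]).
  have [kF FO] := hF k; have [c c0 hcv] := compact_lower_bound kF FO.
  by apply: filterS hcv => x h /h; exact: lt_le_trans.
have := negligible_bigcup nN; apply: negligibleS => x /= /not_implyP[Ox vx].
by move: Ox; rewrite OF => -[k _ Fx]; exists k => // /(_ Fx).
Qed.

Lemma powRN_anti (c x y : R) : 0 <= y -> 0 < c -> c <= x -> x `^ (- y) <= c `^ (- y).
Proof.
move=> y0 c0 cx; rewrite !powRN lef_pV2 ?posrE ?powR_gt0//; last exact: lt_le_trans cx.
by rewrite ge0_ler_powR ?nnegrE ?(ltW c0)// (le_trans (ltW c0)).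
Qed.

Lemma singular_L1 phi c : L1 mu phi -> 0 < c -> (forall x, phi x != 0 -> c <= v x) ->
  L1 mu (fun x => phi x * v x `^ (a - 1)).
Proof.
move=> iphi c0 hphi; have [[mv _ _] _ _] := hv.
apply: (L1_le _ (L1Z (c `^ (a - 1)) (L1_norm iphi))).
  apply: measurable_funM; first exact: L1_measurable iphi.
  by apply: (measurableT_comp (f := fun t : R => t `^ (a - 1))) => //; exact: measurable_powR.
move=> x; have [->|/hphi h] := eqVneq (phi x) 0; first by rewrite !mul0r normr0 mulr0.
rewrite normrM mulrC ler_wpM2r// ger0_norm ?powR_ge0// -opprB; apply: powRN_anti => //.
by rewrite subr_ge0 ltW.
Qed.

(** As v >= c where phi is nonzero, v + e phi >= c / 2 there for small e, whatever the sign of phi.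
    The powers (v + e phi)^(a-1) are then uniformly bounded and the singular quotient passes to the
    limit. *)
Lemma weak_inequality phi H c M : X phi H -> L1 mu phi -> (forall x, `|phi x| <= M) -> 0 < c ->
  (forall x, phi x != 0 -> c <= v x) ->
  lam * (\int[mu]_x (phi x * v x `^ (a - 1))) + dC q v phi <= dA p D v G phi H.
Proof.
move=> hX iphi hM c0 hphi; have [vX v0 vout] := hv; have [mv _ _] := vX.
have M0 : 0 <= M by exact: le_trans (normr_ge0 (phi 0)) (hM 0).
have M1 : 0 < M + 1 by rewrite ltr_wpDl.
have step e x : 0 < e -> e * (M + 1) <= c / 2 -> phi x != 0 -> c / 2 <= v x + e * phi x.
  move=> e0 eM /hphi cv; have h1 : e * - phi x <= e * (M + 1).
    rewrite ler_wpM2l ?(ltW e0)//; apply: (le_trans (ler_norm _)); rewrite normrN.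
    by apply: (le_trans (hM x)); rewrite lerDl.
  by move: h1 cv eM; rewrite mulrN; move: (e * phi x) (e * (M + 1)) (v x) => y1 y2 y3; lra.
have pout x : ~ Omega x -> phi x = 0.
  move=> /vout vx; apply/eqP; apply: contraT => /hphi; rewrite vx => /(lt_le_trans c0).
  by rewrite ltxx.
have feas : exists2 e0, 0 < e0 & forall e, 0 < e < e0 -> Xp (shift v e phi) (shiftg G e H).
  exists (c / 2 / (M + 1)); first by rewrite !divr_gt0.
  move=> e /andP[e0 eM]; split.
  - exact: (XD adm vX (XZ adm e hX)).
  - move=> x; rewrite /shift; have [->|px] := eqVneq (phi x) 0; first by rewrite mulr0 addr0.
    apply: le_trans (step e x e0 _ px); first by rewrite ltW// divr_gt0.
    by rewrite -ler_pdivlMr// ltW.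
  - by move=> x xO; rewrite /shift vout// pout// mulr0 addr0.
have [e [t [P [he ce [t0 ct] cP hk]]]] := critical_ineq adm bO (ltW lam0) hc hX feas.
have small : \forall k \near \oo, e k * (M + 1) <= c / 2.
  have cM : e k * (M + 1) @[k --> \oo] --> (0 * (M + 1) : R) by apply: cvgM => //; exact: cvg_cst.
  rewrite mul0r in cM; have c2 : 0 < c / 2 by rewrite divr_gt0.
  by apply: filterS (cvgr_le _ cM _ c2).
have [N _ hN] := small.
have Ns : forall i, (i + N < i.+1 + N)%N by move=> i; rewrite addSn.
pose f k := e (k + N)%N; pose tt k := t (k + N)%N.
have cf : f k @[k --> \oo] --> (0 : R) by exact: (cvg_subseq Ns ce).
have ctt : tt k @[k --> \oo] --> (1 : R) by exact: (cvg_subseq Ns ct).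
have cPP := cvg_subseq Ns cP.
have f0 k : 0 < f k by case: (he (k + N)%N) => /andP[].
have fM k : f k * (M + 1) <= c / 2 by apply: hN => /=; rewrite leq_addl.
pose F k x := phi x * (v x + f k * phi x) `^ (a - 1).
have mF k : measurable_fun setT (F k).
  apply: measurable_funM; first exact: L1_measurable iphi.
  apply: (measurableT_comp (f := fun t : R => t `^ (a - 1))); first exact: measurable_powR.
  by apply: measurable_funD => //; apply: measurable_funM => //; exact: L1_measurable iphi.
have c20 : 0 < c / 2 by rewrite divr_gt0.
have Fb k x : `|F k x| <= (c / 2) `^ (a - 1) * `|phi x|.
  rewrite /F; have [->|px] := eqVneq (phi x) 0; first by rewrite mul0r normr0 mulr0.
  rewrite normrM mulrC ler_wpM2r// ger0_norm ?powR_ge0// -opprB; apply: powRN_anti => //.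
    by rewrite subr_ge0 ltW.
  exact: step.
have iF k : L1 mu (F k) := L1_le (mF k) (L1Z _ (L1_norm iphi)) (Fb k).
have iS := singular_L1 iphi c0 hphi.
have cF : {ae mu, forall x, F k x @[k --> \oo] --> phi x * v x `^ (a - 1)}.
  apply: nearW => x; rewrite /F; have [->|px] := eqVneq (phi x) 0.
    have -> : (fun k => 0 * (v x + f k * 0) `^ (a - 1)) = (fun=> 0 : R) by apply/funext => k; rewrite mul0r.
    by rewrite mul0r; exact: cvg_cst.
  apply: cvgM; first exact: cvg_cst.
  have cvx : v x + f k * phi x @[k --> \oo] --> v x + 0 * phi x.
    by apply: cvgD; [exact: cvg_cst|apply: cvgM => //; exact: cvg_cst].
  rewrite mul0r addr0 in cvx.
  have vx0 : 0 < v x by exact: lt_le_trans (hphi _ px).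
  rewrite -opprB powRN.
  have -> : (fun k => (v x + f k * phi x) `^ (- (1 - a))) = (fun k => ((v x + f k * phi x) `^ (1 - a))^-1).
    by apply/funext => k; rewrite powRN.
  apply: cvgV; first by rewrite gt_eqF// powR_gt0.
  apply: cvg_powR => //; first by rewrite subr_gt0.
  by move=> k; apply: (le_trans (ltW c20)); exact: step.
have dom : {ae mu, forall x, forall k, `|F k x| <= (c / 2) `^ (a - 1) * `|phi x|}.
  by apply: nearW => x k; exact: Fb.
have [_ cI] := rint_dct mF (L1_measurable iS) (L1Z _ (L1_norm iphi)) dom cF.
have key k : lam * tt k `^ a * (\int[mu]_x F k x) + tt k `^ q * dC q v phi <= tt k `^ p * P (k + N)%N.
  apply: le_trans (hk (k + N)%N); rewrite lerD2r -/(f k) -/(tt k).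
  have [_ hs] := he (k + N)%N; rewrite -/(f k) in hs; have [_ s0 _] := hs.
  have iv := L1_singular_int adm bO oO a01 hv; have is_ := L1_singular_int adm bO oO a01 hs.
  have h1 : singular_int a v + a * f k * (\int[mu]_x F k x) <= singular_int a (shift v (f k) phi).
    rewrite -(rintZ _ (iF k)) -(rintD iv (L1Z _ (iF k))).
    apply: (rint_le (L1D iv (L1Z _ (iF k))) is_) => x.
    rewrite !ger0_norm//; rewrite /F /shift; have [->|px] := eqVneq (phi x) 0.
      by rewrite mul0r !mulr0 !addr0.
    have s_gt0 : 0 < v x + f k * phi x by apply: (lt_le_trans c20); exact: step.
    have := powR_concave_tangent a01 s_gt0 (v0 x); rewrite opprD addNKr -lerBlDr.
    apply: le_trans; rewrite mulrN opprK lerD2l le_eqVlt; apply/orP; left; apply/eqP.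
    by move: (_ `^ (a - 1)) => y; ring.
  have h2 : a * (\int[mu]_x F k x) <= (singular_int a (shift v (f k) phi) - singular_int a v) / f k.
    by rewrite ler_pdivlMr// lerBrDl mulrAC.
  have -> : lam * tt k `^ a * (\int[mu]_x F k x) = lam / a * tt k `^ a * (a * (\int[mu]_x F k x)).
    by move: (tt k `^ a) (\int[mu]_x F k x) => y z; field; rewrite gt_eqF.
  by apply: ler_wpM2l h2; rewrite mulr_ge0 ?powR_ge0// divr_ge0 ?(ltW a0) ?(ltW lam0).
have t1 r : 0 < r -> tt k `^ r @[k --> \oo] --> (1 : R).
  by move=> r0; have := cvg_powR r0 (fun k => ltW (t0 (k + N)%N)) ctt; rewrite powR1.
have cv : tt k `^ p * P (k + N)%N - (lam * tt k `^ a * (\int[mu]_x F k x) + tt k `^ q * dC q v phi) @[k --> \oo] -->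
    1 * dA p D v G phi H - (lam * 1 * (\int[mu]_x (phi x * v x `^ (a - 1))) + 1 * dC q v phi).
  apply: cvgB; first by apply: cvgM; [exact: t1|exact: cPP].
  apply: cvgD; last by apply: cvgM; [exact: t1|exact: cvg_cst].
  by apply: cvgM => //; apply: cvgM; [exact: cvg_cst|exact: t1].
have := ler_cvg_seq (fun k => _) cv; move=> h.
have : 0 <= 1 * dA p D v G phi H - (lam * 1 * (\int[mu]_x (phi x * v x `^ (a - 1))) + 1 * dC q v phi).
  by apply: h => k; rewrite subr_ge0.
by rewrite !mul1r mulr1 subr_ge0.
Qed.

Let minus_arith (l I c d : R) : l * I + c <= d -> l * (- I) + (- c) <= - d -> d = l * I + c.
Proof. by move=> h1 h2; apply/eqP; rewrite eq_le h1 andbT; rewrite mulrN in h2; lra. Qed.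

(* The lower bound for [v] on the support of [phi] only holds almost everywhere,
   so the test function is first modified on the exceptional null set. *)
Lemma weak_identity phi : Cc_infty Omega phi ->
  L1 mu (fun x => phi x * v x `^ (a - 1)) /\
  dA p D v G phi (grad phi) = lam * (\int[mu]_x (phi x * v x `^ (a - 1))) + dC q v phi.
Proof.
move=> hphi; have [vX v0 _] := hv; have [mv _ _] := vX.
have [M M0 hM] := Cc_bounded hphi; have mphi := Cc_meas hphi; have iphi := Cc_L1 hphi.
have hX := X_Cc adm bO hphi; have [_ mG _] := hX.
have [cK KO] : compact (closure [set x | phi x != 0]) /\ closure [set x | phi x != 0] `<=` Omega.
  by case: hphi.
have [c c0 [N [mN N0 hN]]] := compact_lower_bound cK KO.
pose psi x := phi x * \1_(~` N) x.
have psiE x : ~ N x -> phi x = psi x by move=> xN; rewrite /psi indicE mem_set// mulr1.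
have eq_psi : {ae mu, forall x, phi x = psi x}.
  exists N; split => // x /= h; apply: contrapT => xN; exact/h/psiE.
have psi_le x : `|psi x| <= `|phi x|.
  by rewrite /psi normrM ler_piMr// indicE; case: (_ \in _); rewrite ?normr1 ?normr0.
have mpsi : measurable_fun setT psi.
  by apply: measurable_funM => //; apply: measurable_indic; exact: measurableC.
have ipsi : L1 mu psi := L1_le mpsi (L1_norm iphi) psi_le.
have psiM x : `|psi x| <= M by exact: le_trans (psi_le x) (hM x).
have psi_c x : psi x != 0 -> c <= v x.
  rewrite /psi mulf_eq0 negb_or => /andP[px]; rewrite indicE pnatr_eq0 eqb0 negbK => /set_mem xN.
  by apply: contrapT => h; apply: xN; apply: hN => /= h'; apply: h; apply: h'; exact: subset_closure.
have pX : X psi (grad phi) by apply: (X_ae adm bO hX mpsi mG eq_psi); exact: nearW.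
have npX := XZ adm (-1) pX.
have h1 := weak_inequality pX ipsi psiM c0 psi_c.
have nM x : `|-1 * psi x| <= M by rewrite mulN1r normrN.
have nc x : -1 * psi x != 0 -> c <= v x by rewrite mulN1r oppr_eq0; exact: psi_c.
have h2 := weak_inequality npX (L1Z (-1) ipsi) nM c0 nc.
have iS := singular_L1 ipsi c0 psi_c.
have iC := L1_dC adm bO hv pX.
have e1 : \int[mu]_x (-1 * psi x * v x `^ (a - 1)) = - \int[mu]_x (psi x * v x `^ (a - 1)).
  by rewrite -[RHS]mulN1r -(rintZ _ iS); congr Rintegral; apply/funext => x; rewrite mulrA.
have e2 : dC q v (fun x => -1 * psi x) = - dC q v psi.
  by rewrite -[RHS]mulN1r -(rintZ _ iC); congr Rintegral; apply/funext => x; rewrite mulrCA.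
have e3 : dA p D v G (fun x => -1 * psi x) (fun x => -1 *: grad phi x) = - dA p D v G psi (grad phi).
  rewrite /dA (pairingZr p1 (-1) (X_inLp adm bO vX) (X_inLp adm bO hX)).
  have -> : nlf (fun x => -1 * psi x) = (fun z => -1 *: nlf psi z) by apply/funext => z; exact: nlfieldZ.
  by rewrite (pairingZr p1 (-1) (X_nl_inLp adm bO vX) (X_nl_inLp adm bO pX)) !mulN1r opprD.
rewrite e1 e2 e3 in h2; have h := minus_arith h1 h2.
have mS : measurable_fun setT (fun x => phi x * v x `^ (a - 1)).
  apply: measurable_funM => //.
  by apply: (measurableT_comp (f := fun t : R => t `^ (a - 1))) => //; exact: measurable_powR.
have aeS : ae_eq mu setT (fun x => psi x * v x `^ (a - 1)) (fun x => phi x * v x `^ (a - 1)).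
  by apply: filterS eq_psi => x -> _.
have aeC : ae_eq mu setT (fun x => v x `^ (q - 1) * psi x) (fun x => v x `^ (q - 1) * phi x).
  by apply: filterS eq_psi => x -> _.
have iC' := L1_dC adm bO hv hX.
have aeN : ae_eq nu setT (fun z => enorm (nlf v z) `^ (p - 2) * dotp (nlf v z) (nlf psi z))
    (fun z => enorm (nlf v z) `^ (p - 2) * dotp (nlf v z) (nlf phi z)).
  apply: filterS (ae_prod2 eq_psi) => z [z1 z2] _; congr (_ * dotp _ _).
  by rewrite /nlfield z1 z2.
have iN := L1_pairing p1 (X_nl_inLp adm bO vX) (X_nl_inLp adm bO pX).
have iN' := L1_pairing p1 (X_nl_inLp adm bO vX) (X_nl_inLp adm bO hX).
split; first exact: L1_ae mS aeS iS.
rewrite -(rint_ae (L1_measurable iS) mS aeS).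
have eC : dC q v psi = dC q v phi := rint_ae (L1_measurable iC) (L1_measurable iC') aeC.
have eN : pairing nu p (nlf v) (nlf psi) = pairing nu p (nlf v) (nlf phi) :=
  rint_ae (L1_measurable iN) (L1_measurable iN') aeN.
by rewrite -eC -h /dA eN.
Qed.

End lower_bounds.

(** * Weak solutions *)

Section lp_spaces.
Context {R : realType} (n : nat) (p : R).
Hypothesis p1 : 1 < p.
Local Notation mu := (lebesgue_rV R n).
Implicit Types (f g h : 'rV[R]_n -> R) (Omega : set 'rV[R]_n).

Lemma Lnorm_L1 f : L1 mu (fun x => `|f x| `^ p) ->
  ('N[mu]_p%:E [EFin \o f])%E = ((\int[mu]_x (`|f x| `^ p)) `^ p^-1)%:E.
Proof.
move=> i; rewrite unlock -poweR_EFin -(L1_integralE i); congr poweR.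
Qed.

Lemma Lfun_L1 f : measurable_fun setT f -> L1 mu (fun x => `|f x| `^ p) -> f \in Lfun mu p%:E.
Proof.
move=> mf i; rewrite inE; apply/andP; split; rewrite inE//=.
by rewrite /finite_norm (Lnorm_L1 i) ltry.
Qed.

Lemma restrict_integral Omega f f' h : measurable Omega -> (forall x, Omega x -> f x = f' x) ->
  measurable_fun setT f' -> L1 mu h -> (forall x, ~ Omega x -> h x = 0) ->
  {ae mu, forall x, Omega x -> f' x = h x} ->
  mu.-integrable Omega (EFin \o f) /\ \int[mu]_(x in Omega) f x = \int[mu]_x h x.
Proof.
move=> mO ff' mf' ih h0 e.
have eP : (f \_ Omega) = (f' \_ Omega).
  by apply/funext => x; rewrite !patchE; case: ifPn => // /set_mem/ff'.
have mfO : measurable_fun setT (f \_ Omega).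
  by rewrite eP; apply/(measurable_restrictT _ mO); exact: measurable_funS mf'.
have ae_fh : ae_eq mu setT h (f \_ Omega).
  apply: filterS e => x hx _; rewrite eP patchE.
  by case: ifPn => [/set_mem/hx//|/negP xO]; apply: h0 => Ox; exact/xO/mem_set.
have i : L1 mu (f \_ Omega) := L1_ae mfO ae_fh ih.
split; first by apply/(integrable_mkcond _ mO); rewrite restrict_EFin.
by rewrite Rintegral_mkcond -(rint_ae (L1_measurable ih) mfO ae_fh).
Qed.

Lemma le1_powR (x : R) : 0 <= x -> x <= 1 + x `^ p.
Proof.
move=> x0; have [x1|x1] := leP x 1; first by rewrite (le_trans x1)// lerDl powR_ge0.
have := powR_ge_tangent1 p1 x0; have : x - 1 <= p * (x - 1).
  by rewrite ler_peMl ?(ltW p1)// subr_ge0 ltW.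
by move: (p * (x - 1)) (x `^ p) => y z; lra.
Qed.

Lemma Lp_locally_integrable Omega f : measurable_fun setT f -> L1 mu (fun x => `|f x| `^ p) ->
  locally_integrable_on Omega f.
Proof.
move=> mf i K kK _; have [L L0 hL] := compact_box kK.
have mK : measurable K by apply: closed_measurable_rV; apply: compact_closed => //; exact: norm_hausdorff.
have iK : L1 mu (\1_K : 'rV[R]_n -> R).
  apply: (@L1_bounded_cube _ _ _ L 1).
  - exact: measurable_indic.
  - by move=> x; rewrite indicE; case: (_ \in _); rewrite ?normr1 ?normr0.
  - move=> x; rewrite indicE; have [/set_mem xK _|] := boolP (x \in K); last by rewrite eqxx.
    by apply/cubeP => j; exact: hL.
apply/(integrable_mkcond _ mK); rewrite restrict_EFin.
apply: (L1_le _ (L1D iK i)).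
  by apply/(measurable_restrictT _ mK); exact: measurable_funS mf.
move=> x; rewrite patchE indicE; case: ifPn => _; first exact: le1_powR.
by rewrite normr0 add0r powR_ge0.
Qed.

Lemma locally_integrable_measurable Omega f : open Omega -> locally_integrable_on Omega f ->
  measurable_fun Omega f.
Proof.
move=> oO lf; have [F hF ->] := sigma_compact oO.
have mF k : measurable (F k).
  by apply: closed_measurable_rV; apply: compact_closed; [exact: norm_hausdorff|case: (hF k)].
apply/measurable_fun_bigcup => // k; have [kF FO] := hF k.
by have /measurable_int/measurable_EFinP := lf _ kF FO.
Qed.

End lp_spaces.

Section weak_derivatives.
Context {R : realType} (n : nat) (p q D : R) (adm : admissible n p q D).
Variables (Omega : set 'rV[R]_n) (bO : bounded_set Omega) (oO : open Omega).
Local Notation mu := (lebesgue_rV R n).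
Local Notation nu := (mu \x mu)%E.
Local Notation nlf := (nlfield p D).
Local Notation X := (X p q D Omega).
Implicit Types (u v : 'rV[R]_n -> R) (G H : 'rV[R]_n -> 'rV[R]_n).

Let p1 : 1 < p. Proof. by case: adm => /andP[]. Qed.
Let p0 : 0 < p. Proof. exact: lt_trans p1. Qed.
Let mO : measurable Omega. Proof. exact: open_measurable_rV. Qed.

Lemma X_coord_L1 u G i : X u G -> L1 mu (fun x => `|G x ord0 i| `^ p).
Proof.
move=> hX; have [mG iG] := X_inLp adm bO hX; apply: (L1_le _ iG).
  apply: (measurableT_comp (f := fun t : R => t `^ p)); first exact: measurable_powR.
  by apply: measurableT_comp => //; exact: mG.
move=> x; rewrite ger0_norm ?powR_ge0//.
by apply: ge0_ler_powR; rewrite ?nnegrE ?enorm_ge0 ?coord_le_enorm// ltW.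
Qed.

Lemma X_weak_gradient Omega' u G : X u G -> weak_gradient Omega' u G.
Proof.
move=> hX; have [mU mG _] := hX; split.
- exact: (Lp_locally_integrable p1 mU (X_L1p adm bO hX)).
- by move=> i; apply: (Lp_locally_integrable p1 (mG i)); exact: X_coord_L1 hX.
- move=> phi hphi i; have [_ _ e] := X_ibp adm bO i hX hphi.
  have z1 x : ~ Omega' x -> u x * pderiv i phi x = 0.
    by move=> xO; rewrite (Cc_outside (Cc_pderiv i hphi) xO) mulr0.
  have z2 x : ~ Omega' x -> G x ord0 i * phi x = 0.
    by move=> xO; rewrite (Cc_outside hphi xO) mulr0.
  exact: (etrans (Rintegral_support z1) (etrans e (esym (congr1 -%R (Rintegral_support z2))))).
Qed.

(** Outside [Omega] the choice made by [wgrad] is unconstrained and possibly not measurable;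
    extension by zero gives a measurable field on R^n. *)
Definition wgrad0 u (x : 'rV[R]_n) : 'rV[R]_n := if x \in Omega then wgrad Omega u x else 0.

Lemma wgrad_weak u G : X u G -> weak_gradient Omega u (wgrad Omega u).
Proof. by move=> hX; apply: (getPex (ex_intro _ G (X_weak_gradient Omega hX))). Qed.

Lemma wgrad0_ae u G : X u G -> {ae mu, forall x, Omega x -> wgrad0 u x = G x}.
Proof.
move=> hX; have := weak_gradient_unique oO (wgrad_weak hX) (X_weak_gradient Omega hX).
by apply: filterS => x h Ox; rewrite /wgrad0 mem_set// h.
Qed.

Lemma wgrad0E u x : Omega x -> wgrad Omega u x = wgrad0 u x.
Proof. by move=> Ox; rewrite /wgrad0 mem_set. Qed.

Lemma vmeas_wgrad0 u G : X u G -> vmeas (wgrad0 u).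
Proof.
move=> hX i; have [_ lG _] := wgrad_weak hX.
have := locally_integrable_measurable oO (lG i); move/(measurable_restrictT _ mO).
congr measurable_fun; apply/funext => x; rewrite patchE /wgrad0.
by case: ifP => // _; rewrite mxE.
Qed.

Lemma wgrad0_energy u G : X u G -> inLp mu p (wgrad0 u) /\ energy mu p (wgrad0 u) <= energy mu p G.
Proof.
move=> hX; have [mG iG] := X_inLp adm bO hX; have mW := vmeas_wgrad0 hX.
pose h x := \1_Omega x * enorm (G x) `^ p.
have mh : measurable_fun setT h.
  by apply: measurable_funM; [exact: measurable_indic|exact: measurable_enorm_powR].
have h0 x : 0 <= h x by rewrite mulr_ge0 ?powR_ge0// indicE.
have hle x : h x <= enorm (G x) `^ p by rewrite ler_piMl ?powR_ge0// indicE lern1 leq_b1.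
have ih : L1 mu h by apply: (L1_le mh iG) => x; rewrite ger0_norm.
have e : ae_eq mu setT h (fun x => enorm (wgrad0 u x) `^ p).
  apply: filterS (wgrad0_ae hX) => x hx _; rewrite /h indicE.
  have [/set_mem Ox|xO] := boolP (x \in Omega); first by rewrite hx// mul1r.
  by rewrite /wgrad0 (negbTE xO) enorm0 powR0 ?gt_eqF// mul0r.
have mE := measurable_enorm_powR p mW.
split; first by split => //; exact: L1_ae mE e ih.
by rewrite /energy -(rint_ae mh mE e); exact: rint_le.
Qed.

Lemma X_W1p u G : X u G -> (forall x, ~ Omega x -> u x = 0) -> W1p Omega p u.
Proof.
move=> hX u0; have [mU _ _] := hX; split.
- rewrite /in_Lp (_ : u \_ Omega = u); first exact: (Lfun_L1 mU (X_L1p adm bO hX)).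
  apply/funext => x; rewrite patchE; case: ifPn => // /negP xO.
  by rewrite u0// => Ox; exact/xO/mem_set.
- by exists G; exact: X_weak_gradient.
- move=> i; have [[mW iW] _] := wgrad0_energy hX.
  rewrite /in_Lp (_ : (fun x => wgrad Omega u x ord0 i) \_ Omega = (fun x => wgrad0 u x ord0 i)).
    apply: Lfun_L1; first exact: mW.
    apply: (L1_le _ iW).
      apply: (measurableT_comp (f := fun t : R => t `^ p)); first exact: measurable_powR.
      by apply: measurableT_comp => //; exact: mW.
    move=> x; rewrite ger0_norm ?powR_ge0//.
    by apply: ge0_ler_powR; rewrite ?nnegrE ?enorm_ge0 ?coord_le_enorm// ltW.
  by apply/funext => x; rewrite patchE /wgrad0; case: ifP => // _; rewrite mxE.
Qed.

Let thirds_lt (e : R) : 0 < e -> e / 3 + e / 3 < e.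
Proof. by lra. Qed.

Lemma X_W01p u G : X u G -> (forall x, ~ Omega x -> u x = 0) -> W01p Omega p u.
Proof.
move=> hX u0; split; [exact: X_W1p hX u0|exact: u0|move=> e e0].
(* The norm in [W01p] is a sum of two L^p norms; energies at most t make each of them at most e /
   3. *)
pose t := (e / 3) `^ p; have t0 : 0 < t by rewrite powR_gt0// divr_gt0.
have tp : t `^ p^-1 = e / 3.
  by rewrite /t -powRrM mulfV ?gt_eqF// powRr1// divr_ge0// ltW.
have [_ _ /(_ _ t0)[phi hphi [[_ s1] /en_leSf[mw iw s2] _ _]]] := hX.
exists phi => //; have hd : X (u \- phi) (fun x => G x - grad phi x) := XB adm hX (X_Cc adm bO hphi).
have [[mW iW] leW] := wgrad0_energy hd.
have e3 := thirds_lt e0.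
rewrite /W1p_norm.
have -> : (u \- phi) \_ Omega = u \- phi.
  apply/funext => x; rewrite patchE; case: ifPn => // /negP xO.
  have nO : ~ Omega x by move=> Ox; exact/xO/mem_set.
  by rewrite /= u0// (Cc_outside hphi nO) subrr.
have -> : (fun x => enorm (wgrad Omega (u \- phi) x)) \_ Omega = (fun x => enorm (wgrad0 (u \- phi) x)).
  by apply/funext => x; rewrite patchE /wgrad0; case: ifP => // _; rewrite enorm0.
have en : (fun x => `|enorm (wgrad0 (u \- phi) x)| `^ p) = (fun x => enorm (wgrad0 (u \- phi) x) `^ p).
  by apply/funext => x; rewrite ger0_norm ?enorm_ge0.
rewrite (Lnorm_L1 iw) Lnorm_L1 ?en// -EFinD lte_fin.
have mono (y : R) : 0 <= y -> y <= t -> y `^ p^-1 <= e / 3.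
  by move=> y0 yt; rewrite -tp; apply: ge0_ler_powR; rewrite ?nnegrE ?invr_ge0// ltW.
have h1 : (\int[mu]_x (`|(u \- phi) x| `^ p)) `^ p^-1 <= e / 3.
  by apply: (mono _ _ s2); apply: rint_ge0 => x; exact: powR_ge0.
have h2 : energy mu p (wgrad0 (u \- phi)) `^ p^-1 <= e / 3.
  by apply: mono; [exact: energy_ge0|exact: le_trans leW s1].
exact: le_lt_trans (lerD h1 h2) e3.
Qed.

(** G is a weak gradient on the whole space and not only on [Omega], so uniqueness there compares
    the pairs everywhere, including outside [Omega]. *)
Lemma X_gradient_unique u v G H : X u G -> X v H -> {ae mu, forall x, u x = v x} ->
  {ae mu, forall x, G x = H x}.
Proof.
move=> hu hv uv; have [_ mG _] := hu; have [mv _ _] := hv.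
have hvG : X v G by apply: (X_ae adm bO hu mv mG uv); exact: nearW.
have := weak_gradient_unique openT (X_weak_gradient setT hvG) (X_weak_gradient setT hv).
by apply: filterS => x; apply.
Qed.

Lemma dirichlet_ae u v G H : X u G -> X v H -> {ae mu, forall x, u x = v x} -> dirichlet p D u G = dirichlet p D v H.
Proof.
move=> hu hv uv; have GH := X_gradient_unique hu hv uv.
have e1 : energy mu p G = energy mu p H.
  apply: (rint_ae (L1_measurable (X_inLp adm bO hu).2) (L1_measurable (X_inLp adm bO hv).2)).
  by apply: filterS GH => x -> _.
have e2 : energy nu p (nlf u) = energy nu p (nlf v).
  apply: (rint_ae (L1_measurable (X_nl_inLp adm bO hu).2) (L1_measurable (X_nl_inLp adm bO hv).2)).
  by apply: filterS (ae_prod2 uv) => z [z1 z2] _; rewrite /nlfield z1 z2.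
by rewrite /dirichlet e1 e2.
Qed.

End weak_derivatives.

Section weak_solutions.
Context {R : realType} (n : nat) (p s gamma r lam : R).
Local Notation q := (r + 1).
Local Notation D := (n%:R + s * p).
Local Notation a := (1 - gamma).
Hypotheses (adm : admissible n p q D) (a01 : 0 < a < 1) (lam0 : 0 < lam).
Variables (Omega : set 'rV[R]_n) (bO : bounded_set Omega) (oO : open Omega).
Local Notation mu := (lebesgue_rV R n).
Local Notation nu := (mu \x mu)%E.
Local Notation nlf := (nlfield p D).
Local Notation X := (X p q D Omega).

Let p1 : 1 < p. Proof. by case: adm => /andP[]. Qed.
Let p0 : 0 < p. Proof. exact: lt_trans p1. Qed.
Let mO : measurable Omega. Proof. exact: open_measurable_rV. Qed.

Lemma nonlocal_termE (v phi : 'rV[R]_n -> R) z :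
  nonlocal_term p s v phi z = enorm (nlf v z) `^ (p - 2) * dotp (nlf v z) (nlf phi z).
Proof.
have dot1 (x y : R) : dotp (const_mx x : 'rV_1) (const_mx y) = x * y.
  by rewrite /dotp big_ord1 !mxE.
rewrite /nonlocal_term /nlfield dot1 enorm_const1.
have -> : enorm (z.1 - z.2) `^ D = (enorm (z.1 - z.2) `^ (D / p)) `^ p.
  by rewrite -powRrM divfK// gt_eqF.
have : 0 <= enorm (z.1 - z.2) `^ (D / p) by exact: powR_ge0.
move: (enorm _ `^ _) (v z.1 - v z.2) (phi z.1 - phi z.2) => w x y w0.
(* On the diagonal both sides are 0, by the convention that division by 0 gives 0. *)
have [->|wn0] := eqVneq w 0.
  by rewrite powR0 ?gt_eqF// invr0 !mulr0.
have wp : 0 < w by rewrite lt0r wn0.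
have wi : 0 < w^-1 by rewrite invr_gt0.
rewrite normrM (gtr0_norm wi) powRM ?(ltW wi)//.
have -> : (w `^ p)^-1 = w^-1 `^ (p - 2) * (w^-1 * w^-1).
  rewrite -[w^-1 * w^-1]expr2 -powR_mulrn ?(ltW wi)// -powRD ?subrK; last by rewrite gt_eqF ?implybT.
  by rewrite -(powR_inv1 (ltW wp)) -powRrM mulN1r powRN.
by move: (powR `|x| (p - 2)) (powR w^-1 (p - 2)) => y1 y2; ring.
Qed.

Lemma critical_weak_equation v G phi : critical p q D Omega a lam v G -> Cc_infty Omega phi ->
  weak_equation p s gamma r lam Omega v phi.
Proof.
move=> hc hphi; have [[hX v0 vout] _] := hc.
have hphiX := X_Cc adm bO hphi.
have [iS identity] := weak_identity adm bO oO a01 lam0 hc hphi.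
have iC := L1_dC adm bO (And3 hX v0 vout) hphiX.
have [[mW iW] _] := wgrad0_energy adm bO oO hX.
have iL := L1_pairing p1 (X_inLp adm bO hX) (X_inLp adm bO hphiX).
have iN := L1_pairing p1 (X_nl_inLp adm bO hX) (X_nl_inLp adm bO hphiX).
have phi0 x : ~ Omega x -> phi x = 0 by move=> xO; exact: Cc_outside hphi xO.
have gphi0 x : ~ Omega x -> grad phi x = 0.
  by move=> xO; apply/rowP => i; rewrite gradE mxE; exact: Cc_outside (Cc_pderiv i hphi) xO.
have [i1 e1] : mu.-integrable Omega (EFin \o local_term p Omega v phi) /\
    \int[mu]_(x in Omega) local_term p Omega v phi x = pairing mu p G (grad phi).
  apply: (restrict_integral (f' := fun x => enorm (wgrad0 Omega v x) `^ (p - 2) *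
     dotp (wgrad0 Omega v x) (grad phi x)) mO _ _ iL).
  - by move=> x Ox; rewrite /local_term wgrad0E.
  - by apply: measurable_pairing => //; exact: vmeas_grad hphi.
  - by move=> x xO; rewrite gphi0// dotpC dotp0l mulr0.
  - by apply: filterS (wgrad0_ae adm bO oO hX) => x h /h ->.
have E : nonlocal_term p s v phi = (fun z => enorm (nlf v z) `^ (p - 2) * dotp (nlf v z) (nlf phi z)).
  by apply/funext => z; exact: nonlocal_termE.
have [i3 e3] : mu.-integrable Omega (EFin \o singular_term gamma v phi) /\
    \int[mu]_(x in Omega) singular_term gamma v phi x = \int[mu]_x (phi x * v x `^ (a - 1)).
  apply: (restrict_integral mO _ (L1_measurable iS) iS).
  - by move=> x _; rewrite /singular_term addrAC subrr sub0r powRN.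
  - by move=> x xO; rewrite phi0// mul0r.
  - exact: nearW.
have [i4 e4] : mu.-integrable Omega (EFin \o power_term r v phi) /\
    \int[mu]_(x in Omega) power_term r v phi x = dC q v phi.
  apply: (restrict_integral mO _ (L1_measurable iC) iC).
  - by move=> x _; rewrite /power_term addrK.
  - by move=> x xO; rewrite phi0// mulr0.
  - exact: nearW.
split; [exact: i1|by rewrite E|exact: i3|exact: i4|by rewrite e1 E e3 e4].
Qed.

Lemma critical_weak_solution v G : critical p q D Omega a lam v G ->
  weak_solution p s gamma r lam Omega v.
Proof.
move=> hc; have [[hX v0 vout] _] := hc; split.
- exact: (X_W01p adm bO oO hX vout).
- exact: (critical_gt0 adm bO oO a01 lam0 hc).
- move=> omega co cO; have [c c0 h] := compact_lower_bound adm bO oO a01 lam0 hc co cO.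
  by exists c => //; apply: filterS h => x h ox; apply: h; exact: subset_closure.
- by move=> phi; exact: critical_weak_equation hc.
Qed.

Lemma fibu_ae u v G H t : X u G -> X v H -> {ae mu, forall x, u x = v x} ->
  fibu p q D a lam u G t = fibu p q D a lam v H t.
Proof.
move=> hu hv uv; have [mu_ _ _] := hu; have [mv _ _] := hv.
have mp (e : R) (w : 'rV[R]_n -> R) : measurable_fun setT w -> measurable_fun setT (fun x => `|w x| `^ e).
  move=> mw; apply: (measurableT_comp (f := fun t : R => t `^ e)); first exact: measurable_powR.
  exact: measurableT_comp.
have eq e : \int[mu]_x (`|u x| `^ e) = \int[mu]_x (`|v x| `^ e).
  by apply: rint_ae; [exact: mp|exact: mp|apply: filterS uv => x -> _].
by rewrite /fibu (dirichlet_ae adm bO hu hv uv) /singular_int /power_int !eq.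
Qed.

End weak_solutions.

Lemma subcritical_admissible (R : realType) n (p s r : R) : 1 < p < n%:R -> 0 < s < 1 ->
  p - 1 < r < n%:R * p / (n%:R - p) - 1 -> admissible n p (r + 1) (n%:R + s * p).
Proof.
move=> /andP[p1 pn] /andP[s0 s1] /andP[r1 r2]; have p0 : 0 < p by exact: lt_trans p1.
have np : 0 < n%:R - p by rewrite subr_gt0.
split; rewrite ?p1 ?pn//.
- by move: r1; rewrite ltrBlDr.
- have h : (r + 1) * (n%:R - p) < n%:R * p by rewrite -ltr_pdivlMr// -ltrBrDr.
  rewrite -(ltr_pM2r p0) mulrBr mulr1 mulrBl mulrA divfK ?gt_eqF//.
  rewrite ltrBlDr (_ : p * p + _ = n%:R * p); last by ring.
  by rewrite mulrC.
- by rewrite ltrDl mulr_gt0//= ltrD2l gtr_pMl.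
Qed.

Theorem theorem2p13 (R : realType) (n : nat) (p s gamma r : R)
    (Omega : set 'rV[R]_n)
    (hp : 1 < p < n%:R) (hs : 0 < s < 1) (hgamma : 0 < gamma < 1)
    (hr : p - 1 < r < n%:R * p / (n%:R - p) - 1)
    (Omega_nonempty : Omega !=set0) (Omega_open : open Omega)
    (Omega_connected : connected Omega) (Omega_bounded : bounded_set Omega)
    (Omega_C1 : C1_boundary Omega) :
  exists2 Lambda : R, 0 < Lambda &
    forall lambda : R, 0 < lambda < Lambda ->
      exists u v : 'rV[R]_n -> R,
        [/\ weak_solution p s gamma r lambda Omega u,
            weak_solution p s gamma r lambda Omega v &
            ~ ae_eq (lebesgue_rV R n) Omega u v].
Proof.
have adm := subcritical_admissible hp hs hr.
have a01 : 0 < 1 - gamma < 1.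
  by have /andP[g0 g1] := hgamma; rewrite subr_gt0 g1 gtrBl.
have [Lambda L0 hL] := two_critical adm Omega_bounded Omega_open a01 Omega_nonempty.
exists Lambda => // lambda hl; have /andP[l0 _] := hl.
have [u [G [v [H [cu cv /andP[Ju Jv]]]]]] := hL _ hl.
exists u, v; split.
- exact: (critical_weak_solution adm a01 l0 Omega_bounded Omega_open cu).
- exact: (critical_weak_solution adm a01 l0 Omega_bounded Omega_open cv).
- move=> uv; have [[uX _ uout] _] := cu; have [[vX _ vout] _] := cv.
  have euv : {ae lebesgue_rV R n, forall x, u x = v x}.
    apply: filterS uv => x h; have [/h //|xO] := pselect (Omega x).
    by rewrite uout// vout.
  (* J is unchanged by modification on a null set, so its opposite signs at u and v separate the two
     solutions. *)
  move: Ju; rewrite (fibu_ae gamma lambda adm Omega_bounded 1 uX vX euv) => /(lt_trans Jv).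
  by rewrite ltxx.
Qed.
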